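(* Let $d\ge 2$ and let $K\subset\mathbb S^d$ be a proper spherical convex body. Then the spherical curvature entropy $E^s(K):=-\log\mathcal E^s(K)$ satisfies $$E^s(K)=-\frac{1}{P^s(K^* )}\int_{\partial K^*}\log H_{d-1}^s(K^*,\mathbf u)\,\mathrm{vol}_{\partial K^*}^s(d\mathbf u).$$ Furthermore, if $K$ is of class $\mathcal C^{1,1}$, then $$E^s(K)=\frac{1}{P^s(K^* )}\int_{\partial K}H_{d-1}^s(K,\mathbf u)\,\bigl[\log H_{d-1}^s(K,\mathbf u)\bigr]\,\mathrm{vol}_{\partial K}^s(d\mathbf u).$$
   Context: $\mathbb S^d=\{\mathbf u\in\mathbb R^{d+1}:\mathbf u\cdot\mathbf u=1\}$. A spherical convex body is a closed set $K\subset\mathbb S^d$ with non-empty interior that contains, with any two non-antipodal points, the minimal geodesic arc joining them; it is proper if it is contained in an open half-sphere. Dual body: $K^*=\{\mathbf v\in\mathbb S^d:\mathbf v\cdot\mathbf u\ge0\ \forall\mathbf u\in K\}$. $K$ is of class $\mathcal C^{1,1}$ if $\partial K$ is a $\mathcal C^1$-smooth embedded hypersurface and the Gauss map $\mathbf n_K:\partial K\to\mathbb S^d$ (outer unit normal) is Lipschitz continuous. $H_{d-1}^s(K,\cdot)\ge0$ is the generalized spherical Gauss–Kronecker curvature of $\partial K$ (which exists almost everywhere, at boundary points that are twice differentiable in the sense of Aleksandrov, as the product of the generalized principal curvatures in $\mathbb S^d$ with respect to the outer normal), $\mathrm{vol}_{\partial K}^s$ is the $(d-1)$-dimensional Hausdorff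 measure on $\partial K$, and $P^s(K)=\mathrm{vol}_{\partial K}^s(\partial K)$. For $q\ge 0$, $\Omega_q^s(K)=\int_{\partial K}H_{d-1}^s(K,\mathbf u)^{\frac{q}{d+q}}\,\mathrm{vol}_{\partial K}^s(d\mathbf u)$ is the $L_q$-floating area. The spherical entropy power functional is $$\mathcal E^s(K):=\lim_{q\to0^+}\left(\frac{\Omega_q^s(K^* )}{P^s(K^* )}\right)^{1+\frac dq}\in[0,+\infty)$$ (the expression is monotone increasing in $q>0$). Conventions: $\log0=-\infty$, $0\log0=0$; thus $E^s(K)\in(-\infty,+\infty]$. *)

(* Defs.v *)
From HB Require Import structures.
From mathcomp Require Import all_boot all_order all_algebra.
From mathcomp Require Import all_classical all_reals all_analysis.

Set Implicit Arguments.
Unset Strict Implicit.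
Unset Printing Implicit Defensive.

Import Order.TTheory GRing.Theory Num.Def Num.Theory.
Import numFieldNormedType.Exports.

Local Open Scope classical_set_scope.
Local Open Scope ring_scope.

(* The sphere S^d lives in R^(d+1) = 'rV[R]_d.+1.  The library norm `|x| on
   'rV[R]_n is the sup norm: it gives the Euclidean topology, but Euclidean
   lengths are measured by [enorm]. *)
Section Euclidean.
Context {R : realType} {n : nat}.
Implicit Types u v : 'rV[R]_n.

Definition dot u v : R := \sum_(i < n) u 0 i * v 0 i.

Definition enorm u : R := Num.sqrt (dot u u).

Definition diam (A : set 'rV[R]_n) : R :=
  sup [set enorm (x - y) | x in A & y in A].

End Euclidean.

Section CoveringOuterMeasure.
Local Open Scope ereal_scope.
Context {T : Type} {R : realType}.
Variables (g : set T -> \bar R) (P : set (set T)).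

Definition admissible_cover (A : set T) : set ((set T)^nat) :=
  [set F | (forall k, P (F k)) /\ A `<=` \bigcup_k F k].

Definition cover_outer (A : set T) : \bar R :=
  ereal_inf [set \sum_(k <oo) g (F k) | F in admissible_cover A].

Hypothesis g0 : g set0 = 0.
Hypothesis g_ge0 : forall A, 0 <= g A.
Hypothesis P0 : P set0.

Lemma cover_outer_ge0 A : 0 <= cover_outer A.
Proof.
by apply: le_ereal_inf_tmp => x [F _ <-{x}]; apply: nneseries_ge0.
Qed.

Lemma le_cover_outer : {homo cover_outer : A B / A `<=` B >-> A <= B}.
Proof.
move=> A B AB; apply/ereal_inf_le_tmp => x [F [PF BF]] <-{x}.
by exists F => //; split => //; exact: subset_trans BF.
Qed.

Lemma cover_outer0 : cover_outer set0 = 0.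
Proof.
apply/eqP; rewrite eq_le cover_outer_ge0 andbT.
apply: ereal_inf_lbound; exists (fun=> set0); first by split.
by rewrite eseries0.
Qed.

Lemma cover_outer_sigma_subadditive : sigma_subadditive cover_outer.
Proof.
move=> A; have [[i ioo]|] := pselect (exists i, cover_outer (A i) = +oo).
  rewrite (eseries_pinfty _ _ ioo) ?leey// => k _.
  by rewrite -ltNye (lt_le_trans _ (cover_outer_ge0 _)).
rewrite -forallNE => Aoo.
apply/lee_addgt0Pr => _/posnumP[e].
rewrite (le_trans _ (epsilon_trick _ _ _))//; last first.
  by move=> k; exact: cover_outer_ge0.
pose Q k (B : (set T)^nat) := admissible_cover (A k) B /\
  \sum_(j <oo) g (B j) <= cover_outer (A k) + (e%:num / (2 ^ k.+1)%:R)%:E.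
have [G QG] : {G : ((set T)^nat)^nat & forall k, Q k (G k)}.
  apply: (@choice _ _ Q) => k; rewrite /Q /cover_outer.
  set S := (X in ereal_inf X); move infS : (ereal_inf S) => iS.
  case: iS infS => [r Sr|Soo|Soo].
  - have en1 : (0 < e%:num / (2 ^ k.+1)%:R)%R by [].
    have /(lb_ereal_inf_adherent en1) : ereal_inf S \is a fin_num by rewrite Sr.
    move=> [x [B AB gBx] xS].
    by exists B; split => //; rewrite gBx -Sr; exact/ltW.
  - by have := Aoo k; rewrite /cover_outer Soo.
  - suff : lbound S 0 by move/le_ereal_inf_tmp; rewrite Soo.
    by move=> /= _ [B AB <-]; exact: nneseries_ge0.
have gG_ge0 x : 0 <= (g \o uncurry G) x by exact: g_ge0.
apply: (@le_trans _ _ (\esum_(i in setT) (g \o uncurry G) i)).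
  apply: ereal_inf_lbound => /=.
  have /card_esym/ppcard_eqP[f] := card_nat2.
  exists (uncurry G \o f).
    split => [i|]; first by rewrite /= /uncurry; case: (f i) => a b /=;
      exact: (QG a).1.1.
    move=> t [i _ At]; have [j _ Gt] := (QG i).1.2 _ At.
    by exists (f^-1%FUN (i, j)) => //=; rewrite invK ?inE.
  rewrite -(esum_pred_image (g \o uncurry G) _ xpredT) ?[fun=> _]set_true//.
  by rewrite image_eq.
rewrite (_ : esum _ _ = \sum_(i <oo) \sum_(j <oo) g (G i j)); last first.
  pose J : nat -> set (nat * nat) := fun i => [set (i, j) | j in setT].
  rewrite (_ : setT = \bigcup_k J k); last first.
    by rewrite predeqE => -[a b]; split => // _; exists a => //; exists b.
  rewrite esum_bigcupT /=; last 2 first.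
    - apply/trivIsetP => i j _ _ ij.
      rewrite predeqE => -[k m] /=; split => //= -[] [_] _ [<-{k} _].
      by move=> [m' _] [] /esym/eqP; rewrite (negbTE ij).
    - by move=> /= [k m]; exact: g_ge0.
  rewrite -(image_id [set: nat]) -fun_true esum_pred_image//; last first.
    by move=> k _; exact: esum_ge0.
  apply: eq_eseriesr => /= j _.
  rewrite -(esum_pred_image (g \o uncurry G) (pair j) predT)//=; last first.
    by move=> ? ? _ _; exact: (@can_inj _ _ _ snd).
  by congr esum; rewrite predeqE => -[a b]; split; move=> [i _ <-]; exists i.
apply: lee_nneseries => [i _ _|i _]; first exact: nneseries_ge0.
exact: (QG i).2.
Qed.

End CoveringOuterMeasure.

Section Hausdorff.
Local Open Scope ereal_scope.
Context {R : realType} {n : nat}.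

(* Volume of the unit ball of R^m: pi^(m/2) / Gamma(m/2 + 1). *)
Fixpoint unit_ball_volume (m : nat) : R :=
  match m with
  | 0 => 1
  | 1 => 2
  | k.+2 => 2 * pi / k.+2%:R * unit_ball_volume k
  end%R.

(* The factor in front makes the empty set weightless also for m = 0. *)
Definition hausdorff_gauge (m : nat) (A : set 'rV[R]_n) : \bar R :=
  (`[< A !=set0 >]%:R * (unit_ball_volume m * (diam A / 2) ^+ m))%:E.

Definition mesh (delta : R) : set (set 'rV[R]_n) :=
  [set A | forall x y, A x -> A y -> (enorm (x - y) <= delta)%R].

Definition hausdorff_pre (m : nat) (delta : R) : set 'rV[R]_n -> \bar R :=
  cover_outer (hausdorff_gauge m) (mesh delta).

(* Normalized m-dimensional Hausdorff (outer) measure of the Euclidean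
   distance; restricted to subsets of the sphere it agrees with the one of
   the geodesic distance. *)
Definition hausdorff (m : nat) (A : set 'rV[R]_n) : \bar R :=
  ereal_sup [set hausdorff_pre m delta A | delta in [set r : R | (0 < r)%R]].

Lemma unit_ball_volume_ge0 m : (0 <= unit_ball_volume m)%R.
Proof.
elim/ltn_ind: m => -[|[|m]] IH //=.
by rewrite mulr_ge0 ?IH// divr_ge0// mulr_ge0// pi_ge0.
Qed.

Lemma hausdorff_gauge0 m : hausdorff_gauge m set0 = 0.
Proof.
by rewrite /hausdorff_gauge (_ : `[< _ >] = false) ?mul0r//; apply/asboolF => -[].
Qed.

Lemma diam_ge0 (A : set 'rV[R]_n) : (0 <= diam A)%R.
Proof.
rewrite /diam; set S := (X in sup X).
have [hS|/sup_out->//] := pselect (has_sup S).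
have [r Sr] := hS.1; have r0 : (0 <= r)%R by case: Sr => x _ [y _ <-]; exact: sqrtr_ge0.
by apply: (le_trans r0); apply: ub_le_sup => //; exact: hS.2.
Qed.

Lemma hausdorff_gauge_ge0 m A : 0 <= hausdorff_gauge m A.
Proof.
rewrite lee_fin !mulr_ge0 ?unit_ball_volume_ge0//.
by rewrite exprn_ge0// divr_ge0// diam_ge0.
Qed.

Lemma mesh0 delta : mesh delta set0. Proof. by []. Qed.

Lemma hausdorff_pre0 m delta : hausdorff_pre m delta set0 = 0.
Proof.
by apply: cover_outer0; [exact: hausdorff_gauge0|exact: hausdorff_gauge_ge0|].
Qed.

Lemma hausdorff0 m : hausdorff m set0 = 0.
Proof.
rewrite /hausdorff (_ : [set _ | _ in _] = [set 0]) ?ereal_sup1//.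
apply/seteqP; split => [_ [delta _ <-]|_ ->] /=; first exact: hausdorff_pre0.
by exists 1%R; [exact: ltr01|exact: hausdorff_pre0].
Qed.

Lemma hausdorff_ge0 m A : 0 <= hausdorff m A.
Proof.
apply: le_ereal_sup_tmp; exists (hausdorff_pre m 1 A).
  by exists 1%R => //; exact: ltr01.
by apply: cover_outer_ge0; exact: hausdorff_gauge_ge0.
Qed.

Lemma le_hausdorff m : {homo hausdorff m : A B / A `<=` B >-> A <= B}.
Proof.
move=> A B AB; apply: ge_ereal_sup => _ [delta d0 <-].
apply: (@le_trans _ _ (hausdorff_pre m delta B)); first exact: le_cover_outer.
by apply: ereal_sup_ubound; exists delta.
Qed.

Lemma hausdorff_sigma_subadditive m : sigma_subadditive (hausdorff m).
Proof.
move=> A; apply: ge_ereal_sup => _ [delta d0 <-].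
apply: le_trans.
  by apply: cover_outer_sigma_subadditive;
    [exact: hausdorff_gauge_ge0].
apply: lee_nneseries => [i _ _|i _].
  by apply: cover_outer_ge0; exact: hausdorff_gauge_ge0.
by apply: ereal_sup_ubound; exists delta.
Qed.

HB.instance Definition _ m := isOuterMeasure.Build R 'rV[R]_n (hausdorff m)
  (hausdorff0 m) (hausdorff_ge0 m) (@le_hausdorff m)
  (@hausdorff_sigma_subadditive m).

(* Integral over A for the measure obtained by restricting [hausdorff m] to
   its Caratheodory-measurable sets, which include the Borel sets. *)
Definition hausdorff_integral (m : nat) (A : set 'rV[R]_n)
    (f : 'rV[R]_n -> \bar R) : \bar R :=
  \int[(hausdorff m : set (caratheodory_type (hausdorff m)) -> \bar R)]_(x in A)
    f x.

End Hausdorff.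

Section Sphere.
Context {R : realType} {d : nat}.
Implicit Types (K M : set 'rV[R]_d.+1) (u v w n : 'rV[R]_d.+1).

Definition sphere : set 'rV[R]_d.+1 := [set u | dot u u = 1].

(* Points of the sphere in the convex cone of u and v; for non-antipodal u and
   v this is the minimal geodesic arc joining them. *)
Definition arc u v : set 'rV[R]_d.+1 :=
  [set w | sphere w /\
    exists a b : R, [/\ 0 <= a, 0 <= b & w = a *: u + b *: v]].

(* Interior and boundary relative to the sphere. *)
Definition sinterior K : set 'rV[R]_d.+1 :=
  [set u | K u /\ \forall w \near u, sphere w -> K w].

Definition sboundary K : set 'rV[R]_d.+1 :=
  closure K `&` closure (sphere `\` K).

Definition spherical_convex_body K :=
  [/\ closed K, K `<=` sphere, sinterior K !=set0 &
      forall u v, K u -> K v -> v != - u -> arc u v `<=` K].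

Definition proper_body K :=
  exists v, sphere v /\ forall u, K u -> 0 < dot v u.

Definition dual K : set 'rV[R]_d.+1 :=
  [set v | sphere v /\ forall u, K u -> 0 <= dot v u].

Definition outer_unit_normal K u n :=
  [/\ sphere n, dot n u = 0 & forall w, K w -> dot n w <= 0].

Definition gauss_map K u : 'rV[R]_d.+1 :=
  get [set n | outer_unit_normal K u n].

(* Embedded hypersurface of the sphere: locally a regular level set, that is,
   the differential does not vanish on the tangent space of the sphere. *)
Definition C1_hypersurface M :=
  forall u, M u -> exists (U : set 'rV[R]_d.+1) (f : 'rV[R]_d.+1 -> R),
    [/\ open U, U u,
        forall x, U x ->
          differentiable f x /\ forall v, {for x, continuous ('D_v f)},
        M `&` U = [set x | [/\ sphere x, U x & f x = 0]] &
        forall x, M x -> U x -> exists v, dot v x = 0 /\ 'D_v f x != 0].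

(* The norms in [lipschitz] are sup norms; this only affects the constant. *)
Definition C11_body K :=
  C1_hypersurface (sboundary K) /\
  [lipschitz gauss_map K u | u in sboundary K].

(* Orthogonal projection on the orthogonal complement of u and n, for u and n
   orthonormal. *)
Definition tangent_part u n w : 'rV[R]_d.+1 :=
  w - dot w u *: u - dot w n *: n.

(* In the gnomonic chart w |-> w / (w . u) centred at u, the boundary of K is
   near u the graph x |-> u + x - f x n, x orthogonal to u and n. *)
Definition boundary_graph K u n (f : 'rV[R]_d.+1 -> R) :=
  \forall w \near u, sphere w ->
    (sboundary K w <->
     - dot w n / dot w u = f ((dot w u)^-1 *: tangent_part u n w)).

(* The boundary of K is twice differentiable at u in the sense of Aleksandrov,
   with second fundamental form Q (acting on row vectors): the graph function
   has the expansion f x = Q(x, x) / 2 + o(|x|^2) as x -> 0.  The terms of order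
   0 and 1 vanish because the chart is centred at u and n is normal at u. *)
Definition second_order_form K u n (Q : 'M[R]_d.+1) :=
  [/\ sboundary K u, outer_unit_normal K u n,
      [/\ Q^T = Q, u *m Q = 0 & n *m Q = 0] &
      exists f, boundary_graph K u n f /\
        forall eps : R, 0 < eps -> \forall x \near (0 : 'rV[R]_d.+1),
          dot x u = 0 -> dot x n = 0 ->
          `|f x - dot (x *m Q) x / 2| <= eps * dot x x].

(* Eigenvalues, with multiplicity, of Q on the tangent space of the boundary. *)
Definition principal_curvatures u n (Q : 'M[R]_d.+1) (k : 'I_d.-1 -> R) :=
  exists e : 'I_d.-1 -> 'rV[R]_d.+1,
    [/\ forall i, dot (e i) u = 0 /\ dot (e i) n = 0,
        forall i j, dot (e i) (e j) = (i == j)%:R &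
        forall i, e i *m Q = k i *: e i].

(* H_(d-1)^s(K, u), set to 0 where the boundary is not twice differentiable in
   the sense of Aleksandrov (a null set). *)
Definition gauss_kronecker K u : R :=
  xget 0 [set h | exists n Q k, [/\ second_order_form K u n Q,
    principal_curvatures u n Q k & h = \prod_i k i]].

Local Open Scope ereal_scope.

Definition perimeter K : \bar R := hausdorff d.-1 (sboundary K).

Definition boundary_integral K (f : 'rV[R]_d.+1 -> \bar R) : \bar R :=
  hausdorff_integral d.-1 (sboundary K) f.

Definition floating_area (q : R) K : \bar R :=
  boundary_integral K
    (fun u => (gauss_kronecker K u `^ (q / (d%:R + q))%R)%:E).

Definition entropy_power_fun K (q : R) : \bar R :=
  (floating_area q (dual K) / perimeter (dual K)) `^ (1 + d%:R / q)%R.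

Definition entropy_power K : \bar R :=
  lim (entropy_power_fun K q @[q --> 0^'+]).

(* [lne] is the extended logarithm: lne 0 = -oo. *)
Definition log_curvature K u : \bar R := lne (gauss_kronecker K u)%:E.

Definition curvature_entropy K : \bar R := - lne (entropy_power K).

End Sphere.

(* Main.v *)
From HB Require Import structures.
Require Import Defs.
From mathcomp Require Import all_boot all_order all_algebra.
From mathcomp Require Import all_classical all_reals all_analysis.
From mathcomp Require Import ring lra zify measurable_realfun.

(* Put m = d - 1, L = K^*, so that K = L^*.  The boundary of K is the zero set
   on the sphere of the sublinear function F(z) = sup_(v in L) -(v.z)/(v.e), with
   e in the interior of K; projecting radially gives Lipschitz charts, hence a
   finite positive perimeter.

   In terms of incident pairs (u, v), u in bd K, v in bd L, u.v = 0, twice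
   differentiability at u means v.w = Q(w-u,w-u)/2 + o(|w-u|^2) for w in bd K
   near u.  Then every normal v' at w satisfies v' - v = -(w-u)Q + o(|w-u|), so
   the relation u |-> v has a derivative at u with determinant H(K,u), the
   curvature.  If H(K,u) > 0 it can be inverted, which makes L twice
   differentiable at v with H(L,v) = 1/H(K,u).  Cutting into small pieces on which
   the relation is almost linear, the image of a set where H <= b has measure at
   most b times that of the set.  Applied to K and to L this yields the change of
   variables
     int_{H(L,.) > 0} f(H(L,v)) dv = int_{H(K,.) > 0} f(1/H(K,u)) H(K,u) du,
   and in particular H is integrable.  The limit q -> 0+ and the formula for the
   entropy are then the convergence of power means to the geometric mean.

   If the Gauss map of K is Lipschitz, the graph functions have Lipschitz
   gradients, so that by Rademacher's theorem bd K is twice differentiable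
   almost everywhere.  The Gauss map sends the exceptional null set to a null
   set, and {H(K,.) = 0} to a null set by the area inequality; hence H(L,.) > 0
   almost everywhere on bd L, and f = log in the change of variables gives the
   second formula. *)

(** A boundary point may have several normals and a normal several contact points, so the Gauss map
    is replaced by the relation [incident], which is symmetric in [K] and [L]: an upper area bound
    proved for every polar pair serves in both directions, and the inverse densities turn it into an
    equality. Images under a relation need not be measurable, so areas are estimated for arbitrary
    sets with the outer measure, and Borel hulls restore continuity from below and additivity over
    Borel partitions.

    With [p = q / (d + q)] one has [1 + d / q = 1 / p], so the functional is the [p]-mean of the
    curvature on the boundary of the dual body.

    For [w] on the boundary, [dot v w] is the distance to the supporting hyperplane of [v].
    Expanding it in [w - u] describes the second order without a chart and is convenient for
    duality; agreement with the gnomonic definition is a separate equivalence.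

    In Rademacher's theorem the top-dimensional Hausdorff measure plays the role of Lebesgue
    measure: on boxes it is a constant times the volume, and Fubini is applied to pairs of a point
    and a parameter on a line through it. *)

Set Implicit Arguments.
Unset Strict Implicit.
Unset Printing Implicit Defensive.

Import Order.TTheory GRing.Theory Num.Def Num.Theory.
Import numFieldNormedType.Exports.

Local Open Scope classical_set_scope.
Local Open Scope ring_scope.

(** * Euclidean space *)

Section EuclideanTheory.
Context {R : realType} {n : nat}.
Implicit Types (u v w : 'rV[R]_n) (a : R).

Lemma dotC u v : dot u v = dot v u.
Proof. by apply: eq_bigr => i _; rewrite mulrC. Qed.

Lemma dotDl u v w : dot (u + v) w = dot u w + dot v w.
Proof. by rewrite -big_split; apply: eq_bigr => i _; rewrite mxE mulrDl. Qed.

Lemma dotDr u v w : dot w (u + v) = dot w u + dot w v.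
Proof. by rewrite ![dot w _]dotC dotDl. Qed.

Lemma dotZl a u w : dot (a *: u) w = a * dot u w.
Proof. by rewrite mulr_sumr; apply: eq_bigr => i _; rewrite mxE mulrA. Qed.

Lemma dotZr a u w : dot w (a *: u) = a * dot w u.
Proof. by rewrite ![dot w _]dotC dotZl. Qed.

Lemma dotNl u w : dot (- u) w = - dot u w.
Proof. by rewrite -scaleN1r dotZl mulN1r. Qed.

Lemma dotNr u w : dot w (- u) = - dot w u.
Proof. by rewrite dotC dotNl dotC. Qed.

Lemma dotBl u v w : dot (u - v) w = dot u w - dot v w.
Proof. by rewrite dotDl dotNl. Qed.

Lemma dotBr u v w : dot w (u - v) = dot w u - dot w v.
Proof. by rewrite dotDr dotNr. Qed.

Lemma dot0l u : dot 0 u = 0.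
Proof. by rewrite -(scale0r 0) dotZl mul0r. Qed.

Lemma dot0r u : dot u 0 = 0.
Proof. by rewrite dotC dot0l. Qed.

Lemma dot_sumr (I : Type) (r : seq I) (P : pred I) (f : I -> 'rV[R]_n) u :
  dot u (\sum_(i <- r | P i) f i) = \sum_(i <- r | P i) dot u (f i).
Proof.
by elim/big_rec2: _ => [|i x y _ <-]; rewrite ?dot0r ?dotDr.
Qed.

Lemma dot_ge0 u : 0 <= dot u u.
Proof. by apply: sumr_ge0 => i _; rewrite -expr2 sqr_ge0. Qed.

Lemma dot_eq0 u : (dot u u == 0) = (u == 0).
Proof.
apply/idP/eqP => [|->]; last by rewrite dot0l.
rewrite psumr_eq0 => [/allP h|i _]; last by rewrite -expr2 sqr_ge0.
apply/rowP => i; rewrite mxE; apply/eqP; rewrite -sqrf_eq0 expr2.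
by apply: h; rewrite mem_index_enum.
Qed.

Lemma dot_gt0 u : (0 < dot u u) = (u != 0).
Proof. by rewrite lt_def dot_ge0 andbT dot_eq0. Qed.

Lemma enorm_ge0 u : 0 <= enorm u.
Proof. exact: sqrtr_ge0. Qed.
#[local] Hint Resolve enorm_ge0 : core.

Lemma sqr_enorm u : enorm u ^+ 2 = dot u u.
Proof. by rewrite sqr_sqrtr // dot_ge0. Qed.

Lemma enorm0 : enorm (0 : 'rV[R]_n) = 0.
Proof. by rewrite /enorm dot0l sqrtr0. Qed.

Lemma enorm_eq0 u : (enorm u == 0) = (u == 0).
Proof. by rewrite -sqrf_eq0 sqr_enorm dot_eq0. Qed.

Lemma enorm_gt0 u : (0 < enorm u) = (u != 0).
Proof. by rewrite lt_def enorm_ge0 andbT enorm_eq0. Qed.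

Lemma enormZ a u : enorm (a *: u) = `|a| * enorm u.
Proof.
by rewrite /enorm dotZl dotZr mulrA -expr2 sqrtrM ?sqr_ge0// sqrtr_sqr.
Qed.

Lemma enormN u : enorm (- u) = enorm u.
Proof. by rewrite -scaleN1r enormZ normrN1 mul1r. Qed.

Lemma enormB u v : enorm (u - v) = enorm (v - u).
Proof. by rewrite -enormN opprB. Qed.

Lemma CauchySchwarz u v : `|dot u v| <= enorm u * enorm v.
Proof.
rewrite -(@ler_pXn2r _ 2) ?nnegrE ?mulr_ge0 ?enorm_ge0//.
rewrite exprMn !sqr_enorm real_normK ?num_real//.
have [->|v0] := eqVneq v 0; first by rewrite !dot0r expr2 !mulr0.
have vv : 0 < dot v v by rewrite dot_gt0.
(* The square length of this vector is [dot v v] times [a * c - b ^+ 2], the quantity to be shown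
   nonnegative. *)
have := dot_ge0 (dot v v *: u - dot u v *: v).
rewrite dotBl !dotBr !dotZl !dotZr (dotC v u).
set a := dot u u; set b := dot u v; set c := dot v v in vv *.
move=> h; have : 0 <= c * (a * c - b ^+ 2).
  by apply: le_trans h _; rewrite le_eqVlt; apply/orP; left; apply/eqP; ring.
by rewrite pmulr_rge0// subr_ge0.
Qed.

Lemma dot_le u v : dot u v <= enorm u * enorm v.
Proof. by rewrite (le_trans _ (CauchySchwarz u v))// ler_norm. Qed.

Lemma enormD u v : enorm (u + v) <= enorm u + enorm v.
Proof.
rewrite -(@ler_pXn2r _ 2) ?nnegrE ?addr_ge0 ?enorm_ge0//.
rewrite sqrrD !sqr_enorm dotDl !dotDr (dotC v u).
have := dot_le u v; lra.
Qed.

Lemma enormBD u v w : enorm (u - w) <= enorm (u - v) + enorm (v - w).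
Proof. by have := enormD (u - v) (v - w); rewrite addrA subrK. Qed.

Lemma enorm_lerB u v : enorm u - enorm v <= enorm (u - v).
Proof. by rewrite lerBlDr -{1}(subrK v u) enormD. Qed.

Lemma enorm_dist u v : `|enorm u - enorm v| <= enorm (u - v).
Proof.
rewrite ler_norml; apply/andP; split; last exact: enorm_lerB.
by rewrite lerNl opprB (enormB u v) enorm_lerB.
Qed.

Lemma coord_enorm u i : `|u 0 i| <= enorm u.
Proof.
rewrite -(@ler_pXn2r _ 2) ?nnegrE ?enorm_ge0// sqr_enorm real_normK ?num_real//.
rewrite /dot (bigD1 i)//= -expr2 lerDl.
by apply: sumr_ge0 => j _; rewrite -expr2 sqr_ge0.
Qed.

Lemma norm_enorm u : `|u| <= enorm u.
Proof.
rewrite /Num.norm /= mx_normrE; apply/bigmax_leP; split => // -[i j] _ /=.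
by rewrite (ord1 i) coord_enorm.
Qed.

Lemma coord_norm u i : `|u 0 i| <= `|u|.
Proof.
by rewrite [leRHS]/Num.norm/= mx_normrE (le_bigmax _ (fun ij => `|u ij.1 ij.2|) (0, i)).
Qed.

Lemma enorm_norm u : enorm u <= n%:R * `|u|.
Proof.
rewrite -(@ler_pXn2r _ 2) ?nnegrE ?enorm_ge0 ?mulr_ge0// sqr_enorm exprMn.
apply: (@le_trans _ _ (n%:R * `|u| ^+ 2)).
  apply: (@le_trans _ _ (\sum_(i < n) `|u| ^+ 2)).
    apply: ler_sum => i _; rewrite -expr2 -(real_normK (num_real _)).
    by rewrite ler_pXn2r ?nnegrE// coord_norm.
  by rewrite sumr_const card_ord -(mulr_natl (`|u| ^+ 2)).
rewrite ler_wpM2r ?sqr_ge0// -natrX ler_nat.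
by case: n => // k; rewrite -{1}(expn1 k.+1) leq_pexp2l.
Qed.

Lemma near_enormP u (P : set 'rV[R]_n) :
  (\forall w \near u, P w) <->
  exists2 r : R, 0 < r & forall w, enorm (w - u) < r -> P w.
Proof.
split.
- move=> /nbhs_normP[r /= r0 h]; exists r => // w wu; apply: h => /=.
  by rewrite distrC (le_lt_trans (norm_enorm _)).
(* Dividing by [n.+1] rather than by [n] keeps the radius positive in dimension 0. *)
- move=> [r r0 h]; apply/nbhs_normP; exists (r / n.+1%:R) => /=.
    by rewrite divr_gt0.
  move=> w /= wu; apply: h; rewrite enormB.
  apply: le_lt_trans (enorm_norm _) _.
  rewrite -[ltRHS](@divfK _ n.+1%:R)// mulrC.
  apply: (@le_lt_trans _ _ (`|u - w| * n.+1%:R)); last by rewrite ltr_pM2r.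
  by rewrite ler_wpM2l// ler_nat.
Qed.

Lemma dot_delta u i : dot u (delta_mx 0 i) = u 0 i.
Proof.
rewrite /dot (bigD1 i)//= mxE !eqxx mulr1 big1 ?addr0// => j ji.
by rewrite mxE (negbTE ji) mulr0.
Qed.

Lemma dot_mulmx (k : nat) (w : 'rV[R]_k) (A : 'M[R]_(k, n)) u :
  dot (w *m A) u = dot w (u *m A^T).
Proof.
rewrite /dot; under eq_bigr => i _ do rewrite mxE mulr_suml.
rewrite exchange_big/=; apply: eq_bigr => i _.
rewrite mxE mulr_sumr; apply: eq_bigr => j _.
by rewrite mxE; ring.
Qed.

Lemma dotE u v : dot u v = (u *m v^T) 0 0.
Proof. by rewrite mxE; apply: eq_bigr => i _; rewrite mxE. Qed.

End EuclideanTheory.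
#[global] Hint Extern 0 (is_true (@Order.le ring_display _ _ (enorm _))) =>
  solve [apply: enorm_ge0] : core.

(** * Hausdorff measures *)

Section HausdorffMeasure.
Local Open Scope ereal_scope.
Context {R : realType} {n : nat} (m : nat).
Implicit Types (A B C X : set 'rV[R]_n) (delta : R).

HB.instance Definition _ delta := isOuterMeasure.Build R 'rV[R]_n
  (hausdorff_pre m delta) (hausdorff_pre0 m delta)
  (@cover_outer_ge0 _ R _ (mesh delta) (@hausdorff_gauge_ge0 R n m))
  (@le_cover_outer _ _ (hausdorff_gauge m) (mesh delta))
  (@cover_outer_sigma_subadditive _ _ _ (mesh delta)
     (@hausdorff_gauge_ge0 R n m)).

Lemma le_hausdorff_pre A (delta1 delta2 : R) : (delta1 <= delta2)%R ->
  hausdorff_pre m delta2 A <= hausdorff_pre m delta1 A.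
Proof.
move=> d12; apply/ereal_inf_le_tmp => x [F [PF AF]] <-{x}.
exists F => //; split => // k x y Fx Fy.
exact: le_trans (PF k x y Fx Fy) d12.
Qed.

Lemma hausdorff_pre_le A delta : (0 < delta)%R ->
  hausdorff_pre m delta A <= hausdorff m A.
Proof. by move=> d0; apply: ereal_sup_ubound; exists delta. Qed.

(** A set of diameter at most [delta < r] cannot meet both [A] and [B], so the members of a cover of
    the union that meet [A] and those that meet [B] are disjoint subfamilies. *)
Lemma hausdorff_pre_separated A B (r delta : R) : (delta < r)%R ->
  (forall x y, A x -> B y -> (r <= enorm (x - y))%R) ->
  hausdorff_pre m delta A + hausdorff_pre m delta B <=
    hausdorff_pre m delta (A `|` B).
Proof.
move=> dr sAB; apply: le_ereal_inf_tmp => _ [F [PF ABF] <-].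
pose G (D : set 'rV[R]_n) k := if `[< (F k `&` D) !=set0 >] then F k else set0.
have hG D : D `<=` A `|` B ->
    hausdorff_pre m delta D <= \sum_(k <oo) hausdorff_gauge m (G D k).
  move=> DAB; apply: ereal_inf_lbound; exists (G D) => //; split.
    by move=> k; rewrite /G; case: ifP => _ //; exact: PF.
  move=> x Dx; have [k _ Fx] := ABF _ (DAB _ Dx); exists k => //.
  by rewrite /G asboolT//; exists x.
apply: le_trans (leeD (hG A _) (hG B _)) _; [exact: subsetUl|exact: subsetUr|].
rewrite -nneseriesD; try by move=> *; exact: hausdorff_gauge_ge0.
apply: lee_nneseries => [k _ _|k _]; first by rewrite adde_ge0// hausdorff_gauge_ge0.
rewrite /G; case: asboolP => [[x [Fx Ax]]|_]; case: asboolP => [[y [Fy By]]|_];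
  rewrite ?hausdorff_gauge0 ?add0e ?adde0 ?hausdorff_gauge_ge0//.
have := le_lt_trans (PF k x y Fx Fy) dr.
by rewrite ltNge (sAB x y Ax By).
Qed.

Lemma hausdorff_separated A B (r : R) : (0 < r)%R ->
  (forall x y, A x -> B y -> (r <= enorm (x - y))%R) ->
  hausdorff m A + hausdorff m B <= hausdorff m (A `|` B).
Proof.
move=> r0 sAB.
have [->|ABoo] := eqVneq (hausdorff m (A `|` B)) +oo; first by rewrite leey.
have [fA fB] : hausdorff m A \is a fin_num /\ hausdorff m B \is a fin_num.
  split; rewrite ge0_fin_numE ?hausdorff_ge0//;
    (apply: le_lt_trans (_ : hausdorff m (A `|` B) < +oo); last by rewrite ltey).
    by apply: le_hausdorff; exact: subsetUl.
  by apply: le_hausdorff; exact: subsetUr.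
have key (d1 d2 : R) : (0 < d1)%R -> (0 < d2)%R ->
    hausdorff_pre m d1 A + hausdorff_pre m d2 B <= hausdorff m (A `|` B).
  (* The mesh has to be finer than both given ones and strictly finer than the gap [r]. *)
  move=> d10 d20; pose d := minr (minr d1 d2) (r / 2)%R.
  have d0 : (0 < d)%R by rewrite !lt_min d10 d20 divr_gt0.
  have dr : (d < r)%R by rewrite gt_min ltr_pdivrMr// ltr_pMr// ltr1n orbT.
  apply: (@le_trans _ _ (hausdorff_pre m d A + hausdorff_pre m d B)).
    by apply: leeD; apply: le_hausdorff_pre; rewrite !ge_min lexx ?orbT.
  exact: le_trans (hausdorff_pre_separated dr sAB) (hausdorff_pre_le _ d0).
rewrite -leeBrDr//; apply: ge_ereal_sup => _ [d1 d10 <-].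
have f1 : hausdorff_pre m d1 A \is a fin_num.
  rewrite ge0_fin_numE ?outer_measure_ge0//.
  by rewrite (le_lt_trans (hausdorff_pre_le _ d10))// -ge0_fin_numE// hausdorff_ge0.
rewrite leeBrDr// addeC -leeBrDr//; apply: ge_ereal_sup => _ [d2 d20 <-].
by rewrite leeBrDr// addeC key.
Qed.

(* Caratheodory's criterion: the sets of points of [X] at distance at least
   [1 / k.+1] of [C] exhaust [X `\` C] in measure, because every other ring
   between two of them is separated from the previous ones. *)
Lemma closed_caratheodory C : closed C ->
  (hausdorff m).-caratheodory C.
Proof.
move=> clC; apply: le_caratheodory_measurable => X.
change (hausdorff m (X `&` C) + hausdorff m (X `&` ~` C) <= hausdorff m X).
have [->|Xoo] := eqVneq (hausdorff m X) +oo; first by rewrite leey.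
have fX : hausdorff m X < +oo by rewrite ltey.
have fin Y : Y `<=` X -> hausdorff m Y \is a fin_num.
  move=> YX; rewrite ge0_fin_numE ?hausdorff_ge0//.
  exact: le_lt_trans (le_hausdorff m YX) fX.
pose D k := [set x | X x /\ forall c, C c -> (k.+1%:R^-1 <= enorm (x - c))%R].
have DX k : D k `<=` X by move=> x [].
have DS i j : (i <= j)%N -> D i `<=` D j.
  move=> ij x [Xx h]; split => // c /h; apply: le_trans.
  by rewrite lef_pV2 ?posrE// ler_nat.
pose E k := D k.+1 `\` D k.
have EX k : E k `<=` X by move=> x [/DX].
(* [y] lies outside [D j], hence within [1 / j.+1] of a point of [C], from which [x] is at least
   [1 / i.+2] away. *)
have sepE i j x y : (i.+1 < j)%N -> D i.+1 x -> E j y ->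
    (i.+2%:R^-1 - j.+1%:R^-1 <= enorm (x - y))%R.
  move=> ij [_ hx] [[Xy _] /not_andP[//|]] /existsNP[c /not_implyP[Cc /negP]].
  rewrite -ltNge => yc; rewrite lerBlDr.
  apply: le_trans (hx _ Cc) _; apply: le_trans (enormBD x y c) _.
  by rewrite lerD2l ltW.
have sep0 i j : (i.+1 < j)%N -> (0 < i.+2%:R^-1 - j.+1%:R^-1 :> R)%R.
  by move=> ij; rewrite subr_gt0 ltf_pV2 ?posrE// ltr_nat ltnS.
(* [b] is the parity, 0 or 1; rings of equal parity are pairwise separated, so their measures add up
   to at most that of [X]. *)
have sumE b N : \sum_(0 <= i < N) hausdorff m (E (i.*2 + b)%N) <= hausdorff m X.
  suff : \sum_(0 <= i < N) hausdorff m (E (i.*2 + b)%N) <=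
     hausdorff m (\big[setU/set0]_(0 <= i < N) E (i.*2 + b)%N).
    move=> /le_trans; apply; apply: le_hausdorff.
    by rewrite big_mkord -(bigcup_mkord N (fun i => E (i.*2 + b)%N)) => x [i _]; exact: EX.
  elim: N => [|N IH]; first by rewrite !big_nil hausdorff0.
  rewrite !big_nat_recr//=.
  apply: le_trans (leeD2r _ IH) _.
  case: N {IH} => [|N]; first by rewrite !big_nil hausdorff0 add0e set0U.
  apply: (@hausdorff_separated _ _ ((N.*2 + b).+2%:R^-1 - (N.+1.*2 + b).+1%:R^-1)).
    by apply: sep0; rewrite doubleS addSn.
  move=> x y; rewrite big_mkord -(bigcup_mkord N.+1 (fun i => E (i.*2 + b)%N)) => -[i /= iN [Dx _]].
  apply: sepE; first by rewrite doubleS addSn.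
  by apply: DS Dx; rewrite ltnS leq_add2r leq_double.
have split2 N : \sum_(0 <= i < N.*2) hausdorff m (E i) =
    \sum_(0 <= i < N) (hausdorff m (E (i.*2 + 0)%N) + hausdorff m (E (i.*2 + 1)%N)).
  elim: N => [|k IH]; first by rewrite !big_nil.
  by rewrite doubleS !big_nat_recr//= IH addn0 addn1 addeA.
have sumEoo : \sum_(0 <= i <oo) hausdorff m (E i) < +oo.
  apply: (@le_lt_trans _ _ (hausdorff m X + hausdorff m X)); last first.
    by rewrite lte_add_pinfty.
  apply: lime_le.
    by apply: is_cvg_nneseries => i _ _; exact: hausdorff_ge0.
  near=> N; apply: (@le_trans _ _ (\sum_(0 <= i < N.*2) hausdorff m (E i))).
    rewrite [leRHS](@big_cat_nat _ _ _ N)//=; last by rewrite -addnn leq_addr.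
    by rewrite leeDl// sume_ge0// => i _; exact: hausdorff_ge0.
  apply: le_trans (leeD (sumE 0%N N) (sumE 1%N N)).
  by rewrite -big_split/= -split2.
(* Closedness of [C] enters here: a point off [C] has a positive distance to it. *)
have XC : X `&` ~` C `<=` \bigcup_k D k.
  move=> x [Xx Cx].
  have : (\forall y \near x, (~` C) y) by apply: open_nbhs_nbhs; split => //; exact: closed_openC.
  move=> /near_enormP[r r0 h].
  have [k kr] : exists k : nat, (k.+1%:R^-1 < r)%R.
    have := near_infty_natSinv_lt (PosNum r0) => -[N _ hN].
    by exists N; apply: (hN N) => /=.
  exists k => //; split => // c Cc; rewrite leNgt; apply/negP => xc.
  by apply: (h c) => //; rewrite enormB (lt_trans xc).
have main k : hausdorff m (X `&` C) + hausdorff m (D k) <= hausdorff m X.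
  apply: le_trans (@hausdorff_separated _ _ (k.+1%:R^-1) _ _) _.
  - by rewrite invr_gt0.
  - by move=> x y [_ Cx] [_ h]; rewrite enormB; exact: h.
  - by apply: le_hausdorff => x [[]|/DX].
have tail k : hausdorff m (X `&` ~` C) <=
    hausdorff m (D k) + \sum_(k <= i <oo) hausdorff m (E i).
  apply: (@le_trans _ _ (hausdorff m (D k `|` \bigcup_i E (i + k)%N))).
    apply: le_hausdorff => x /XC[j _]; elim: j => [|j IH] Dx.
      by left; apply: DS Dx.
    have [Djx|nDjx] := pselect (D j x); first exact: IH.
    have [jk|kj] := ltnP j k; first by left; apply: DS Dx.
    by right; exists (j - k)%N => //; rewrite subnK.
  apply: le_trans (outer_measureU2 _ _ _) _; rewrite leeD2l//.
  rewrite -nneseries_addn//; last by move=> i; exact: hausdorff_ge0.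
  exact: outer_measure_sigma_subadditive.
apply/lee_addgt0Pr => e e0.
have [k hk] : exists k, \sum_(k <= i <oo) hausdorff m (E i) <= e%:E.
  have h := @nneseries_tail_cvg R (fun i => hausdorff m (E i)) xpredT sumEoo
    (fun k _ => hausdorff_ge0 _ _).
  have : \forall k \near \oo, \sum_(k <= i <oo) hausdorff m (E i) < e%:E.
    apply: (h [set x | x < e%:E]); apply: open_nbhs_nbhs; split => //=.
    exact: open_ereal_lt_ereal.
  by case=> N _ hN; exists N; apply/ltW/(hN N) => /=.
apply: le_trans (leeD2l _ (tail k)) _.
by rewrite addeA; apply: leeD => //; exact: main.
Unshelve. all: by end_near. Qed.

End HausdorffMeasure.

(** * Hausdorff measures under Lipschitz maps *)

Section HausdorffLipschitz.
Context {R : realType}.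

Lemma has_sup_diam n (A : set 'rV[R]_n) (M : R) : A !=set0 ->
  (forall x y, A x -> A y -> enorm (x - y) <= M) ->
  has_sup [set enorm (x - y) | x in A & y in A].
Proof.
move=> [x Ax] AM; split; first by exists (enorm (x - x)); exists x => //; exists x.
by exists M => _ [y Ay [z Az <-]]; exact: AM.
Qed.

Lemma diam_le n (A : set 'rV[R]_n) (M : R) : 0 <= M ->
  (forall x y, A x -> A y -> enorm (x - y) <= M) -> diam A <= M.
Proof.
move=> M0 AM; have [[x Ax]|] := pselect (A !=set0); last first.
  move=> /set0P/negP; rewrite negbK => /eqP ->.
  rewrite /diam (_ : [set _ | _ in _ & _ in _] = set0) ?sup0//.
  by apply/seteqP; split => // _ [y []].
apply: ge_sup; last by move=> _ [y Ay [z Az <-]]; exact: AM.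
by exists (enorm (x - x)), x => //; exists x.
Qed.

Lemma enorm_diam n (A : set 'rV[R]_n) (M : R) x y :
  (forall x y, A x -> A y -> enorm (x - y) <= M) -> A x -> A y ->
  enorm (x - y) <= diam A.
Proof.
move=> AM Ax Ay; apply: ub_le_sup; last by exists x => //; exists y.
by apply: (has_sup_diam _ AM).2; exists x.
Qed.

(** A cover of mesh [delta / L] is mapped to one of mesh [delta]. Its members are first intersected
    with [A], the only place where [f] is known to be Lipschitz. *)
Lemma hausdorff_lipschitz n p m (A : set 'rV[R]_n) (f : 'rV[R]_n -> 'rV[R]_p)
    (L : R) : 0 < L ->
  (forall x y, A x -> A y -> enorm (f x - f y) <= L * enorm (x - y)) ->
  (hausdorff m (f @` A) <= (L ^+ m)%:E * hausdorff m A)%E.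
Proof.
move=> L0 fL; apply: ge_ereal_sup => _ [delta /= d0 <-].
have dL0 : 0 < delta / L by rewrite divr_gt0.
apply: (@le_trans _ _ ((L ^+ m)%:E * hausdorff_pre m (delta / L) A)%E); last first.
  by rewrite lee_wpmul2l ?lee_fin ?exprn_ge0 ?(ltW L0)// hausdorff_pre_le.
rewrite muleC -lee_pdivrMr ?exprn_gt0//.
apply: le_ereal_inf_tmp => _ [F [PF AF] <-].
rewrite lee_pdivrMr ?exprn_gt0// muleC.
rewrite -nneseriesZl; last by move=> k _; exact: hausdorff_gauge_ge0.
have fF k x y : (f @` (F k `&` A)) x -> (f @` (F k `&` A)) y ->
    enorm (x - y) <= L * diam (F k).
  move=> [x' [Fx Ax] <-] [y' [Fy Ay] <-]; apply: le_trans (fL _ _ Ax Ay) _.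
  by rewrite ler_pM2l//; apply: (enorm_diam (PF k)).
apply: (@le_trans _ _ (\sum_(k <oo) hausdorff_gauge m (f @` (F k `&` A)))%E).
  apply: ereal_inf_lbound; exists (fun k => f @` (F k `&` A)) => //; split.
    move=> k x y fx fy; apply: le_trans (fF k x y fx fy) _.
    rewrite mulrC -ler_pdivlMr//; apply: diam_le; first exact: ltW.
    exact: PF.
  move=> _ [x Ax <-]; have [k _ Fx] := AF _ Ax; exists k => //.
  by exists x.
apply: lee_nneseries => [k _ _|k _]; first exact: hausdorff_gauge_ge0.
rewrite /hausdorff_gauge -EFinM lee_fin.
case: asboolP => [[_ [x [Fx Ax] _]]|_]; last first.
  by rewrite mul0r !mulr_ge0 ?unit_ball_volume_ge0 ?exprn_ge0 ?divr_ge0 ?diam_ge0// ltW.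
rewrite asboolT; last by exists x.
rewrite !mul1r mulrCA ler_wpM2l ?unit_ball_volume_ge0// -exprMn mulrA.
rewrite lerXn2r ?nnegrE ?divr_ge0 ?mulr_ge0 ?diam_ge0 ?(ltW L0)//.
rewrite ler_wpM2r// diam_le//; last exact: fF.
by rewrite mulr_ge0 ?diam_ge0 ?(ltW L0).
Qed.

Lemma hausdorff_lipschitz0 n p m (A : set 'rV[R]_n) (f : 'rV[R]_n -> 'rV[R]_p)
    (L : R) : 0 <= L ->
  (forall x y, A x -> A y -> enorm (f x - f y) <= L * enorm (x - y)) ->
  hausdorff m A = 0%E -> hausdorff m (f @` A) = 0%E.
Proof.
move=> L0 fL A0; apply/eqP; rewrite eq_le hausdorff_ge0 andbT.
apply: le_trans (@hausdorff_lipschitz _ _ m A f (L + 1) _ _) _.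
- by rewrite ltr_wpDl.
- by move=> x y Ax Ay; apply: le_trans (fL _ _ Ax Ay) _; rewrite ler_wpM2r ?enorm_ge0 ?lerDl.
- by rewrite A0 mule0.
Qed.

Lemma hausdorff_subset0 n m (A B : set 'rV[R]_n) : A `<=` B ->
  hausdorff m B = 0%E -> hausdorff m A = 0%E.
Proof.
move=> AB B0; apply/eqP; rewrite eq_le hausdorff_ge0 andbT -B0.
exact: le_hausdorff.
Qed.

Lemma hausdorff_bigcup0 n m (A : (set 'rV[R]_n)^nat) :
  (forall k, hausdorff m (A k) = 0%E) -> hausdorff m (\bigcup_k A k) = 0%E.
Proof.
move=> A0; apply/eqP; rewrite eq_le hausdorff_ge0 andbT.
apply: le_trans (@hausdorff_sigma_subadditive R n m A) _.
by rewrite eseries0.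
Qed.

End HausdorffLipschitz.

(** * Boxes, the Borel sets they generate, and Borel hulls *)

Section Boxes.
Context {R : realType} {n : nat}.
Implicit Types (a b x : 'rV[R]_n).

Definition box a b : set 'rV[R]_n :=
  [set x | forall i, a 0 i <= x 0 i < b 0 i].

Definition boxes : set (set 'rV[R]_n) :=
  [set B | exists a b, B = box a b].

(** The Borel sets, presented by a generating family closed under intersection, as the uniqueness
    theorem for measures requires. *)
Definition boxType := g_sigma_algebraType boxes.

Lemma setI_closed_boxes : setI_closed boxes.
Proof.
move=> _ _ [a [b ->]] [c [e ->]].
exists (\row_i maxr (a 0 i) (c 0 i)), (\row_i minr (b 0 i) (e 0 i)).
apply/seteqP; split => x /=.
  move=> [h1 h2] i; rewrite !mxE ge_max lt_min.
  by have /andP[-> ->] := h1 i; have /andP[-> ->] := h2 i.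
move=> h; split=> i; have := h i; rewrite !mxE ge_max lt_min;
  by move=> /andP[/andP[h1 h2] /andP[h3 h4]]; apply/andP.
Qed.

Lemma closed_ge (c : R) i : closed [set x : 'rV[R]_n | c <= x 0 i].
Proof.
have -> : [set x : 'rV[R]_n | c <= x 0 i] = (fun x : 'rV[R]_n => x 0 i) @^-1` [set y | c <= y] by [].
apply: preimage_closed; last exact: closed_ge.
by move=> x _; exact: coord_continuous.
Qed.

Lemma finite_caratheodory_bigcap m (I : finType) (F : I -> set 'rV[R]_n) :
  (forall i, (hausdorff m).-caratheodory (F i)) ->
  (hausdorff m).-caratheodory [set x | forall i, F i x].
Proof.
move=> cF.
have -> : [set x | forall i, F i x] = \big[setI/setT]_(i <- index_enum I) F i.
  apply/seteqP; split => [x h|x]; first by elim/big_ind: _ => // A B; split.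
  by rewrite -bigcap_seq => h i; apply: h; rewrite /= mem_index_enum.
elim/big_ind: _ => // [|A B cA cB].
  by rewrite -setC0; apply: caratheodory_measurable_setC; exact: caratheodory_measurable_set0.
exact: caratheodory_measurable_setI.
Qed.

Lemma box_caratheodory m a b : (hausdorff m).-caratheodory (box a b).
Proof.
apply: (@finite_caratheodory_bigcap m 'I_n (fun i => [set x : 'rV[R]_n | a 0 i <= x 0 i < b 0 i])) => i.
rewrite (_ : [set _ | _] = [set x : 'rV[R]_n | a 0 i <= x 0 i] `\` [set x | b 0 i <= x 0 i]).
  by apply: caratheodory_measurable_setD; apply: closed_caratheodory; exact: closed_ge.
apply/seteqP; split => x /=; first by move=> /andP[-> h]; split => //; rewrite leNgt h.
by move=> [-> /negP]; rewrite -ltNge => ->.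
Qed.

Lemma boxType_caratheodory m (A : set boxType) : measurable A ->
  (hausdorff m).-caratheodory (A : set 'rV[R]_n).
Proof.
move=> mA.
have : <<s boxes >> `<=` (hausdorff m : {outer_measure set 'rV[R]_n -> \bar R}).-caratheodory.
  apply: smallest_sub; first by split;
    [exact: caratheodory_measurable_set0
    |move=> B mB; rewrite setTD; exact: caratheodory_measurable_setC
    |exact: caratheodory_measurable_bigcup].
  by move=> _ [a [b ->]]; exact: box_caratheodory.
exact.
Qed.

Lemma box_measurable a b : measurable (box a b : set boxType).
Proof. by apply: sub_sigma_algebra; exists a, b. Qed.

(** An open set is the union of the countably many rational boxes that it contains; [f] enumerates
    these through [pickle]. *)
Lemma open_boxType_measurable (U : set 'rV[R]_n) : open U ->
  measurable (U : set boxType).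
Proof.
move=> oU.
pose f (k : nat) : set boxType :=
  if (unpickle k : option ('rV[rat]_n * 'rV[rat]_n)%type) is Some p then
    let B := box (map_mx ratr p.1) (map_mx ratr p.2) in
    if `[< B `<=` U >] then B else set0
  else set0.
rewrite (_ : U = \bigcup_k f k).
  apply: bigcupT_measurable => k; rewrite /f.
  case: unpickle => [p|]; last exact: measurable0.
  by case: ifP => _; [exact: box_measurable|exact: measurable0].
apply/seteqP; split => [x Ux|x [k _]]; last first.
  rewrite /f; case: unpickle => // p /=.
  by case: asboolP => // h /h.
have : nbhs x U by apply: open_nbhs_nbhs.
move=> /nbhs_normP[r /= r0 hr].
have lower i : exists q : rat, x 0 i - r / 2 < ratr q <= x 0 i.
  have : x 0 i - r / 2 < x 0 i by rewrite ltrBlDr ltrDl divr_gt0.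
  by move=> /rat_in_itvoo[q]; rewrite in_itv/= => /andP[h1 h2]; exists q; rewrite h1 ltW.
have upper i : exists q : rat, x 0 i < ratr q < x 0 i + r / 2.
  have : x 0 i < x 0 i + r / 2 by rewrite ltrDl divr_gt0.
  by move=> /rat_in_itvoo[q]; rewrite in_itv/= => /andP[h1 h2]; exists q; rewrite h1.
have [a ha] := choice lower; have [b hb] := choice upper.
pose p := (\row_i a i, \row_i b i).
exists (pickle p) => //; rewrite /f pickleK /=.
have xB : box (map_mx ratr (\row_i a i)) (map_mx ratr (\row_i b i)) x.
  by move=> i; rewrite !mxE; have /andP[_ ->] := ha i; have /andP[-> _] := hb i.
rewrite asboolT// => y yB; apply: hr => /=.
rewrite /Num.norm/= mx_normrE; apply/bigmax_ltP; split => // -[j i] _ /=.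
rewrite (ord1 j) !mxE; have := yB i; rewrite !mxE.
have /andP[h1 h2] := ha i; have /andP[h3 h4] := hb i.
move=> /andP[h5 h6]; rewrite ltr_norml; apply/andP; split; lra.
Qed.

Lemma closed_boxType_measurable (C : set 'rV[R]_n) : closed C ->
  measurable (C : set boxType).
Proof.
move=> /closed_openC/open_boxType_measurable/measurableC; by rewrite setCK.
Qed.

Lemma diam_closure (A : set 'rV[R]_n) delta : 0 <= delta -> mesh delta A ->
  mesh delta (closure A) /\ diam (closure A) <= diam A.
Proof.
move=> d0 dA.
have key M : (forall x y, A x -> A y -> enorm (x - y) <= M) ->
    forall x y, closure A x -> closure A y -> enorm (x - y) <= M.
  move=> hM x y cx cy; apply/ler_addgt0Pr => e e0.
  have e2 : 0 < e / 2 by rewrite divr_gt0.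
  have nb (z : 'rV[R]_n) : nbhs z [set w | enorm (w - z) < e / 2].
    by apply/near_enormP; exists (e / 2).
  have [x' [Ax' xx']] := cx _ (nb x); have [y' [Ay' yy']] := cy _ (nb y).
  have := hM _ _ Ax' Ay'; move: xx' yy' => /=.
  have := enormBD x x' y; have := enormBD x' y' y; rewrite (enormB x x').
  lra.
split; first exact: key.
apply: diam_le; first exact: diam_ge0.
by apply: key => x y; exact: (enorm_diam dA).
Qed.

(** Closing a set does not increase its diameter, so near-optimal covers may be taken closed. The
    hull is the intersection over [k] of the unions of such covers of mesh [1 / k.+1]. *)
Lemma hausdorff_hull m (A : set 'rV[R]_n) : exists2 G : set boxType,
  measurable G & A `<=` G /\ hausdorff m G = hausdorff m A.
Proof.
have [Aoo|Aoo] := eqVneq (hausdorff m A) +oo%E.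
  exists setT => //; split => //; apply/eqP; rewrite Aoo -leye_eq -Aoo.
  exact: le_hausdorff.
have fA : hausdorff m A \is a fin_num.
  by rewrite ge0_fin_numE ?hausdorff_ge0// ltey.
have ex (k : nat) : exists F : (set 'rV[R]_n)^nat,
    admissible_cover (mesh k.+1%:R^-1) A F /\
    (\sum_(j <oo) hausdorff_gauge m (F j) <= hausdorff m A + (k.+1%:R^-1)%:E)%E.
  have k0 : 0 < k.+1%:R^-1 :> R by rewrite invr_gt0.
  have ple := hausdorff_pre_le m A k0.
  have fp : hausdorff_pre m k.+1%:R^-1 A \is a fin_num.
    rewrite ge0_fin_numE ?outer_measure_ge0//; apply: le_lt_trans ple _.
    by rewrite ltey.
  have [x [F AF <-] xle] := lb_ereal_inf_adherent k0 fp.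
  exists F; split => //; apply/ltW; apply: lt_le_trans xle _.
  by rewrite leeD2r.
have [F hF] := choice ex.
pose G : set 'rV[R]_n := \bigcap_k \bigcup_j closure (F k j).
have AG : A `<=` G.
  move=> x Ax k _; have [[_ /(_ x Ax)[j _ Fx]] _] := hF k.
  by exists j => //; exact: subset_closure.
exists G; first apply: bigcapT_measurable => k; first apply: bigcupT_measurable => j.
  by apply: closed_boxType_measurable; exact: closed_closure.
split => //; apply/eqP; rewrite eq_le (le_hausdorff m AG) andbT.
apply: ge_ereal_sup => _ [delta /= d0 <-].
apply/lee_addgt0Pr => e e0.
(* [k] has to serve twice: its mesh must be at most [delta], and its error [1 / k.+1] at most
   [e]. *)
pose r := minr delta e.
have r0 : 0 < r by rewrite lt_min d0.
have [k kr] : exists k : nat, k.+1%:R^-1 < r.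
  have := near_infty_natSinv_lt (PosNum r0) => -[N _ hN].
  by exists N; apply: (hN N) => /=.
have [[PF AF] Fle] := hF k.
have kd : k.+1%:R^-1 <= delta by rewrite (le_trans (ltW kr))// ge_min lexx.
have ke : k.+1%:R^-1 <= e by rewrite (le_trans (ltW kr))// ge_min lexx orbT.
have cF j := @diam_closure (F k j) k.+1%:R^-1 (ltW (lt_trans _ (_ : 0 < _))) (PF j).
apply: (@le_trans _ _ (\sum_(j <oo) hausdorff_gauge m (closure (F k j)))%E).
  apply: ereal_inf_lbound; exists (fun j => closure (F k j)) => //; split.
    move=> j x y Fx Fy; apply: le_trans kd.
    by apply: (diam_closure _ (PF j)).1 => //; rewrite invr_ge0.
  by move=> x /(_ k I).
apply: (@le_trans _ _ (\sum_(j <oo) hausdorff_gauge m (F k j))%E); last first.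
  by apply: le_trans Fle _; rewrite leeD2l ?lee_fin.
apply: lee_nneseries => [j _ _|j _]; first exact: hausdorff_gauge_ge0.
rewrite lee_fin; case: asboolP => [[x cx]|_]; last first.
  by rewrite mul0r !mulr_ge0 ?unit_ball_volume_ge0 ?exprn_ge0 ?divr_ge0 ?diam_ge0.
rewrite asboolT ?mul1r; last first.
  by have [y [Fy _]] := cx _ (filterT : nbhs x setT); exists y.
rewrite ler_wpM2l ?unit_ball_volume_ge0// lerXn2r ?nnegrE ?divr_ge0 ?diam_ge0//.
rewrite ler_wpM2r//.
by apply: (diam_closure _ (PF j)).2; rewrite invr_ge0.
Qed.

End Boxes.

Section HausdorffParam.
Context {R : realType}.

(** The inequality makes [g s] a function of [f s], so a Lipschitz map between the two images exists
    without being given. This suits relations: [S] will be a set of incident pairs, with [f] and [g]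
    depending on one component each. *)
Lemma hausdorff_param (T : Type) n p m (S : set T) (f : T -> 'rV[R]_n)
    (g : T -> 'rV[R]_p) (L : R) : 0 < L ->
  (forall s t, S s -> S t -> enorm (g s - g t) <= L * enorm (f s - f t)) ->
  (hausdorff m (g @` S) <= (L ^+ m)%:E * hausdorff m (f @` S))%E.
Proof.
move=> L0 gf.
have ex (y : 'rV[R]_n) : exists z : 'rV[R]_p, (f @` S) y ->
    exists2 s, S s & f s = y /\ g s = z.
  have [[s Ss <-]|?] := pselect ((f @` S) y); last by exists 0.
  by exists (g s) => _; exists s.
have [h hP] := choice ex.
have -> : g @` S = h @` (f @` S).
  have hg s : S s -> h (f s) = g s.
    move=> Ss; have fS : (f @` S) (f s) by exists s.
    have [t St [tf <-]] := hP _ fS.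
    apply/eqP; rewrite -subr_eq0 -enorm_eq0 eq_le enorm_ge0 andbT.
    by apply: le_trans (gf _ _ St Ss) _; rewrite tf subrr enorm0 mulr0.
  apply/seteqP; split => [_ [s Ss <-]|_ [_ [s Ss <-] <-]].
    by exists (f s); [exists s|exact: hg].
  by exists s => //; rewrite hg.
apply: hausdorff_lipschitz => // _ _ [s Ss <-] [t St <-].
have [s' Ss' [<- <-]] := hP _ (ex_intro2 _ _ s Ss erefl).
have [t' St' [<- <-]] := hP _ (ex_intro2 _ _ t St erefl).
exact: gf.
Qed.

Lemma hausdorff_isometry (T : Type) n p m (S : set T) (f : T -> 'rV[R]_n)
    (g : T -> 'rV[R]_p) :
  (forall s t, S s -> S t -> enorm (g s - g t) = enorm (f s - f t)) ->
  hausdorff m (g @` S) = hausdorff m (f @` S).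
Proof.
move=> gf; apply/eqP; rewrite eq_le; apply/andP; split.
  have := @hausdorff_param T n p m S f g 1 ltr01.
  rewrite expr1n mul1e; apply => s t Ss St; by rewrite mul1r gf.
have := @hausdorff_param T p n m S g f 1 ltr01.
rewrite expr1n mul1e; apply => s t Ss St; by rewrite mul1r gf.
Qed.

Lemma hausdorff_translate n m (A : set 'rV[R]_n) v :
  hausdorff m ((fun x => x + v) @` A) = hausdorff m A.
Proof.
rewrite (@hausdorff_isometry _ n n m A id) ?image_id// => x y _ _.
by rewrite addrKA opprK addrACA subrr addr0 || (congr enorm; rewrite opprD addrACA subrr addr0).
Qed.

Lemma le_hausdorff_pre_gauge n m (A : set 'rV[R]_n) delta : mesh delta A ->
  (hausdorff_pre m delta A <= hausdorff_gauge m A)%E.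
Proof.
move=> dA; apply: ereal_inf_lbound.
exists (fun k : nat => match k return set 'rV[R]_n with 0%N => A | _ => set0 end).
  by split => [[|k]//|x Ax]; exists 0%N.
rewrite nneseries_recl//=; last by move=> k _; exact: hausdorff_gauge_ge0.
rewrite eseries_cond eseries0 ?adde0//.
by move=> [|k] // _ _; rewrite hausdorff_gauge0.
Qed.

Lemma hausdorff_pre_bigcup n m (I : finType) (F : I -> set 'rV[R]_n) delta :
  (hausdorff_pre m delta (\bigcup_i F i) <=
   \sum_(i : I) hausdorff_pre m delta (F i))%E.
Proof.
have -> : \bigcup_i F i = \big[setU/set0]_(i : I) F i.
  rewrite -bigcup_seq; apply/seteqP; split => x [i _ Fi]; exists i => //=.
  by rewrite mem_index_enum.
elim/big_rec2: _ => [|i x y _ h]; first by rewrite outer_measure0.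
apply: le_trans (outer_measureU2 (hausdorff_pre m delta) _ _) _.
by rewrite leeD2l.
Qed.

End HausdorffParam.

(** Cauchy's functional equation on a half-line: nonnegativity makes [f] monotone, and squeezing
    [t * k.+1] between consecutive integers bounds the deviation from linearity by [f 1 / k.+1]. *)
Lemma additive_ge0_linear (R : realType) (f : R -> R) :
  (forall s t, 0 <= s -> 0 <= t -> f (s + t) = f s + f t) ->
  (forall t, 0 <= t -> 0 <= f t) -> forall t, 0 <= t -> f t = t * f 1.
Proof.
move=> fD f0 t t0.
have fn (k : nat) s : 0 <= s -> f (k%:R * s) = k%:R * f s.
  move=> s0; elim: k => [|k IH].
    rewrite !mul0r; have := fD 0 0 (lexx _) (lexx _); rewrite addr0; lra.
  by rewrite -addn1 natrD !mulrDl !mul1r fD ?mulr_ge0// IH.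
have fle s u : 0 <= s -> s <= u -> f s <= f u.
  move=> s0 su; rewrite -(subrKC s u) fD ?subr_ge0// lerDl f0// subr_ge0.
  by [].
have bound (k : nat) : `|f t - t * f 1| * k.+1%:R <= f 1.
  have kt0 : 0 <= t * k.+1%:R by rewrite mulr_ge0.
  have /andP[t1 t2] := Num.Theory.truncn_itv kt0.
  set N := Num.truncn _ in t1 t2.
  have h1 := fle _ _ (ler0n _ _) t1.
  have h2 := fle _ _ kt0 (ltW t2).
  have e1 (j : nat) : f j%:R = j%:R * f 1 by rewrite -(fn _ _ ler01) mulr1.
  have e2 : f (t * k.+1%:R) = k.+1%:R * f t by rewrite mulrC fn.
  rewrite e1 e2 in h1; rewrite e1 e2 in h2.
  have f1 := f0 _ ler01.
  have k0 : 0 <= k.+1%:R :> R by [].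
  rewrite -(ger0_norm k0) -normrM ler_norml mulrBl.
  have h3 : N%:R * f 1 <= t * k.+1%:R * f 1 by rewrite ler_wpM2r.
  have h4 : t * k.+1%:R * f 1 <= N.+1%:R * f 1 by rewrite ler_wpM2r// ltW.
  move: h2 h4; rewrite -addn1 natrD; rewrite mulrDl mul1r => h2 h4.
  apply/andP; split; rewrite -?[t * f 1 * _]mulrAC ?[f t * _]mulrC; lra.
apply/eqP; rewrite -subr_eq0 -normr_le0; apply/ler_addgt0Pr => e e0.
rewrite add0r.
have [k hk] : exists k : nat, f 1 < e * k.+1%:R.
  exists (Num.truncn (f 1 / e)); rewrite mulrC -ltr_pdivrMr//.
  exact: Num.Theory.truncnS_gt.
rewrite leNgt; apply/negP => he.
have := bound k; rewrite leNgt => /negP; apply.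
by apply: lt_le_trans hk _; rewrite ler_wpM2r// ltW.
Qed.

(** * Hausdorff measure of boxes and of diagonal images *)

Section BoxMeasure.
Context {R : realType} {n : nat}.
Implicit Types (a b l x : 'rV[R]_n).

(** The Hausdorff measure carried over to the box sigma-algebra, so that uniqueness of measures and
    Fubini apply to it. *)
Definition hmeasure (m : nat) (A : set (@boxType R n)) : \bar R :=
  hausdorff m (A : set 'rV[R]_n).

Let hmeasure_semi_sigma_additive m : semi_sigma_additive (hmeasure m).
Proof.
move=> F mF tF mUF.
apply: (@caratheodory_measure_sigma_additive R _ (hausdorff m : {outer_measure set 'rV[R]_n -> \bar R}) F) => //.
  by move=> i; exact: (boxType_caratheodory m (mF i)).
exact: (boxType_caratheodory m mUF).
Qed.

HB.instance Definition _ m := isMeasure.Build _ _ _ (hmeasure m)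
  (hausdorff0 m) (fun A => hausdorff_ge0 m A) (@hmeasure_semi_sigma_additive m).

Definition unit_cube : set 'rV[R]_n := box 0 (const_mx 1).

(** Cut into [N.+1 ^ n] cubes of side [1 / N.+1], each of diameter at most [n / N.+1]: the sum of
    the gauges is bounded by [C] whatever [N] is. *)
Lemma unit_cube_finite : (hausdorff n unit_cube < +oo)%E.
Proof.
pose C : R := unit_ball_volume n * (n%:R / 2) ^+ n.
apply: (@le_lt_trans _ _ C%:E); last by rewrite ltey.
apply: ge_ereal_sup => _ [delta /= d0 <-].
have [N Nd] : exists N : nat, n%:R * N.+1%:R^-1 < delta.
  have n0 : 0 < delta / n.+1%:R by rewrite divr_gt0.
  have := near_infty_natSinv_lt (PosNum n0) => -[N _ hN]; exists N.
  have := hN N (leqnn _); rewrite /= ltr_pdivlMr// mulrC.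
  by apply: le_lt_trans; rewrite ler_wpM2r ?ler_nat// invr_ge0.
pose c (f : {ffun 'I_n -> 'I_N.+1}) : set 'rV[R]_n :=
  box (\row_i ((f i)%:R / N.+1%:R)) (\row_i ((f i).+1%:R / N.+1%:R)).
have cover : unit_cube `<=` \bigcup_f c f.
  move=> x xQ.
  have ex i : exists k : 'I_N.+1, k%:R / N.+1%:R <= x 0 i < k.+1%:R / N.+1%:R.
    have := xQ i; rewrite !mxE => /andP[x0 x1].
    have Nx0 : 0 <= x 0 i * N.+1%:R by rewrite mulr_ge0.
    have /andP[t1 t2] := Num.Theory.truncn_itv Nx0.
    have tN : (Num.truncn (x 0 i * N.+1%:R)%R < N.+1)%N.
      by rewrite -(ltr_nat R) (le_lt_trans t1)// gtr_pMl.
    by exists (Ordinal tN); rewrite /= ler_pdivrMr// ltr_pdivlMr// t1 t2.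
  have [f hf] := choice ex; exists [ffun i => f i] => // i.
  by rewrite !mxE ffunE hf.
have cdiam f x y : c f x -> c f y -> enorm (x - y) <= n%:R * N.+1%:R^-1.
  move=> cx cy; apply: le_trans (enorm_norm _) _; rewrite ler_wpM2l//.
  rewrite /Num.norm/= mx_normrE; apply/bigmax_leP; split => [|[j i] _ /=].
    by rewrite invr_ge0.
  rewrite (ord1 j) !mxE; have := cx i; have := cy i; rewrite !mxE.
  rewrite -[in (f i).+1%:R]addn1 natrD mulrDl mul1r.
  set r := (f i)%:R / N.+1%:R; set t := N.+1%:R^-1; move: r t => r t.
  by move=> /andP[h1 h2] /andP[h3 h4]; rewrite ler_norml; apply/andP; split; lra.
apply: le_trans (le_outer_measure (hausdorff_pre n delta) _ _ cover) _.
apply: le_trans (hausdorff_pre_bigcup _ _ _) _.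
apply: (@le_trans _ _ (\sum_(f : {ffun 'I_n -> 'I_N.+1})
   (unit_ball_volume n * (n%:R * N.+1%:R^-1 / 2) ^+ n)%:E)%E).
  apply: lee_sum => f _; apply: le_trans (le_hausdorff_pre_gauge _ _) _.
    by move=> x y cx cy; apply: le_trans (cdiam f x y cx cy) (ltW Nd).
  have nN0 : 0 <= n%:R * N.+1%:R^-1 :> R by rewrite mulr_ge0 ?invr_ge0.
  rewrite lee_fin; case: asboolP => _; last first.
    by rewrite mul0r !mulr_ge0 ?unit_ball_volume_ge0 ?exprn_ge0 ?divr_ge0.
  rewrite mul1r ler_wpM2l ?unit_ball_volume_ge0// lerXn2r ?nnegrE ?divr_ge0 ?diam_ge0//.
  by rewrite ler_wpM2r// diam_le// => x y; exact: cdiam.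
rewrite sumEFin lee_fin sumr_const card_ffun !card_ord -(mulr_natl (unit_ball_volume n * _)) natrX.
rewrite mulrCA -exprMn /C.
suff -> : N.+1%:R * (n%:R * N.+1%:R^-1 / 2) = n%:R / 2 :> R by [].
by rewrite mulrAC mulrCA mulfV ?pnatr_eq0// mulr1.
Qed.

Lemma box_translate a b v : (fun x => x + v) @` box a b = box (a + v) (b + v).
Proof.
apply/seteqP; split => [_ [x xab <-] i|x xab].
  by rewrite !mxE lerD2r ltrD2r; exact: xab.
exists (x - v); last by rewrite subrK.
by move=> i; have := xab i; rewrite !mxE lerBrDr ltrBlDr.
Qed.

Lemma hausdorff_box_translate m a b v :
  hausdorff m (box (a + v) (b + v)) = hausdorff m (box a b).
Proof. by rewrite -box_translate hausdorff_translate. Qed.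

Lemma hausdorff_box_finite a b : (hausdorff n (box a b) < +oo)%E.
Proof.
pose M : R := 1 + `|a| + `|b|.
have M0 : 0 < M by rewrite /M; have := normr_ge0 a; have := normr_ge0 b; lra.
pose f (x : 'rV[R]_n) : 'rV[R]_n := (2 * M) *: x - const_mx M.
apply: (@le_lt_trans _ _ (hausdorff n (f @` unit_cube))).
  apply: le_hausdorff => x xab.
  exists ((2 * M)^-1 *: (x + const_mx M)); last first.
    by rewrite /f scalerA divff ?scale1r ?addrK// gt_eqF// mulr_gt0.
  move=> i; rewrite !mxE; have := xab i => /andP[h1 h2].
  have := coord_norm a i; have := coord_norm b i; rewrite !ler_norml.
  move=> /andP[h3 h4] /andP[h5 h6].
  have := normr_ge0 a; have := normr_ge0 b => hb ha.
  rewrite mulrC pmulr_lge0 ?invr_gt0 ?mulr_gt0// ltr_pdivrMr ?mulr_gt0//.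
  by apply/andP; split; rewrite /M; lra.
apply: le_lt_trans (@hausdorff_lipschitz _ _ _ n _ f (2 * M) _ _) _.
- by rewrite mulr_gt0.
- move=> x y _ _; rewrite /f opprB addrA subrK -scalerBr enormZ ger0_norm//.
  by rewrite mulr_ge0// ltW.
- by rewrite lte_mul_pinfty ?lee_fin ?exprn_ge0 ?mulr_ge0 ?(ltW M0)// unit_cube_finite.
Qed.

Definition set_coord i (t : R) l : 'rV[R]_n :=
  \row_j (if j == i then t else l 0 j).

(** The ratio of [hausdorff n] to volume, kept as an unspecified finite constant that appears on
    both sides of each comparison. *)
Definition cube_volume : R := fine (hausdorff n unit_cube).

Let vol l : R := fine (hausdorff n (box 0 l)).

Let volE l : hausdorff n (box 0 l) = (vol l)%:E.
Proof.
by rewrite /vol fineK// ge0_fin_numE ?hausdorff_ge0// hausdorff_box_finite.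
Qed.

Let vol_ge0 l : 0 <= vol l. Proof. by rewrite fine_ge0// hausdorff_ge0. Qed.

Let vol_add i l s t : (forall j, 0 <= l 0 j) -> 0 <= s -> 0 <= t ->
  vol (set_coord i (s + t) l) = vol (set_coord i s l) + vol (set_coord i t l).
Proof.
move=> l0 s0 t0; apply: EFin_inj; rewrite EFinD -!volE.
rewrite -[X in (_ = _ + X)%E](hausdorff_box_translate n _ _ (set_coord i s 0)).
have -> : box 0 (set_coord i (s + t) l) = box 0 (set_coord i s l) `|`
    box (0 + set_coord i s 0) (set_coord i t l + set_coord i s 0).
  apply/seteqP; split => x /=.
    move=> xB; have [xs|xs] := ltP (x 0 i) s.
      left => j; have := xB j; rewrite !mxE.
      by case: eqP => // -> /andP[-> _].
    right => j; have := xB j; rewrite !mxE.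
    case: eqP => [->|_]; last by rewrite add0r addr0.
    by move=> /andP[_ h]; rewrite add0r xs addrC.
  move=> [|] xB j; have := xB j; rewrite !mxE; case: eqP => // _.
  - by move=> /andP[-> h]/=; rewrite (lt_le_trans h)// lerDl.
  - by rewrite add0r => /andP[h1 h2]; rewrite (le_trans s0 h1)/= addrC.
  - by rewrite add0r addr0.
have := @measureU _ _ _ (hmeasure n) _ _ (@box_measurable R n 0 (set_coord i s l))
  (box_measurable (0 + set_coord i s 0) (set_coord i t l + set_coord i s 0)).
apply; apply/seteqP; split => // x [/(_ i) h1 /(_ i)].
by move: h1; rewrite !mxE !eqxx add0r => /andP[_ h1] /andP[h2 _]; move: (lt_le_trans h1 h2); rewrite ltxx.
Qed.

(** Cutting a box across one axis and translating a half shows that its measure is additive in that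
    side length, hence linear in it by Cauchy's equation. *)
Lemma hausdorff_box l : (forall j, 0 <= l 0 j) ->
  hausdorff n (box 0 l) = ((\prod_j l 0 j) * cube_volume)%:E.
Proof.
move=> l0; rewrite volE; congr EFin.
have scale i (u : 'rV[R]_n) t : (forall j, 0 <= u 0 j) -> 0 <= t ->
    vol (set_coord i t u) = t * vol (set_coord i 1 u).
  move=> u0 t0; apply: (@additive_ge0_linear _ (fun t => vol (set_coord i t u))) => //.
  by move=> s s' ss s0; exact: vol_add.
(* Side lengths are switched from 1 to those of [l] one coordinate at a time, starting at the unit
   cube. *)
pose u k : 'rV[R]_n := \row_j (if (j < k)%N then l 0 j else 1).
suff main k : (k <= n)%N -> vol (u k) = (\prod_(j < n | (j < k)%N) l 0 j) * cube_volume.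
  have -> : l = u n by apply/rowP => j; rewrite mxE ltn_ord.
  rewrite main//; congr (_ * _); apply: eq_big => j; first by rewrite ltn_ord.
  by move=> _; rewrite mxE ltn_ord.
elim: k => [_|k IH kn].
  by rewrite big_pred0// mul1r /vol /cube_volume (_ : u 0%N = const_mx 1)//;
    apply/rowP => j; rewrite !mxE.
pose i := Ordinal kn.
have u0 j : 0 <= u k 0 j by rewrite mxE; case: ifP.
have -> : u k.+1 = set_coord i (l 0 i) (u k).
  apply/rowP => j; rewrite !mxE ltnS [(j <= k)%N]leq_eqVlt.
  have [->|ji] := eqVneq j i; first by rewrite eqxx.
  by rewrite (_ : (j == k :> nat) = false)//; apply/negbTE.
rewrite scale// (_ : set_coord i 1 (u k) = u k); last first.
  apply/rowP => j; rewrite !mxE; case: eqP => // ->.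
  by rewrite ltnn.
rewrite IH 1?ltnW// [in RHS](bigD1 i)//= mulrA; congr (_ * _ * _).
apply: eq_bigl => j; rewrite ltnS [(j <= k)%N]leq_eqVlt.
have [->|ji] := eqVneq j i; first by rewrite ltnn andbF.
rewrite andbT (_ : (j == k :> nat) = false)//; exact/negbTE.
Qed.

Definition diag_scale l x : 'rV[R]_n := \row_i (l 0 i * x 0 i).

Lemma diag_scaleK l : (forall i, 0 < l 0 i) ->
  cancel (diag_scale l) (diag_scale (map_mx GRing.inv l)).
Proof.
by move=> l0 x; apply/rowP => i; rewrite !mxE mulKf// gt_eqF.
Qed.

Lemma diag_scaleKV l : (forall i, 0 < l 0 i) ->
  cancel (diag_scale (map_mx GRing.inv l)) (diag_scale l).
Proof.
by move=> l0 x; apply/rowP => i; rewrite !mxE mulVKf// gt_eqF.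
Qed.

Lemma diag_scale_box l a b : (forall i, 0 < l 0 i) ->
  diag_scale l @^-1` box a b =
  box (diag_scale (map_mx GRing.inv l) a) (diag_scale (map_mx GRing.inv l) b).
Proof.
move=> l0; apply/seteqP; split => x h i; have := h i; rewrite !mxE.
  by rewrite ler_pdivrMl// ltr_pdivlMl.
by rewrite ler_pdivrMl// ltr_pdivlMl.
Qed.

Lemma measurable_diag_scale l : (forall i, 0 < l 0 i) ->
  measurable_fun [set: @boxType R n] (diag_scale l : boxType -> @boxType R n).
Proof.
move=> l0; apply: (@measurability _ _ (@boxType R n) (@boxType R n) setT (diag_scale l) (@boxes R n)) => //.
move=> _ [_ [a [b ->]] <-]; rewrite setTI diag_scale_box//.
exact: box_measurable.
Qed.

Lemma hausdorff_box_ab a b : (forall i, a 0 i <= b 0 i) ->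
  hausdorff n (box a b) = ((\prod_j (b 0 j - a 0 j)) * cube_volume)%:E.
Proof.
move=> ab; rewrite -(hausdorff_box_translate n a b (- a)) subrr hausdorff_box.
  by congr (_ * _)%:E; apply: eq_bigr => j _; rewrite !mxE.
by move=> j; rewrite !mxE subr_ge0.
Qed.

(** For Borel sets the two sides are measures that agree on boxes. An arbitrary [A] is replaced by a
    Borel hull, which leaves an inequality. *)
Lemma hausdorff_diag_scale l (A : set 'rV[R]_n) : (forall i, 0 < l 0 i) ->
  (hausdorff n (diag_scale l @` A) <= (\prod_i l 0 i)%:E * hausdorff n A)%E.
Proof.
move=> l0; have p0 : 0 <= \prod_i l 0 i by apply: prodr_ge0 => i _; exact: ltW.
have [G mG [AG <-]] := hausdorff_hull n A.
apply: (@le_trans _ _ (hausdorff n (diag_scale l @` (G : set 'rV[R]_n)))).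
  by apply: le_hausdorff; exact: image_subset.
have l'0 i : 0 < map_mx GRing.inv l 0 i by rewrite mxE invr_gt0.
have mD := measurable_diag_scale l'0.
have imE (B : set 'rV[R]_n) : diag_scale l @` B = diag_scale (map_mx GRing.inv l) @^-1` B.
  apply/seteqP; split => [_ [x Bx <-]|x Bx]; first by rewrite /preimage/= diag_scaleK.
  by exists (diag_scale (map_mx GRing.inv l) x) => //; rewrite diag_scaleKV.
rewrite imE.
pose mu1 : {measure set (@boxType R n) -> \bar R} := pushforward (hmeasure n) (diag_scale (map_mx GRing.inv l) : @boxType R n -> @boxType R n).
pose mu2 : {measure set (@boxType R n) -> \bar R} := mscale (NngNum p0) (hmeasure n).
suff : mu1 mD G = mu2 G by rewrite /mu1 /mu2/= /pushforward /mscale/= /hmeasure => ->.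
apply: (@g_sigma_algebra_measure_unique _ R (@boxType R n) (@boxes R n) _
  (fun k => box (- const_mx k%:R) (const_mx k%:R)) _ _ (mu1 mD) mu2 _ _ _ _ mG) => //.
- by move=> _ [a [b ->]]; exact: box_measurable.
- by move=> k; exists (- const_mx k%:R), (const_mx k%:R).
- apply/seteqP; split => // x _; exists (Num.truncn `|x|).+1 => // i.
  rewrite !mxE; have := coord_norm x i; rewrite ler_norml => /andP[h1 h2].
  have h3 := Num.Theory.truncnS_gt `|x|.
  by apply/andP; split; [apply: le_trans h1; rewrite lerN2 ltW|exact: le_lt_trans h3].
- exact: setI_closed_boxes.
- move=> _ [a [b ->]]; rewrite /mu1 /mu2/= /pushforward /mscale/= /hmeasure.
  rewrite diag_scale_box//.
  rewrite (_ : diag_scale _ a = diag_scale l a); last by apply/rowP => i; rewrite !mxE invrK.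
  rewrite (_ : diag_scale _ b = diag_scale l b); last by apply/rowP => i; rewrite !mxE invrK.
  have [ab|/existsNP[i /negP abi]] := pselect (forall i, a 0 i <= b 0 i).
    rewrite !hausdorff_box_ab//; last by move=> i; rewrite !mxE ler_pM2l.
    rewrite -EFinM mulrA -big_split/=; congr (_ * _)%:E; apply: eq_bigr => i _.
    by rewrite !mxE mulrBr.
  have empty (c e : 'rV[R]_n) : e 0 i < c 0 i -> box c e = set0.
    move=> ec; apply/seteqP; split => // x /(_ i) /andP[h1 h2].
    by have := lt_trans (le_lt_trans h1 h2) ec; rewrite ltxx.
  by rewrite !empty ?hausdorff0 ?mule0 ?mxE ?ltr_pM2l// ltNge.
- move=> k; rewrite /mu1/= /pushforward diag_scale_box// /hmeasure.
  exact: hausdorff_box_finite.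
Qed.

End BoxMeasure.

(** * Positivity of the Hausdorff measure of a cube *)

Section CubePositive.
Context {R : realType} {n : nat}.
Local Open Scope ereal_scope.

Let face (k : nat) (c : 'rV[R]_n) : set 'rV[R]_n :=
  [set x | forall i : 'I_n, if (i < k)%N then is_true (0 <= x 0%R i <= 1)%R else x 0%R i = c 0%R i].

(* Slicing by the last free coordinate and integrating over it lowers the
   exponent of the diameters by one. *)
Lemma face_cover k c (F : (set 'rV[R]_n)^nat) delta : (k <= n)%N ->
  (forall j, mesh delta (F j)) -> face k c `<=` \bigcup_j F j ->
  1 <= \sum_(j <oo) ((`[< (F j `&` face k c) !=set0 >])%:R * diam (F j) ^+ k)%:E.
Proof.
have g0 (j k' : nat) (c' : 'rV[R]_n) : 0 <= ((`[< (F j `&` face k' c') !=set0 >])%:R * diam (F j) ^+ k')%:E.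
  by rewrite lee_fin mulr_ge0// exprn_ge0// diam_ge0.
move=> + FM; elim: k c => [c _|k IH c kn] cov.
  have fc : face 0 c c by move=> i.
  have [j _ Fj] := cov _ fc.
  apply: (@le_trans _ _ (\sum_(0 <= i < j.+1) ((`[< (F i `&` face 0 c) !=set0 >])%:R * diam (F i) ^+ 0)%:E)).
    rewrite big_nat_recr//= asboolT; last by exists c.
    by rewrite expr0 mulr1 leeDr// sume_ge0.
  exact: nneseries_lim_ge.
pose i0 := Ordinal kn.
pose q (j : nat) : set R := [set x 0%R i0 | x in F j `&` face k.+1 c].
(* The projection [q j] of a cover member may fail to be measurable; the interval that it spans is
   measurable and no longer than [diam (F j)]. *)
pose I (j : nat) : set R := `[inf (q j), sup (q j)]%classic.
pose ct t : 'rV[R]_n := set_coord i0 t c.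
have ctf t : (0 <= t <= 1)%R -> face k (ct t) `<=` face k.+1 c.
  move=> t01 x fx i; have := fx i; rewrite /ct mxE ltnS [(i <= k)%N]leq_eqVlt.
  have [->|ii] := eqVneq i i0; first by rewrite ltnn eqxx /= => ->.
  by rewrite (_ : (i == k :> nat) = false)//; exact/negbTE.
have qb j x y : q j x -> q j y -> (`|x - y| <= diam (F j))%R.
  move=> [x' [Fx _] <-] [y' [Fy _] <-].
  apply: le_trans (_ : _ <= enorm (x' - y'))%R _; last exact: (enorm_diam (FM j)).
  by have := coord_enorm (x' - y') i0; rewrite !mxE.
have qI j : q j `<=` I j.
  move=> x qx; rewrite /I /= in_itv/=; apply/andP; split.
    apply: ge_inf => //; exists (x - diam (F j))%R => y qy.
    have := qb j _ _ qx qy; rewrite ler_norml => /andP[_]; lra.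
  apply: ub_le_sup => //; exists (x + diam (F j))%R => y qy.
  have := qb j _ _ qx qy; rewrite ler_norml => /andP[+ _]; lra.
have lI j : (F j `&` face k.+1 c) !=set0 -> lebesgue_measure (I j) <= (diam (F j))%:E.
  move=> [x Fx]; have qx : q j (x 0%R i0) by exists x.
  rewrite /I lebesgue_measure_itv/=; case: ifP => _; last by rewrite lee_fin diam_ge0.
  rewrite -EFinB lee_fin lerBlDr.
  apply: ge_sup; first by exists (x 0%R i0).
  move=> y qy; rewrite -lerBlDl; apply: lb_le_inf; first by exists (x 0%R i0).
  by move=> z qz; have := qb j _ _ qy qz; rewrite ler_norml => /andP[_]; lra.
pose a j : R := ((`[< (F j `&` face k.+1 c) !=set0 >])%:R * diam (F j) ^+ k)%R.
have a0 j : (0 <= a j)%R by rewrite mulr_ge0// exprn_ge0// diam_ge0.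
have mI j : measurable (I j) by exact: measurable_itv.
(* The induction hypothesis holds on every slice, and the slice at [t] meets only members whose
   interval contains [t]; integrating over [t] costs each member one factor of its diameter. *)
have one : 1 <= \int[lebesgue_measure]_(t in `[0%R, 1%R]) (\sum_(j <oo) (a j)%:E * (\1_(I j) t)%:E).
  rewrite -[leLHS](_ : \int[lebesgue_measure]_(t in `[0%R, 1%R]) (cst 1 t) = _); last first.
    by rewrite integral_cst//= mul1e lebesgue_measure_itv/= lte_fin ltr01 -EFinB subr0.
  apply: ge0_le_integral => //=.
  - apply: ge0_emeasurable_sum => [j t _ _|j _]; first by rewrite -EFinM lee_fin mulr_ge0.
    apply/measurable_EFinP/measurable_funM => //.
    exact: (measurable_indic (mI j)).
  move=> t; rewrite in_itv/= => t01.
  apply: le_trans (IH (ct t) (ltnW kn) _) _.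
    by move=> x /(ctf _ t01)/cov.
  apply: lee_nneseries => [j _ _|j _]; first exact: g0.
  rewrite -EFinM lee_fin; case: asboolP => [[x [Fx fx]]|_]; last by rewrite mul0r mulr_ge0.
  have fx' := ctf _ t01 _ fx.
  rewrite /a asboolT; last by exists x.
  rewrite mul1r indicE mem_set ?mulr1 ?mul1r//.
  by apply: qI; exists x => //; have := fx i0; rewrite ltnn /ct mxE eqxx.
apply: (le_trans one).
rewrite integral_nneseries//=; last 2 first.
  - move=> j; apply/measurable_EFinP/measurable_funM => //.
    exact: (measurable_indic (mI j)).
  - by move=> j t _; rewrite -EFinM lee_fin mulr_ge0.
apply: lee_nneseries => [j _ _|j _].
  by apply: integral_ge0 => t _; rewrite -EFinM lee_fin mulr_ge0.
rewrite ge0_integralZl//=; last 2 first.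
  - by apply/measurable_EFinP; exact: (measurable_indic (mI j)).
  - by rewrite lee_fin.
rewrite integral_indic//; last exact: mI.
rewrite /a; case: asboolP => [ne|_]; last by rewrite !mul0r mul0e.
rewrite !mul1r exprSr EFinM lee_wpmul2l ?lee_fin ?exprn_ge0 ?diam_ge0//.
apply: le_trans (lI j ne); apply: le_measure; rewrite ?inE; [apply: measurableI => //; exact: mI|exact: mI|exact: subIsetl].
Qed.

Lemma unit_ball_volume_gt0 m : (0 < unit_ball_volume m :> R)%R.
Proof.
elim/ltn_ind: m => -[|[|m]] IH //=.
by rewrite mulr_gt0 ?IH// divr_gt0// mulr_gt0// pi_gt0.
Qed.

(** On nonempty sets the gauge is [c0] times the [n]-th power of the diameter, so [face_cover]
    bounds the sum over every cover below by [c0]. *)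
Lemma hausdorff_closed_cube_gt0 :
  0 < hausdorff n [set x : 'rV[R]_n | forall i, (0 <= x 0%R i <= 1)%R].
Proof.
set Q := [set _ | _].
pose c0 : R := (unit_ball_volume n * (2^-1) ^+ n)%R.
have c00 : (0 < c0)%R by rewrite mulr_gt0 ?unit_ball_volume_gt0// exprn_gt0.
apply: (@lt_le_trans _ _ (hausdorff_pre n 1 Q)); last exact: hausdorff_pre_le.
apply: (@lt_le_trans _ _ c0%:E); first by rewrite lte_fin.
apply: le_ereal_inf_tmp => _ [F [PF QF] <-].
have fQ : face n 0%R = Q.
  by apply/seteqP; split => x h i; have := h i; rewrite ltn_ord.
have := @face_cover n 0%R F 1%R (leqnn _) PF; rewrite fQ => /(_ QF) h.
apply: (@le_trans _ _ (c0%:E * \sum_(j <oo) ((`[< (F j `&` Q) !=set0 >])%:R * diam (F j) ^+ n)%:E)).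
  by rewrite -[leLHS]mule1 lee_wpmul2l// lee_fin ltW.
rewrite -nneseriesZl; last by move=> j _; rewrite lee_fin mulr_ge0// exprn_ge0// diam_ge0.
apply: lee_nneseries => [j _ _|j _].
  by rewrite mule_ge0 ?lee_fin ?(ltW c00)// mulr_ge0 ?exprn_ge0 ?diam_ge0.
rewrite -EFinM lee_fin exprMn mulrCA ler_pM//.
- by rewrite (mulr_ge0 (ltW c00))// exprn_ge0// diam_ge0.
- case: asboolP => [[x [Fx _]]|_]; last by [].
  by rewrite asboolT//; exists x.
- by rewrite /c0 -mulrA (mulrC (2^-1 ^+ n)%R).
Qed.

End CubePositive.

(** * Polar pairs of spherical bodies *)

Section DotContinuity.
Context {R : realType} {n : nat}.
Implicit Types (u v : 'rV[R]_n).

Lemma enorm_continuous : continuous (@enorm R n).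
Proof.
move=> u; apply/(@cvgrPdist_lt R R _ (nbhs u) (nbhs_filter u)) => e e0; apply/near_enormP; exists e => // w wu.
by rewrite (le_lt_trans (enorm_dist _ _))// enormB.
Qed.

Lemma enorm_dist_continuous v : continuous (fun u => enorm (u - v)).
Proof.
move=> u; apply/(@cvgrPdist_lt R R _ (nbhs u) (nbhs_filter u)) => e e0; apply/near_enormP.
exists e => // w wu; rewrite (le_lt_trans (enorm_dist _ _))//.
by rewrite opprB addrA subrK enormB.
Qed.

Lemma dot_continuous v : continuous (fun u => dot u v).
Proof.
move=> u; apply/(@cvgrPdist_lt R R _ (nbhs u) (nbhs_filter u)) => e e0; apply/near_enormP.
exists (e / (1 + enorm v)); first by rewrite divr_gt0// ltr_pwDl.
move=> w wu; rewrite -dotBl; apply: le_lt_trans (CauchySchwarz _ _) _.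
rewrite enormB; have v0 := enorm_ge0 v; have w0 := enorm_ge0 (w - u).
apply: (@le_lt_trans _ _ (enorm (w - u) * (1 + enorm v))).
  by rewrite ler_wpM2l// lerDr.
by rewrite -ltr_pdivlMr// ltr_pwDl.
Qed.

Lemma enorm_cvg_compact (A : set 'rV[R]_n) (M : R) : closed A ->
  (forall x, A x -> enorm x <= M) -> compact A.
Proof.
move=> cA AM; apply: bounded_closed_compact => //.
exists M; split; first exact: num_real. move=> N MN x Ax.
by apply: le_trans (norm_enorm _) _; apply: le_trans (AM _ Ax) (ltW MN).
Qed.

Lemma closed_dot_ge v (c : R) : closed [set u | c <= dot u v].
Proof.
rewrite (_ : [set u | c <= dot u v] = (fun u => dot u v) @^-1` [set y | c <= y])//.
apply: preimage_closed; first by move=> x _; exact: dot_continuous.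
exact: mathcomp.analysis.normedtype_theory.num_normedtype.closed_ge.
Qed.

End DotContinuity.

Section Polarity.
Context {R : realType} {d : nat}.
Implicit Types (K L : set 'rV[R]_d.+1) (u v w z e : 'rV[R]_d.+1).

Lemma sphere_enorm u : sphere u <-> enorm u = 1.
Proof.
rewrite /sphere /=; split => [h|h]; first by rewrite /enorm h sqrtr1.
by rewrite -sqr_enorm h expr1n.
Qed.

Definition unit_vec u : 'rV[R]_d.+1 := (enorm u)^-1 *: u.

Lemma unit_vec_sphere u : u != 0 -> sphere (unit_vec u).
Proof.
move=> u0; apply/sphere_enorm; rewrite enormZ ger0_norm ?invr_ge0//.
by rewrite mulVf// enorm_eq0.
Qed.

Lemma unit_vec_dist u : u != 0 -> enorm (unit_vec u - u) = `|1 - enorm u|.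
Proof.
move=> u0; have u1 : enorm u != 0 by rewrite enorm_eq0.
rewrite -{2}(scale1r u) -scalerBl enormZ -{2}(ger0_norm (enorm_ge0 u)) -normrM.
by congr `|_|; rewrite mulrBl mulVf ?mul1r.
Qed.

Lemma closed_sphere : closed (@sphere R d).
Proof.
rewrite (_ : @sphere R d = @enorm R d.+1 @^-1` [set 1]); last first.
  by apply/seteqP; split => u /sphere_enorm.
apply: preimage_closed; first by move=> x _; exact: enorm_continuous.
exact: closed_eq.
Qed.

Lemma closed_dual K : closed (dual K).
Proof.
rewrite (_ : dual K = sphere `&` \bigcap_(u in K) [set v | 0 <= dot v u]); last first.
  by apply/seteqP; split => v [? h]; split.
apply: closedI; first exact: closed_sphere.
by apply: closed_bigI => u _; exact: closed_dot_ge.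
Qed.

Lemma compact_sphere_sub K : closed K -> K `<=` sphere -> compact K.
Proof.
move=> cK Ks; apply: (@enorm_cvg_compact _ _ K 1) => // x /Ks/sphere_enorm ->.
by [].
Qed.

(** A symmetric packaging of a body and its dual, so that each result holds with the roles
    exchanged. The margins [r] say that both bodies lie in open half-spheres, uniformly. *)
Definition polar_pair K L := [/\ K = dual L, L = dual K,
  exists e, exists2 r : R, 0 < r & forall v, L v -> r <= dot v e &
  exists e, exists2 r : R, 0 < r & forall u, K u -> r <= dot u e].

Lemma polar_pairC K L : polar_pair K L -> polar_pair L K.
Proof. by case. Qed.

(** Separation: if [w] is outside [K], the point [p] of the cone over [K] nearest to [w] yields a
    vector [z = p - w] that is nonnegative on [K], orthogonal to [p], and negative on [w]. *)
Lemma bipolar K : spherical_convex_body K -> proper_body K ->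
  dual (dual K) `<=` K.
Proof.
move=> [clK Ks [k0 [Kk0 _]] convK] [v0 [v0s v0K]] w [ws wdual].
have [//|Kw] := pselect (K w); exfalso.
(* The cone is cut off at radius 2 for compactness: beyond it, points are farther from the unit
   vector [w] than the origin is. *)
pose A : set 'rV[R]_d.+1 := (fun p : R * 'rV[R]_d.+1 => p.1 *: p.2) @` (`[0, 2] `*` K).
have cA : compact A.
  apply: continuous_compact; last first.
    by apply: compact_setX; [exact: segment_compact|exact: compact_sphere_sub].
  by apply: continuous_subspaceT => p; exact: scale_continuous.
have A0 : A 0.
  exists (0, k0) => /=; last by rewrite scale0r.
  by split => //=; rewrite in_itv/= lexx ler0n.
have [p Ap pmin] : exists2 p, A p & forall x, A x -> enorm (p - w) <= enorm (x - w).
  have [||p pA h] := @EVT_min_rV R _ (fun x => enorm (x - w)) A _ cA.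
  - by exists 0.
  - by apply: continuous_subspaceT; exact: enorm_dist_continuous.
  - by exists p; [rewrite -inE|move=> x Ax; apply: h; rewrite inE].
pose C : set 'rV[R]_d.+1 := [set x | exists l u, [/\ 0 <= l, K u & x = l *: u]].
have pminC x : C x -> enorm (p - w) <= enorm (x - w).
  move=> [l [u [l0 Ku ->]]]; have [l2|l2] := leP l 2.
    by apply: pmin; exists (l, u) => //; split => //=; rewrite in_itv/= l0.
  apply: le_trans (pmin _ A0) _; rewrite sub0r enormN.
  have [/sphere_enorm w1 /sphere_enorm u1] := (ws, Ks _ Ku).
  have := enorm_lerB (l *: u) w; rewrite enormZ u1 w1 ger0_norm//; lra.
have Cp : C p.
  by case: Ap => -[l u] [/= + Ku] <-; rewrite in_itv/= => /andP[l0 _]; exists l, u.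
have CD x y : C x -> C y -> C (x + y).
  move=> [a [u [a0 Ku ->]]] [b [v [b0 Kv ->]]].
  have := a0; rewrite le_eqVlt => /orP[/eqP<-|a1].
    by rewrite scale0r add0r; exists b, v.
  have := b0; rewrite le_eqVlt => /orP[/eqP<-|b1].
    by rewrite scale0r addr0; exists a, u.
  (* Properness keeps the sum of two nonzero cone vectors away from the origin, so that it can be
     normalised to a point of an arc. *)
  set z := _ + _; have z0 : 0 < dot v0 z.
    by rewrite /z dotDr !dotZr addr_gt0// mulr_gt0// v0K.
  have zn : z != 0 by apply: contraTneq z0 => ->; rewrite dot0r ltxx.
  have zp : 0 < enorm z by rewrite enorm_gt0.
  exists (enorm z), (unit_vec z); split => //.
    apply: (convK u v Ku Kv).
      apply/eqP => vu; have := v0K _ Kv; rewrite vu dotNr oppr_gt0 ltNge.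
      by rewrite (ltW (v0K _ Ku)).
    split; first exact: unit_vec_sphere.
    exists ((enorm z)^-1 * a), ((enorm z)^-1 * b); split.
    - by rewrite mulr_ge0// invr_ge0 ltW.
    - by rewrite mulr_ge0// invr_ge0 ltW.
    - by rewrite -!scalerA -scalerDr.
  by rewrite /unit_vec scalerA divff ?scale1r// gt_eqF.
have CZ t x : 0 <= t -> C x -> C (t *: x).
  move=> t0 [a [u [a0 Ku ->]]]; exists (t * a), u.
  by split => //; [rewrite mulr_ge0|rewrite scalerA].
have [z zE] : exists z, z = p - w by exists (p - w).
(* First-order optimality of [p]; it is used with [x] in [K] and with [x = p] and [x = - p]. *)
have quad x : (forall t, 0 < t -> t <= 1 -> C (p + t *: x)) -> 0 <= dot z x.
  move=> h; rewrite leNgt; apply/negP => zx.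
  pose t := minr 1 (- dot z x / (1 + dot x x)).
  have xx : 0 < 1 + dot x x by rewrite ltr_pwDl// dot_ge0.
  have t0 : 0 < t by rewrite lt_min ltr01 divr_gt0// oppr_gt0.
  have t1 : t <= 1 by rewrite ge_min lexx.
  have t2 : t * (1 + dot x x) <= - dot z x.
    by rewrite -ler_pdivlMr// /t ge_min lexx orbT.
  have := pminC _ (h t t0 t1); rewrite -(@ler_pXn2r _ 2) ?nnegrE//.
  rewrite !sqr_enorm addrAC -zE dotDl !dotDr !dotZl !dotZr (dotC x z).
  have : t * (t * (1 + dot x x)) <= t * (- dot z x) by rewrite ler_pM2l.
  have := mulr_gt0 t0 t0; nra.
have zK u : K u -> 0 <= dot z u.
  move=> Ku; apply: quad => t t0 _; apply: CD => //; exists t, u; split => //.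
  exact: ltW.
have zp : dot z p = 0.
  apply/eqP; rewrite eq_le; apply/andP; split.
    rewrite -oppr_ge0 -dotNr; apply: quad => t t0 t1.
    rewrite scalerN -[X in X - _]scale1r -scalerBl; apply: CZ => //; lra.
  apply: quad => t t0 t1; apply: CD => //; apply: CZ => //; exact: ltW.
have z0 : z != 0.
  rewrite zE subr_eq0; apply/eqP => pw; case: Cp => l [u [l0 Ku pE]].
  have /sphere_enorm u1 := Ks _ Ku; have /sphere_enorm w1 := ws.
  have : enorm w = l by rewrite -pw pE enormZ u1 mulr1 ger0_norm.
  by rewrite w1 => l1; apply: Kw; rewrite -pw pE -l1 scale1r.
have zd : dual K (unit_vec z).
  split; first exact: unit_vec_sphere.
  by move=> u Ku; rewrite dotZl mulr_ge0 ?invr_ge0// zK.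
have := wdual _ zd; rewrite dotZr leNgt => /negP; apply.
rewrite pmulr_rlt0 ?invr_gt0 ?enorm_gt0//.
have -> : w = p - z by rewrite zE opprB addrC subrK.
by rewrite dotBl (dotC p) zp sub0r oppr_lt0 dot_gt0.
Qed.

(** A unit step of length [t] from [e] against [v], followed by normalisation, moves by at most
    [2 * t] and so stays in [K]; pairing the result with [v] yields [dot v e >= t]. *)
Lemma sinterior_dual K e : sphere e -> sinterior K e ->
  exists2 r : R, 0 < r & forall v, dual K v -> r <= dot v e.
Proof.
move=> es [_ /near_enormP[r r0 h]].
pose t := minr (1 / 2) (r / 4).
have t0 : 0 < t by rewrite lt_min !divr_gt0.
have t1 : t <= 1 / 2 by rewrite ge_min lexx.
have t2 : t <= r / 4 by rewrite ge_min lexx orbT.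
exists t => // v [vs vK].
have [/sphere_enorm v1 /sphere_enorm e1] := (vs, es).
pose x := e - t *: v.
have xe : enorm (x - e) = t by rewrite /x addrAC subrr sub0r enormN enormZ v1 mulr1 gtr0_norm.
have := enorm_dist x e; rewrite xe e1 => xe1.
have x0 : x != 0.
  rewrite -enorm_gt0; move: xe1; rewrite ler_norml => /andP[]; lra.
have Kx : K (unit_vec x).
  apply: h; last exact: unit_vec_sphere.
  apply: le_lt_trans (enormBD _ x _) _; rewrite unit_vec_dist// xe distrC.
  lra.
have := vK _ Kx; rewrite dotZr pmulr_rge0 ?invr_gt0 ?enorm_gt0//.
by rewrite /x dotBr dotZr (_ : dot v v = 1)// mulr1 subr_ge0.
Qed.

Lemma body_polar_pair K : spherical_convex_body K -> proper_body K ->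
  polar_pair K (dual K).
Proof.
move=> bK pK; have [clK Ks [e eK] convK] := bK; have [v [vs vK]] := pK.
split => //.
- apply/seteqP; split; last exact: bipolar.
  move=> u Ku; split; first exact: Ks.
  by move=> w [_ wK]; rewrite dotC wK.
- by exists e; apply: (sinterior_dual (Ks _ eK.1) eK).
- have [||c cK h] := @EVT_min_rV R _ (fun u => dot u v) K _ (compact_sphere_sub clK Ks).
  + by exists e; exact: eK.1.
  + by apply: continuous_subspaceT; exact: dot_continuous.
  + exists v, (dot c v); first by rewrite dotC vK// -inE.
    by move=> u Ku; apply: h; rewrite inE.
Qed.

Section Pair.
Variables (K L : set 'rV[R]_d.+1).
Hypothesis KL : polar_pair K L.

Lemma pair_sphere u : K u -> sphere u.
Proof. by case: KL => -> _ _ _ []. Qed.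

Lemma pair_closed : closed K.
Proof. by case: KL => -> _ _ _; exact: closed_dual. Qed.

Lemma pair_compact : compact K.
Proof. exact: compact_sphere_sub pair_closed pair_sphere. Qed.

Lemma pair_ge0 u v : K u -> L v -> 0 <= dot u v.
Proof. by case: KL => -> _ _ _ [_ h] Lv; exact: h. Qed.

Lemma pairP u : K u <-> sphere u /\ forall v, L v -> 0 <= dot u v.
Proof. by have [KE _ _ _] := KL; rewrite {1}KE; split. Qed.

End Pair.

Lemma pair_nonempty K L : polar_pair K L -> L !=set0.
Proof.
move=> [KE LE [e [r r0 rL]] [e' [r' r'0 rK]]].
have [//|L0] := pselect (L !=set0).
pose e0 : 'rV[R]_d.+1 := delta_mx 0 0.
have e0s : sphere e0 by rewrite /sphere/= dot_delta mxE !eqxx.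
have Ks u : sphere u -> K u.
  by move=> us; rewrite KE; split => // v Lv; exfalso; apply: L0; exists v.
have := rK _ (Ks _ e0s).
have : sphere (- e0) by rewrite /sphere /= dotNl dotNr opprK.
by move=> /Ks/rK; rewrite dotNl; lra.
Qed.

Definition incident K L u v := [/\ K u, L v & dot u v = 0].

Lemma incidentC K L u v : incident K L u v -> incident L K v u.
Proof. by case=> ? ? ?; split => //; rewrite dotC. Qed.

(** If every point of [L] paired positively with [u], compactness would give a margin and a
    neighbourhood of [u] would lie in [K]. Conversely a step from [u] against [v] leaves [K]. *)
Lemma sboundaryE K L u : polar_pair K L ->
  sboundary K u <-> exists v, incident K L u v.
Proof.
move=> KL; have clK := pair_closed KL; split.
  move=> [cu cSu]; have Ku : K u by rewrite (closure_id K).1.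
  have LK := polar_pairC KL.
  have [v0 Lv0] := pair_nonempty KL.
  have [||v Lv vmin] := @EVT_min_rV R _ (fun v => dot v u) L _ (pair_compact LK).
  - by exists v0.
  - by apply: continuous_subspaceT; exact: dot_continuous.
  rewrite inE in Lv; exists v; split => //.
  apply/eqP; rewrite eq_le (pair_ge0 KL Ku Lv) andbT leNgt; apply/negP => vu.
  have nb : nbhs u [set w | enorm (w - u) < dot u v].
    by apply/near_enormP; exists (dot u v).
  have [w [[ws Kw] /= wu]] := cSu _ nb.
  apply: Kw; apply/(pairP KL); split => // v' Lv'.
  have h1 := vmin v'; rewrite inE in h1; have {h1} := h1 Lv'.
  have : dot (w - u) v' >= - enorm (w - u).
    have := CauchySchwarz (w - u) v'.
    have /sphere_enorm -> := pair_sphere LK Lv'.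
    by rewrite mulr1 ler_norml => /andP[].
  rewrite dotBl (dotC v') (dotC v); lra.
move=> [v [Ku Lv uv]]; split; first exact: subset_closure.
move=> B /near_enormP[r r0 hB].
have us := pair_sphere KL Ku; have vs := pair_sphere (polar_pairC KL) Lv.
have [/sphere_enorm u1 /sphere_enorm v1] := (us, vs).
pose t := minr (1 / 2) (r / 4).
have t0 : 0 < t by rewrite lt_min !divr_gt0.
have t1 : t <= 1 / 2 by rewrite ge_min lexx.
have t2 : t <= r / 4 by rewrite ge_min lexx orbT.
pose x := u - t *: v.
have xe : enorm (x - u) = t by rewrite /x addrAC subrr sub0r enormN enormZ v1 mulr1 gtr0_norm.
have := enorm_dist x u; rewrite xe u1 => xe1.
have x0 : x != 0.
  rewrite -enorm_gt0; move: xe1; rewrite ler_norml => /andP[]; lra.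
exists (unit_vec x); split.
  split; first exact: unit_vec_sphere.
  move=> Kx; have := pair_ge0 KL Kx Lv.
  rewrite dotZl pmulr_rge0 ?invr_gt0 ?enorm_gt0// /x dotBl dotZl uv.
  by rewrite (_ : dot v v = 1)// mulr1 sub0r oppr_ge0 leNgt t0.
apply: hB; apply: le_lt_trans (enormBD _ x _) _; rewrite unit_vec_dist// xe distrC.
lra.
Qed.

(** Points of the dual body are inner normals, hence the sign. *)
Lemma outer_unit_normalE K L u n : polar_pair K L -> K u ->
  outer_unit_normal K u n <-> incident K L u (- n).
Proof.
move=> KL Ku; have [KE LE _ _] := KL; split => [[ns nu nK]|[_ Ln un]].
  split => //; last by rewrite dotNr dotC nu oppr0.
  rewrite LE; split; first by rewrite /sphere/= dotNl dotNr opprK.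
  by move=> w Kw; rewrite dotNl oppr_ge0 nK.
split; first by have := pair_sphere (polar_pairC KL) Ln; rewrite /sphere/= dotNl dotNr opprK.
  by apply/eqP; rewrite -oppr_eq0 -dotNl dotC un.
by move=> w Kw; have := pair_ge0 KL Kw Ln; rewrite dotNr oppr_ge0 dotC.
Qed.

(* The convex cone generated by [K] is the sublevel set [F <= 0] of a
   sublinear function [F], the height over the cone in the direction [e]. *)
Section HeightFunction.
Variables (K L : set 'rV[R]_d.+1) (e : 'rV[R]_d.+1) (r : R).
Hypotheses (KL : polar_pair K L) (r0 : 0 < r) (eL : forall v, L v -> r <= dot v e).

(** The multiple of [v] whose product with [e] is -1: all support functionals then drop at unit
    speed along [e], and so does their supremum. *)
Definition slope v : 'rV[R]_d.+1 := - (dot v e)^-1 *: v.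

Definition height z : R := sup [set dot (slope v) z | v in L].

Let ve0 v : L v -> 0 < dot v e.
Proof. by move=> /eL; exact: lt_le_trans. Qed.

Lemma enorm_slope v : L v -> enorm (slope v) <= r^-1.
Proof.
move=> Lv; rewrite enormZ normrN ger0_norm ?invr_ge0 ?(ltW (ve0 Lv))//.
have /sphere_enorm -> := pair_sphere (polar_pairC KL) Lv.
by rewrite mulr1 lef_pV2 ?posrE ?ve0// eL.
Qed.

Lemma slope_e v : L v -> dot (slope v) e = -1.
Proof. by move=> Lv; rewrite dotZl mulNr mulVf// gt_eqF// ve0. Qed.

Lemma height_attained z :
  exists2 v, L v & height z = dot (slope v) z /\
    forall v', L v' -> dot (slope v') z <= dot (slope v) z.
Proof.
have LK := polar_pairC KL; have [v0 Lv0] := pair_nonempty KL.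
have [||v Lv vmax] := @EVT_max_rV R _ (fun v => dot (slope v) z) L _ (pair_compact LK).
- by exists v0.
- rewrite continuous_subspace_in => x; rewrite inE => Lx.
  apply: continuous_subspaceT_for => //.
  rewrite (_ : (fun v => _) = (fun v => - (dot v e)^-1 * dot v z)); last first.
    by apply/funext => v; rewrite dotZl.
  apply: continuousM; last exact: dot_continuous.
  apply: continuousN; apply: continuousV; first by rewrite gt_eqF// ve0.
  exact: dot_continuous.
rewrite inE in Lv; exists v => //.
have h v' : L v' -> dot (slope v') z <= dot (slope v) z.
  by move=> Lv'; apply: vmax; rewrite inE.
split => //; apply/eqP; rewrite eq_le; apply/andP; split.
  by apply: ge_sup; [exists (dot (slope v) z), v|move=> _ [v' Lv' <-]; exact: h].
by apply: ub_le_sup; [exists (dot (slope v) z) => _ [v' Lv' <-]; exact: h|exists v].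
Qed.

Lemma height_ge z v : L v -> dot (slope v) z <= height z.
Proof. by move=> Lv; have [v' Lv' [-> h]] := height_attained z; exact: h. Qed.

Lemma heightZ a z : 0 <= a -> height (a *: z) = a * height z.
Proof.
move=> a0; apply/eqP; rewrite eq_le; apply/andP; split.
  have [v Lv [-> _]] := height_attained (a *: z).
  by rewrite dotZr ler_wpM2l// height_ge.
have [v Lv [-> _]] := height_attained z.
by rewrite -dotZr height_ge.
Qed.

Lemma heightDe z s : height (z + s *: e) = height z - s.
Proof.
apply/eqP; rewrite eq_le; apply/andP; split.
  have [v Lv [-> _]] := height_attained (z + s *: e).
  by rewrite dotDr dotZr slope_e// mulrN1 lerD2r height_ge.
have [v Lv [-> _]] := height_attained z.
by apply: le_trans (height_ge _ Lv); rewrite dotDr dotZr slope_e// mulrN1.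
Qed.

Lemma height_lip z z' : `|height z - height z'| <= r^-1 * enorm (z - z').
Proof.
suff h x y : height x - height y <= r^-1 * enorm (x - y).
  by rewrite ler_norml h lerNl opprB enormB h.
have [v Lv [-> _]] := height_attained x.
apply: (@le_trans _ _ (dot (slope v) (x - y))).
  by rewrite dotBr lerD2l lerN2 height_ge.
by apply: le_trans (dot_le _ _) _; rewrite ler_wpM2r// enorm_slope.
Qed.

Lemma height_le0 w : sphere w -> K w <-> height w <= 0.
Proof.
move=> ws; rewrite (pairP KL); split => [[_ h]|h].
  have [v Lv [-> _]] := height_attained w.
  by rewrite dotZl mulNr oppr_le0 mulr_ge0 ?invr_ge0 ?(ltW (ve0 Lv))// dotC h.
split => // v Lv; have := le_trans (height_ge w Lv) h.
by rewrite dotZl mulNr oppr_le0 pmulr_rge0 ?invr_gt0 ?ve0// dotC.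
Qed.

Lemma height_incident w v : sphere w -> incident K L w v <->
  [/\ L v, height w = 0 & dot (slope v) w = 0].
Proof.
move=> ws; split => [[Kw Lv wv]|[Lv hw sv]].
  have sv : dot (slope v) w = 0 by rewrite dotZl (dotC v w) wv mulr0.
  split => //; apply/eqP; rewrite eq_le (height_le0 ws).1//=.
  by rewrite -sv height_ge.
split => //; first by apply/(height_le0 ws); rewrite hw.
move: sv; rewrite dotZl mulNr => /eqP; rewrite oppr_eq0 mulf_eq0 invr_eq0.
by rewrite (gt_eqF (ve0 Lv))/= dotC => /eqP.
Qed.

Lemma height0 w : sphere w -> sboundary K w <-> height w = 0.
Proof.
move=> ws; rewrite (sboundaryE w KL); split => [[v /(height_incident v ws)[]]//|h].
have [v Lv [hv _]] := height_attained w.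
by exists v; apply/(height_incident v ws); split => //; rewrite -hv.
Qed.

Lemma sboundary_sphere w : sboundary K w -> sphere w.
Proof. by move=> /(sboundaryE w KL)[v [Kw _ _]]; exact: (pair_sphere KL). Qed.

Lemma slope_enorm v : L v -> enorm (slope v) = (dot v e)^-1.
Proof.
move=> Lv; rewrite enormZ normrN ger0_norm ?invr_ge0 ?(ltW (ve0 Lv))//.
by have /sphere_enorm -> := pair_sphere (polar_pairC KL) Lv; rewrite mulr1.
Qed.

End HeightFunction.

End Polarity.

(** * Rademacher's theorem *)

Section LipschitzLine.
Context {R : realType}.
Implicit Types (G : R -> R) (t q c : R).

Definition lin_at G t q := forall eps, 0 < eps ->
  exists2 delta, 0 < delta &
    forall h, `|h| < delta -> `|G (t + h) - G t - q * h| <= eps * `|h|.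

Lemma derivable_lin_at G t : derivable G t 1 -> exists q, lin_at G t q.
Proof.
move=> /cvg_ex[q /= Gq]; exists q => eps e0.
have := Gq; move=> /cvgrPdist_le/(_ _ e0).
rewrite near_withinE => /nbhs_normP[delta /= d0 hd]; exists delta => // h hdel.
have [->|h0] := eqVneq h 0; first by rewrite addr0 subrr mulr0 subr0 normr0 mulr0.
have := hd h; rewrite /= sub0r normrN => /(_ hdel h0).
rewrite /GRing.scale/= mulr1 => hq; rewrite (addrC t h).
have -> : G (h + t) - G t - q * h = - h * (q - (h^-1 * (G (h + t) - G t))).
  by rewrite mulrBr !mulNr mulrA mulfV// mul1r opprK addrC mulrC.
by rewrite normrM normrN mulrC ler_wpM2r.
Qed.

Lemma lin_at_near G F t q r : 0 < r ->
  (forall s, `|s - t| < r -> F s = G s) -> lin_at F t q -> lin_at G t q.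
Proof.
move=> r0 FG Fq eps e0; have [delta d0 hd] := Fq _ e0.
exists (minr delta r) => [|h]; first by rewrite lt_min d0.
rewrite lt_min => /andP[h1 h2]; rewrite -!FG; first exact: hd.
  by rewrite subrr normr0.
by rewrite addrC addKr.
Qed.

Lemma lin_at_affine G t q (a b c : R) : lin_at G t q ->
  lin_at (fun s => a * G s + b * s + c) t (a * q + b).
Proof.
move=> Gq eps e0; have a1 : 0 < `|a| + 1 by rewrite ltr_wpDl.
have [delta d0 hd] := Gq _ (divr_gt0 e0 a1).
exists delta => // h /hd hh.
have -> : a * G (t + h) + b * (t + h) + c - (a * G t + b * t + c) - (a * q + b) * h
  = a * (G (t + h) - G t - q * h) by ring.
rewrite normrM; apply: (@le_trans _ _ (`|a| * (eps / (`|a| + 1) * `|h|))).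
  by rewrite ler_wpM2l.
rewrite mulrA ler_wpM2r// mulrCA ler_piMr ?(ltW e0)//.
by rewrite ler_pdivrMr// mul1r lerDl.
Qed.

Lemma lipschitz_continuous1 G c : (forall s t, `|G s - G t| <= c * `|s - t|) ->
  continuous G.
Proof.
move=> Gc t; apply/cvgrPdist_lt => e e0.
have c1 : 0 < `|c| + 1 by rewrite ltr_wpDl.
apply/nbhs_normP; exists (e / (`|c| + 1)) => /=; first by rewrite divr_gt0.
move=> s /=; rewrite ltr_pdivlMr// => h; apply: le_lt_trans (Gc _ _) _.
apply: le_lt_trans h; rewrite mulrC ler_wpM2l//.
by rewrite (le_trans (ler_norm _))// lerDl.
Qed.

Section ClampedLine.
Variables (psi : R -> R) (a b c : R).
Hypotheses (nd : {homo psi : x y / x <= y}).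
Hypothesis lip : forall s t, `|psi s - psi t| <= c * `|s - t|.
Hypotheses (psia : forall t, t <= a -> psi t = 0) (psib : forall t, b <= t -> psi t = 1).

Let rc : right_continuous psi.
Proof. by apply: right_continuousW; exact: lipschitz_continuous1 lip. Qed.

Let cvgN : psi @ -oo --> (0 : R).
Proof.
apply: cvg_near_cst; exists a; split; first exact: num_real.
by move=> t ta; apply: psia; exact: ltW.
Qed.

Let cvgY : psi @ +oo --> (1 : R).
Proof.
apply: cvg_near_cst; exists b; split; first exact: num_real.
by move=> t ta; apply: psib; exact: ltW.
Qed.

(** [psi] is the distribution function of a probability measure that is absolutely continuous; its
    density is integrable, and the fundamental theorem of calculus, based at [a - 1] where [psi]
    vanishes, differentiates it almost everywhere. *)
Lemma clamped_ae_lin_at :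
  {ae lebesgue_measure, forall t, a - 1 < t -> exists q, lin_at psi t q}.
Proof.
pose f : cumulativeBounded (0 : R) (1 : R) := HB.pack psi
  (isCumulative.Build R _ R psi nd rc) (isCumulativeBounded.Build R 0 1 psi cvgN cvgY).
pose nu : {finite_measure set (measurableTypeR R) -> \bar R} :=
  [the {finite_measure set _ -> \bar R} of lebesgue_stieltjes_measure f].
have nuE (x y : R) : x <= y -> nu `]x, y]%classic = (psi y - psi x)%:E.
  move=> xy; rewrite /nu /= /lebesgue_stieltjes_measure /measure_extension.
  by rewrite measurable_mu_extE/=; [rewrite wlength_itv_bnd|exact: is_ocitv].
have c0 : 0 <= c.
  have := lip 1 0; rewrite subr0 normr1 mulr1; exact: le_trans.
(* Both measures are infima over covers by half-open intervals, and on each interval the Lipschitz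
   bound compares the two lengths. *)
have dom : nu `<< (@lebesgue_measure R).
  apply/null_content_dominatesP => A mA A0.
  apply/eqP; rewrite eq_le measure_ge0 andbT.
  apply/lee_addgt0Pr => e e0; rewrite add0e.
  have e1 : 0 < e / (c + 1) by rewrite divr_gt0// ltr_wpDl.
  have fA : lebesgue_measure A \is a fin_num by rewrite A0.
  have [x [F [mF AF] <-] xle] := lb_ereal_inf_adherent e1 fA.
  have {}xle : (\sum_(k <oo) wlength idfun (F k) < (e / (c + 1))%:E)%E.
    by apply: (lt_le_trans xle); rewrite -[X in (X + _)%E]/(lebesgue_measure A) A0 add0e.
  apply: (@le_trans _ _ (\sum_(k <oo) wlength psi (F k))%E).
    by apply: ereal_inf_lbound; exists F.
  apply: (@le_trans _ _ (\sum_(k <oo) (c%:E * wlength idfun (F k)))%E).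
    apply: lee_nneseries => [k _ _|k _]; first exact: (wlength_ge0 f).
    have := mF k => /ocitvP[->|[p p12 ->]]; first by rewrite !wlength0 mule0.
    rewrite !wlength_itv_bnd ?(ltW p12)// -EFinM lee_fin /=.
    have := lip p.2 p.1; rewrite (ger0_norm (_ : 0 <= p.2 - p.1)) ?subr_ge0 ?(ltW p12)//.
    exact/le_trans/ler_norm.
  rewrite nneseriesZl; last by move=> k _; exact: (wlength_ge0 idfun).
  apply: (@le_trans _ _ (c%:E * (e / (c + 1))%:E)%E).
    by rewrite lee_wpmul2l// ltW.
  by rewrite -EFinM lee_fin mulrCA ler_piMr ?(ltW e0)// ler_pdivrMr ?mul1r ?lerDl// ltr_wpDl.
pose g t := fine (Radon_Nikodym_SigmaFinite.f nu lebesgue_measure t).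
have gE : EFin \o g = Radon_Nikodym_SigmaFinite.f nu lebesgue_measure.
  by apply/funext => t /=; rewrite fineK// Radon_Nikodym_SigmaFinite.f_fin_num.
have gint : lebesgue_measure.-integrable [set: R] (EFin \o g).
  by rewrite gE; exact: Radon_Nikodym_SigmaFinite.f_integrable.
have gloc : locally_integrable [set: R] g.
  by apply: open_integrable_locally => //; exact: openT.
have := @FTC1 R g (BRight (a - 1)) _ gloc.
have h y : lebesgue_measure.-integrable [set` Interval (BRight (a - 1)) (BRight y)] (EFin \o g).
  by apply: integrableS gint => //; exact: measurable_itv.
move=> /(_ h); apply: (@filterS _ _ (ae_filter_ringOfSetsType (@lebesgue_measure R))) => t ht at1.
have [//|dF _] := ht _; have [q Fq] := derivable_lin_at dF; exists q.
apply: (@lin_at_near _ _ t q (t - (a - 1)) _ _ Fq) => [|s sr]; first by rewrite subr_gt0.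
have as1 : a - 1 <= s.
  by move: sr; rewrite ltr_norml => /andP[+ _]; lra.
apply: EFin_inj; rewrite /Rintegral fineK; last first.
  by apply: integrable_fin_num => //; exact: measurable_itv.
rewrite -[LHS](_ : nu `]a - 1, s]%classic = _).
  by rewrite nuE// (psia (_ : a - 1 <= a)) ?subr0//; lra.
rewrite (Radon_Nikodym_SigmaFinite.f_integral dom)//.
by apply: eq_integral => x _; rewrite -gE.
Qed.

End ClampedLine.

(** Adding [(c + 1) * t] makes every increment at least [t - s]; clamping the argument to a
    symmetric interval and dividing by the positive total increment [D N] then gives a distribution
    function. *)
Lemma lipschitz_ae_lin_at G c : (forall s t, `|G s - G t| <= c * `|s - t|) ->
  {ae lebesgue_measure, forall t, exists q, lin_at G t q}.
Proof.
move=> lip; have c0 : 0 <= c.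
  by have := lip 1 0; rewrite subr0 normr1 mulr1; exact: le_trans.
pose H t := G t + (c + 1) * t.
have Hinc s t : s < t -> t - s <= H t - H s.
  move=> st; have := lip t s; rewrite (gtr0_norm (_ : 0 < t - s)) ?subr_gt0//.
  by rewrite ler_norml /H => /andP[+ _]; lra.
have Hlip s t : `|H s - H t| <= (2 * c + 1) * `|s - t|.
  rewrite (_ : H s - H t = (G s - G t) + (c + 1) * (s - t)); last by rewrite /H; ring.
  apply: le_trans (ler_normD _ _) _; rewrite normrM (ger0_norm (_ : 0 <= c + 1)) ?addr_ge0//.
  by have := lip s t; lra.
pose cl (N : nat) t : R := maxr (- N.+1%:R) (minr N.+1%:R t).
have clnd N : {homo cl N : x y / x <= y}.
  by move=> x y xy; rewrite /cl le_max2// le_min2.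
have cllip N s t : `|cl N s - cl N t| <= `|s - t|.
  wlog st : s t / s <= t.
    by move=> h; have [/h//|/ltW/h] := leP s t; rewrite distrC [leRHS]distrC.
  rewrite distrC [leRHS]distrC !ger0_norm ?subr_ge0 ?clnd//.
  have N0 : 0 <= N.+1%:R :> R by [].
  rewrite /cl; move: N.+1%:R N0 => M M0.
  rewrite /maxr /minr; do ! case: ifPn; rewrite -?leNgt => *; lra.
pose D (N : nat) : R := H N.+1%:R - H (- N.+1%:R).
have D0 N : 0 < D N.
  have N0 : 0 < N.+1%:R :> R by [].
  have : - N.+1%:R < N.+1%:R :> R by lra.
  by move=> /Hinc; rewrite /D; lra.
pose psi N t : R := (H (cl N t) - H (- N.+1%:R)) / D N.
have main N : {ae lebesgue_measure, forall t, - N.+1%:R - 1 < t -> exists q, lin_at (psi N) t q}.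
  apply: (@clamped_ae_lin_at _ _ N.+1%:R ((2 * c + 1) / D N)).
  - move=> x y xy; rewrite ler_pM2r ?invr_gt0// lerD2r.
    have := clnd N _ _ xy; rewrite le_eqVlt => /orP[/eqP->//|/Hinc].
    have := clnd N _ _ xy; lra.
  - move=> s t; rewrite /psi -mulrBl opprB addrA subrK normrM.
    rewrite (gtr0_norm (_ : 0 < (D N)^-1)) ?invr_gt0//.
    rewrite mulrAC ler_pM2r ?invr_gt0//.
    apply: le_trans (Hlip _ _) _; rewrite ler_wpM2l//.
    by rewrite addr_ge0// mulr_ge0.
  - move=> t tN; rewrite /psi /cl.
    have N0 : 0 <= N.+1%:R :> R by [].
    rewrite (min_idPr _) ?(max_idPl _) ?subrr ?mul0r//.
    by apply: (le_trans tN); lra.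
  - move=> t tN; rewrite /psi /cl.
    have N0 : 0 <= N.+1%:R :> R by [].
    by rewrite (min_idPl _)// (max_idPr _) ?divff ?(gt_eqF (D0 N))//; lra.
have := ae_foralln main; apply: (@filterS _ _ (ae_filter_ringOfSetsType (@lebesgue_measure R))) => t ht.
have tN := Num.Theory.truncnS_gt `|t|; set N := Num.truncn _ in tN.
have tN1 : - N.+1%:R - 1 < t.
  by move: tN; rewrite ltr_norml => /andP[+ _]; lra.
have [q pq] := ht N tN1.
have dN : 0 < N.+1%:R - `|t| by rewrite subr_gt0.
have := lin_at_affine (D N) (- (c + 1)) (H (- N.+1%:R)) pq => h.
eexists; apply: lin_at_near dN _ h => s sr.
have : `|s| < N.+1%:R.
  by rewrite -(subrK t s) (le_lt_trans (ler_normD _ _))// -ltrBrDr.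
rewrite ltr_norml => /andP[s1 s2].
have -> : psi N s = (H s - H (- N.+1%:R)) / D N.
  by rewrite /psi /cl (min_idPr (ltW s2)) (max_idPr (ltW s1)).
rewrite mulrC divfK ?gt_eqF// /H; ring.
Qed.

End LipschitzLine.

(** * Limits of functions on a line evaluated at shifted points *)

Section LineShift.
Context {R : realType}.
Local Open Scope ereal_scope.
Notation mu := (@lebesgue_measure R).

Lemma measurable_shift (c : R) : measurable_fun [set: R] (fun t : R => (t + c)%R).
Proof. exact: measurable_funD. Qed.

Lemma lebesgue_measure_shift (c : R) (A : set R) : measurable A ->
  mu ((fun t : R => (t + c)%R) @^-1` A) = mu A.
Proof.
move=> mA; pose f : measurableTypeR R -> measurableTypeR R := fun t : R => (t + c)%R.
have mf : measurable_fun setT f by exact: measurable_shift.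
pose nu := pushforward mu f : {measure set (measurableTypeR R) -> \bar R}.
apply/esym; apply: (@lebesgue_measure_unique R (nu mf)) => // X [[a b] _ <-{X}].
rewrite /nu /= /pushforward.
have -> : f @^-1` `]a, b]%classic = `](a - c)%R, (b - c)%R]%classic.
  by apply/seteqP; split => t; rewrite /f /= !in_itv/= ltrBlDr lerBrDr.
rewrite !lebesgue_measure_itv/= !lte_fin ltrD2r; case: ifP => // _.
by rewrite -!EFinB; congr EFin; ring.
Qed.

Lemma ge0_integral_shift (c a b : R) (g : R -> R) : measurable_fun setT g ->
  (forall t, 0 <= g t)%R ->
  \int[mu]_(t in `]a, b]) (g (t + c)%R)%:E = \int[mu]_(t in `](a + c)%R, (b + c)%R]) (g t)%:E.
Proof.
move=> mg g0; pose f : measurableTypeR R -> measurableTypeR R := fun t : R => (t + c)%R.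
have mf : measurable_fun setT f by exact: measurable_shift.
pose nu := pushforward mu f : {measure set (measurableTypeR R) -> \bar R}.
have -> : \int[mu]_(t in `](a + c)%R, (b + c)%R]) (g t)%:E =
    \int[nu mf]_(t in `](a + c)%R, (b + c)%R]) (g t)%:E.
  apply: (@eq_measure_integral _ (measurableTypeR R)) => A mA _.
  by rewrite /nu/= /pushforward lebesgue_measure_shift.
rewrite /nu/= (@ge0_integral_pushforward _ _ (measurableTypeR R) (measurableTypeR R) R f)//.
- congr (integral _ _ _); apply/seteqP; split => t; rewrite /f /= !in_itv/= ltrD2r lerD2r//.
- by apply/measurable_EFinP; exact: measurable_funTS.
- by move=> t _; rewrite lee_fin.
Qed.

Section ShiftLimit.
Variables (g : nat -> R -> R) (C : R).
Hypotheses (mg : forall k, measurable_fun [set: R] (g k)).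
Hypotheses (g0 : forall k t, (0 <= g k t)%R) (gC : forall k t, (g k t <= C)%R).
Let h (k : nat) : R := k.+1%:R^-1%R.
Let h0 k : (0 < h k)%R. Proof. by rewrite invr_gt0. Qed.

(** The upper limit clipped to [[0, C]]: an everywhere defined measurable function that equals the
    limit wherever it exists. *)
Let lims (f : nat -> R -> R) (t : R) : R :=
  Num.min C (Num.max 0%R (fine (limn_esup (fun k => (f k t)%:E)))).

Let C0 : (0 <= C)%R. Proof. exact: le_trans (g0 0%N 0%R) (gC 0%N 0%R). Qed.

Let lims_ge0 f t : (0 <= lims f t)%R.
Proof. by rewrite le_min C0 le_max lexx. Qed.

Let lims_le f t : (lims f t <= C)%R.
Proof. by rewrite ge_min lexx. Qed.

Let measurable_lims (f : nat -> R -> R) : (forall k, measurable_fun [set: R] (f k)) ->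
  measurable_fun [set: R] (lims f).
Proof.
move=> mf; apply: measurable_minr => //; apply: measurable_maxr => //.
apply: (measurableT_comp (fine_measurable _)) => //.
by apply: measurable_fun_limn_esup => k; apply/measurable_EFinP.
Qed.

Let limsE (f : nat -> R -> R) t (q : R) : (forall k, 0 <= f k t <= C)%R -> f ^~ t @ \oo --> q -> lims f t = q.
Proof.
move=> fC fq; have : EFin \o (f ^~ t) @ \oo --> q%:E by apply/cvg_EFin => //; exact: nearW.
rewrite /lims => /cvg_limn_einf_sup[_ ->] /=.
have q0 : (0 <= q)%R.
  by rewrite -(cvg_lim _ fq)//; apply: limr_ge; [by apply/cvg_ex; exists q|near=> k; have /andP[] := fC k].
have qC : (q <= C)%R.
  by rewrite -(cvg_lim _ fq)//; apply: limr_le; [by apply/cvg_ex; exists q|near=> k; have /andP[] := fC k].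
by rewrite (max_idPr q0) (min_idPr qC).
Unshelve. all: by end_near. Qed.

Let bounded_int (f : R -> R) (a b : R) : measurable_fun [set: R] f -> (forall t, 0 <= f t <= C)%R ->
  mu.-integrable `]a, b] (EFin \o f).
Proof.
move=> mf fC; apply: measurable_bounded_integrable => //.
- apply: (@le_lt_trans _ _ (@lebesgue_measure R `]a, b]%classic)); first by [].
  by rewrite lebesgue_measure_itv/=; case: ifP; rewrite ?ltry// -EFinB ltry.
- exact: measurable_funTS.
- exists C; split; first exact: num_real.
  move=> x Cx t _ /=; have /andP[f0 fc] := fC t.
  by rewrite ger0_norm// (le_trans fc)// ltW.
Qed.

Let int_lims (f : nat -> R -> R) (a b : R) : (forall k, measurable_fun [set: R] (f k)) ->
  (forall k t, 0 <= f k t <= C)%R ->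
  {ae mu, forall t, exists q : R, f ^~ t @ \oo --> q} ->
  \int[mu]_(t in `]a, b]) (f k t)%:E @[k --> \oo] --> \int[mu]_(t in `]a, b]) (lims f t)%:E.
Proof.
move=> mf fC fq.
have mab : measurable (`]a, b]%classic : set (measurableTypeR R)) by exact: measurable_itv.
have [] := @dominated_convergence _ (measurableTypeR R) R mu `]a, b]%classic mab
   (fun k t => (f k t)%:E) (fun t => (lims f t)%:E) (cst C%:E).
- by move=> k; apply/measurable_EFinP/measurable_funTS; exact: mf.
- by apply/measurable_EFinP/measurable_funTS; exact: measurable_lims.
- apply: (@filterS _ _ (ae_filter_ringOfSetsType mu) _ _ _ fq) => t [q fq'] _.
  by apply/cvg_EFin; [exact: nearW|rewrite (limsE _ fq')].
- by apply: (bounded_int (f := cst C)) => // t; rewrite C0 lexx.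
- apply: (@filterS _ _ (ae_filter_ringOfSetsType mu) _ _ _ fq) => t _ k _ /=.
  by rewrite lee_fin; have /andP[f0 fc] := fC k t; rewrite ger0_norm.
- by move=> _ _.
Qed.

Let gshift k t := g k (t + h k)%R.

Let mgshift k : measurable_fun setT (gshift k).
Proof. by apply: measurableT_comp => //; exact: measurable_shift. Qed.

(** Shifting the argument by [h k] changes only the two end pieces of the interval of integration,
    each of length [h k]. *)
Let shift_close k (a b : R) : (a <= b)%R ->
  (`|fine (\int[mu]_(t in `]a, b]) (gshift k t)%:E)%E -
     fine (\int[mu]_(t in `]a, b]) (g k t)%:E)%E| <= C * h k)%R.
Proof.
move=> ab; rewrite ge0_integral_shift//.
have gk0C t : (0 <= g k t <= C)%R by rewrite g0 gC.
have gi x y : mu.-integrable `]x, y] (EFin \o g k) by exact: bounded_int.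
have fin x y : \int[mu]_(t in `]x, y]) (g k t)%:E \is a fin_num.
  by apply: integrable_fin_num => //; exact: measurable_itv.
have split3 x y z : (x <= y)%R -> (y <= z)%R ->
   fine (\int[mu]_(t in `]x, z]) (g k t)%:E) =
   (fine (\int[mu]_(t in `]x, y]) (g k t)%:E) + fine (\int[mu]_(t in `]y, z]) (g k t)%:E))%R.
  move=> xy yz; rewrite -fineD//; congr fine.
  rewrite (@itv_bndbnd_setU _ _ _ (BRight y)) ?bnd_simp//.
  rewrite ge0_integral_setU//=.
  - by apply/measurable_EFinP/measurable_funTS; exact: mg.
  - by move=> t _; rewrite lee_fin.
  - apply/disj_setPS => t [] /=; rewrite !in_itv/= => /andP[_ h1] /andP[h2 _].
    by have := lt_le_trans h2 h1; rewrite ltxx.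
have small x : (0 <= fine (\int[mu]_(t in `]x, (x + h k)%R]) (g k t)%:E) <= C * h k)%R.
  rewrite fine_ge0 /=; last by apply: integral_ge0 => t _; rewrite lee_fin.
  rewrite -lee_fin fineK//.
  apply: (@le_trans _ _ (\int[mu]_(t in `]x, (x + h k)%R]) (cst C%:E) t)).
    apply: ge0_le_integral => //=.
    - by move=> t _; rewrite lee_fin.
    - by apply/measurable_EFinP/measurable_funTS; exact: mg.
    - by move=> t _; rewrite lee_fin.
  rewrite integral_cst//=.
  rewrite lebesgue_measure_itv/= lte_fin ltrDl h0 -EFinB -EFinM lee_fin.
  by rewrite addrAC subrr add0r.
have e1 := split3 a b (b + h k)%R ab; rewrite lerDl (ltW (h0 k)) in e1.
have e2 := split3 a (a + h k)%R (b + h k)%R; rewrite lerDl lerD2r (ltW (h0 k)) ab in e2.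
have e3 := e1 isT; rewrite (e2 isT isT) in e3.
have /andP[s1 s2] := small a; have /andP[s3 s4] := small b.
move: e3 s1 s2 s3 s4; clear split3 small e1 e2 gi fin.
move: (fine _) (fine _) (fine _) (fine _) (C * h k)%R => i1 i2 i3 i4 i5 *.
by rewrite ler_norml; apply/andP; split; lra.
Qed.

(* The two limits have the same integral on every interval. *)
Lemma shift_limit : {ae mu, forall t, exists q : R, g ^~ t @ \oo --> q} ->
  {ae mu, forall t, exists q : R, gshift ^~ t @ \oo --> q} ->
  {ae mu, forall t, forall q r : R, g ^~ t @ \oo --> q -> gshift ^~ t @ \oo --> r -> q = r}.
Proof.
move=> gq sq.
have gk0C k t : (0 <= g k t <= C)%R by rewrite g0 gC.
have sk0C k t : (0 <= gshift k t <= C)%R by rewrite /gshift g0 gC.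
have mq := measurable_lims mg; have ms := measurable_lims mgshift.
have lims0C f t : (0 <= lims f t <= C)%R by rewrite lims_ge0 lims_le.
have eqint (a b : R) : (a <= b)%R -> \int[mu]_(t in `]a, b]) (lims g t)%:E =
    \int[mu]_(t in `]a, b]) (lims gshift t)%:E.
  move=> ab.
  have fin (f : R -> R) : measurable_fun [set: R] f -> (forall t, 0 <= f t <= C)%R ->
      \int[mu]_(t in `]a, b]) (f t)%:E \is a fin_num.
    move=> mf fC; apply: integrable_fin_num; first exact: measurable_itv.
    exact: bounded_int.
  rewrite -(fineK (fin _ mq (lims0C g))) -(fineK (fin _ ms (lims0C gshift))); congr EFin.
  have c1 := @int_lims g a b mg gk0C gq; have c2 := @int_lims gshift a b mgshift sk0C sq.
  rewrite -(fineK (fin _ mq (lims0C g))) in c1; rewrite -(fineK (fin _ ms (lims0C gshift))) in c2.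
  have /= := cvgB (fine_cvg c2) (fine_cvg c1).
  set u := (X in X @ _ --> _) => ul.
  have u0 : u @ \oo --> 0%R.
    apply/cvgrPdist_le => e e0; near=> k; rewrite sub0r normrN.
    apply: le_trans (shift_close k ab) _.
    have : (h k < e / (C + 1))%R.
      near: k; have ec : (0 < e / (C + 1))%R by rewrite divr_gt0// ltr_wpDl.
      exact: (near_infty_natSinv_lt (PosNum ec)).
    have C1 : (0 < C + 1)%R by rewrite ltr_wpDl.
    rewrite ltr_pdivlMr// => /ltW; apply: le_trans.
    by rewrite mulrC ler_wpM2l ?(ltW (h0 k))// lerDl.
  by apply/eqP; rewrite eq_sym -subr_eq0; apply/eqP; exact: (cvg_unique _ (ul _ _ _) u0).
pose s t := (lims gshift t - lims g t)%R.
have ms' : measurable_fun [set: R] s by exact: measurable_funB.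
have si (a b : R) : mu.-integrable `]a, b] (EFin \o s).
  have mab : measurable (`]a, b]%classic : set (measurableTypeR R)) by exact: measurable_itv.
  have := integrableB mab (@bounded_int _ a b ms (lims0C gshift)) (@bounded_int _ a b mq (lims0C g)).
  by apply: eq_integrable => // t _ /=; rewrite EFinB.
have s0 (a b : R) : (\int[mu]_(t in `]a, b]) s t)%R = 0%R.
  have [ab|ba] := leP a b; last first.
    rewrite (_ : `]a, b]%classic = set0) ?Rintegral_set0//.
    by rewrite set_itv_ge// bnd_simp -leNgt ltW.
  rewrite RintegralB; [|exact: measurable_itv|exact: bounded_int|exact: bounded_int].
  by rewrite /Rintegral eqint// subrr.
have sloc : locally_integrable [set: R] s.
  split => //; first exact: openT.
  move=> K _ cK; apply: (@le_lt_trans _ _ (\int[mu]_(x in K) (cst C%:E) x)).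
    apply: ge0_le_integral => //=.
    - exact: compact_measurable.
    - by apply/measurable_EFinP; apply: measurableT_comp => //; exact: measurable_funTS.
    - move=> t _; rewrite lee_fin /s; have /andP[a1 a2] := lims0C g t.
      by have /andP[a3 a4] := lims0C gshift t; rewrite ler_norml; apply/andP; split; lra.
  rewrite integral_cst//; last exact: compact_measurable.
  by rewrite lte_mul_pinfty ?lee_fin//; exact: compact_finite_measure.
(* Almost everywhere [s] is the derivative of its integral from [- N], and that integral vanishes
   identically. *)
have ae0 N : {ae mu, forall t, (- N%:R < t)%R -> s t = 0%R}.
  have := @FTC1 R s (BRight (- N%:R)%R) (fun y => si _ y) sloc.
  apply: (@filterS _ _ (ae_filter_ringOfSetsType mu)) => t ht Nt.
  have [//|_ <-] := ht _.
  rewrite (_ : (fun _ => _) = cst 0%R) ?derive1_cst//.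
  by apply/funext => x; rewrite s0.
have h1 := ae_foralln ae0.
apply: (@filterS3 _ _ (ae_filter_ringOfSetsType mu) _ _ _ _ _ h1 gq sq) => t st _ _ q r tq tr.
have tN : (- (Num.truncn `|t|).+1%:R < t)%R.
  by have := Num.Theory.truncnS_gt `|t|; rewrite ltr_norml => /andP[].
have := st _ tN; rewrite /s (limsE (gk0C^~ t) tq) (limsE (sk0C^~ t) tr) => /eqP.
by rewrite subr_eq0 => /eqP.
Unshelve. all: by end_near. Qed.

End ShiftLimit.

End LineShift.

(** * Null sets and their sections by parallel lines *)

Section LineSections.
Context {R : realType} {n : nat}.
Local Open Scope ereal_scope.
Notation lambda := (@lebesgue_measure R).

Lemma continuous_boxType_measurable (f : 'rV[R]_n -> R) : continuous f ->
  measurable_fun [set: @boxType R n] (f : boxType -> R).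
Proof.
move=> cf; apply: (@measurability _ _ (@boxType R n) (measurableTypeR R) setT f (@RGenOpens.G R)).
  exact: RGenOpens.measurableE.
move=> _ [_ [a [b ->]] <-]; rewrite setTI; apply: open_boxType_measurable.
by move/continuousP: cf; apply; exact: interval_open.
Qed.

Let sigma_finite_hmeasure : sigma_finite [set: @boxType R n] (hmeasure n).
Proof.
exists (fun k => box (- const_mx k%:R) (const_mx k%:R)).
  apply/esym/seteqP; split => // x _; exists (Num.truncn `|x|).+1 => // i.
  rewrite !mxE; have := coord_norm x i; rewrite ler_norml => /andP[h1 h2].
  have h3 := Num.Theory.truncnS_gt `|x|%R.
  by apply/andP; split; [apply: le_trans h1; rewrite lerN2 ltW|exact: le_lt_trans h3].
by move=> k; split; [exact: box_measurable|exact: hausdorff_box_finite].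
Qed.

HB.instance Definition _ := @Measure_isSigmaFinite.Build _ _ _
  (@hmeasure R n n) sigma_finite_hmeasure.

Notation mu := (@hmeasure R n n).

Let line (e : 'rV[R]_n) (p : @boxType R n * measurableTypeR R) : @boxType R n :=
  ((p.1 : 'rV[R]_n) + (p.2 : R) *: e)%R.

Let measurable_line e : measurable_fun setT (line e).
Proof.
apply: (@measurability _ _ (@boxType R n * measurableTypeR R)%type (@boxType R n) setT (line e) (@boxes R n)) => //.
move=> _ [_ [a [b ->]] <-]; rewrite setTI.
have -> : line e @^-1` box a b = \bigcap_(i in [set: 'I_n])
    ((fun p : @boxType R n * measurableTypeR R => (p.1 : 'rV[R]_n) 0%R i + (p.2 : R) * e 0%R i)%R
      @^-1` `[a 0%R i, b 0%R i[%classic).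
  apply/seteqP; split => p.
    by move=> h i _; have := h i; rewrite /line !mxE /= in_itv.
  by move=> h i; have := h i I; rewrite /= in_itv/= /line !mxE.
apply: fin_bigcap_measurable; first exact: finite_finset.
move=> i _; rewrite -[X in measurable X]setTI.
suff mf : measurable_fun setT (fun p : @boxType R n * measurableTypeR R =>
    ((p.1 : 'rV[R]_n) 0%R i + (p.2 : R) * e 0%R i)%R).
  by apply: mf => //; exact: measurable_itv.
apply: measurable_funD => //.
- apply: (measurableT_comp (f := fun x : @boxType R n => (x : 'rV[R]_n) 0%R i) _ measurable_fst).
  apply: continuous_boxType_measurable => x.
  exact: coord_continuous.
- by apply: measurable_funM => //; exact: measurable_snd.
Qed.

Definition line_section (E : set 'rV[R]_n) (e x : 'rV[R]_n) : set R :=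
  [set t | E (x + t *: e)%R].

Lemma measurable_line_section (E : set 'rV[R]_n) e x : measurable (E : set boxType) ->
  measurable (line_section E e x).
Proof.
move=> mE; have mA : measurable (line e @^-1` (E : set boxType)).
  by rewrite -[X in measurable X]setTI; exact: measurable_line.
have := @measurable_xsection _ _ _ _ _ (x : boxType) mA.
by congr measurable; apply/seteqP; split => t; rewrite /xsection /= inE.
Qed.

(** Fubini for the set of pairs [(x, t)] with [x + t *: e] in [E]: at fixed [t] the section is a
    translate of [E], so integrating over the whole line produces the factor [+oo]. A Borel set is
    therefore null exactly when almost all of its line sections are. *)
Lemma line_section_integral (E : set 'rV[R]_n) e : measurable (E : set boxType) ->
  measurable_fun setT (fun x : @boxType R n => lambda (line_section E e x)) /\
  \int[mu]_x lambda (line_section E e x) = hausdorff n E * +oo.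
Proof.
move=> mE; have mA : measurable (line e @^-1` (E : set boxType)).
  by rewrite -[X in measurable X]setTI; exact: measurable_line.
have xE x : xsection (line e @^-1` (E : set boxType)) x = line_section E e x.
  by apply/seteqP; split => t; rewrite /xsection /= inE.
have FE := @indic_fubini_tonelli_FE _ _ _ _ R lambda _ mA.
have FE' : (fun x : @boxType R n => lambda (line_section E e x)) =
    fubini_F lambda (EFin \o \1_(line e @^-1` (E : set boxType))).
  by rewrite FE; apply/funext => x /=; rewrite xE.
split; first by rewrite FE'; exact: indic_measurable_fun_fubini_tonelli_F.
rewrite FE' (@indic_fubini_tonelli _ _ _ _ R mu lambda _ mA).
rewrite (@indic_fubini_tonelli_GE _ _ _ _ R mu _ mA).
rewrite (eq_integral (cst (hausdorff n E))); last first.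
  move=> t _ /=; rewrite -[RHS](hausdorff_translate n E (- (t *: e))%R).
  congr (hausdorff n _); apply/seteqP; split => x.
    rewrite /ysection /= inE => Ex; exists (x + t *: e)%R => //.
    by rewrite addrK.
  by move=> [y Ey <-]; rewrite /ysection /= inE /line /= subrK.
rewrite integral_cst//=; congr (_ * _).
rewrite -set_itvNyy lebesgue_measure_itv/=. 
by [].
Qed.

Lemma null_of_line_sections (E : set 'rV[R]_n) e : measurable (E : set boxType) ->
  {ae mu, forall x, lambda (line_section E e x) = 0} -> hausdorff n E = 0.
Proof.
move=> mE h; have [mF] := line_section_integral e mE.
rewrite (ge0_ae_eq_integral (g := cst 0))//; last first.
  by apply: (@filterS _ _ (ae_filter_ringOfSetsType mu) _ _ _ h) => x hx _.
rewrite integral0 => /esym/eqP; rewrite mule_eq0 /= orbF.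
by move=> /eqP.
Qed.

Lemma line_sections_of_null (E : set 'rV[R]_n) e : measurable (E : set boxType) ->
  hausdorff n E = 0 -> {ae mu, forall x, lambda (line_section E e x) = 0}.
Proof.
move=> mE E0; have [mF I0] := line_section_integral e mE.
rewrite E0 mul0e in I0.
have aI0 : \int[mu]_x `|lambda (line_section E e x)| = 0.
  by rewrite -[RHS]I0; apply: eq_integral => x _; rewrite gee0_abs.
have := (@ae_eq_integral_abs _ _ R mu setT measurableT _ mF).1 aI0.
by apply: (@filterS _ _ (ae_filter_ringOfSetsType mu)) => x /(_ I).
Qed.

End LineSections.

(** * Almost everywhere differentiability of Lipschitz functions *)

Section Rademacher.
Context {R : realType} {n : nat}.
Variables (G : 'rV[R]_n -> R) (C : R).
Hypothesis GC : forall x y, `|G x - G y| <= C * enorm (x - y).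
Implicit Types (x e a b : 'rV[R]_n) (h t : R).

Definition diff_at (F : 'rV[R]_n -> R) x (D : 'rV[R]_n) := forall eps, 0 < eps ->
  exists2 delta, 0 < delta & forall z, enorm z < delta ->
    `|F (x + z) - F x - dot D z| <= eps * enorm z.

Let quot e h x : R := (G (x + h *: e) - G x) / h.

Let continuous_G : continuous G.
Proof.
move=> x; apply/(@cvgrPdist_lt R R _ (nbhs x) (nbhs_filter x)) => eps e0; apply/near_enormP.
have c1 : 0 < `|C| + 1 by rewrite ltr_wpDl.
exists (eps / (`|C| + 1)); first by rewrite divr_gt0.
move=> y; rewrite ltr_pdivlMr// => h; apply: le_lt_trans (GC _ _) _.
rewrite enormB; apply: le_lt_trans h; rewrite mulrC ler_wpM2l//.
by rewrite (le_trans (ler_norm _))// lerDl.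
Qed.

Let continuous_quot e h : continuous (quot e h).
Proof.
move=> x; apply: (@continuousM _ _ (fun x => G (x + h *: e) - G x) (fun=> h^-1)).
  2: exact: cst_continuous.
apply: (@continuousB _ _ _ (fun x => G (x + h *: e)) G); last exact: continuous_G.
apply: (@continuous_comp _ _ _ (fun x => x + h *: e) G); last exact: continuous_G.
by apply: continuousD; [exact: cvg_id|exact: cst_continuous].
Qed.

Let quot_bound e h x : h != 0 -> `|quot e h x| <= C * enorm e.
Proof.
move=> h0; rewrite normrM normfV ler_pdivrMr ?normr_gt0//.
apply: le_trans (GC _ _) _; rewrite addrAC subrr add0r enormZ.
by rewrite -mulrA (mulrC (enorm e)).
Qed.

(* Uniform smallness as a parameter [p] shrinks, in a form which is visibly
   Borel. *)
Let vanishing (T : Type) (S : nat -> set T) (Psi : T -> 'rV[R]_n -> R) : set 'rV[R]_n :=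
  [set x | forall k : nat, exists j : nat, forall p, S j p -> `|Psi p x| <= k.+1%:R^-1].

Let measurable_vanishing T S Psi : (forall p, continuous (Psi p)) ->
  measurable (@vanishing T S Psi : set boxType).
Proof.
move=> cPsi.
have -> : @vanishing T S Psi =
    \bigcap_k \bigcup_j \bigcap_(p in S j) [set x | `|Psi p x| <= k.+1%:R^-1].
  apply/seteqP; split => [x h k _|x h k]; first by have [j hj] := h k; exists j.
  by have [j _ hj] := h k I; exists j.
apply: bigcapT_measurable => k; apply: bigcupT_measurable => j.
apply: closed_boxType_measurable; apply: closed_bigI => p _.
rewrite (_ : [set x | _] = (fun x => `|Psi p x|) @^-1` [set y | y <= k.+1%:R^-1])//.
apply: preimage_closed; last exact: mathcomp.analysis.normedtype_theory.num_normedtype.closed_le.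
by move=> x _; apply: continuous_comp; [exact: cPsi|exact: norm_continuous].
Qed.

Let small (j : nat) : set R := [set h | h != 0 /\ `|h| < j.+1%:R^-1].

(** Existence of the derivative along [e], in the form of a Cauchy criterion: no limit is named,
    which leaves only closed conditions under countable operations. *)
Let good e := vanishing (fun j => small j `*` small j)
  (fun (p : R * R) x => quot e p.1 x - quot e p.2 x).

Let linear_good a b := vanishing small
  (fun h x => quot (a + b) h x - quot a h x - quot b h x).

Let measurable_good e : measurable (good e : set boxType).
Proof.
apply: measurable_vanishing => p x.
by apply: (@continuousB _ _ _ (quot e p.1) (quot e p.2)); exact: continuous_quot.
Qed.

Let measurable_linear_good a b : measurable (linear_good a b : set boxType).
Proof.
apply: measurable_vanishing => p x.
apply: (@continuousB _ _ _ (fun x => quot (a + b) p x - quot a p x) (quot b p)).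
  by apply: (@continuousB _ _ _ (quot (a + b) p) (quot a p)); exact: continuous_quot.
exact: continuous_quot.
Qed.

Let ex_inv (eps : R) : 0 < eps -> exists j : nat, j.+1%:R^-1 < eps.
Proof.
move=> e0; have := near_infty_natSinv_lt (PosNum e0) => -[N _ hN].
by exists N; exact: (hN N (leqnn _)).
Qed.

Let good_cvg e x : good e x -> exists q : R, quot e h x @[h --> (0 : R)^'] --> q.
Proof.
move=> gx; apply/cvg_ex; apply: cauchy_cvg; apply: cauchy_exP => eps e0.
have [k ke] := ex_inv e0; have [j hj] := gx k.
pose h0 : R := j.+2%:R^-1.
have sh0 : small j h0.
  by split; rewrite ?invr_neq0// ger0_norm ?invr_ge0// ltf_pV2 ?posrE// ltr_nat.
exists (quot e h0 x); rewrite /nbhs/= /dnbhs /within /=; apply/nbhs_normP.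
exists j.+1%:R^-1 => /=; first by rewrite invr_gt0.
move=> h /=; rewrite sub0r normrN => hj1 hn0.
apply: le_lt_trans ke; have := hj (h0, h); apply.
by split.
Qed.

Let cvg_good e x (q : R) : quot e h x @[h --> (0 : R)^'] --> q -> good e x.
Proof.
move=> /cvgrPdist_le hq k; have k0 : 0 < k.+1%:R^-1 / 2 :> R by rewrite divr_gt0 ?invr_gt0.
have := hq _ k0; rewrite near_withinE => /nbhs_normP[r /= r0 hr].
have [j jr] := ex_inv r0; exists j => -[h h'] [[/= h0 hj] [h'0 h'j]].
have h1 : `|q - quot e h x| <= k.+1%:R^-1 / 2.
  by apply: hr => //=; rewrite sub0r normrN (lt_trans hj).
have h2 : `|q - quot e h' x| <= k.+1%:R^-1 / 2.
  by apply: hr => //=; rewrite sub0r normrN (lt_trans h'j).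
rewrite (_ : quot e h x - quot e h' x = (q - quot e h' x) - (q - quot e h x)); last by ring.
apply: le_trans (ler_normB _ _) _; rewrite [leRHS]splitr lerD//.
Qed.

Let quot_mul e x h (q : R) : h != 0 ->
  `|q - quot e h x| * `|h| = `|G (x + h *: e) - G x - q * h|.
Proof.
by move=> h0; rewrite -normrM -[LHS]normrN /quot mulrBl divfK// opprB.
Qed.

Let lin_cvg e x (q : R) : lin_at (fun t => G (x + t *: e)) 0 q <-> quot e h x @[h --> (0 : R)^'] --> q.
Proof.
split.
- move=> lq; apply/cvgrPdist_le => eps e0; rewrite near_withinE; apply/nbhs_normP.
  have [delta d0 hd] := lq _ e0; exists delta => //= h /=.
  rewrite sub0r normrN => hdel h0; have := hd h hdel.
  rewrite add0r scale0r addr0 => hh.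
  by rewrite -(@ler_pM2r _ `|h|) ?normr_gt0// quot_mul.
- move=> /cvgrPdist_le hq eps e0; have := hq _ e0; rewrite near_withinE.
  move=> /nbhs_normP[r /= r0 hr]; exists r => // h hlt.
  rewrite add0r scale0r addr0.
  have [->|h0] := eqVneq h 0; first by rewrite scale0r addr0 subrr mulr0 subr0 normr0 mulr0.
  have := hr h; rewrite /= sub0r normrN => /(_ hlt h0) hh.
  by rewrite -(@ler_pM2r _ `|h|) ?normr_gt0// quot_mul in hh.
Qed.

Notation lambda := (@lebesgue_measure R).
Notation mu := (@hmeasure R n n).

(** The one-dimensional theorem holds on every line parallel to [e], and Fubini collects these null
    sections. *)
Let good_null e : hausdorff n (~` good e) = 0%E.
Proof.
have mE : measurable (~` good e : set boxType) by apply: measurableC; exact: measurable_good.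
apply: (null_of_line_sections (e := e) mE).
apply: (@aeW _ _ _ mu) => x.
have := @lipschitz_ae_lin_at R (fun t => G (x + t *: e)) (C * enorm e).
have lipg s t : `|G (x + s *: e) - G (x + t *: e)| <= C * enorm e * `|s - t|.
  apply: le_trans (GC _ _) _.
  by rewrite opprD addrACA subrr add0r -scalerBl enormZ -mulrA (mulrC (enorm e)).
move=> /(_ lipg) ae; apply/negligibleP; first exact: measurable_line_section.
apply: negligibleS ae => t /= ngood [q lq]; apply: ngood.
apply: (@cvg_good _ _ q); apply/lin_cvg => eps e0; have [delta d0 hd] := lq _ e0.
exists delta => // h /hd; rewrite add0r scale0r addr0.
by rewrite scalerDl addrA.
Qed.

(** The quotient along [a + b] minus the one along [a] is the quotient along [b] taken at the
    shifted point [x + h *: a]. On lines of direction [a] the shift does not change the limit, by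
    [shift_limit]. *)
Let linear_good_null a b : hausdorff n (~` linear_good a b) = 0%E.
Proof.
have mE : measurable (~` linear_good a b : set boxType).
  by apply: measurableC; exact: measurable_linear_good.
apply: (null_of_line_sections (e := a) mE).
have sec e : {ae mu, forall x, lambda (line_section (~` good e) a x) = 0%E}.
  apply: line_sections_of_null (good_null e).
  by apply: measurableC; exact: measurable_good.
apply: (@filterS3 _ _ (ae_filter_ringOfSetsType mu) _ _ _ _ _ (sec a) (sec b) (sec (a + b))).
move=> x xa xb xab.
have aegood e : lambda (line_section (~` good e) a x) = 0%E ->
    {ae lambda, forall t, good e (x + t *: a)}.
  move=> l0; have mS : measurable (line_section (~` good e) a x).
    by apply: measurable_line_section; apply: measurableC; exact: measurable_good.
  have : lambda.-negligible (line_section (~` good e) a x) by apply/negligibleP.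
  by apply: negligibleS => t /=.
have {xa}ga := aegood _ xa; have {xb}gb := aegood _ xb; have {xab}gab := aegood _ xab.
(* Adding [M] moves the quotients into [[0, 2 * M]], as [shift_limit] wants nonnegative bounded
   functions. *)
pose M : R := C * enorm b.
pose g (k : nat) (t : R) : R := quot b k.+1%:R^-1 (x + t *: a) + M.
have k0 (k : nat) : k.+1%:R^-1 != 0 :> R by rewrite invr_neq0.
have mg k : measurable_fun [set: R] (g k).
  apply: measurable_funD => //; apply: continuous_measurable_fun => t.
  apply: (@continuous_comp _ _ _ (fun t : R => x + t *: a) (quot b k.+1%:R^-1)); last exact: continuous_quot.
  apply: continuousD; first exact: cst_continuous.
  exact: (@scalel_continuous R 'rV[R]_n a).
have gb0 k t : 0 <= g k t <= 2 * M.
  have := quot_bound b (x + t *: a) (k0 k); rewrite ler_norml /g -/M => /andP[h1 h2].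
  by apply/andP; split; lra.
have hk0 : (fun k : nat => k.+1%:R^-1 : R) @ \oo --> (0 : R)^'.
  move=> P; rewrite /dnbhs /within /= => /nbhs_normP[r /= r0 hr].
  have [N Nr] := ex_inv r0; exists N => // k /= Nk; apply: hr; last exact: k0.
  rewrite /= sub0r normrN ger0_norm ?invr_ge0//; apply: le_lt_trans Nr.
  by rewrite lef_pV2 ?posrE// ler_nat.
have quot_seq e y (q : R) : quot e h y @[h --> (0 : R)^'] --> q -> quot e k.+1%:R^-1 y @[k --> \oo] --> q.
  by move=> hq; exact: (cvg_comp (fun k : nat => k.+1%:R^-1 : R) (fun h => quot e h y) hk0 hq).
have shiftE k t : g k (t + k.+1%:R^-1) =
    quot (a + b) k.+1%:R^-1 (x + t *: a) - quot a k.+1%:R^-1 (x + t *: a) + M.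
  rewrite /g /quot -mulrBl; congr (_ / _ + _).
  rewrite opprB addrA subrK scalerDl scalerDr !addrA.
  by [].
have := @shift_limit R g (2 * M) mg (fun k t => (andP (gb0 k t)).1) (fun k t => (andP (gb0 k t)).2).
have cg : {ae lambda, forall t, exists q : R, g ^~ t @ \oo --> q}.
  apply: (@filterS _ _ (ae_filter_ringOfSetsType lambda) _ _ _ gb) => t /good_cvg[q hq].
  by exists (q + M); apply: cvgD; [exact: quot_seq|exact: cvg_cst].
have cs : {ae lambda, forall t, exists q : R, (fun k => g k (t + k.+1%:R^-1)) @ \oo --> q}.
  apply: (@filterS2 _ _ (ae_filter_ringOfSetsType lambda) _ _ _ _ ga gab) => t /good_cvg[q hq] /good_cvg[r hr].
  exists (r - q + M); under eq_fun do rewrite shiftE.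
  by apply: cvgD; [apply: cvgB; exact: quot_seq|exact: cvg_cst].
move=> /(_ cg cs) sl.
apply/negligibleP; first exact: measurable_line_section.
have := @filterI _ _ (ae_filter_ringOfSetsType lambda) _ _ sl
  (@filterI _ _ (ae_filter_ringOfSetsType lambda) _ _ ga
    (@filterI _ _ (ae_filter_ringOfSetsType lambda) _ _ gb gab)).
apply: negligibleS => t /= nlin [st [/good_cvg[qa ha] [/good_cvg[qb hb] /good_cvg[qab hab]]]].
apply: nlin => k.
have h1 : g ^~ t @ \oo --> qb + M by apply: cvgD; [exact: quot_seq|exact: cvg_cst].
have h2 : (fun k => g k (t + k.+1%:R^-1)) @ \oo --> qab - qa + M.
  under eq_fun do rewrite shiftE.
  by apply: cvgD; [apply: cvgB; exact: quot_seq|exact: cvg_cst].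
have qE : qab - qa - qb = 0.
  by have := st _ _ h1 h2; lra.
have : (quot (a + b) h (x + t *: a) - quot a h (x + t *: a) - quot b h (x + t *: a))
   @[h --> (0 : R)^'] --> qab - qa - qb by apply: cvgB => //; exact: cvgB.
rewrite qE.
move=> /cvgrPdist_le hq; have k1 : 0 < k.+1%:R^-1 :> R by rewrite invr_gt0.
have := hq _ k1; rewrite near_withinE => /nbhs_normP[r /= r0 hr].
have [j jr] := ex_inv r0; exists j => h [hn0 hj].
have := hr h; rewrite /= !sub0r !normrN; apply => //.
exact: lt_trans jr.
Qed.

Let int_vec (z : 'rV[int]_n) : 'rV[R]_n := map_mx intr z.

Let int_vecD (y z : 'rV[int]_n) : int_vec (y + z) = int_vec y + int_vec z.
Proof. by apply/rowP => i; rewrite !mxE intrD. Qed.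

Let near_int (N : nat) (y : R) : `|y| <= N.+1%:R ->
  exists k : 'I_(2 * N + 5), `|y - (k%:Z - N.+2%:Z)%:~R| <= 1.
Proof.
rewrite ler_norml => /andP[z1 z2].
have /andP[f1 f2] := Num.Theory.floor_itv y.
have [m mE] : exists m, Num.floor y = m - N.+2%:Z.
  by exists (Num.floor y + N.+2%:Z); rewrite addrK.
rewrite mE in f1 f2; move: f1 f2; rewrite intrD intrB.
have N2 : N.+2%:Z%:~R = N.+1%:R + 1 :> R by rewrite -[LHS]/(N.+2%:R) -natr1.
rewrite N2; have r1 : (1 : int)%:~R = 1 :> R by [].
rewrite r1 => f1 f2.
have m1 : 0 <= m.
  rewrite -ltzD1 -(ltr_int R) intrD r1.
  move: f2 z1; rewrite (_ : 0%:~R = 0 :> R)//.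
  by set a := m%:~R; set b := N.+1%:R; lra.
have m2 : m < (2 * N + 5)%:Z.
  rewrite -(ltr_int R).
  have -> : (2 * N + 5)%:Z%:~R = N.+1%:R + N.+1%:R + 3 :> R.
    by rewrite -[LHS]/((2 * N + 5)%:R) -!natrD; congr _%:R; lia.
  by move: f1 z2; set a := m%:~R; set b := N.+1%:R; lra.
case: m m1 m2 mE f1 f2 => // k _ kN mE f1 f2; rewrite ltz_nat in kN.
exists (Ordinal kN) => /=; rewrite intrB.
rewrite N2 ler_norml; move: f1 f2; set a := k%:~R; set b := N.+1%:R.
by move=> f1 f2; apply/andP; split; lra.
Qed.

(** Off a countable union of null sets, derivatives along integer vectors exist and are additive,
    hence given by a vector [D]. Any [z] is within [n * h] of a multiple [h *: e] of an integer
    vector, where [h = enorm z / N.+1], and the Lipschitz bound absorbs the difference. *)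
Lemma rademacher : exists2 N : set 'rV[R]_n, hausdorff n N = 0%E &
  forall x, ~ N x -> exists D, diff_at G x D.
Proof.
pose bad1 (k : nat) : set 'rV[R]_n :=
  if (unpickle k : option 'rV[int]_n) is Some z then ~` good (int_vec z) else set0.
pose bad2 (k : nat) : set 'rV[R]_n :=
  if (unpickle k : option ('rV[int]_n * 'rV[int]_n)%type) is Some p
  then ~` linear_good (int_vec p.1) (int_vec p.2) else set0.
exists (\bigcup_k (bad1 k `|` bad2 k)).
  apply: hausdorff_bigcup0 => k; apply/eqP; rewrite eq_le hausdorff_ge0 andbT.
  apply: le_trans (outer_measureU2 (hausdorff n) _ _) _ => /=.
  rewrite (_ : hausdorff n (bad1 k) = 0%E); last first.
    by rewrite /bad1; case: unpickle => [z|]; [exact: good_null|exact: hausdorff0].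
  rewrite (_ : hausdorff n (bad2 k) = 0%E) ?adde0//.
  by rewrite /bad2; case: unpickle => [z|]; [exact: linear_good_null|exact: hausdorff0].
move=> x xN.
have xg z : good (int_vec z) x.
  apply: contrapT => nz; apply: xN; exists (pickle z) => //; left.
  by rewrite /bad1 pickleK.
have xl y z : linear_good (int_vec y) (int_vec z) x.
  apply: contrapT => nz; apply: xN; exists (pickle (y, z)) => //; right.
  by rewrite /bad2 pickleK.
have ex z : exists q : R, quot (int_vec z) h x @[h --> (0 : R)^'] --> q := good_cvg (xg z).
have [q hq] := choice ex.
have qD y z : q (y + z) = q y + q z.
  have h1 : (quot (int_vec (y + z)) h x - quot (int_vec y) h x - quot (int_vec z) h x)
     @[h --> (0 : R)^'] --> q (y + z) - q y - q z.
    by apply: cvgB => //; apply: cvgB.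
  have h0 : (quot (int_vec (y + z)) h x - quot (int_vec y) h x - quot (int_vec z) h x)
     @[h --> (0 : R)^'] --> (0 : R).
    apply/cvgrPdist_le => eps e0; have [k ke] := ex_inv e0.
    have [j hj] := xl y z k; rewrite near_withinE; apply/nbhs_normP.
    exists j.+1%:R^-1 => /=; first by rewrite invr_gt0.
    move=> h /=; rewrite !sub0r !normrN => hlt hn0; apply: le_trans (ltW ke).
    by rewrite int_vecD; apply: hj; split.
  have qE : q (y + z) - q y - q z = 0 := cvg_unique (F := (quot (int_vec (y + z)) h x - quot (int_vec y) h x - quot (int_vec z) h x)
     @[h --> (0 : R)^']) (@norm_hausdorff _ R) h1 h0.
  have {}qE := qE (fmap_proper_filter _ _).
  by apply/eqP; rewrite -subr_eq0 opprD addrA qE.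
have q0 : q 0 = 0 by have := qD 0 0; rewrite addr0; lra.
have qN z : q (- z) = - q z.
  by have := qD z (- z); rewrite subrr q0; lra.
have qn (k : nat) z : q (z *+ k) = k%:R * q z.
  elim: k => [|k IH]; first by rewrite mulr0n q0 mul0r.
  by rewrite mulrS qD IH -natr1 mulrDl mul1r addrC.
pose D : 'rV[R]_n := \row_i q (delta_mx 0 i).
have qE z : q z = dot D (int_vec z).
  rewrite {1}(row_sum_delta z) (big_morph q qD q0); apply: eq_bigr => i _.
  have qz (k : nat) w : q (k%:Z *: w) = k%:R * q w.
    rewrite -(qn k w); congr (q _); rewrite -scaler_nat.
    by congr (_ *: _); rewrite natz.
  rewrite !mxE mulrC; case: (z 0 i) => k; first by rewrite qz.
  by rewrite NegzE scaleNr qN qz -mulNr intrN.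
exists D => eps e0.
pose C1 := `|C| + 1; have C10 : 0 < C1 by rewrite ltr_wpDl.
(* The three terms, times [h], bound the error of replacing [z] by [h *: e] in [G], the error of the
   difference quotient, and the error of the same replacement in [D]. *)
pose B := C1 * n%:R + 1 + enorm D * n%:R.
have B0 : 0 < B by rewrite /B ltr_wpDr ?mulr_ge0// ltr_wpDl ?mulr_ge0 ?(ltW C10).
have [N BN] : exists N : nat, B / N.+1%:R <= eps.
  exists (Num.truncn (B / eps)); rewrite ler_pdivrMr// mulrC -ler_pdivrMr//.
  by apply: ltW; exact: Num.Theory.truncnS_gt.
(* Only finitely many integer directions occur for a given [N], so one radius serves for all their
   quotients. *)
pose ev (f : {ffun 'I_n -> 'I_(2 * N + 5)}) : 'rV[int]_n := \row_i ((f i)%:Z - N.+2%:Z).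
have near_all : \forall h \near (0 : R), forall f, h != 0 ->
    `|q (ev f) - quot (int_vec (ev f)) h x| <= 1.
  apply: (@filter_forall _ {ffun 'I_n -> 'I_(2 * N + 5)}
    (fun f h => h != 0 -> `|q (ev f) - quot (int_vec (ev f)) h x| <= 1)
    (nbhs (0 : R)) (nbhs_filter _)) => f; have /cvgrPdist_le/(_ _ ltr01) := hq (ev f).
  by rewrite near_withinE.
have /nbhs_normP[r /= r0 hr] := near_all.
exists r => // z zr.
have [->|z0] := eqVneq z 0; first by rewrite addr0 subrr dot0r subrr normr0 enorm0 mulr0.
have zp : 0 < enorm z by rewrite enorm_gt0.
pose h := enorm z / N.+1%:R.
have h0 : 0 < h by rewrite divr_gt0.
have hE : enorm z = N.+1%:R * h by rewrite mulrC divfK.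
have exf i : exists k : 'I_(2 * N + 5), `|z 0 i - h * (k%:Z - N.+2%:Z)%:~R| <= h.
  have zih : `|z 0 i / h| <= N.+1%:R.
    rewrite normrM normfV (gtr0_norm h0) ler_pdivrMr// -hE.
    exact: coord_enorm.
  pose m := Num.floor (z 0 i / h) + N.+2%:Z.
  have [k hk] := near_int zih; exists k.
  rewrite (_ : _ - _ = h * (z 0 i / h - (k%:Z - N.+2%:Z)%:~R)); last first.
    by rewrite mulrBr mulrCA mulfV ?lt0r_neq0// mulr1.
  by rewrite normrM (gtr0_norm h0) ler_piMr ?(ltW h0).
have [f hf] := choice exf; pose e := int_vec (ev [ffun i => f i]).
have zhe : enorm (z - h *: e) <= n%:R * h.
  apply: le_trans (enorm_norm _) _; rewrite ler_wpM2l//.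
  rewrite /Num.norm/= mx_normrE; apply/bigmax_leP; split => [|[j i] _ /=]; first exact: ltW.
  by rewrite (ord1 j) !mxE ffunE; exact: hf.
have t1 : `|G (x + z) - G (x + h *: e)| <= C1 * (n%:R * h).
  apply: le_trans (GC _ _) _; rewrite addrKA opprK || rewrite opprD addrACA subrr add0r.
  apply: (@le_trans _ _ (C1 * enorm (z - h *: e))); last by rewrite ler_pM2l.
  by rewrite ler_wpM2r// (le_trans (ler_norm _))// lerDl.
have t2 : `|G (x + h *: e) - G x - dot D (h *: e)| <= h.
  have hh : `|0 - h| < r.
    rewrite sub0r normrN gtr0_norm//; apply: le_lt_trans zr.
    by rewrite hE ler_peMl ?(ltW h0)// ler1n.
  have := hr h hh [ffun i => f i] (lt0r_neq0 h0); rewrite -(@ler_pM2r _ `|h|) ?normr_gt0 ?lt0r_neq0//.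
  by rewrite quot_mul ?lt0r_neq0// mul1r qE dotZr mulrC (gtr0_norm h0).
have t3 : `|dot D (h *: e) - dot D z| <= enorm D * (n%:R * h).
  rewrite -dotBr; apply: le_trans (CauchySchwarz _ _) _.
  by rewrite ler_wpM2l// enormB.
rewrite (_ : G (x + z) - G x - dot D z = (G (x + z) - G (x + h *: e)) +
   (G (x + h *: e) - G x - dot D (h *: e)) + (dot D (h *: e) - dot D z)); last by ring.
apply: le_trans (ler_normD _ _) _; apply: le_trans (lerD (ler_normD _ _) (lexx _)) _.
apply: (@le_trans _ _ (B * h)).
  have -> : B * h = C1 * (n%:R * h) + h + enorm D * (n%:R * h) by rewrite /B; ring.
  exact: lerD (lerD t1 t2) t3.
by rewrite /h mulrCA mulrC ler_pM2r.
Qed.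

End Rademacher.

(** * Power means and the geometric mean *)

Section PowerMean.
Context {R : realType}.
Implicit Types (p q h t x : R).

Lemma expR_convex t x : 0 <= t -> t <= 1 -> expR (t * x) <= t * expR x + (1 - t).
Proof.
move=> t0 t1.
have e1 : expR x = expR (t * x) * expR ((1 - t) * x).
  by rewrite -expRD; congr expR; ring.
have e2 : 1 = expR (t * x) * expR (- (t * x)) by rewrite -expRD subrr expR0.
have -> : t * expR x + (1 - t) = expR (t * x) * (t * expR ((1 - t) * x) + (1 - t) * expR (- (t * x))).
  rewrite mulrDr mulrCA -e1 (mulrCA (expR (t * x)) (1 - t)) -e2; ring.
rewrite ler_peMr ?expR_ge0//.
have h1 : t * (1 + (1 - t) * x) <= t * expR ((1 - t) * x) by rewrite ler_wpM2l// expR_ge1Dx.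
have h2 : (1 - t) * (1 + - (t * x)) <= (1 - t) * expR (- (t * x)).
  by rewrite ler_wpM2l ?subr_ge0// expR_ge1Dx.
apply: le_trans (lerD h1 h2).
by rewrite le_eqVlt; apply/orP; left; apply/eqP; ring.
Qed.

(** The deformed logarithm (Box and Cox): it decreases to [ln h] as [p] tends to 0 from above, and
    at [h = 0] equals [- 1 / p], which tends to [-oo]. *)
Definition dilog p h : R := (h `^ p - 1) / p.

Lemma powR_expR p h : 0 < h -> h `^ p = expR (p * ln h).
Proof. by move=> h0; rewrite /powR gt_eqF. Qed.

Lemma le_dilog p q h : 0 < p -> p <= q -> 0 <= h -> dilog p h <= dilog q h.
Proof.
move=> p0 pq; have q0 := lt_le_trans p0 pq.
rewrite le_eqVlt => /predU1P[<-|h0]; rewrite /dilog.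
  rewrite !powR0 ?gt_eqF// sub0r !mulN1r lerN2.
  by rewrite lef_pV2.
rewrite !powR_expR// ler_pdivrMr// -mulrA (mulrC _ p) mulrA mulrAC -mulrA.
have t0 : 0 <= p / q by rewrite divr_ge0 ?ltW.
have t1 : p / q <= 1 by rewrite ler_pdivrMr// mul1r.
have := @expR_convex (p / q) (q * ln h) t0 t1.
by rewrite mulrA divfK ?gt_eqF// mulrBl mul1r => H; rewrite -subr_ge0; move: H; rewrite -subr_ge0; congr (0 <= _); ring.
Qed.

Lemma ln_le_dilog p h : 0 < p -> 0 < h -> ln h <= dilog p h.
Proof.
move=> p0 h0; rewrite /dilog ler_pdivlMr// powR_expR// lerBrDr addrC mulrC.
exact: expR_ge1Dx.
Qed.

Lemma dilog_le p h : 0 < p -> 0 < h -> dilog p h <= ln h * expR (p * ln h).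
Proof.
move=> p0 h0; rewrite /dilog ler_pdivrMr// powR_expR//.
have := expR_ge1Dx (- (p * ln h)).
rewrite -(@ler_pM2l _ (expR (p * ln h))) ?expR_gt0// -expRD subrr expR0.
by rewrite mulrDr mulr1; set a := expR _; lra.
Qed.

Lemma dilog_cvg h : 0 <= h -> (dilog k.+1%:R^-1 h)%:E @[k --> \oo] --> lne h%:E.
Proof.
have inv0 : (fun k : nat => k.+1%:R^-1 : R) @ \oo --> (0 : R).
  exact: (@cvg_harmonic R).
rewrite le_eqVlt => /predU1P[<-|h0].
  rewrite (le0_lneNy (lexx _)).
  rewrite (_ : (fun _ => _) = (fun k : nat => (- k.+1%:R)%:E : \bar R)); last first.
    apply/funext => k; rewrite /dilog powR0 ?invr_neq0// sub0r mulN1r invrK.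
    by [].
  apply/cvgeNyPle => A; exists (Num.truncn `|A|) => // k /= kA.
  rewrite lee_fin lerNl; apply: (le_trans (ler_norm _)); rewrite normrN.
  by apply: ltW; apply: lt_le_trans (Num.Theory.truncnS_gt _) _; rewrite ler_nat.
rewrite lne_EFin//; apply: cvg_EFin; first by near=> k.
apply: (@squeeze_cvgr _ _ _ _ (fun=> ln h) (fun k : nat => ln h * expR (k.+1%:R^-1 * ln h))).
- near=> k; apply/andP; split; first by apply: ln_le_dilog => //; rewrite invr_gt0.
  by apply: dilog_le => //; rewrite invr_gt0.
- exact: cvg_cst.
- rewrite -[X in _ --> X]mulr1 -[X in _ * X](@expR0 R); apply: cvgM; first exact: cvg_cst.
  have c0 : (fun k : nat => k.+1%:R^-1 * ln h) @ \oo --> (0 : R).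
    by rewrite -(mul0r (ln h)); apply: cvgM => //; exact: cvg_cst.
  exact: (cvg_comp (fun k : nat => k.+1%:R^-1 * ln h) expR c0 (@continuous_expR R 0)).
Unshelve. all: by end_near. Qed.

Local Open Scope ereal_scope.

(** The deficit in [log h <= h - 1]; it is nonnegative, and [+oo] at [h = 0], so its integral always
    makes sense. *)
Definition logdef h : \bar R := (h - 1)%:E - lne h%:E.

Lemma logdef_ge0 h : (0 <= h)%R -> 0 <= logdef h.
Proof.
rewrite le_eqVlt => /predU1P[<-|h0]; rewrite /logdef.
  by rewrite (le0_lneNy (lexx _)) /= leey.
rewrite lne_EFin// -EFinB lee_fin.
have := @le_ln1Dx R (h - 1)%R; rewrite addrCA subrr addr0 subr_ge0; apply.
by rewrite ltrBrDr addNr.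
Qed.

(* [exp x >= 1 + x] at [x = p (log h - c)], rearranged so that both sides are
   nonnegative. *)
Lemma powR_tangent p h (c : R) : (0 < p)%R -> (0 <= h)%R ->
  (1 + p * h + p * (`|c| - c))%:E <=
  (expR (- (p * c)) * h `^ p)%:E + p%:E * logdef h + (p * (1 + `|c|))%:E.
Proof.
move=> p0; rewrite le_eqVlt => /predU1P[<-|h0]; rewrite /logdef.
  by rewrite (le0_lneNy (lexx _)) /= muleC gt0_mulye ?lte_fin//= leey.
rewrite lne_EFin// -EFinB -EFinM -!EFinD lee_fin powR_expR// -expRD.
have := expR_ge1Dx (- (p * c) + p * ln h); set a := expR _.
move=> H; rewrite -subr_ge0; move: H; rewrite -subr_ge0; congr (0 <= _)%R; ring.
Qed.

End PowerMean.

Section PowerMeanLimit.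
Local Open Scope ereal_scope.
Context {disp : measure_display} {T : measurableType disp} {R : realType}.
Variables (mu : {measure set T -> \bar R}) (D : set T) (H : T -> R) (P A : R).
Hypotheses (mD : measurable D) (mH : measurable_fun D H).
Hypotheses (H0 : forall x, (0 <= H x)%R) (P0 : (0 < P)%R).
Hypotheses (DP : mu D = P%:E) (HA : \int[mu]_(x in D) (H x)%:E = A%:E).

Lemma measurable_lne_EFin : measurable_fun [set: R] (fun h : R => lne h%:E).
Proof.
rewrite (_ : (fun h => _) = fun h : R => if (h <= 0)%R then -oo else (ln h)%:E); last first.
  by apply/funext => h; case: ifPn => h0; [rewrite le0_lneNy|rewrite lne_EFin// ltNge].
apply: measurable_fun_ifT => //; first exact: measurable_fun_ler.
by apply/measurable_EFinP; exact: measurable_ln.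
Qed.

Let mlogH : measurable_fun D (fun x => lne (H x)%:E).
Proof. exact: (measurableT_comp measurable_lne_EFin mH). Qed.

Let mEH : measurable_fun D (fun x => (H x)%:E).
Proof. exact/measurable_EFinP. Qed.

Let mpow p : measurable_fun D (fun x => H x `^ p)%R.
Proof. exact: (measurableT_comp (measurable_powR p) mH). Qed.

Let mdilog p : measurable_fun D (fun x => (H x - 1 - dilog p (H x)))%R.
Proof.
apply: measurable_funB; first exact: measurable_funB.
by apply: measurable_funM => //; apply: measurable_funB.
Qed.

Let mdef : measurable_fun D (fun x => logdef (H x)).
Proof.
apply: emeasurable_funB => //; apply/measurable_EFinP; exact: measurable_funB.
Qed.

Let Jp p : \bar R := \int[mu]_(x in D) (H x - 1 - dilog p (H x))%:E.
Let J := \int[mu]_(x in D) logdef (H x).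
Let Ap p := \int[mu]_(x in D) (H x `^ p)%:E.

Let dil_ge0 p x : (0 < p)%R -> (p <= 1)%R -> (0 <= H x - 1 - dilog p (H x))%R.
Proof.
move=> p0 p1; rewrite subr_ge0; apply: le_trans (le_dilog p0 p1 (H0 x)) _.
by rewrite /dilog powRr1// divr1.
Qed.

Let int_cst (c : R) : \int[mu]_(x in D) c%:E = (c * P)%:E.
Proof. by rewrite integral_cst// DP. Qed.

Let intD f g : (forall x, 0 <= f x) -> (forall x, 0 <= g x) ->
  measurable_fun D f -> measurable_fun D g ->
  \int[mu]_(x in D) (f x + g x) = \int[mu]_(x in D) f x + \int[mu]_(x in D) g x.
Proof. by move=> f0 g0 mf mg; apply: ge0_integralD. Qed.

Let intZ p f : (0 <= p)%R -> (forall x, 0 <= f x) -> measurable_fun D f ->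
  \int[mu]_(x in D) (p%:E * f x) = p%:E * \int[mu]_(x in D) f x.
Proof. by move=> p0 f0 mf; apply: ge0_integralZl_EFin. Qed.

(** Integrates the pointwise identity [h ^ p + p * (h - 1 - dilog p h) = p * h + 1 - p], arranged as
    sums of nonnegative terms because finiteness of [Ap] and [Jp] is only deduced from it. *)
Let ApE p : (0 < p)%R -> (p <= 1)%R ->
  Ap p + p%:E * Jp p = (p * A + (1 - p) * P)%:E.
Proof.
move=> p0 p1; have p0' := ltW p0.
have p1' : (0 <= 1 - p)%R by rewrite subr_ge0.
have d0 x : 0 <= (H x - 1 - dilog p (H x))%:E by rewrite lee_fin dil_ge0.
have md : measurable_fun D (fun x => (H x - 1 - dilog p (H x))%:E).
  exact/measurable_EFinP.
have HE0 x : 0 <= (H x)%:E by rewrite lee_fin.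
rewrite /Jp -(intZ p0' d0 md) -intD; last 4 first.
- by move=> x; rewrite lee_fin powR_ge0.
- by move=> x; rewrite mule_ge0.
- exact/measurable_EFinP.
- exact: measurable_funeM.
rewrite EFinD EFinM -HA -(int_cst (1 - p)) -intZ// -intD; last 4 first.
- by move=> x; rewrite mule_ge0.
- by move=> x; rewrite lee_fin.
- exact: measurable_funeM.
- exact: measurable_cst.
apply: eq_integral => x _; rewrite -!EFinM -!EFinD; congr _%:E; rewrite /dilog.
by rewrite mulrBr mulrBr mulrCA divff ?gt_eqF// mulr1; ring.
Qed.

Let Ap_real p : (0 < p)%R -> (p <= 1)%R -> exists ap jp : R,
  [/\ Ap p = ap%:E, Jp p = jp%:E, (0 <= ap)%R, (0 <= jp)%R &
      (ap + p * jp = p * A + (1 - p) * P)%R].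
Proof.
move=> p0 p1; have := ApE p0 p1.
have a0 : 0 <= Ap p by apply: integral_ge0 => x _; rewrite lee_fin powR_ge0.
have j0 : 0 <= Jp p by apply: integral_ge0 => x _; rewrite lee_fin dil_ge0.
move: a0 j0; case: (Ap p) => [a| |]//; case: (Jp p) => [j| |]//.
- rewrite !lee_fin => a0 j0; rewrite -EFinM -EFinD => -[e].
  by exists a, j.
- by move=> _ _; rewrite gt0_muley ?lte_fin.
- by move=> _ _; rewrite gt0_muley ?lte_fin.
Qed.

Let pos_int : \int[mu]_(x in D) (fun x => lne (H x)%:E)^\+ x < +oo.
Proof.
apply: (@le_lt_trans _ _ A%:E); last exact: ltry.
have mlp := measurable_funepos mlogH.
rewrite -HA; apply: ge0_le_integral => //.
move=> x _; rewrite funeposE ge_max lee_fin H0 andbT.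
have := H0 x; rewrite le_eqVlt => /predU1P[<-|h0].
  by rewrite (le0_lneNy (lexx _)) leNye.
by rewrite lne_EFin// lee_fin ltW// ln_sublinear.
Qed.

(** The deficit may have infinite integral, so the relation is first proved with all terms on the
    side where they are nonnegative. The positive part of the logarithm is controlled by [H]. *)
Let intlogE : \int[mu]_(x in D) lne (H x)%:E = (A - P)%:E - J.
Proof.
rewrite integralE.
set Ip := \int[mu]_(x in D) (_ ^\+ x); set In := \int[mu]_(x in D) (_ ^\- x).
have e : J + Ip + P%:E = A%:E + In.
  rewrite -DP -[mu D]mul1e -integral_cst// -HA /J /Ip /In.
  have lp0 x : 0 <= (fun x => lne (H x)%:E)^\+ x by exact: funepos_ge0.
  have ln0 x : 0 <= (fun x => lne (H x)%:E)^\- x by exact: funeneg_ge0.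
  have mlp := measurable_funepos mlogH; have mln := measurable_funeneg mlogH.
  rewrite -intD//; last by move=> x; exact: logdef_ge0.
  rewrite -intD//; last 2 first.
  - by move=> x; rewrite adde_ge0// logdef_ge0.
  - exact: emeasurable_funD.
  have H0E x : 0 <= (H x)%:E by rewrite lee_fin.
  rewrite -intD//.
  apply: eq_integral => x _; rewrite /logdef funeposE funenegE.
  have := H0 x; rewrite le_eqVlt => /predU1P[<-|h0].
    by rewrite le0_lneNy//= maxNye ?maxye ?addye//.
  rewrite lne_EFin// -EFinN -!EFin_max /= -EFinB -!EFinD; congr _%:E.
  set y := ln (H x).
  by case: (leP y 0%R) => h1; case: (leP (- y)%R 0%R) => h2; lra.
have Ip0 : 0 <= Ip by apply: integral_ge0.
have In0 : 0 <= In by apply: integral_ge0.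
have J0 : 0 <= J by apply: integral_ge0 => x _; exact: logdef_ge0.
move: pos_int e; rewrite -/Ip; move: Ip0 In0 J0.
case: Ip => [i| |]//; case: In => [n| |]//; case: J => [j| |]//.
by move=> _ _ _ _; rewrite -!EFinD => -[e]; congr _%:E; lra.
Qed.

Let Jcvg : (Jp k.+1%:R^-1) @[k --> \oo] --> J.
Proof.
have lim x : limn (fun k => (H x - 1 - dilog k.+1%:R^-1 (H x))%:E) = logdef (H x).
  apply/cvg_lim => //; under eq_fun do rewrite EFinB.
  by apply: cvgeB; [|exact: cvg_cst|exact: dilog_cvg].
have := @cvg_monotone_convergence _ _ _ mu D mD
  (fun k x => (H x - 1 - dilog k.+1%:R^-1 (H x))%:E).
rewrite /= (_ : (fun x => limn _) = (fun x => logdef (H x))); last first.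
  by apply/funext => x; exact: lim.
apply.
- by move=> k; exact/measurable_EFinP.
- by move=> k x _; rewrite lee_fin dil_ge0 ?invr_gt0// invf_le1// ler1n.
- move=> x _ k l kl; rewrite lee_fin lerB// le_dilog ?invr_gt0//.
  by rewrite lef_pV2 ?posrE// ler_nat.
Qed.

Let pmean p : \bar R := (Ap p / mu D) `^ p^-1%R.

Let mean_real p : (0 < p)%R -> (p <= 1)%R -> exists ap jp m : R,
  [/\ Ap p = ap%:E, Jp p = jp%:E, pmean p = m%:E, (0 <= ap)%R &
    [/\ (ap + p * jp)%R = (p * A + (1 - p) * P)%R, m = ((ap / P) `^ p^-1)%R & (0 <= m)%R ]].
Proof.
move=> p0 p1; have [ap [jp [e1 e2 a0 j0 e]]] := Ap_real p0 p1.
exists ap, jp, ((ap / P) `^ p^-1%R)%R; split => //; last by split => //; rewrite powR_ge0.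
by rewrite /pmean e1 DP inver gt_eqF.
Qed.

(** By the integrated identity the mean of [H ^ p] is [1 + p * x] with [x = (A - P - j) / P], at
    most [expR (p * x)]. *)
Let mean_le p m j : (0 < p)%R -> (p <= 1)%R -> pmean p = m%:E -> Jp p = j%:E ->
  (m <= expR ((A - P - j) / P))%R.
Proof.
move=> p0 p1; have [ap [jp [m' [e1 e2 e3 a0 [e mE m0]]]]] := mean_real p0 p1.
rewrite e2 e3 => -[<-] [<-]; rewrite mE.
have aP : (ap / P = 1 + p * ((A - P - jp) / P))%R.
  apply: (mulIf (lt0r_neq0 P0)); rewrite mulrDl mul1r mulrA !divfK ?gt_eqF//.
  by move: e; rewrite !mulrBr mulrBl mul1r; lra.
rewrite [leRHS](_ : _ = (expR (p * ((A - P - jp) / P))) `^ p^-1)%R; last first.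
  by rewrite -expRM; congr expR; rewrite mulrAC mulfV ?gt_eqF// mul1r.
apply: ge0_ler_powR; rewrite ?nnegrE ?invr_ge0 ?(ltW p0)// ?expR_ge0//.
  by rewrite divr_ge0// ltW.
by rewrite aP expR_ge1Dx.
Qed.

Let mean_ge p m j : (0 < p)%R -> (p <= 1)%R -> pmean p = m%:E -> J = j%:E ->
  (expR ((A - P - j) / P) <= m)%R.
Proof.
move=> p0 p1; have [ap [jp [m' [e1 e2 e3 a0 [e mE m0]]]]] := mean_real p0 p1.
rewrite e3 => -[<-] Jj; rewrite mE.
(* [c] is the mean of [log H]; the tangent at [c] is the one that proves Jensen's inequality for the
   exponential. *)
have [c cE] : exists c, c = ((A - P - j) / P)%R by exists ((A - P - j) / P)%R.
rewrite -cE.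
have H1 : ((1 + p * (`|c| - c)) * P + p * A)%:E <=
    (expR (- (p * c)) * ap)%:E + p%:E * j%:E + (p * (1 + `|c|) * P)%:E.
  have p0' := ltW p0; have c0 : (0 <= 1 + p * (`|c| - c))%R.
    by rewrite addr_ge0// mulr_ge0// subr_ge0 ler_norm.
  have c1 : (0 <= p * (1 + `|c|))%R by rewrite mulr_ge0// addr_ge0.
  have H0E x : 0 <= (H x)%:E by rewrite lee_fin.
  have Hp0E x : 0 <= (H x `^ p)%:E by rewrite lee_fin powR_ge0.
  have mHp : measurable_fun D (fun x => (H x `^ p)%:E) by exact/measurable_EFinP.
  have L0 x : 0 <= logdef (H x) by exact: logdef_ge0.
  rewrite EFinD (EFinM (expR _)) -e1 -Jj -(int_cst (1 + _)) -(int_cst (p * _)).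
  rewrite (EFinM p A) -HA -!intZ ?expR_ge0// -!intD//.
  all: try by move=> x; rewrite ?adde_ge0 ?mule_ge0 ?lee_fin ?expR_ge0.
  all: try exact: measurable_funeM.
  - apply: ge0_le_integral => //.
    + by move=> x _; rewrite adde_ge0 ?mule_ge0// lee_fin.
    + by apply: emeasurable_funD => //; exact: measurable_funeM.
    + apply: emeasurable_funD => //; apply: emeasurable_funD; exact: measurable_funeM.
    + by move=> x _; rewrite -!EFinM -EFinD addrAC; exact: powR_tangent.
  - by move=> x; rewrite adde_ge0// mule_ge0// lee_fin// expR_ge0.
  - by apply: emeasurable_funD; exact: measurable_funeM.
  - by move=> x; rewrite mule_ge0// lee_fin expR_ge0.
have cP : (c * P = A - P - j)%R by rewrite cE divfK// gt_eqF.
have H2 : (P <= expR (- (p * c)) * ap)%R.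
  move: H1; rewrite -EFinM -!EFinD lee_fin !mulrDl !mulrDr mul1r mulr1.
  move=> H1; have : (p * (c * P) = p * (A - P - j))%R by rewrite cP.
  rewrite !mulrBr; rewrite !mulrDl mulrN mulNr -!mulrA in H1.
  by move: H1; set X := (p * (`|c| * P))%R; set Y := (expR _ * _)%R; lra.
have -> : (expR c = (expR (p * c)) `^ p^-1)%R.
  by rewrite -expRM; congr expR; rewrite mulrAC mulfV ?gt_eqF// mul1r.
apply: ge0_ler_powR; rewrite ?nnegrE ?invr_ge0 ?(ltW p0)// ?expR_ge0//.
  by rewrite divr_ge0// ltW.
rewrite ler_pdivlMr// -(@ler_pM2l _ (expR (- (p * c)))) ?expR_gt0// mulrA -expRD.
by rewrite addNr expR0 mul1r.
Qed.

Let mean_homo_J p q : (0 < p)%R -> (p <= q)%R -> (q <= 1)%R -> Jp q <= Jp p.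
Proof.
move=> p0 pq q1; have q0 := lt_le_trans p0 pq.
apply: ge0_le_integral => //.
- by move=> x _; rewrite lee_fin dil_ge0.
- exact/measurable_EFinP.
- exact/measurable_EFinP.
- by move=> x _; rewrite lee_fin lerB// le_dilog.
Qed.

(** The means never go below the geometric mean [l], and lie below [expR ((A - P - Jp p) / P)],
    which decreases to [l] because [Jp] increases to [J] by monotone convergence. *)
Lemma power_mean_limit (a : R) : (0 < a)%R -> exists2 l : R, (0 <= l)%R &
  [/\ (\int[mu]_(x in D) (H x `^ (q / (a + q)))%:E / mu D) `^ (1 + a / q)%R
        @[q --> 0%R^'+] --> l%:E,
      \int[mu]_(x in D) (fun x => lne (H x)%:E)^\+ x < +oo &
      lne l%:E = 1 / mu D * \int[mu]_(x in D) lne (H x)%:E].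
Proof.
move=> a0; rewrite intlogE; have muV : (mu D)^-1 = P^-1%:E by rewrite DP inver gt_eqF.
rewrite muV mul1e.
have J0 : 0 <= J by apply: integral_ge0 => x _; exact: logdef_ge0.
(* An infinite deficit corresponds to [l = 0]. The last clause is the form in which the upper bound
   falls below [l + eps] once [Jp p] is close to [J]. *)
have [l [l0 lE lge lup]] : exists l : R, [/\ (0 <= l)%R,
    lne l%:E = P^-1%:E * ((A - P)%:E - J),
    forall p m, (0 < p)%R -> (p <= 1)%R -> pmean p = m%:E -> (l <= m)%R &
    forall eps, (0 < eps)%R -> (A - P - P * ln (l + eps))%:E < J].
  move: J0 mean_ge; case: J => [j| |]//.
  - move=> _ mge; exists (expR ((A - P - j) / P)); split => //.
    + by apply: etrans (expeRK ((A - P - j) / P)%:E) _; rewrite -EFinB -EFinM mulrC.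
    + by move=> p m p0 p1 pm; apply: mge pm _.
    + move=> eps e0; rewrite lte_fin.
      have : ((A - P - j) / P < ln (expR ((A - P - j) / P) + eps))%R.
        rewrite -[ltLHS]expRK ltr_ln ?posrE ?expR_gt0 ?ltrDl//.
        by rewrite addr_gt0// expR_gt0.
      by rewrite ltr_pdivrMr//; set X := ln _; rewrite mulrC; lra.
  - move=> _ _; exists 0%R; split => //.
    + rewrite le0_lneNy//= gt0_muleNy// lte_fin invr_gt0//.
    + move=> p m p0 p1 pm; have [ap [jp [m' [_ _ e3 _ [_ _ m0]]]]] := mean_real p0 p1.
      by move: e3; rewrite pm => -[->].
    + by move=> eps e0; rewrite ltry.
exists l => //; split => //.
have qp q : (0 < q)%R -> (1 + a / q = (q / (a + q))^-1)%R.
  by move=> q0; rewrite invf_div mulrDl divff ?gt_eqF// addrC.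
have qp0 q : (0 < q)%R -> (0 < q / (a + q))%R by move=> q0; rewrite divr_gt0// addr_gt0.
have qp1 q : (0 < q)%R -> (q / (a + q) <= 1)%R.
  by move=> q0; rewrite ler_pdivrMr ?addr_gt0// mul1r lerDr ltW.
have ME q : (0 < q)%R -> (\int[mu]_(x in D) (H x `^ (q / (a + q)))%:E * P^-1%:E)
   `^ (1 + a / q)%R = pmean (q / (a + q))%R.
  by move=> q0; rewrite /pmean qp// muV.
apply: cvg_EFin.
  near=> q; have q0 : (0 < q)%R by near: q; exact: nbhs_right_gt.
  by have [ap [jp [m [_ _ e _ _]]]] := mean_real (qp0 q q0) (qp1 q q0); rewrite ME// e.
apply/cvgrPdist_lt => eps e0.
have [k _ /(_ k (leqnn k)) kJ] : \forall k \near \oo,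
    (A - P - P * ln (l + eps))%:E < Jp k.+1%:R^-1.
  have := Jcvg; move/(_ [set y | (A - P - P * ln (l + eps))%:E < y]); apply.
  by apply: open_nbhs_nbhs; split; [exact: open_ereal_gt_ereal|exact: lup].
near=> q; have q0 : (0 < q)%R by near: q; exact: nbhs_right_gt.
have qk : (q < a / k.+1%:R)%R by near: q; apply: nbhs_right_lt; rewrite divr_gt0.
have [ap [jp [m [_ e2 e3 _ _]]]] := mean_real (qp0 q q0) (qp1 q q0).
rewrite /= ME// e3 /=.
have lm := lge _ _ (qp0 q q0) (qp1 q q0) e3.
rewrite ler0_norm ?subr_le0// opprB ltrBlDl.
apply: le_lt_trans (mean_le (qp0 q q0) (qp1 q q0) e3 e2) _.
have le0 : (0 < l + eps)%R by rewrite ltr_wpDl.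
rewrite -[ltRHS]lnK ?posrE// ltr_expR ltr_pdivrMr//.
have : Jp k.+1%:R^-1 <= Jp (q / (a + q)).
  apply: mean_homo_J => //; [exact: qp0| |by rewrite invf_le1 ?ler1n].
  rewrite ler_pdivrMr ?addr_gt0// mulrC ler_pdivlMr//.
  move: qk; rewrite ltr_pdivlMr// => /ltW/le_trans; apply.
  by rewrite lerDl ltW.
rewrite e2 => /(lt_le_trans kJ); rewrite lte_fin; set X := ln _; rewrite mulrC.
by lra.
Unshelve. all: by end_near. Qed.

End PowerMeanLimit.

(** * Quadratic forms and second fundamental forms *)

Section QuadraticForms.
Context {R : realType} {n : nat}.
Implicit Types (x y u : 'rV[R]_n) (Q : 'M[R]_n).

(** A crude Euclidean operator norm: one factor [n] is for the sum over a column, the other for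
    passing from the sup norm to [enorm]. *)
Definition mxbound Q : R := (n * n)%:R * `|Q|.

Lemma mxbound_ge0 Q : 0 <= mxbound Q.
Proof. by rewrite /mxbound mulr_ge0. Qed.

Lemma mulmx_enorm x Q : enorm (x *m Q) <= mxbound Q * enorm x.
Proof.
apply: le_trans (enorm_norm _) _; rewrite /mxbound natrM -!mulrA ler_wpM2l//.
rewrite {1}/Num.norm/= mx_normrE; apply/bigmax_leP; split => [|[j i] _ /=].
  by rewrite !mulr_ge0.
rewrite (ord1 j) mxE; apply: le_trans (ler_norm_sum _ _ _) _.
apply: (@le_trans _ _ (\sum_(k < n) `|Q| * enorm x)).
  apply: ler_sum => k _; rewrite normrM mulrC ler_pM// ?coord_enorm//.
  rewrite /Num.norm/= mx_normrE.
  by apply: (le_bigmax (0 : R) (fun p : 'I_n * 'I_n => `|Q p.1 p.2|) (k, i)).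
by rewrite sumr_const card_ord -[leLHS]mulr_natl.
Qed.

Definition qf Q x : R := dot (x *m Q) x.

Lemma qf_bound Q x : `|qf Q x| <= mxbound Q * enorm x ^+ 2.
Proof.
apply: le_trans (CauchySchwarz _ _) _.
by rewrite expr2 mulrA ler_wpM2r// mulmx_enorm.
Qed.

Lemma dot_mulmx_sym Q x y : Q^T = Q -> dot (x *m Q) y = dot (y *m Q) x.
Proof. by move=> sQ; rewrite dot_mulmx sQ dotC. Qed.

Lemma qf_diff Q x y : `|qf Q x - qf Q y| <= mxbound Q * enorm (x - y) * (enorm x + enorm y).
Proof.
have -> : qf Q x - qf Q y = dot ((x - y) *m Q) x + dot (y *m Q) (x - y).
  by rewrite /qf mulmxBl dotBl dotBr; ring.
apply: le_trans (ler_normD _ _) _; rewrite mulrDr lerD//.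
  by apply: le_trans (CauchySchwarz _ _) _; rewrite ler_wpM2r// mulmx_enorm.
apply: le_trans (CauchySchwarz _ _) _; rewrite mulrAC ler_wpM2r//.
exact: mulmx_enorm.
Qed.

Lemma qfD Q x y : Q^T = Q -> qf Q (x + y) = qf Q x + 2 * dot (x *m Q) y + qf Q y.
Proof.
move=> sQ; rewrite /qf mulmxDl dotDl !dotDr (dot_mulmx_sym y x sQ); ring.
Qed.

Lemma qfZ Q a x : qf Q (a *: x) = a ^+ 2 * qf Q x.
Proof. by rewrite /qf -scalemxAl dotZl dotZr mulrA expr2. Qed.

Lemma qfN Q x : qf Q (- x) = qf Q x.
Proof. by rewrite -scaleN1r qfZ sqrrN expr1n mul1r. Qed.

Lemma qf_ker Q u x a : Q^T = Q -> u *m Q = 0 -> qf Q (a *: u + x) = qf Q x.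
Proof.
move=> sQ uQ; rewrite qfD// qfZ -scalemxAl dotZl /qf uQ !dot0l.
by rewrite !mulr0 !add0r.
Qed.

Lemma qf_mxB Q1 Q2 x : qf (Q1 - Q2) x = qf Q1 x - qf Q2 x.
Proof. by rewrite /qf mulmxBr dotBl. Qed.

Lemma qf_eq0 Q : Q^T = Q -> (forall x, qf Q x = 0) -> Q = 0.
Proof.
move=> sQ q0; apply/matrixP => i j; rewrite mxE.
have := q0 (delta_mx 0 i + delta_mx 0 j); rewrite qfD// !q0 add0r addr0.
move/eqP; rewrite mulf_eq0 pnatr_eq0 /= => /eqP.
by rewrite -rowE dot_delta mxE.
Qed.

Lemma qf_continuous Q : continuous (qf Q).
Proof.
move=> x; apply/(@cvgrPdist_lt R R _ (nbhs x) (nbhs_filter x)) => eps e0; apply/near_enormP.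
have M0 := mxbound_ge0 Q.
pose B := mxbound Q * (1 + 2 * enorm x) + 1.
have B0 : 0 < B by rewrite ltr_wpDl// mulr_ge0// addr_ge0// mulr_ge0.
exists (Num.min 1 (eps / B)); first by rewrite lt_min ltr01 divr_gt0.
move=> y; rewrite lt_min => /andP[y1 y2]; rewrite ltr_pdivlMr// in y2.
apply: le_lt_trans (qf_diff _ _ _) _; apply: le_lt_trans y2.
rewrite enormB mulrAC [leRHS]mulrC ler_wpM2r//.
have := enorm_lerB y x; rewrite /B => h.
apply: (@le_trans _ _ (mxbound Q * (1 + 2 * enorm x))); last by rewrite lerDl.
by rewrite ler_wpM2l//; move: y1 h; lra.
Qed.

End QuadraticForms.

(** * Orthonormal eigenvectors of symmetric matrices *)

Section Spectral.
Context {R : realType} {d : nat}.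
Notation n := d.+1.
Implicit Types (x y u : 'rV[R]_n) (Q : 'M[R]_n).

Definition orthonormal_upto (k : nat) (f : nat -> 'rV[R]_n) :=
  forall i j, (i < k)%N -> (j < k)%N -> dot (f i) (f j) = (i == j)%:R.

(* Maximise the quadratic form on the unit sphere orthogonal to the
   eigenvectors already found; the maximiser is the next eigenvector. *)
Lemma eigenvector_extend Q (k : nat) (f : nat -> 'rV[R]_n) : Q^T = Q -> (k < n)%N ->
  (forall i, (i < k)%N -> exists l, f i *m Q = l *: f i) ->
  exists x, [/\ sphere x, forall i, (i < k)%N -> dot x (f i) = 0 &
    exists l, x *m Q = l *: x].
Proof.
move=> sQ kn ef.
pose S := [set x : 'rV[R]_n | sphere x /\ forall i, (i < k)%N -> dot x (f i) = 0].
have S0 : S !=set0.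
  pose A : 'M[R]_(k, n) := \matrix_(i < k) f i.
  have : kermx A^T != 0.
    rewrite -mxrank_eq0 mxrank_ker mxrank_tr -lt0n subn_gt0.
    by apply: leq_ltn_trans kn; exact: rank_leq_row.
  move=> /rowV0Pn[x /sub_kermxP xA x0].
  exists (unit_vec x); split; first exact: unit_vec_sphere.
  move=> i ik; rewrite /unit_vec dotZl; apply/eqP; rewrite mulf_eq0; apply/orP; right.
  have /matrixP/(_ 0 (Ordinal ik)) := xA; rewrite !mxE => h.
  apply/eqP; rewrite -[RHS]h; apply: eq_bigr => j _.
  by rewrite !mxE.
have cS : compact S.
  apply: compact_sphere_sub; last by move=> x [].
  have -> : S = sphere `&` \bigcap_(i in [set i | (i < k)%N]) [set x | dot x (f i) = 0].
    by apply/seteqP; split => x [h1 h2]; split.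
  apply: closedI; first exact: closed_sphere.
  apply: closed_bigI => i _.
  rewrite (_ : [set x | _] = (fun x => dot x (f i)) @^-1` [set 0])//.
  by apply: preimage_closed => [x _|]; [exact: dot_continuous|exact: closed_eq].
have [x Sx xmax] : exists2 x, S x & forall y, S y -> qf Q y <= qf Q x.
  have [|c /set_mem cS1 cmax] := compact_EVT_max S0 cS (f := qf Q).
    by apply: continuous_subspaceT; exact: qf_continuous.
  by exists c => // y Sy; apply: cmax; rewrite inE.
have xx : dot x x = 1 by exact: Sx.1.
exists x; split; [exact: Sx.1|exact: Sx.2|]; exists (qf Q x).
have [z zE] : exists z, z = x *m Q - qf Q x *: x by exists (x *m Q - qf Q x *: x).
have zf i : (i < k)%N -> dot z (f i) = 0.
  move=> ik; have [l fl] := ef i ik.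
  by rewrite zE dotBl dotZl dot_mulmx sQ fl dotZr (Sx.2 i ik) !mulr0 subrr.
have zx : dot z x = 0 by rewrite zE dotBl dotZl xx mulr1 /qf subrr.
have zz : dot (x *m Q) z = dot z z.
  by rewrite {2}zE dotBl dotZl (dotC x) zx mulr0 subr0.
(* Maximality tested at [x + s *: z], normalised, with [z] the residual of the eigenvector equation:
   the left side is linear in [s] and the right side quadratic, which forces [z = 0]. *)
have key s : 2 * s * dot z z <= s ^+ 2 * (qf Q x * dot z z - qf Q z).
  have [y yE] : exists y, y = x + s *: z by exists (x + s *: z).
  have yy : dot y y = 1 + s ^+ 2 * dot z z.
    by rewrite yE dotDl !dotDr !dotZl !dotZr (dotC x z) zx xx expr2; ring.
  have y0 : y != 0 by rewrite -dot_gt0 yy ltr_wpDr// mulr_ge0 ?sqr_ge0 ?dot_ge0.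
  have /xmax : S (unit_vec y).
    split; first exact: unit_vec_sphere.
    move=> i ik; rewrite /unit_vec dotZl yE dotDl dotZl (Sx.2 i ik) zf//.
    by rewrite mulr0 addr0 mulr0.
  rewrite /unit_vec qfZ exprVn sqr_enorm mulrC ler_pdivrMr ?dot_gt0// yy yE.
  rewrite qfD// dotZr zz qfZ; set a := dot z z; set b := qf Q x; set c := qf Q z.
  by rewrite expr2; lra.
apply/eqP; rewrite -subr_eq0 -zE -dot_eq0 eq_le dot_ge0 andbT leNgt; apply/negP => z0.
pose C := `|qf Q x * dot z z - qf Q z| + 1.
have C0 : 0 < C by rewrite ltr_wpDl.
pose s := dot z z / C; have s0 : 0 < s by rewrite divr_gt0.
have sX : s * (qf Q x * dot z z - qf Q z) <= dot z z.
  rewrite -[leRHS](divfK (lt0r_neq0 C0)) -/s ler_pM2l// /C.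
  by apply: le_trans (ler_norm _) _; rewrite lerDl.
have := key s; rewrite expr2 -[leRHS]mulrA mulrAC => k1.
have : s * (s * (qf Q x * dot z z - qf Q z)) <= s * dot z z by rewrite ler_pM2l.
have : 0 < s * dot z z by rewrite mulr_gt0.
by move: k1; rewrite -mulrA (mulrC (dot z z)); lra.
Qed.

(** Eigenvectors known in advance are kept as the first ones; for a second fundamental form these
    are the point and its normal. *)
Lemma spectral_frame Q (k : nat) (f : nat -> 'rV[R]_n) : Q^T = Q -> (k <= n)%N ->
  orthonormal_upto k f ->
  (forall i, (i < k)%N -> exists l, f i *m Q = l *: f i) ->
  exists g, [/\ orthonormal_upto n g, forall i, (i < k)%N -> g i = f i &
    forall i, (i < n)%N -> exists l, g i *m Q = l *: g i].
Proof.
move=> sQ kn of_ ef.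
move: {2}(n - k)%N (erefl (n - k)%N) => j.
elim: j k f kn of_ ef => [|j IH] k f kn of_ ef nk.
  have nk' : (n <= k)%N by rewrite -subn_eq0 nk.
  exists f; split => // [a b an bn|a an].
    by apply: of_; apply: leq_trans nk'.
  by apply: ef; apply: leq_trans nk'.
have kn' : (k < n)%N by rewrite -subn_gt0 nk.
have [x [xx xf [l xl]]] := eigenvector_extend sQ kn' ef.
pose f' i := if i == k then x else f i.
have f'E i : (i < k)%N -> f' i = f i by move=> ik; rewrite /f' ltn_eqF.
have f'k : f' k = x by rewrite /f' eqxx.
have [|||g [og gf eg]] := IH k.+1 f' kn'.
- have spl a : (a < k.+1)%N -> a = k \/ (a < k)%N.
    by rewrite ltnS leq_eqVlt => /predU1P[]; [left|right].
  move=> a b /spl[->|ak] /spl[->|bk].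
  + by rewrite f'k eqxx.
  + by rewrite f'k f'E// xf// gtn_eqF.
  + by rewrite f'k f'E// dotC xf// ltn_eqF.
  + by rewrite !f'E// of_.
- move=> a; rewrite ltnS leq_eqVlt => /predU1P[->|ak]; first by rewrite f'k; exists l.
  by rewrite f'E//; exact: ef.
- by rewrite subnS nk.
- exists g; split => // i ik; rewrite gf ?f'E//.
  exact: ltnW.
Qed.

Lemma orthonormal_frame (k : nat) (f : nat -> 'rV[R]_n) : (k <= n)%N ->
  orthonormal_upto k f ->
  exists g, orthonormal_upto n g /\ forall i, (i < k)%N -> g i = f i.
Proof.
move=> kn of_; have [||g [og gf _]] := @spectral_frame 0 k f _ kn of_.
- by rewrite trmx0.
- by move=> i _; exists 0; rewrite mulmx0 scale0r.
- by exists g.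
Qed.

Definition frame_mx (g : nat -> 'rV[R]_n) : 'M[R]_n := \matrix_(i < n) g i.

Lemma frame_mxP g : orthonormal_upto n g -> frame_mx g *m (frame_mx g)^T = 1%:M.
Proof.
move=> og; apply/matrixP => i j; rewrite !mxE -[RHS](og i j (ltn_ord i) (ltn_ord j)).
by apply: eq_bigr => k _; rewrite !mxE.
Qed.

Lemma frame_mx_unitary g : orthonormal_upto n g -> (frame_mx g)^T *m frame_mx g = 1%:M.
Proof. by move=> og; apply: mulmx1C; exact: frame_mxP. Qed.

Lemma frame_decomp g x : orthonormal_upto n g ->
  x = \sum_(i < n) dot x (g i) *: g i.
Proof.
move=> og; rewrite -{1}[x]mulmx1 -(frame_mx_unitary og) mulmxA.
rewrite mulmx_sum_row; apply: eq_bigr => i _; rewrite rowK; congr (_ *: _).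
by rewrite mxE; apply: eq_bigr => k _; rewrite !mxE.
Qed.

Lemma frame_enorm g x : orthonormal_upto n g ->
  dot x x = \sum_(i < n) dot x (g i) ^+ 2.
Proof.
move=> og; rewrite {2}(frame_decomp x og) dot_sumr; apply: eq_bigr => i _.
by rewrite dotZr expr2.
Qed.

Lemma det_eigen g Q (l : nat -> R) : orthonormal_upto n g ->
  (forall i, (i < n)%N -> g i *m Q = l i *: g i) -> \det Q = \prod_(i < n) l i.
Proof.
move=> og ge.
have h : frame_mx g *m Q = diag_mx (\row_i l i) *m frame_mx g.
  apply/row_matrixP => i; rewrite row_mul rowK ge ?ltn_ord// row_mul row_diag_mx.
  by rewrite -scalemxAl -rowE rowK mxE.
have := congr1 determinant h; rewrite !det_mulmx det_diag mulrC => /mulIf.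
have d0 : \det (frame_mx g) != 0.
  have := congr1 determinant (frame_mxP og); rewrite det_mulmx det1 => e.
  by apply/eqP => e0; move: e; rewrite e0 mul0r => /eqP; rewrite eq_sym oner_eq0.
by move=> /(_ d0) ->; apply: eq_bigr => i _; rewrite mxE.
Qed.

End Spectral.

(** * The curvature as a determinant in the ambient space *)

Section CurvatureDeterminant.
Context {R : realType} {m : nat}.
Notation V := 'rV[R]_m.+2.
Implicit Types (u v n : V) (Q : 'M[R]_m.+2).

Definition orthonormal2 u v := [/\ sphere u, sphere v & dot u v = 0].

(* For orthonormal [u], [v] in the kernel of [Q], its determinant is the product
   of the eigenvalues of [Q] on the orthogonal complement of [u] and [v]. *)
Definition curv_mx u v Q : 'M[R]_m.+2 := Q + u^T *m u + v^T *m v.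

Lemma mulmx_outer (x u : V) : x *m (u^T *m u) = dot x u *: u.
Proof.
rewrite mulmxA; apply/rowP => i; rewrite !mxE big_ord1; congr (_ * _).
by rewrite mxE; apply: eq_bigr => j _; rewrite !mxE.
Qed.

Lemma mul_curv_mx x u v Q : x *m curv_mx u v Q = x *m Q + dot x u *: u + dot x v *: v.
Proof. by rewrite /curv_mx !mulmxDr !mulmx_outer. Qed.

Lemma principal_frame u v Q : orthonormal2 u v -> Q^T = Q -> u *m Q = 0 -> v *m Q = 0 ->
  exists g k, [/\ orthonormal_upto m.+2 g, g 0%N = u, g 1%N = v,
    forall i, (i < m)%N -> g i.+2 *m Q = k i *: g i.+2 &
    \det (curv_mx u v Q) = \prod_(i < m) k i].
Proof.
move=> [su sv uv] sQ uQ vQ.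
pose f i := if i == 0%N then u else v.
have of_ : orthonormal_upto 2 f.
  move=> i j; case: i => [|[|//]]; case: j => [|[|//]] _ _; rewrite /f/=; [exact: su|exact: uv|by rewrite dotC uv|exact: sv].
have [|i _|g [og gf eg]] := spectral_frame sQ _ of_ => //.
  by exists 0; rewrite scale0r /f; case: ifP.
have g0 : g 0%N = u by rewrite gf.
have g1 : g 1%N = v by rewrite gf.
have ex i : exists l, (i < m.+2)%N -> g i *m Q = l *: g i.
  have [im|im] := boolP (i < m.+2)%N; last by exists 0.
  by have [l hl] := eg i im; exists l.
have [l hl] := choice ex.
exists g, (fun i => l i.+2); split => //; first by move=> i im; rewrite hl.
pose l' i := if i is i.+2 then l i.+2 else 1.
rewrite (@det_eigen _ _ g _ l') //; last first.
  move=> [|[|i]] im; rewrite mul_curv_mx.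
  - by rewrite g0 uQ su uv scale0r addr0 add0r scale1r.
  - by rewrite g1 vQ sv (dotC v) uv scale0r !add0r scale1r.
  - by rewrite hl// -g0 -g1 !og//= !scale0r !addr0.
by rewrite big_ord_recl/= big_ord_recl/= !mul1r.
Qed.

Lemma ord2_ind (P : nat -> Prop) : P 0%N -> P 1%N -> (forall j : 'I_m, P j.+2) ->
  forall i, (i < m.+2)%N -> P i.
Proof. by move=> P0 P1 PS [|[|i]] // im; exact: (PS (@Ordinal m i im)). Qed.

Lemma principal_curvatures_det u n Q (k : 'I_m -> R) : orthonormal2 u n ->
  u *m Q = 0 -> n *m Q = 0 -> @principal_curvatures R m.+1 u n Q k ->
  \prod_i k i = \det (curv_mx u n Q).
Proof.
move=> [su sn un] uQ nQ [e [eun ee eQ]].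
pose g i : V := if i is i.+2 then (if insub i is Some j then e j else 0) else if i is 0%N then u else n.
have ge (j : 'I_m) : g j.+2 = e j by rewrite /g insubT ?ltn_ord// => h; congr (e _); exact: val_inj.
pose l i := if i is i.+2 then (if insub i is Some j then k j else 0) else 1.
have le (j : 'I_m) : l j.+2 = k j by rewrite /l insubT ?ltn_ord// => h; congr (k _); exact: val_inj.
have og : orthonormal_upto m.+2 g.
  move=> i j im jm; move: i im; apply: ord2_ind => [||i]; move: j jm; apply: ord2_ind => [||j].
  - exact: su.
  - exact: un.
  - by have [h _] := eun j; rewrite ge /= dotC h.
  - by rewrite /= dotC.
  - exact: sn.
  - by have [_ h] := eun j; rewrite ge /= dotC h.
  - by have [h _] := eun i; rewrite ge /= h.
  - by have [_ h] := eun i; rewrite ge /= h.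
  - by rewrite !ge ee eqSS.
rewrite (@det_eigen _ _ g _ l) //.
  by rewrite big_ord_recl/= big_ord_recl/= !mul1r; apply: eq_bigr => i _; rewrite -le.
apply: ord2_ind => [||i]; rewrite mul_curv_mx.
- by rewrite /g uQ su un scale0r addr0 add0r.
- by rewrite /g nQ sn (dotC n) un scale0r !add0r.
- by have [h1 h2] := eun i; rewrite ge h1 h2 eQ !scale0r !addr0 le.
Qed.

Lemma principal_curvatures_exist u n Q : orthonormal2 u n -> Q^T = Q ->
  u *m Q = 0 -> n *m Q = 0 -> exists k : 'I_m -> R, @principal_curvatures R m.+1 u n Q k.
Proof.
move=> on sQ uQ nQ; have [g [k [og g0 g1 gk _]]] := principal_frame on sQ uQ nQ.
exists (fun i => k i), (fun i => g i.+2); split => [i|i j|i].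
- by have im : (i < m)%N := ltn_ord i; rewrite -g0 -g1 !og.
- have im : (i < m)%N := ltn_ord i; have jm : (j < m)%N := ltn_ord j.
  by rewrite og.
- by rewrite gk.
Qed.

End CurvatureDeterminant.

Section Eventually.
Context {R : realType} {T : Type}.
Implicit Types (s : T -> R) (P Q : T -> Prop).

(** Validity for small [s], with [s] a distance to a point, the length of an increment or the size
    of a parameter; keeping the radius visible makes composition of estimates easy. *)
Definition evt s P := exists2 rho, 0 < rho & forall x, s x < rho -> P x.

Lemma evtI s P Q : evt s P -> evt s Q -> evt s (fun x => P x /\ Q x).
Proof.
move=> [a a0 ha] [b b0 hb]; exists (Num.min a b); first by rewrite lt_min a0.
by move=> x; rewrite lt_min => /andP[xa xb]; split; [exact: ha|exact: hb].
Qed.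

Lemma evtS s P Q : (forall x, P x -> Q x) -> evt s P -> evt s Q.
Proof. by move=> PQ [a a0 ha]; exists a => // x /ha/PQ. Qed.

Lemma evt_ltM s a c : 0 < a -> 0 < c -> evt s (fun x => a * s x < c).
Proof.
by move=> a0 c0; exists (c / a); rewrite ?divr_gt0// => x; rewrite ltr_pdivlMr// mulrC.
Qed.

Lemma evt_lt s c : 0 < c -> evt s (fun x => s x < c).
Proof. by move=> c0; exists c. Qed.

End Eventually.

Section Arithmetic.
Context {R : realType}.
Implicit Types q x y z D : R.

(** Final arithmetic of [normal_expansion], with the products replaced by variables so that it
    becomes linear. *)
Lemma expansion_arith1 q x y z D : 16 * y + D < 1 -> 2 * z + D < 1 ->
  q <= z / 12 + x -> x <= y -> D <= 1 -> 0 <= D -> q <= 8^-1.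
Proof. by lra. Qed.

Lemma expansion_arith2 q x1 x2 x3 x4 z y1 y2 :
  6 * x1 + 4 * x2 + 2 * x3 + x4 <= z / 2 -> q <= z / 12 + x1 -> y1 <= x2 ->
  y2 <= x3 -> 0 <= x4 -> 6 * q + 4 * y1 + 2 * y2 <= z.
Proof. by lra. Qed.

End Arithmetic.

(** * Second-order expansions of the boundary and of its normals *)

Section SecondOrder.
Context {R : realType} {m : nat}.
Notation V := 'rV[R]_m.+2.
Variables (K L : set V) (e : V) (r : R).
Hypotheses (KL : polar_pair K L) (r0 : 0 < r).
Hypotheses (eL : forall v, L v -> r <= dot v e) (e1 : enorm e = 1).
Implicit Types (u v w z : V) (Q : 'M[R]_m.+2).
Notation F := (height L e).
Notation p_ := (slope e).
Notation dist u := (fun w => enorm (w - u)).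

Let c1 : R := 1 + r^-1.
Let c1_gt0 : 0 < c1. Proof. by rewrite ltr_wpDr// invr_ge0 ltW. Qed.

(** Projection onto the boundary of the cone over [K] along [e], since the height drops at unit
    speed in that direction. *)
Definition foot z : V := z + F z *: e.

Lemma height_foot z : F (foot z) = 0.
Proof. by rewrite /foot (heightDe KL r0 eL) subrr. Qed.

Lemma height_unit_vec z : F z = 0 -> F (unit_vec z) = 0.
Proof. by move=> Fz; rewrite /unit_vec (heightZ KL r0 eL) ?invr_ge0// Fz mulr0. Qed.

Lemma foot_boundary z : foot z != 0 -> sboundary K (unit_vec (foot z)).
Proof.
move=> z0; apply/(height0 KL r0 eL); first exact: unit_vec_sphere.
by apply: height_unit_vec; exact: height_foot.
Qed.

Lemma boundary_height u : sboundary K u -> F u = 0.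
Proof. by move=> bu; apply/(height0 KL r0 eL (sboundary_sphere KL bu)). Qed.

Lemma foot_boundaryK u : sboundary K u -> foot u = u.
Proof. by move=> bu; rewrite /foot boundary_height// scale0r addr0. Qed.

Lemma foot_lip z z' : enorm (foot z - foot z') <= c1 * enorm (z - z').
Proof.
rewrite /foot opprD addrACA -scalerBl; apply: le_trans (enormD _ _) _.
rewrite /c1 mulrDl mul1r lerD2l enormZ e1 mulr1.
exact: (height_lip KL r0 eL).
Qed.

Lemma foot_near u z : sboundary K u -> enorm (foot (u + z) - u) <= c1 * enorm z.
Proof.
move=> bu; rewrite -{2}(foot_boundaryK bu); apply: le_trans (foot_lip _ _) _.
by rewrite addrAC subrr add0r.
Qed.

Lemma unit_vec_near u y : sphere u -> enorm (y - u) <= 2^-1 ->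
  [/\ y != 0, 2^-1 <= enorm y, enorm y <= 3/2, `|1 - enorm y| <= enorm (y - u) &
      enorm (unit_vec y - u) <= 2 * enorm (y - u)].
Proof.
move=> /sphere_enorm su h.
have h1 : `|1 - enorm y| <= enorm (y - u) by rewrite -su enormB; exact: enorm_dist.
have /andP[a b] : - 2^-1 <= 1 - enorm y <= 2^-1 by rewrite -ler_norml (le_trans h1).
have y0 : y != 0 by rewrite -enorm_gt0; lra.
split => //; [lra|lra|].
apply: le_trans (enormBD _ y _) _; rewrite unit_vec_dist//.
by rewrite mulr_natl mulr2n lerD2r.
Qed.

(** The bridge between two views of second order: the excess of the height over its support
    functional at [u], and the pairing of [v] with boundary points near [u]. *)
Lemma foot_dot u v z : incident K L u v ->
  dot v (foot (u + z)) = dot v e * (F (u + z) - dot (p_ v) z).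
Proof.
move=> [_ Lv uv]; have ve : dot v e != 0 by rewrite gt_eqF// (lt_le_trans r0)// eL.
rewrite /foot !dotDr (dotC v u) uv add0r dotZr /slope dotZl mulNr mulrBr mulrN opprK.
by rewrite mulrA divff// mul1r addrC mulrC.
Qed.

Lemma height_ge_slope u v z : incident K L u v -> dot (p_ v) z <= F (u + z).
Proof.
move=> uv; have us : sphere u by case: uv => /(pair_sphere KL).
have [Lv _ pu] := (height_incident KL r0 eL v us).1 uv.
by apply: le_trans (height_ge KL r0 eL _ Lv); rewrite dotDr pu add0r.
Qed.

Lemma incident_boundary u v : incident K L u v -> sboundary K u.
Proof. by move=> uv; apply/(sboundaryE _ KL); exists v. Qed.

Lemma slope_bound v : L v -> enorm (p_ v) <= r^-1.
Proof. exact: (enorm_slope KL r0 eL). Qed.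

(** The boundary point over [u + z] is within [2 * c1 * enorm z] of [u], so the hypothesis applies
    to it; [3/2] bounds the length of the foot before normalisation, and [r] bounds [dot v e] from
    below. *)
Lemma upper_tangent u v c : incident K L u v -> 0 <= c ->
  evt (dist u) (fun w => sboundary K w -> dot v w <= c * enorm (w - u) ^+ 2) ->
  exists2 C, 0 <= C & evt enorm (fun z => F (u + z) - dot (p_ v) z <= C * enorm z ^+ 2).
Proof.
move=> uv c0 [rho rho0 H]; have bu := incident_boundary uv.
have us := sboundary_sphere KL bu.
have Lv : L v by case: uv.
have ve := eL Lv; have ve0 := lt_le_trans r0 ve.
pose C := 3/2 * (c * (2 * c1) ^+ 2) / r.
exists C; first by rewrite divr_ge0 ?(ltW r0)// mulr_ge0// mulr_ge0// sqr_ge0.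
exists (Num.min (2^-1 / c1) (rho / (2 * c1))).
  by rewrite lt_min !divr_gt0// mulr_gt0.
move=> z; rewrite lt_min !ltr_pdivlMr ?mulr_gt0// => /andP[z1 z2].
have yn := foot_near z bu.
have y12 : enorm (foot (u + z) - u) <= 2^-1.
  by rewrite (le_trans yn)// mulrC ltW.
have [y0 y1 y2 y3 y4] := unit_vec_near us y12.
have wu : enorm (unit_vec (foot (u + z)) - u) <= 2 * c1 * enorm z.
  by rewrite (le_trans y4)// -mulrA ler_pM2l.
have := H _ (le_lt_trans wu _) (foot_boundary y0).
rewrite mulrC => /(_ z2) hw.
have vy : dot v (foot (u + z)) = enorm (foot (u + z)) * dot v (unit_vec (foot (u + z))).
  by rewrite /unit_vec dotZr mulrA divff ?mul1r// enorm_eq0.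
rewrite -(ler_pM2l ve0) -foot_dot// vy.
apply: (@le_trans _ _ (3/2 * (c * (2 * c1 * enorm z) ^+ 2))).
  apply: ler_pM => //.
    by rewrite dotZr mulr_ge0 ?invr_ge0// (foot_dot _ uv) mulr_ge0 ?(ltW ve0)// subr_ge0 height_ge_slope.
  apply: (le_trans hw); rewrite ler_wpM2l// ler_pXn2r ?nnegrE ?mulr_ge0 ?(ltW c1_gt0)//.
apply: (@le_trans _ _ (r * (C * enorm z ^+ 2))).
  by rewrite /C le_eqVlt; apply/orP; left; apply/eqP; field; rewrite gt_eqF.
rewrite ler_wpM2r// mulr_ge0 ?sqr_ge0//.
by rewrite divr_ge0 ?(ltW r0)// mulr_ge0// mulr_ge0// sqr_ge0.
Qed.

(** If the slopes differed by [h], stepping by [t *: h] would give [t <= C * t ^+ 2] after division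
    by the square length of [h], false for small [t]. Equal slopes have equal lengths, hence come
    from the same unit vector. *)
Lemma tangent_unique u v v' C : incident K L u v -> incident K L u v' -> 0 <= C ->
  evt enorm (fun z => F (u + z) - dot (p_ v) z <= C * enorm z ^+ 2) -> v' = v.
Proof.
move=> uv uv' C0 [rho rho0 H].
have Lv : L v by case: uv. have Lv' : L v' by case: uv'.
have pE : p_ v' = p_ v.
  apply/eqP; rewrite -subr_eq0 -enorm_eq0; apply/negPn/negP => h0.
  have hp : 0 < enorm (p_ v' - p_ v) by rewrite lt_neqAle eq_sym h0 enorm_ge0.
  set h := p_ v' - p_ v in h0 hp.
  pose t := Num.min (rho / (2 * enorm h)) ((2 * (C + 1))^-1).
  have C1 : 0 < C + 1 by rewrite ltr_wpDl.
  have t0 : 0 < t by rewrite lt_min divr_gt0 ?mulr_gt0//= invr_gt0 mulr_gt0.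
  have tr : enorm (t *: h) < rho.
    rewrite enormZ gtr0_norm// -ltr_pdivlMr//; apply: (@le_lt_trans _ _ (rho / (2 * enorm h))).
      by rewrite /t ge_min lexx.
    by rewrite ltr_pM2l// ltf_pV2 ?posrE ?mulr_gt0//; lra.
  have tC : t * (C + 1) <= 2^-1.
    by rewrite -ler_pdivlMr// -invfM /t ge_min lexx orbT.
  have := H _ tr; have := height_ge_slope (t *: h) uv'.
  rewrite enormZ gtr0_norm// exprMn => a b.
  have : dot (p_ v' - p_ v) (t *: h) <= C * (t ^+ 2 * enorm h ^+ 2) by rewrite dotBl; lra.
  rewrite -/h dotZr -sqr_enorm mulrA ler_pM2r ?exprn_gt0//.
  rewrite expr2 mulrA -{1}[t]mul1r ler_pM2r// leNgt => /negP; apply.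
  by rewrite mulrC; move: tC; rewrite mulrDr mulr1; lra.
have := congr1 enorm pE; rewrite !(slope_enorm KL r0 eL)// => /invr_inj ne.
have ve0 : dot v e != 0 by rewrite gt_eqF// (lt_le_trans r0)// eL.
move: pE; rewrite /slope ne => /(congr1 (fun x => - dot v e *: x)).
by rewrite !scalerA mulrNN divff// !scale1r.
Qed.

Definition quad_exp u v Q := forall eps, 0 < eps -> evt (dist u)
  (fun w => sboundary K w -> `|dot v w - qf Q (w - u) / 2| <= eps * enorm (w - u) ^+ 2).

(* [second_order_form K u (- v) Q] without the chart: [v] is the inner normal. *)
Definition second_form u v Q := [/\ incident K L u v, Q^T = Q, u *m Q = 0, v *m Q = 0 &
  quad_exp u v Q].

Lemma approx_upper u v Q c : 0 <= c -> evt (dist u) (fun w => sboundary K w ->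
    `|dot v w - qf Q (w - u) / 2| <= c * enorm (w - u) ^+ 2) ->
  evt (dist u) (fun w => sboundary K w -> dot v w <= (c + mxbound Q) * enorm (w - u) ^+ 2).
Proof.
move=> c0; apply: evtS => w H /H; rewrite ler_norml => /andP[_ h].
have := qf_bound Q (w - u); rewrite ler_norml => /andP[_ h'].
by move: h h'; rewrite mulrDl; have := mulr_ge0 (mxbound_ge0 Q) (sqr_ge0 (enorm (w - u))); lra.
Qed.

Lemma approx_normal_unique u v v' Q c : incident K L u v -> incident K L u v' -> 0 <= c ->
  evt (dist u) (fun w => sboundary K w ->
    `|dot v w - qf Q (w - u) / 2| <= c * enorm (w - u) ^+ 2) -> v' = v.
Proof.
move=> uv uv' c0 /(approx_upper c0) H.
have [|C C0 HC] := upper_tangent uv _ H; first by rewrite addr_ge0// mxbound_ge0.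
exact: tangent_unique uv uv' C0 HC.
Qed.

Lemma second_form_upper u v Q : second_form u v Q ->
  exists2 C, 0 <= C & evt enorm (fun z => F (u + z) - dot (p_ v) z <= C * enorm z ^+ 2).
Proof.
move=> [uv _ _ _ /(_ _ ltr01)/(approx_upper ler01) H].
by apply: upper_tangent uv _ H; rewrite addr_ge0// mxbound_ge0.
Qed.

Lemma second_form_normal_unique u v Q v' : second_form u v Q -> incident K L u v' -> v' = v.
Proof.
move=> H uv'; have [C C0 HC] := second_form_upper H.
by case: H => uv _ _ _ _; exact: tangent_unique uv uv' C0 HC.
Qed.

(** The first-order displacement of [foot (u + z)]: [z] is moved along [e] into the hyperplane
    orthogonal to [v]. *)
Definition tilt v z : V := z + dot (p_ v) z *: e.

Lemma tilt_bound v z : L v -> enorm (tilt v z) <= c1 * enorm z.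
Proof.
move=> Lv; apply: le_trans (enormD _ _) _; rewrite enormZ e1 mulr1 /c1 mulrDl mul1r.
rewrite lerD2l (le_trans (CauchySchwarz _ _))// ler_wpM2r//; exact: slope_bound.
Qed.

(** The expansion is applied at the normalised foot of [u + z]. Besides its own remainder, errors
    come from the normalising factor and from replacing the displacement of the foot by [tilt v z];
    both are of third order. *)
Lemma height_taylor2 u v Q : second_form u v Q -> forall eps, 0 < eps ->
  evt enorm (fun z => `|dot v e * (F (u + z) - dot (p_ v) z) - qf Q (tilt v z) / 2|
    <= eps * enorm z ^+ 2).
Proof.
move=> SF eps eps0; have [C C0 HC] := second_form_upper SF.
case: SF => uv sQ uQ vQ qe; have Lv : L v by case: uv.
have bu := incident_boundary uv; have us := sboundary_sphere KL bu.
have [M ME] : exists M, M = mxbound Q by exists (mxbound Q).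
have M0 : 0 <= M by rewrite ME mxbound_ge0.
(* The remainder is multiplied by at most [3/2 * (2 * c1) ^+ 2 = 6 * c1 ^+ 2], which leaves
   [eps / 2]. *)
pose eps1 := eps / (12 * c1 ^+ 2).
have eps10 : 0 < eps1 by rewrite divr_gt0// mulr_gt0// exprn_gt0.
pose B := M * c1 ^+ 3 + M * C * c1 + 1.
have c10 := ltW c1_gt0.
have B0 : 0 < B by rewrite ltr_wpDl// addr_ge0// !mulr_ge0// exprn_ge0.
have [rho rho0 H] := qe _ eps10.
have c120 : 0 < 2 * c1 by rewrite mulr_gt0.
have h2 : 0 < 2^-1 :> R by rewrite invr_gt0.
have eps2 : 0 < eps / 2 by rewrite divr_gt0.
apply: evtS (evtI HC (evtI (evt_ltM (@enorm R _) c1_gt0 h2)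
  (evtI (evt_ltM (@enorm R _) c120 rho0) (evt_ltM (@enorm R _) B0 eps2)))) => z [hC [z1 [z2 z3]]].
have [t tE] : exists t, t = F (u + z) - dot (p_ v) z by exists (F (u + z) - dot (p_ v) z).
have t0 : 0 <= t by rewrite tE subr_ge0 height_ge_slope.
have [y yE] : exists y, y = foot (u + z) by exists (foot (u + z)).
have vy : dot v e * (F (u + z) - dot (p_ v) z) = dot v y by rewrite yE foot_dot.
have yu : y - u = tilt v z + t *: e.
  apply/eqP; rewrite subr_eq yE tE /foot /tilt; apply/eqP.
  by apply/rowP => i; rewrite !mxE; ring.
rewrite vy; rewrite -tE in hC.
have yn : enorm (y - u) <= c1 * enorm z by rewrite yE foot_near.
have [y0 y1 y2 y3 y4] := unit_vec_near us (le_trans yn (ltW z1)).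
have wu : enorm (unit_vec y - u) <= 2 * c1 * enorm z.
  by rewrite (le_trans y4)// -mulrA ler_pM2l.
have by_ : sboundary K (unit_vec y) by rewrite yE; apply: foot_boundary; rewrite -yE.
have := H _ (le_lt_trans wu z2) by_.
have N0 : 0 < enorm y by rewrite enorm_gt0.
have -> : qf Q (unit_vec y - u) = enorm y ^- 2 * qf Q (y - u).
  have := @qf_ker _ _ Q u (unit_vec y) (-1) sQ uQ; rewrite scaleN1r addrC => ->.
  have := @qf_ker _ _ Q u y (-1) sQ uQ; rewrite scaleN1r addrC => ->.
  by rewrite /unit_vec qfZ exprVn.
have -> : dot v (unit_vec y) = (enorm y)^-1 * dot v y by rewrite /unit_vec dotZr.
have zt := tilt_bound z Lv.
have qb := qf_bound Q (y - u).
have qd := qf_diff Q (y - u) (tilt v z).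
have yz : enorm (y - u - tilt v z) = t by rewrite yu addrC addKr enormZ e1 mulr1 ger0_norm.
rewrite yz -ME in qd; rewrite -ME in qb.
move: (enorm (unit_vec y - u)) (enorm_ge0 (unit_vec y - u)) wu => W W0 wu.
move: (qf Q (y - u)) (qf Q (tilt v z)) (dot v y) qb qd => q qz a qb qd ha.
move: (enorm y) N0 y1 y2 y3 ha => N N0 y1 y2 y3 ha.
move: (enorm (y - u)) (enorm_ge0 (y - u)) yn y3 qb qd => Y Y0 yn y3 qb qd.
move: (enorm (tilt v z)) (enorm_ge0 (tilt v z)) zt qd => Z Z0 zt qd.
move: (enorm z) (enorm_ge0 z) hC z1 z2 z3 wu yn zt => D D0 hC z1 z2 z3 wu yn zt.
have -> : a - qz / 2 = N * (N^-1 * a - N ^- 2 * q / 2) + (N^-1 - 1) * q / 2 + (q - qz) / 2.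
  by field; rewrite gt_eqF.
have A1 : `|N * (N^-1 * a - N ^- 2 * q / 2)| <= eps / 2 * D ^+ 2.
  rewrite normrM (gtr0_norm N0).
  apply: (@le_trans _ _ (3 / 2 * (eps1 * (2 * c1 * D) ^+ 2))).
    apply: ler_pM => //; first exact: ltW.
    apply: le_trans ha _; rewrite ler_pM2l// ler_pXn2r// nnegrE mulr_ge0//.
    exact: ltW.
  rewrite /eps1 le_eqVlt; apply/orP; left; apply/eqP; field.
  by rewrite gt_eqF.
have q2 : `|q| <= M * (c1 ^+ 2 * D ^+ 2).
  apply: le_trans qb _; rewrite ler_wpM2l// -exprMn ler_pXn2r// nnegrE mulr_ge0//.
have A2 : `|(N^-1 - 1) * q / 2| <= M * c1 ^+ 3 * D * D ^+ 2.
  have -> : N^-1 - 1 = (1 - N) / N by field; rewrite gt_eqF.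
  rewrite !normrM (ger0_norm (_ : 0 <= 2^-1)) ?invr_ge0// ler_pdivrMr//.
  apply: (@le_trans _ _ ((2 * (c1 * D)) * (M * (c1 ^+ 2 * D ^+ 2)))); last first.
    by rewrite le_eqVlt; apply/orP; left; apply/eqP; ring.
  apply: ler_pM => //.
  rewrite mulrC ler_pM ?invr_ge0//; last exact: le_trans yn.
  by rewrite normfV gtr0_norm// invf_ple ?posrE.
have A3 : `|(q - qz) / 2| <= M * C * c1 * D * D ^+ 2.
  rewrite normrM (ger0_norm (_ : 0 <= 2^-1)) ?invr_ge0// ler_pdivrMr//.
  apply: le_trans qd _.
  apply: (@le_trans _ _ (M * (C * D ^+ 2) * (2 * (c1 * D)))); last first.
    by rewrite le_eqVlt; apply/orP; left; apply/eqP; ring.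
  apply: ler_pM; rewrite ?mulr_ge0 ?addr_ge0 ?ler_wpM2l//.
  by rewrite mulr_natl mulr2n lerD.
apply: le_trans (ler_normD _ _) _; apply: le_trans (lerD (ler_normD _ _) (lexx _)) _.
apply: le_trans (lerD (lerD A1 A2) A3) _.
have D20 : 0 <= D ^+ 2 by exact: sqr_ge0.
have : B * D * D ^+ 2 <= eps / 2 * D ^+ 2 by rewrite ler_wpM2r// ltW.
rewrite /B; set X := D ^+ 2 in D20 *; have := mulr_ge0 D0 D20.
by rewrite !mulrDl mul1r; set a1 := M * _ * D * X; set a2 := M * C * c1 * D * X; lra.
Qed.

Lemma tiltD v y z : tilt v (y + z) = tilt v y + tilt v z.
Proof. by rewrite /tilt dotDr scalerDl addrACA. Qed.

(** Convexity upgrades a second-order expansion of values to a first-order expansion of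
    subgradients: the support inequality at [w] is tested in the direction of the error vector [q]
    itself, with a step of length [t * enorm (w - u)]. *)
Lemma slope_expansion u v Q : second_form u v Q -> forall eps, 0 < eps ->
  evt (dist u) (fun w => forall v', incident K L w v' ->
    enorm (dot v e *: (p_ v' - p_ v) - tilt v (w - u) *m Q
      - dot (tilt v (w - u) *m Q) e *: p_ v) <= eps * enorm (w - u)).
Proof.
move=> SF eps eps0; have [uv sQ uQ vQ _] := SF; have Lv : L v by case: uv.
have [M ME] : exists M, M = mxbound Q by exists (mxbound Q).
have M0 : 0 <= M by rewrite ME mxbound_ge0.
have ve0 := lt_le_trans r0 (eL Lv).
(* The step must be short enough for its own quadratic term, of order the square of [t], to be at
   most [eps * t]. *)
have [t [t0 t1 tM]] : exists t : R, [/\ 0 < t, t <= 1 & M * c1 ^+ 2 * t <= eps].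
  have B0 : 0 < M * c1 ^+ 2 + 1 by rewrite ltr_wpDl// mulr_ge0// sqr_ge0.
  exists (Num.min 1 (eps / (M * c1 ^+ 2 + 1))); split.
  - by rewrite lt_min ltr01 divr_gt0.
  - by rewrite ge_min lexx.
  - apply: (@le_trans _ _ ((M * c1 ^+ 2 + 1) * (eps / (M * c1 ^+ 2 + 1)))).
      apply: ler_pM; first by rewrite mulr_ge0// sqr_ge0.
      - by rewrite le_min ler01 divr_ge0// ltW.
      - by rewrite lerDl.
      - by rewrite ge_min lexx orbT.
    by rewrite mulrC divfK// gt_eqF.
(* Expansion at [w] and at [w + h] costs [(1 + 4) * eps'], half of the allowed [eps * t]; half the
   quadratic term of the step takes the rest. *)
have [eps' eps'E] : exists eps', eps' = eps * t / 10 by exists (eps * t / 10).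
have eps'0 : 0 < eps' by rewrite eps'E divr_gt0// mulr_gt0.
have [rho rho0 T2] := height_taylor2 SF eps'0.
exists (rho / 2); first by rewrite divr_gt0.
move=> w wr v' wv'; set q := (X in enorm X).
(* At [w = u] the claim amounts to uniqueness of the normal. *)
have [wu|wu] := eqVneq w u.
  have v'E : v' = v by apply: second_form_normal_unique SF _; rewrite -wu.
  rewrite /q v'E wu !subrr scaler0 /tilt dot0r scale0r addr0 mul0mx dot0l scale0r subr0 subrr.
  by rewrite enorm0 mulr0.
have [q0|q0] := eqVneq q 0; first by rewrite q0 enorm0 mulr_ge0// ltW.
have qp : 0 < enorm q by rewrite enorm_gt0.
have dp : 0 < enorm (w - u) by rewrite enorm_gt0 subr_eq0.
have [h hE] : exists h, h = (t * enorm (w - u) / enorm q) *: q.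
  by exists ((t * enorm (w - u) / enorm q) *: q).
have hn : enorm h = t * enorm (w - u).
  rewrite hE enormZ ger0_norm; first by rewrite divfK// gt_eqF.
  by rewrite !mulr_ge0 ?invr_ge0 ?(ltW t0) ?enorm_ge0.
have qh : dot q h = t * enorm (w - u) * enorm q.
  by rewrite hE dotZr -sqr_enorm expr2 mulrA divfK// gt_eqF.
have dh : enorm (w - u + h) <= 2 * enorm (w - u).
  apply: le_trans (enormD _ _) _; rewrite hn mulrDl mul1r lerD2l.
  by rewrite -[leRHS]mul1r ler_pM2r.
have wr' : enorm (w - u) < rho by apply: lt_trans wr _; rewrite ltr_pdivrMr//; lra.
have uw : u + (w - u) = w by rewrite addrC subrK.
have := T2 _ wr'; rewrite uw (boundary_height (incident_boundary wv')) sub0r.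
rewrite ler_norml => /andP[a1 _].
have := T2 (w - u + h); rewrite addrA uw => b1.
have {b1} := b1 (le_lt_trans dh _); rewrite mulrC -ltr_pdivlMr// => /(_ wr).
rewrite ler_norml => /andP[_ b1].
have c2 := height_ge_slope h wv'.
rewrite tiltD qfD// in b1.
have zh := qf_bound Q (tilt v h).
have zhb : enorm (tilt v h) <= c1 * (t * enorm (w - u)) by rewrite -hn tilt_bound.
have {}zh : qf Q (tilt v h) <= M * c1 ^+ 2 * t * (t * enorm (w - u) ^+ 2).
  apply: le_trans (ler_norm _) _; apply: le_trans zh _; rewrite -ME.
  apply: (@le_trans _ _ (M * (c1 * (t * enorm (w - u))) ^+ 2)).
    by rewrite ler_wpM2l// ler_pXn2r ?nnegrE// !mulr_ge0 ?(ltW c1_gt0) ?(ltW t0).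
  by rewrite le_eqVlt; apply/orP; left; apply/eqP; ring.
have dh2 : enorm (w - u + h) ^+ 2 <= 4 * enorm (w - u) ^+ 2.
  have -> : 4 * enorm (w - u) ^+ 2 = (2 * enorm (w - u)) ^+ 2 by ring.
  by rewrite ler_pXn2r ?nnegrE ?mulr_ge0.
have qhE : dot q h = dot v e * (dot (p_ v') h - dot (p_ v) h) -
    dot (tilt v (w - u) *m Q) (tilt v h).
  rewrite /q [tilt v h]/tilt; move: (tilt v (w - u) *m Q) (p_ v) (p_ v') => X a b.
  by rewrite !dotBl !dotZl dotBl dotDr dotZr; ring.
have c3 : dot v e * dot (p_ v') h <= dot v e * F (w + h) by rewrite ler_pM2l.
have key : dot q h <= eps * (t * enorm (w - u) ^+ 2).
  rewrite qhE; rewrite (dotDr (w - u) h (p_ v)) in b1.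
  have zh' : qf Q (tilt v h) <= eps * (t * enorm (w - u) ^+ 2).
    by apply: le_trans zh _; rewrite ler_wpM2r// mulr_ge0 ?(ltW t0)// sqr_ge0.
  have e3 : eps' * enorm (w - u + h) ^+ 2 <= eps' * (4 * enorm (w - u) ^+ 2).
    by rewrite ler_pM2l.
  have e4 : 10 * (eps' * enorm (w - u) ^+ 2) = eps * (t * enorm (w - u) ^+ 2).
    by rewrite eps'E; field.
  move: a1 b1 c3 zh' e3 e4; rewrite !mulrBr !mulrDr.
  set A1 := _ * enorm (w - u) ^+ 2; lra.
rewrite -(@ler_pM2l _ (t * enorm (w - u))) ?mulr_gt0// -qh.
by apply: le_trans key _; rewrite le_eqVlt; apply/orP; left; apply/eqP; ring.
Qed.

(** Passing from slopes to unit vectors: as [x] is orthogonal to [v], the length of [a *: v - x]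
    differs from [a] only at second order, so [b] is close to [a], and dividing by it costs only
    products of small quantities. *)
Lemma unit_perturbation v v' x q (a b : R) : sphere v -> sphere v' -> dot x v = 0 ->
  0 < b -> b *: v' = a *: v - x - q -> `|a - 1| <= 4^-1 -> enorm x <= 4^-1 ->
  enorm q <= 8^-1 ->
  enorm (v' - v + x) <= 6 * enorm q + 4 * enorm x ^+ 2 + 2 * (`|a - 1| * enorm x).
Proof.
move=> sv sv' xv b0 bE a1 x1 q1.
have a0 : 3/4 <= a by move: a1; rewrite ler_norml => /andP[]; lra.
have nb : `|b - enorm (a *: v - x)| <= enorm q.
  have -> : b = enorm (a *: v - x - q).
    by rewrite -bE enormZ (gtr0_norm b0) (sphere_enorm v').1// mulr1.
  by apply: le_trans (enorm_dist _ _) _; rewrite addrAC subrr add0r enormN.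
have sq : enorm (a *: v - x) ^+ 2 = a ^+ 2 + enorm x ^+ 2.
  rewrite !sqr_enorm dotBl !dotBr !dotZl !dotZr sv (dotC v x) xv; ring.
have na : a <= enorm (a *: v - x) <= a + enorm x ^+ 2.
  have X0 := sqr_ge0 (enorm x).
  apply/andP; split; rewrite -(@ler_pXn2r _ 2) ?nnegrE//; try by lra.
  rewrite sq sqrrD -addrA lerD2l.
  have : a * enorm x ^+ 2 *+ 2 = 2 * a * enorm x ^+ 2 by rewrite mulr2n; ring.
  have : 0 <= (enorm x ^+ 2) ^+ 2 by exact: sqr_ge0.
  have : (2 * (3/4)) * enorm x ^+ 2 <= 2 * a * enorm x ^+ 2 by rewrite ler_wpM2r//; lra.
  by set X := enorm x ^+ 2 in X0 *; set Y := X ^+ 2; lra.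
have X16 : enorm x ^+ 2 <= 4^-1 * 4^-1 by rewrite expr2 ler_pM.
have ba : `|b - a| <= enorm q + enorm x ^+ 2.
  move/andP: na => [n1 n2]; move: nb; rewrite !ler_norml => /andP[n3 n4].
  have := enorm_ge0 q; have := sqr_ge0 (enorm x).
  by set X := enorm x ^+ 2 in n2 *; move=> ? ?; apply/andP; split; lra.
have b12 : 2^-1 <= b.
  by move: ba X16 q1; rewrite ler_norml => /andP[? _]; lra.
have e2 : b *: (v' - v + x) = (a - b) *: v + (b - 1) *: x - q.
  rewrite scalerDr scalerBr bE; apply/rowP => i; rewrite !mxE; ring.
have : b * enorm (v' - v + x) <= `|b - a| + `|b - 1| * enorm x + enorm q.
  have -> : b * enorm (v' - v + x) = enorm (b *: (v' - v + x)).
    by rewrite enormZ gtr0_norm.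
  rewrite e2; apply: le_trans (enormD _ _) _.
  rewrite enormN lerD2r; apply: le_trans (enormD _ _) _.
  by rewrite !enormZ (sphere_enorm v).1// mulr1 distrC.
have b1 : `|b - 1| <= enorm q + enorm x ^+ 2 + `|a - 1|.
  have -> : b - 1 = (b - a) + (a - 1) by ring.
  by apply: le_trans (ler_normD _ _) _; rewrite lerD2r.
have b1x : `|b - 1| * enorm x <= 4^-1 * enorm q + 4^-1 * enorm x ^+ 2 + `|a - 1| * enorm x.
  apply: le_trans (ler_wpM2r (enorm_ge0 x) b1) _; rewrite !mulrDl !lerD2r lerD//.
    by rewrite mulrC ler_wpM2r.
  by rewrite mulrC ler_wpM2r// sqr_ge0.
have bl : 2^-1 * enorm (v' - v + x) <= b * enorm (v' - v + x) by rewrite ler_wpM2r.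
have := mulr_ge0 (normr_ge0 (a - 1)) (enorm_ge0 x).
move: ba b1x bl; set A := `|a - 1| * enorm x; set X := enorm x ^+ 2.
have : 0 <= X by exact: sqr_ge0.
have := enorm_ge0 q.
by set B := `|b - 1| * enorm x; set C := b * _; lra.
Qed.

Lemma normal_expansion u v Q : second_form u v Q -> forall eps, 0 < eps ->
  evt (dist u) (fun w => forall v', incident K L w v' ->
    enorm (v' - v + (w - u) *m Q) <= eps * enorm (w - u)).
Proof.
move=> SF eps eps0; have [uv sQ uQ vQ qe] := SF; have Lv : L v by case: uv.
have [M ME] : exists M, M = mxbound Q by exists (mxbound Q).
have M0 : 0 <= M by rewrite ME mxbound_ge0.
have ve0 := lt_le_trans r0 (eL Lv).
have sv : sphere v by exact: (pair_sphere (polar_pairC KL)).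
have eps12 : 0 < eps / 12 by rewrite divr_gt0.
have S1 := slope_expansion SF eps12.
have S2 := approx_upper ler01 (qe _ ltr01); rewrite -ME in S2.
have [C0 C0E] : exists C0, C0 = (1 + M) / r * M by exists ((1 + M) / r * M).
have C00 : 0 <= C0 by rewrite C0E !mulr_ge0// ?addr_ge0// invr_ge0 ltW.
have [C2 C2E] : exists C2, C2 = M * c1 / r by exists (M * c1 / r).
have C20 : 0 <= C2 by rewrite C2E !mulr_ge0 ?(ltW c1_gt0)// invr_ge0 ltW.
have [B BE] : exists B, B = 6 * C0 + 4 * M ^+ 2 + 2 * (C2 * M) + 1.
  by exists (6 * C0 + 4 * M ^+ 2 + 2 * (C2 * M) + 1).
have M20 := sqr_ge0 M; have C2M0 := mulr_ge0 C20 M0.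
have B0 : 0 < B by rewrite BE; lra.
have C21 : 0 < C2 + 1 by lra.
have M1 : 0 < M + 1 by lra.
have C01 : 0 < 16 * C0 + 1 by lra.
have E1 : 0 < 2 * eps + 1 by lra.
have h4 : 0 < 4^-1 :> R by rewrite invr_gt0.
have eps2 : 0 < eps / 2 by rewrite divr_gt0.
apply: evtS (evtI S1 (evtI S2 (evtI (evt_ltM (dist u) B0 eps2) (evtI (evt_ltM (dist u) C21 h4)
  (evtI (evt_ltM (dist u) M1 h4) (evtI (evt_ltM (dist u) C01 ltr01)
   (evt_ltM (dist u) E1 ltr01))))))) => w [s1 [s2 [b1 [b2 [b3 [b4 b5]]]]]] v' wv'.
have Lv' : L v' by case: wv'.
have ve'0 := lt_le_trans r0 (eL Lv').
have bw := incident_boundary wv'.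
have {}s2 := s2 bw.
have {}s1 := s1 _ wv'.
set D := enorm (w - u) in s1 s2 b1 b2 b3 b4 b5 *.
have D0 : 0 <= D by exact: enorm_ge0.
have [pd pdE] : exists pd, pd = dot (p_ v) (w - u) by exists (dot (p_ v) (w - u)).
have pdb : `|pd| <= (1 + M) / r * D ^+ 2.
  have vu : dot v u = 0 by case: uv => _ _; rewrite dotC.
  rewrite pdE /slope dotZl dotBr vu subr0 normrM normrN normfV (gtr0_norm ve0).
  rewrite ger0_norm; last by case: wv' => Kw _ _; rewrite dotC (pair_ge0 KL).
  rewrite mulrC ler_pdivrMr//; apply: le_trans s2 _.
  rewrite (_ : _ * dot v e = (1 + M) * D ^+ 2 * (dot v e / r)); last by ring.
  rewrite ler_peMr//; first by rewrite mulr_ge0 ?addr_ge0 ?sqr_ge0.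
  by rewrite ler_pdivlMr// mul1r eL.
have [k kE] : exists k, k = dot (tilt v (w - u) *m Q) e by exists (dot (tilt v (w - u) *m Q) e).
have kb : `|k| <= M * c1 * D.
  rewrite kE; apply: le_trans (CauchySchwarz _ _) _; rewrite e1 mulr1.
  apply: le_trans (mulmx_enorm _ _) _; rewrite -ME -mulrA ler_wpM2l//.
  exact: tilt_bound.
have [q' q'E] : exists q', q' = (dot v e *: (p_ v' - p_ v) - tilt v (w - u) *m Q
      - k *: p_ v) + pd *: (e *m Q) by eexists.
have q'b : enorm q' <= eps / 12 * D + C0 * D ^+ 2.
  rewrite q'E; apply: le_trans (enormD _ _) _; rewrite kE lerD// enormZ.
  apply: (@le_trans _ _ ((1 + M) / r * D ^+ 2 * M)); last by rewrite C0E mulrAC.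
  apply: ler_pM => //; apply: le_trans (mulmx_enorm _ _) _.
  by rewrite e1 mulr1 ME.
have [x xE] : exists x, x = (w - u) *m Q by eexists.
have xb : enorm x <= M * D by rewrite xE ME; exact: mulmx_enorm.
have xv : dot x v = 0 by rewrite xE dot_mulmx sQ vQ dot0r.
(* Multiplying the slope of [v'] by [- dot v e] gives [b *: v']; the error component along [p_ v] in
   [slope_expansion] merely changes the coefficient of [v] from 1 to [a]. *)
pose a := 1 + k / dot v e; pose b := dot v e / dot v' e.
have ab : `|a - 1| <= C2 * D.
  rewrite /a addrAC subrr add0r normrM normfV (gtr0_norm ve0) ler_pdivrMr//.
  apply: le_trans kb _; rewrite C2E.
  rewrite (_ : _ * dot v e = M * c1 * D * (dot v e / r)); last by ring.
  rewrite ler_peMr//; first by rewrite !mulr_ge0// ltW.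
  by rewrite ler_pdivlMr// mul1r eL.
have b0 : 0 < b by rewrite divr_gt0.
have bE : b *: v' = a *: v - x - q'.
  have tx : tilt v (w - u) *m Q = x + pd *: (e *m Q).
    by rewrite /tilt mulmxDl -scalemxAl -xE -pdE.
  rewrite q'E tx /slope /a /b; apply/rowP => i; rewrite !mxE.
  by field; rewrite !gt_eqF.
have := unit_perturbation sv (pair_sphere (polar_pairC KL) Lv') xv b0 bE.
rewrite -xE; move: (enorm (v' - v + x)) => N.
have nx := enorm_ge0 x; have nq := enorm_ge0 q'; have na := normr_ge0 (a - 1).
move: (enorm x) (enorm q') `|a - 1| nx nq na xb q'b ab => X q A nx nq na xb q'b ab key.
have M2 : X ^+ 2 <= M ^+ 2 * D ^+ 2 by rewrite -exprMn ler_pXn2r// nnegrE mulr_ge0.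
have AX : A * X <= C2 * M * D ^+ 2.
  by apply: le_trans (ler_pM na nx ab xb) _; rewrite le_eqVlt; apply/orP; left; apply/eqP; ring.
have D2 : 0 <= D ^+ 2 := sqr_ge0 D.
have epsD : 0 <= eps * D by rewrite mulr_ge0// ltW.
have C0D : 0 <= C0 * D by rewrite mulr_ge0.
have C2D : 0 <= C2 * D by rewrite mulr_ge0.
have MD : 0 <= M * D by rewrite mulr_ge0.
have D1 : D <= 1 by move: b5; rewrite mulrDl mul1r -mulrA; lra.
have DD : C0 * D ^+ 2 <= C0 * D by rewrite expr2 mulrA ler_piMr.
have BD : B * D * D <= eps / 2 * D by rewrite ler_wpM2r// ltW.
rewrite mulrDl mul1r in b2; rewrite mulrDl mul1r in b3.
rewrite mulrDl mul1r -mulrA in b4; rewrite mulrDl mul1r -mulrA in b5.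
rewrite (mulrAC eps) in q'b; rewrite (mulrAC eps) in BD.
have q8 : q <= 8^-1.
  exact: expansion_arith1 b4 b5 q'b DD D1 D0.
have {}key : N <= 6 * q + 4 * X ^+ 2 + 2 * (A * X).
  apply: key => //; [apply: le_trans ab _|apply: le_trans xb _]; apply: ltW.
    by apply: le_lt_trans b2; rewrite lerDl.
  by apply: le_lt_trans b3; rewrite lerDl.
apply: (le_trans key).
have e3 : B * D * D = 6 * (C0 * D ^+ 2) + 4 * (M ^+ 2 * D ^+ 2) + 2 * (C2 * M * D ^+ 2) + D ^+ 2.
  by rewrite BE; ring.
by rewrite e3 in BD; exact: expansion_arith2 BD q'b M2 AX D2.
Qed.

End SecondOrder.

Lemma addr3K (G : zmodType) (a b c : G) : a + b + c - a = b + c.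
Proof. by rewrite -(addrA a b c) (addrC a (b + c)) addrK. Qed.

(** * Equivalence with the expansion in the gnomonic chart *)

Section GraphForm.
Context {R : realType} {m : nat}.
Notation V := 'rV[R]_m.+2.
Variables (K L : set V) (e : V) (r : R).
Hypotheses (KL : polar_pair K L) (r0 : 0 < r).
Hypotheses (eL : forall v, L v -> r <= dot v e) (e1 : enorm e = 1).
Implicit Types (u v w z x : V) (Q : 'M[R]_m.+2).
Notation F := (height L e).
Notation p_ := (slope e).
Notation dist u := (fun w => enorm (w - u)).
Notation second_form := (second_form K L).

Lemma tangent_partN u v w : tangent_part u (- v) w = tangent_part u v w.
Proof. by rewrite /tangent_part dotNr scalerN scaleNr opprK. Qed.

Lemma tangent_part_shift u v w : orthonormal2 u v ->
  tangent_part u v w = tangent_part u v (w - u).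
Proof.
move=> [su sv uv]; rewrite /tangent_part !dotBl su uv scalerBl scale1r subr0 opprB.
by rewrite addrA subrK.
Qed.

Lemma tangent_part_dot u v w : orthonormal2 u v ->
  dot (tangent_part u v w) u = 0 /\ dot (tangent_part u v w) v = 0.
Proof.
move=> [su sv uv]; rewrite /tangent_part; rewrite !dotBl !dotZl su sv (dotC v u) uv.
by split; ring.
Qed.

Lemma tangent_part_le u v w : orthonormal2 u v -> enorm (tangent_part u v w) <= enorm w.
Proof.
move=> on; have [tu tv] := tangent_part_dot w on; have [su sv uv] := on.
rewrite -(@ler_pXn2r _ 2) ?nnegrE// !sqr_enorm.
rewrite {2}/tangent_part 2!dotBr !dotZr tu tv !mulr0 !subr0 /tangent_part !dotBl !dotZl.
by rewrite (dotC u w) (dotC v w) -!expr2 -addrA gerDl -opprD oppr_le0 addr_ge0 ?sqr_ge0.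
Qed.

Lemma qf_tangent_part u v Q w : Q^T = Q -> u *m Q = 0 -> v *m Q = 0 ->
  qf Q (tangent_part u v w) = qf Q w.
Proof.
move=> sQ uQ vQ; rewrite /tangent_part -!scaleNr addrC qf_ker// addrC qf_ker//.
Qed.

Lemma incident_orthonormal u v : incident K L u v -> orthonormal2 u v.
Proof.
move=> [Ku Lv uv]; split => //; first exact: (pair_sphere KL).
exact: (pair_sphere (polar_pairC KL)).
Qed.

Lemma sphere_dot u w : sphere u -> sphere w -> dot w u = 1 - enorm (w - u) ^+ 2 / 2.
Proof.
move=> su sw; by rewrite sqr_enorm dotBl !dotBr su sw (dotC u w); field.
Qed.

(** The chart divides by [s = dot w u], which is [1 - enorm (w - u) ^+ 2 / 2], and [Q] ignores the
    components along [u] and [v]; the change of scale is therefore of higher order. *)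
Lemma second_order_form_quad u v Q : second_order_form K u (- v) Q -> second_form u v Q.
Proof.
move=> [bu nu [sQ uQ nQ] [f [bg fe]]].
have uv : incident K L u v.
  have Ku : K u by have [v' [? _ _]] := (sboundaryE u KL).1 bu.
  by have := (outer_unit_normalE (- v) KL Ku).1 nu; rewrite opprK.
have vQ : v *m Q = 0 by apply/eqP; rewrite -oppr_eq0 -mulNmx nQ.
split => // eps eps0.
have on := incident_orthonormal uv; have [su sv uv0] := on.
have [M ME] : exists M, M = mxbound Q by exists (mxbound Q).
have M0 : 0 <= M by rewrite ME mxbound_ge0.
have [rho1 rho10 H1] := (near_enormP _ _).1 bg.
have eps4 : 0 < eps / 4 by rewrite divr_gt0.
have [rho2 rho20 H2] := (near_enormP _ _).1 (fe _ eps4).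
have M1 : 0 < M + 1 by rewrite ltr_wpDl.
have eps2 : 0 < eps / 2 by rewrite divr_gt0.
apply: evtS (evtI (evt_lt (dist u) rho10) (evtI (evt_ltM (dist u) (ltr0n _ 2) rho20)
  (evtI (evt_lt (dist u) ltr01) (evt_ltM (dist u) M1 eps2)))) => w [w1 [w2 [w3 w4]]] bw.
have sw := sboundary_sphere KL bw.
have := (H1 w w1 sw).1 bw; rewrite tangent_partN dotNr opprK.
set D := enorm (w - u) in w1 w2 w3 w4 *.
have D0 : 0 <= D := enorm_ge0 _.
have [s sE] : exists s, s = dot w u by exists (dot w u).
have s1 : s = 1 - D ^+ 2 / 2 by rewrite sE sphere_dot.
have D1 : D ^+ 2 <= D by rewrite expr2 ler_piMl// ltW.
have s12 : 2^-1 <= s by lra.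
have s0 : 0 < s by lra.
rewrite -sE => fE.
have [x xE] : exists x, x = s^-1 *: tangent_part u v w by eexists.
have xn : enorm x <= 2 * D.
  rewrite xE enormZ gtr0_norm ?invr_gt0// ler_pM ?invr_ge0 ?(ltW s0)//.
    by rewrite invf_ple ?posrE.
  by rewrite tangent_part_shift//; exact: tangent_part_le.
have [tu tv] := tangent_part_dot w on.
have xu : dot x u = 0 by rewrite xE dotZl tu mulr0.
have xv : dot x (- v) = 0 by rewrite xE dotNr dotZl tv mulr0 oppr0.
rewrite -xE in fE.
have := H2 x; rewrite subr0 => /(_ (le_lt_trans xn w2) xu xv).
have qx : dot (x *m Q) x = s^-1 ^+ 2 * qf Q (w - u).
  rewrite -/(qf Q x) xE qfZ qf_tangent_part//; congr (_ * _).
  by have := @qf_ker _ _ Q u w (-1) sQ uQ; rewrite scaleN1r addrC.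
rewrite -fE qx -sqr_enorm => H.
have qb := qf_bound Q (w - u); rewrite -ME -/D in qb.
rewrite (dotC v w); move: (dot w v) (qf Q (w - u)) H qb => a q H qb.
have -> : a - q / 2 = s * (a / s - s^-1 ^+ 2 * q / 2) + (s^-1 - 1) * q / 2.
  by field; rewrite gt_eqF.
have x2 : enorm x ^+ 2 <= s^-1 ^+ 2 * D ^+ 2.
  rewrite -exprMn ler_pXn2r ?nnegrE ?mulr_ge0 ?invr_ge0 ?(ltW s0)//.
  rewrite xE enormZ gtr0_norm ?invr_gt0// ler_wpM2l ?invr_ge0 ?(ltW s0)//.
  by rewrite tangent_part_shift//; exact: tangent_part_le.
have i2 : s^-1 <= 2 by rewrite invf_ple ?posrE.
have i0 : 0 < s^-1 by rewrite invr_gt0.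
have A1 : `|s * (a / s - s^-1 ^+ 2 * q / 2)| <= eps / 2 * D ^+ 2.
  rewrite normrM (gtr0_norm s0).
  apply: (@le_trans _ _ (s * (eps / 4 * (s^-1 ^+ 2 * D ^+ 2)))).
    by rewrite ler_pM2l//; apply: le_trans H _; rewrite ler_pM2l.
  rewrite (_ : s * (_ * _) = s^-1 * (eps / 4 * D ^+ 2)); last by field; rewrite gt_eqF.
  apply: (@le_trans _ _ (2 * (eps / 4 * D ^+ 2))).
    by rewrite ler_wpM2r// mulr_ge0 ?sqr_ge0// ltW.
  by rewrite le_eqVlt; apply/orP; left; apply/eqP; field.
have A2 : `|(s^-1 - 1) * q / 2| <= M * D * D ^+ 2.
  have -> : (s^-1 - 1) * q / 2 = s^-1 * (D ^+ 2 * q) / 4 by rewrite (_ : D ^+ 2 = 2 * (1 - s)); [field; rewrite gt_eqF|lra].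
  rewrite 3!normrM (gtr0_norm i0) (ger0_norm (sqr_ge0 D)) (ger0_norm (_ : 0 <= 4^-1)) ?invr_ge0//.
  rewrite ler_pdivrMr//.
  apply: (@le_trans _ _ (2 * (D ^+ 2 * (M * D ^+ 2)))).
    by rewrite ler_pM ?mulr_ge0 ?sqr_ge0 ?(ltW i0)// ler_wpM2l ?sqr_ge0.
  have D20 := sqr_ge0 D.
  apply: (@le_trans _ _ (2 * (D * (M * D ^+ 2)))).
    by rewrite ler_wpM2l// ler_wpM2r// mulr_ge0.
  have : 0 <= M * D * D ^+ 2 by rewrite !mulr_ge0.
  by rewrite (_ : D * (M * D ^+ 2) = M * D * D ^+ 2); [lra|ring].
apply: le_trans (ler_normD _ _) _; apply: le_trans (lerD A1 A2) _.
rewrite -mulrDl ler_wpM2r ?sqr_ge0//.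
by move: w4; rewrite mulrDl mul1r; lra.
Qed.

Lemma tangent_partK u v w : orthonormal2 u v -> dot w u != 0 ->
  w = dot w u *: (u + (dot w u)^-1 *: tangent_part u v w + (dot w v / dot w u) *: v).
Proof.
move=> _ s0; rewrite !scalerDr !scalerA divff// scale1r mulrCA divff// mulr1.
by rewrite /tangent_part; apply/rowP => i; rewrite !mxE; ring.
Qed.

(* In the direction of the inner normal [v] the height function is strictly
   decreasing near [u], because nearby normals are close to [v]. *)
Lemma graph_unique u v Q : second_form u v Q -> exists2 rho, 0 < rho &
  forall x t t', enorm x < rho -> `|t| < rho -> `|t'| < rho ->
    F (u + x + t *: v) = 0 -> F (u + x + t' *: v) = 0 -> t = t'.
Proof.
move=> SF; have [uv sQ uQ vQ qe] := SF; have [su sv uv0] := incident_orthonormal uv.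
have [rho0 rho00 NE] := normal_expansion KL r0 eL e1 SF ltr01.
have [M ME] : exists M, M = mxbound Q by exists (mxbound Q).
have M0 : 0 <= M by rewrite ME mxbound_ge0.
have M2 : 0 < M + 2 by rewrite ltr_wpDl.
exists (Num.min 4^-1 (Num.min (rho0 / 4) (8^-1 / (M + 2)))).
  by rewrite !lt_min invr_gt0 ltr0n !divr_gt0 ?invr_gt0.
move=> x t t'; rewrite !lt_min => /andP[x1 /andP[x2 x3]] /andP[t1 /andP[t2 t3]] /andP[t1' /andP[t2' t3']].
wlog: t t' t1 t2 t3 t1' t2' t3' / t <= t'.
  by move=> H a b; have [tt|/ltW tt] := leP t t'; [exact: H|apply/esym; exact: H].
rewrite le_eqVlt => /predU1P[//|tt] Ft Ft'; exfalso.
have near_u s : `|s| < 4^-1 -> `|s| < rho0 / 4 -> `|s| < 8^-1 / (M + 2) -> [/\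
    u + x + s *: v != 0, sphere (unit_vec (u + x + s *: v)) &
    enorm (unit_vec (u + x + s *: v) - u) < rho0 /\
    (M + 2) * enorm (unit_vec (u + x + s *: v) - u) < 2^-1].
  move=> s1 s2 s3.
  have yu : enorm (u + x + s *: v - u) <= enorm x + `|s|.
    rewrite addr3K; apply: le_trans (enormD _ _) _.
    by rewrite lerD2l enormZ (sphere_enorm v).1// mulr1.
  have yu2 : enorm (u + x + s *: v - u) <= 2^-1 by apply: le_trans yu _; lra.
  have [y0 y1 y2 y3 y4] := unit_vec_near su yu2.
  split => //; first exact: unit_vec_sphere.
  rewrite !ltr_pdivlMr// in x3 s3.
  split; first by apply: le_lt_trans y4 _; move: yu; lra.
  rewrite mulrC -ltr_pdivlMr//; apply: le_lt_trans y4 _.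
  rewrite ltr_pdivlMr//; apply: (@le_lt_trans _ _ (2 * (enorm x + `|s|) * (M + 2))).
    by rewrite ler_wpM2r ?(ltW M2)// ler_pM2l.
  by move: x3 s3; rewrite -mulrA [(_ + _) * (M + 2)]mulrDl; set a := _ * (M + 2); set b := _ * (M + 2); lra.
have [y0 sy _] := near_u t t1 t2 t3.
have [y0' sy' [d1 d2]] := near_u t' t1' t2' t3'.
set y := u + x + t *: v in Ft y0 sy; set y' := u + x + t' *: v in Ft' y0' sy' d1 d2.
have by' : sboundary K (unit_vec y').
  by apply/(height0 KL r0 eL sy'); exact: (height_unit_vec KL r0 eL).
have [v'' wv] := (sboundaryE _ KL).1 by'.
have Ky : K (unit_vec y) by apply/(height_le0 KL r0 eL sy); rewrite (height_unit_vec KL r0 eL).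
have := NE _ d1 _ wv; rewrite mul1r => hv.
have vv : 0 < dot v'' v.
  have -> : dot v'' v = 1 + dot (v'' - v) v by rewrite dotBl sv; ring.
  have : enorm (v'' - v) < 2^-1.
    have -> : v'' - v = (v'' - v + (unit_vec y' - u) *m Q) - (unit_vec y' - u) *m Q by rewrite addrK.
    apply: le_lt_trans (enormD _ _) _; rewrite enormN.
    have := mulmx_enorm (unit_vec y' - u) Q; rewrite -ME.
    move: d2; rewrite mulrDl; have := enorm_ge0 (unit_vec y' - u).
    by move: hv; set a := enorm (_ + _); set b := enorm (_ *m _); set c := enorm _; lra.
  have := CauchySchwarz (v'' - v) v; rewrite (sphere_enorm v).1// mulr1 ler_norml.
  by move=> /andP[h _]; lra.
have Lv'' : L v'' by case: wv.
have h1 : dot v'' y' = 0.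
  case: wv => _ _; rewrite dotC /unit_vec dotZr => /eqP; rewrite mulf_eq0 invr_eq0.
  by rewrite enorm_eq0 (negbTE y0') => /eqP.
have h2 : 0 <= dot v'' y.
  have := pair_ge0 KL Ky Lv''; rewrite dotC /unit_vec dotZr pmulr_rge0//.
  by rewrite invr_gt0 enorm_gt0.
have : dot v'' (y - y') = (t - t') * dot v'' v.
  by rewrite /y /y' addrKA opprK || rewrite /y /y' opprD addrACA subrr add0r -scalerBl dotZr.
rewrite dotBr h1 subr0 => h3; move: h2; rewrite h3 pmulr_lge0// subr_ge0 leNgt tt.
by [].
Qed.

Lemma height_continuous : continuous F.
Proof.
move=> x; apply/(@cvgrPdist_lt R R _ (nbhs x) (nbhs_filter x)) => eps eps0; apply/near_enormP.
exists (eps * r); first by rewrite mulr_gt0.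
move=> y; rewrite -ltr_pdivrMr// => h; apply: le_lt_trans (height_lip KL r0 eL _ _) _.
by rewrite enormB mulrC.
Qed.

(** Along [v] the height behaves like [- t / dot v e] up to a quadratic error, so for small [x] it
    changes sign between [- enorm x] and [enorm x], and the intermediate value theorem applies. *)
Lemma graph_exists u v Q : second_form u v Q -> exists2 rho, 0 < rho &
  forall x, enorm x < rho -> dot x v = 0 ->
    exists2 t, `|t| <= enorm x & F (u + x + t *: v) = 0.
Proof.
move=> SF; have [uv sQ uQ vQ qe] := SF; have [su sv uv0] := incident_orthonormal uv.
have [C C0 [rho rho0 H]] := second_form_upper KL r0 eL e1 SF.
have Lv : L v by case: uv. have ve0 := lt_le_trans r0 (eL Lv).
have C1 : 0 < 4 * C * dot v e + 1 by rewrite ltr_wpDl// !mulr_ge0// ltW.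
exists (Num.min (rho / 2) (4 * C * dot v e + 1)^-1); first by rewrite lt_min divr_gt0//= invr_gt0.
move=> x; rewrite lt_min => /andP[x1 x2] xv.
have [->|x0] := eqVneq x 0.
  exists 0; rewrite ?normr0 ?enorm_ge0// scale0r !addr0.
  by have [_ h _] := (height_incident KL r0 eL v su).1 uv.
have xp : 0 < enorm x by rewrite enorm_gt0.
pose g t := F (u + x + t *: v).
have cg : continuous g.
  move=> t; apply: (@continuous_comp _ _ _ (fun t : R => u + x + t *: v) F); last exact: height_continuous.
  apply: continuousD; first exact: cst_continuous.
  exact: (@scalel_continuous R V v).
have pz t : dot (p_ v) (x + t *: v) = - (t / dot v e).
  by rewrite /slope dotZl dotDr dotZr (dotC v x) xv sv add0r mulr1 mulNr mulrC.
have gle t : `|t| <= enorm x -> - (t / dot v e) <= g t /\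
    g t <= - (t / dot v e) + C * (4 * enorm x ^+ 2).
  move=> tx; have xt : enorm (x + t *: v) <= 2 * enorm x.
    apply: le_trans (enormD _ _) _; rewrite enormZ (sphere_enorm v).1// mulr1.
    by rewrite mulr_natl mulr2n lerD2l.
  have xr : enorm (x + t *: v) < rho by apply: le_lt_trans xt _; lra.
  have := H _ xr; rewrite pz addrA -/(g t) => h1.
  have := height_ge_slope KL r0 eL (x + t *: v) uv; rewrite pz addrA -/(g t) => h2; split => //.
  rewrite -lerBlDl; apply: le_trans h1 _; rewrite ler_wpM2l//.
  have -> : 4 * enorm x ^+ 2 = (2 * enorm x) ^+ 2 by ring.
  by rewrite ler_pXn2r ?nnegrE ?mulr_ge0.
have gx : g (enorm x) <= 0.
  apply: le_trans (gle _ _).2 _; first by rewrite ger0_norm.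
  rewrite addrC subr_le0 ler_pdivlMr//.
  rewrite (_ : _ * dot v e = (4 * C * dot v e * enorm x) * enorm x); last by ring.
  rewrite -[leRHS]mul1r ler_wpM2r//.
  have : (4 * C * dot v e + 1) * enorm x < 1.
    by rewrite mulrC -ltr_pdivlMr// mul1r.
  by rewrite mulrDl mul1r; lra.
have gNx : 0 <= g (- enorm x).
  apply: le_trans (gle _ _).1; last by rewrite normrN ger0_norm.
  by rewrite mulNr opprK divr_ge0// ltW.
have [|||t /itvP tI gt0] := @IVT R g (- enorm x) (enorm x) 0 _ _ _.
- by lra.
- exact: continuous_subspaceT.
- by rewrite ge_min gx orbT le_max gNx.
- by exists t; rewrite ?ler_norml ?tI.
Qed.

Lemma second_form_order u v Q : second_form u v Q -> second_order_form K u (- v) Q.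
Proof.
move=> SF; have [uv sQ uQ vQ qe] := SF; have on := incident_orthonormal uv.
have [su sv uv0] := on; have bu := incident_boundary KL uv.
have [rho1 rho10 H1] := graph_unique SF.
have [rho2 rho20 H2] := graph_exists SF.
have Ku : K u by case: uv.
split => //; first by apply/(outer_unit_normalE _ KL Ku); rewrite opprK.
  by split; rewrite ?mulNmx ?vQ ?oppr0.
(* The size restriction makes the solution unique for small [x]; the default 0 is taken only where
   there is none. *)
pose f x := xget 0 [set t | `|t| < rho1 /\ F (u + x + t *: v) = 0].
have fE x t : enorm x < rho1 -> `|t| < rho1 -> F (u + x + t *: v) = 0 -> f x = t.
  move=> x1 t1 Ft; rewrite /f; case: xgetP => [s _ [s1 Fs]|/(_ t) h].
    exact: H1 x1 s1 t1 Fs Ft.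
  by exfalso; apply: h; split.
have fex x : enorm x < rho1 -> enorm x < rho2 -> dot x v = 0 ->
    `|f x| <= enorm x /\ F (u + x + f x *: v) = 0.
  move=> x1 x2 xv; have [t tx Ft] := H2 _ x2 xv.
  by rewrite (fE _ _ x1 (le_lt_trans tx x1) Ft).
exists f; split.
- apply/near_enormP; exists (Num.min 1 (Num.min (rho1 / 2) (rho2 / 2))).
    by rewrite !lt_min ltr01 !divr_gt0.
  move=> w; rewrite !lt_min => /andP[w3 /andP[w1 w2]] sw.
  rewrite tangent_partN dotNr opprK.
  have s1 := sphere_dot su sw.
  set D := enorm (w - u) in w1 w2 w3 s1.
  have D0 : 0 <= D := enorm_ge0 _.
  have D1 : D ^+ 2 <= D by rewrite expr2 ler_piMl// ltW.
  have [s sE] : exists s, s = dot w u by exists (dot w u).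
  rewrite -sE in s1 *; have s12 : 2^-1 <= s by lra.
  have s0 : 0 < s by lra.
  have si : s^-1 <= 2 by rewrite invf_ple ?posrE.
  have [x xE] : exists x, x = s^-1 *: tangent_part u v w by eexists.
  have xn : enorm x <= 2 * D.
    rewrite xE enormZ gtr0_norm ?invr_gt0// ler_pM ?invr_ge0 ?(ltW s0)//.
    by rewrite tangent_part_shift//; exact: tangent_part_le.
  have tn : `|dot w v / s| <= 2 * D.
    rewrite normrM normfV (gtr0_norm s0) mulrC ler_pM ?invr_ge0 ?(ltW s0)//.
    have -> : dot w v = dot (w - u) v by rewrite dotBl uv0 subr0.
    by apply: le_trans (CauchySchwarz _ _) _; rewrite (sphere_enorm v).1// mulr1.
  have [tu tv] := tangent_part_dot w on.
  have xv : dot x v = 0 by rewrite xE dotZl tv mulr0.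
  have wE : w = s *: (u + x + (dot w v / s) *: v).
    by rewrite xE sE -tangent_partK// -sE gt_eqF.
  have FwE : F w = s * F (u + x + (dot w v / s) *: v).
    by rewrite {1}wE (heightZ KL r0 eL) ?ltW.
  rewrite -xE; split.
  + move=> bw; apply/esym; apply: fE; [lra|lra|].
    have := boundary_height KL r0 eL bw; rewrite FwE => /eqP.
    by rewrite mulf_eq0 gt_eqF//= => /eqP.
  + move=> tE; apply/(height0 KL r0 eL sw); rewrite FwE tE.
    by have [||_ ->] := fex x _ _ xv; rewrite ?mulr0//; lra.
- move=> eps eps0; apply/near_enormP.
  have [M ME] : exists M, M = mxbound Q by exists (mxbound Q).
  have M0 : 0 <= M by rewrite ME mxbound_ge0.
  (* The remainder at the normalised point gets multiplied by at most [3 / 2 * 4 ^+ 2 = 24], leaving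
     [eps / 2]. *)
  have eps48 : 0 < eps / 48 by rewrite divr_gt0.
  have [rho3 rho30 H3] := qe _ eps48.
  have M4 : 0 < 4 * M + 1 by rewrite ltr_wpDl// mulr_ge0.
  exists (Num.min (Num.min rho1 rho2) (Num.min 4^-1 (Num.min (rho3 / 4) (eps / (4 * M + 1))))).
    by rewrite !lt_min rho10 rho20 !divr_gt0//= invr_gt0 ltr0n.
  move=> x; rewrite subr0 !lt_min => /andP[/andP[x1 x2] /andP[x3 /andP[x4 x5]]] xu.
  rewrite dotNr => /eqP; rewrite oppr_eq0 => /eqP xv.
  rewrite ltr_pdivlMr// in x5.
  have [fx Ffx] := fex x x1 x2 xv.
  set t := f x in fx Ffx *.
  have [y yE] : exists y, y = u + x + t *: v by eexists.
  have yu : enorm (y - u) <= 2 * enorm x.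
    rewrite yE addr3K; apply: le_trans (enormD _ _) _.
    by rewrite enormZ (sphere_enorm v).1// mulr1 mulr_natl mulr2n lerD2l.
  have yu2 : enorm (y - u) <= 2^-1 by apply: le_trans yu _; lra.
  have [y0 y1 y2 y3 y4] := unit_vec_near su yu2.
  have wu : enorm (unit_vec y - u) <= 4 * enorm x by lra.
  have bw : sboundary K (unit_vec y).
    apply/(height0 KL r0 eL); first exact: unit_vec_sphere.
    by apply: (height_unit_vec KL r0 eL); rewrite yE.
  have := H3 _ (le_lt_trans wu _) bw; rewrite -ltr_pdivlMl// mulrC => /(_ x4).
  have N0 : 0 < enorm y by rewrite enorm_gt0.
  have -> : qf Q (unit_vec y - u) = enorm y ^- 2 * qf Q x.
    have := @qf_ker _ _ Q u (unit_vec y) (-1) sQ uQ; rewrite scaleN1r addrC => ->.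
    rewrite /unit_vec qfZ exprVn; congr (_ * _); rewrite yE addrC qf_ker//.
    by rewrite -[u]scale1r qf_ker.
  have -> : dot v (unit_vec y) = (enorm y)^-1 * t.
    rewrite /unit_vec dotZr yE !dotDr dotZr (dotC v u) uv0 (dotC v x) xv sv.
    by rewrite !add0r mulr1.
  rewrite -sqr_enorm -/(qf Q x).
  have qb := qf_bound Q x; rewrite -ME in qb.
  move: (enorm (unit_vec y - u)) (enorm_ge0 (unit_vec y - u)) wu => W W0 wu.
  move: (qf Q x) qb => q qb.
  move: (enorm y) N0 y1 y2 y3 => N N0 y1 y2 y3.
  move: (enorm (y - u)) y3 yu => Y y3 yu.
  move: (enorm x) (enorm_ge0 x) x3 x5 yu wu qb => D D0 x3 x5 yu wu qb ha.
  have -> : t - q / 2 = N * (N^-1 * t - N ^- 2 * q / 2) + (N^-1 - 1) * q / 2.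
    by field; rewrite gt_eqF.
  have A1 : `|N * (N^-1 * t - N ^- 2 * q / 2)| <= eps / 2 * D ^+ 2.
    rewrite normrM (gtr0_norm N0).
    apply: (@le_trans _ _ (3 / 2 * (eps / 48 * (4 * D) ^+ 2))).
      apply: ler_pM => //; first exact: ltW.
      by apply: le_trans ha _; rewrite ler_pM2l// ler_pXn2r// nnegrE mulr_ge0.
    by rewrite le_eqVlt; apply/orP; left; apply/eqP; field.
  have A2 : `|(N^-1 - 1) * q / 2| <= 2 * M * D * D ^+ 2.
    have -> : N^-1 - 1 = (1 - N) / N by field; rewrite gt_eqF.
    rewrite !normrM (ger0_norm (_ : 0 <= 2^-1)) ?invr_ge0// ler_pdivrMr//.
    apply: (@le_trans _ _ ((2 * D * 2) * (M * D ^+ 2))); last first.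
      by rewrite le_eqVlt; apply/orP; left; apply/eqP; ring.
    apply: ler_pM => //.
    rewrite ler_pM ?invr_ge0//; first exact: le_trans yu.
    by rewrite normfV gtr0_norm// invf_ple ?posrE.
  apply: le_trans (ler_normD _ _) _; apply: le_trans (lerD A1 A2) _.
  rewrite -mulrDl ler_wpM2r ?sqr_ge0//.
  by move: x5; rewrite mulrDr mulr1 mulrC -mulrA -mulrA; lra.
Qed.

Lemma second_order_formE u v Q : second_order_form K u (- v) Q <-> second_form u v Q.
Proof. by split; [exact: second_order_form_quad|exact: second_form_order]. Qed.

End GraphForm.

(** * Uniqueness, positivity and duality of second fundamental forms *)

Section CurvatureOfForm.
Context {R : realType} {m : nat}.
Notation V := 'rV[R]_m.+2.
Variables (K L : set V) (e : V) (r : R).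
Hypotheses (KL : polar_pair K L) (r0 : 0 < r).
Hypotheses (eL : forall v, L v -> r <= dot v e) (e1 : enorm e = 1).
Implicit Types (u v w z x h : V) (Q : 'M[R]_m.+2).
Notation F := (height L e).
Notation p_ := (slope e).
Notation dist u := (fun w => enorm (w - u)).
Notation dual_form := (second_form L K).
Notation second_form := (second_form K L).

Lemma qf_orthogonal v Q x : sphere v -> Q^T = Q -> v *m Q = 0 ->
  qf Q x = qf Q (x - dot x v *: v) /\ dot (x - dot x v *: v) v = 0.
Proof.
move=> sv sQ vQ; split; first by rewrite addrC -scaleNr qf_ker.
by rewrite dotBl dotZl sv mulr1 subrr.
Qed.

Lemma slope_orth v h (t : R) : dot h v = 0 -> dot (p_ v) (t *: h) = 0.
Proof. by move=> hv; rewrite /slope dotZl dotZr (dotC v h) hv !mulr0. Qed.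

Lemma tangent_part_sqr u v w : orthonormal2 u v ->
  enorm (tangent_part u v w) ^+ 2 = enorm w ^+ 2 - dot w u ^+ 2 - dot w v ^+ 2.
Proof.
move=> on; have [tu tv] := tangent_part_dot w on; rewrite !sqr_enorm.
rewrite {2}/tangent_part 2!dotBr !dotZr tu tv !mulr0 !subr0 /tangent_part !dotBl !dotZl.
by rewrite (dotC u w) (dotC v w) -!expr2.
Qed.

(** On lines orthogonal to [v] the linear term and the tilt vanish, so the quadratic form can be
    read off from the height alone. *)
Lemma tangent_height u v Q h : second_form u v Q -> dot h v = 0 -> forall eps, 0 < eps ->
  evt (fun t : R => `|t|) (fun t => `|dot v e * F (u + t *: h) - t ^+ 2 * qf Q h / 2| <= eps * t ^+ 2).
Proof.
move=> SF hv eps eps0.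
have h1 : 0 < enorm h + 1 by rewrite ltr_wpDl.
have eps1 : 0 < eps / (enorm h + 1) ^+ 2 by rewrite divr_gt0// exprn_gt0.
have [rho rho0 T2] := height_taylor2 KL r0 eL e1 SF eps1.
exists (rho / (enorm h + 1)); first by rewrite divr_gt0.
move=> t; rewrite ltr_pdivlMr// => tr.
have th : enorm (t *: h) < rho.
  by apply: le_lt_trans tr; rewrite enormZ ler_wpM2l// lerDl.
have p0 := slope_orth t hv.
have := T2 _ th; rewrite /tilt p0 scale0r addr0 subr0 qfZ => H; apply: le_trans H _.
rewrite enormZ exprMn real_normK ?num_real// mulrCA mulrC ler_wpM2r ?sqr_ge0//.
rewrite -mulrA ler_piMr ?(ltW eps0)// mulrC ler_pdivrMr ?exprn_gt0// mul1r.
by rewrite ler_pXn2r ?nnegrE ?(ltW h1)// lerDl.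
Qed.

Lemma evt_pos (P : R -> Prop) : evt (fun t : R => `|t|) P -> exists2 t : R, 0 < t & P t.
Proof.
move=> [rho rho0 H]; exists (rho / 2); first by rewrite divr_gt0.
by apply: H; rewrite ger0_norm ?divr_ge0 ?(ltW rho0)//; lra.
Qed.

Lemma second_form_psd u v Q x : second_form u v Q -> 0 <= qf Q x.
Proof.
move=> SF; have [uv sQ uQ vQ _] := SF; have [su sv _] := incident_orthonormal KL uv.
have [-> hv] := qf_orthogonal x sv sQ vQ; set h := x - _ in hv *.
have Lv : L v by case: uv. have ve0 := lt_le_trans r0 (eL Lv).
rewrite leNgt; apply/negP => q0.
have eps0 : 0 < - qf Q h / 4 by rewrite divr_gt0// oppr_gt0.
have [t t0] := evt_pos (tangent_height SF hv eps0).
rewrite ler_norml => /andP[_ H].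
have : 0 <= dot v e * F (u + t *: h).
  rewrite mulr_ge0 ?(ltW ve0)//; apply: le_trans (height_ge_slope KL r0 eL _ uv).
  by rewrite slope_orth.
have : 0 < t ^+ 2 * - qf Q h by rewrite mulr_gt0 ?exprn_gt0// oppr_gt0.
move: H; rewrite mulrN; have -> : - qf Q h / 4 * t ^+ 2 = - (t ^+ 2 * qf Q h) / 4 by ring.
by lra.
Qed.

Lemma second_form_unique u v v' Q Q' : second_form u v Q -> second_form u v' Q' ->
  v' = v /\ Q' = Q.
Proof.
move=> SF SF'; have [uv sQ uQ vQ _] := SF; have [uv' sQ' uQ' vQ' _] := SF'.
have v'v := second_form_normal_unique KL r0 eL e1 SF uv'; split => //; subst v'.
have [su sv _] := incident_orthonormal KL uv.
apply/eqP; rewrite -subr_eq0; apply/eqP; apply: qf_eq0.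
  by rewrite linearB /= sQ sQ'.
move=> x; rewrite qf_mxB.
have [-> hv] := qf_orthogonal x sv sQ vQ; have [-> _] := qf_orthogonal x sv sQ' vQ'.
set h := x - _ in hv *.
apply/eqP/negPn/negP => q0; set q := (X in X != 0) in q0.
have qp : 0 < `|q| by rewrite normr_gt0.
have eps0 : 0 < `|q| / 5 by rewrite divr_gt0.
have [t t0 [H H']] := evt_pos (evtI (tangent_height SF hv eps0) (tangent_height SF' hv eps0)).
have : `|t ^+ 2 * q / 2| <= 2 * (`|q| / 5 * t ^+ 2).
  rewrite (_ : t ^+ 2 * q / 2 = (dot v e * F (u + t *: h) - t ^+ 2 * qf Q h / 2) -
    (dot v e * F (u + t *: h) - t ^+ 2 * qf Q' h / 2)); last by rewrite /q; field.
  by apply: le_trans (ler_normB _ _) _; rewrite mulr_natl mulr2n lerD.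
rewrite normrM normrM (ger0_norm (sqr_ge0 t)) (ger0_norm (_ : 0 <= 2^-1)) ?invr_ge0//.
have -> : 2 * (`|q| / 5 * t ^+ 2) = t ^+ 2 * `|q| * (2 / 5) by ring.
by rewrite ler_pM2l ?mulr_gt0 ?exprn_gt0//; lra.
Qed.

Lemma curv_mxN u v Q : curv_mx u (- v) Q = curv_mx u v Q.
Proof. by congr (_ + _); apply/matrixP => i j; rewrite !mxE !big_ord1 !mxE mulrNN. Qed.

(** Uniqueness of the form makes the value independent of the choice in [xget], and the spectral
    theorem shows that there is something to choose. *)
Lemma gauss_kroneckerE u v Q : second_form u v Q ->
  gauss_kronecker K u = \det (curv_mx u v Q).
Proof.
move=> SF; have [uv sQ uQ vQ _] := SF.
have onN u1 v1 : incident K L u1 v1 -> orthonormal2 u1 (- v1).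
  by move=> /(incident_orthonormal KL)[? ? o]; split; rewrite /sphere/= ?dotNl ?dotNr ?opprK ?o ?oppr0.
rewrite /gauss_kronecker; case: xgetP => [h _ [n [Q' [k [SO PC ->]]]]|H].
  have SF' : second_form u (- n) Q' by apply/(second_order_formE KL r0 eL e1); rewrite opprK.
  have [vE QE] := second_form_unique SF SF'; have [uv' sQ' uQ' vQ' _] := SF'.
  have nQ' : n *m Q' = 0 by rewrite -[n]opprK mulNmx vQ' oppr0.
  have on' := onN _ _ uv'; rewrite opprK in on'.
  by rewrite (principal_curvatures_det on' uQ' nQ' PC) QE -vE curv_mxN.
exfalso; have nQ : - v *m Q = 0 by rewrite mulNmx vQ oppr0.
have [k PC] := principal_curvatures_exist (onN _ _ uv) sQ uQ nQ.
apply: (H (\prod_i k i)); exists (- v), Q, k; split => //.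
exact/(second_order_formE KL r0 eL e1).
Qed.

Lemma gauss_kronecker_out u : ~ (exists v Q, second_form u v Q) -> gauss_kronecker K u = 0.
Proof.
move=> nSF; rewrite /gauss_kronecker; case: xgetP => // h _ [n [Q [k [SO _ _]]]].
exfalso; apply: nSF; exists (- n), Q.
by apply/(second_order_formE KL r0 eL e1); rewrite opprK.
Qed.

Lemma curvature_frame u v Q : second_form u v Q -> exists g k,
  [/\ orthonormal_upto m.+2 g, g 0%N = u, g 1%N = v,
    forall i, (i < m)%N -> g i.+2 *m Q = k i *: g i.+2 /\ 0 <= k i &
    \det (curv_mx u v Q) = \prod_(i < m) k i].
Proof.
move=> SF; have [uv sQ uQ vQ _] := SF.
have [g [k [og g0 g1 gk dE]]] := principal_frame (incident_orthonormal KL uv) sQ uQ vQ.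
exists g, k; split => // i im; split; first exact: gk.
have := second_form_psd (g i.+2) SF; rewrite /qf gk// dotZl og// eqxx mulr1.
by [].
Qed.

Lemma det_curv_ge0 u v Q : second_form u v Q -> 0 <= \det (curv_mx u v Q).
Proof.
move=> SF; have [g [k [_ _ _ gk ->]]] := curvature_frame SF.
by apply: prodr_ge0 => i _; exact: (gk i (ltn_ord i)).2.
Qed.

Lemma gauss_kronecker_ge0 u : 0 <= gauss_kronecker K u.
Proof.
have [[v [Q SF]]|h] := pselect (exists v Q, second_form u v Q).
  by rewrite (gauss_kroneckerE SF); exact: det_curv_ge0 SF.
by rewrite gauss_kronecker_out.
Qed.

Lemma tangent_inverse_bound u v Q : orthonormal2 u v -> Q^T = Q -> u *m Q = 0 -> v *m Q = 0 ->
  \det (curv_mx u v Q) != 0 -> exists2 B, 0 <= B & forall x, dot x u = 0 -> dot x v = 0 ->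
    enorm x <= B * enorm (x *m Q).
Proof.
move=> on sQ uQ vQ d0; exists (mxbound (invmx (curv_mx u v Q))); first exact: mxbound_ge0.
move=> x xu xv; have uM : curv_mx u v Q \in unitmx by rewrite unitmxE unitfE.
rewrite -{1}(mulmxK uM x) mul_curv_mx xu xv !scale0r !addr0.
exact: mulmx_enorm.
Qed.

(** Near [u] a displacement [w - u] is at most twice its tangential part, hence at most [2 * B]
    times its image under [Q]. Expanding the normal with precision [(4 * B + 1)^-1] replaces that
    image by [v' - v] and loses at most half of the displacement. *)
Lemma curvature_coercive u v Q : second_form u v Q -> \det (curv_mx u v Q) != 0 ->
  exists2 B, 0 <= B & evt (dist u) (fun w => forall v', incident K L w v' ->
    enorm (w - u) <= B * enorm (v' - v)).
Proof.
move=> SF d0; have [uv sQ uQ vQ qe] := SF; have on := incident_orthonormal KL uv.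
have [su sv uv0] := on.
have [B B0 HB] := tangent_inverse_bound on sQ uQ vQ d0.
exists (4 * B); first by rewrite mulr_ge0.
have [M ME] : exists M, M = mxbound Q by exists (mxbound Q).
have M0 : 0 <= M by rewrite ME mxbound_ge0.
have S2 := approx_upper ler01 (qe _ ltr01); rewrite -ME in S2.
have B1 : 0 < 4 * B + 1 by rewrite ltr_wpDl// mulr_ge0.
have eps0 : 0 < (4 * B + 1)^-1 by rewrite invr_gt0.
have S1 := normal_expansion KL r0 eL e1 SF eps0.
have M2 : 0 < 2 * (1 + M) by rewrite mulr_gt0// ltr_wpDr.
apply: evtS (evtI S1 (evtI S2 (evtI (evt_lt (dist u) ltr01) (evt_ltM (dist u) M2 ltr01))))
  => w [s1 [s2 [w1 w2]]] v' wv'.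
have bw := incident_boundary KL wv'; have {}s2 := s2 bw; have {}s1 := s1 _ wv'.
have sw := sboundary_sphere KL bw; have Kw : K w by case: wv'.
have Lv : L v by case: uv.
have [tu tv] := tangent_part_dot (w - u) on.
have := HB _ tu tv.
have -> : tangent_part u v (w - u) *m Q = (w - u) *m Q.
  by rewrite /tangent_part !mulmxBl -!scalemxAl uQ vQ !scaler0 !subr0.
have tn : enorm (w - u) ^+ 2 = enorm (tangent_part u v (w - u)) ^+ 2 +
    (enorm (w - u) ^+ 2 / 2) ^+ 2 + dot v w ^+ 2.
  rewrite (tangent_part_sqr _ on) (_ : dot (w - u) u = - (enorm (w - u) ^+ 2 / 2)).
    by rewrite (_ : dot (w - u) v = dot v w) 1?sqrrN; [ring|rewrite dotBl uv0 subr0 dotC].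
  by rewrite dotBl su (sphere_dot su sw); ring.
have vw0 : 0 <= dot v w by rewrite dotC (pair_ge0 KL).
have dQ : enorm ((w - u) *m Q) <= enorm (v' - v) + (4 * B + 1)^-1 * enorm (w - u).
  have -> : (w - u) *m Q = (v' - v + (w - u) *m Q) - (v' - v) by rewrite [v' - v + _]addrC addrK.
  by apply: le_trans (enormD _ _) _; rewrite enormN addrC lerD2l.
have nD := enorm_ge0 (w - u); have nT := enorm_ge0 (tangent_part u v (w - u)).
have nV := enorm_ge0 (v' - v).
move: (dot v w) (enorm (tangent_part u v (w - u))) (enorm ((w - u) *m Q)) (enorm (v' - v))
  (enorm (w - u)) vw0 nD nT nV dQ tn s2 w1 w2 {s1} => a T X W D vw0 D0 T0 W0 dQ tn s2 w1 w2 TX.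
have aD : a <= D / 2.
  apply: le_trans s2 _; have -> : (1 + M) * D ^+ 2 = D / 2 * (2 * (1 + M) * D) by field.
  by rewrite ler_piMr ?divr_ge0// ltW.
have a2 : a ^+ 2 <= D ^+ 2 / 4.
  have -> : D ^+ 2 / 4 = (D / 2) ^+ 2 by field.
  by rewrite ler_pXn2r// nnegrE divr_ge0.
have d4 : (D ^+ 2 / 2) ^+ 2 <= D ^+ 2 / 4.
  have -> : (D ^+ 2 / 2) ^+ 2 = D ^+ 2 / 4 * D ^+ 2 by field.
  rewrite ler_piMr ?divr_ge0 ?sqr_ge0//.
  by rewrite expr2 -[leRHS]mulr1 ler_pM// ltW.
have DT : D <= 2 * T.
  rewrite -(@ler_pXn2r _ 2) ?nnegrE ?mulr_ge0// exprMn.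
  have -> : 2 ^+ 2 = 4 :> R by ring.
  by move: tn a2 d4 (sqr_ge0 T); move: (T ^+ 2) ((D ^+ 2 / 2) ^+ 2) (a ^+ 2) (D ^+ 2) => y1 y2 y3 y4; lra.
have : B * X <= B * (W + (4 * B + 1)^-1 * D) by rewrite ler_wpM2l.
rewrite mulrDr.
have : B * ((4 * B + 1)^-1 * D) <= 4^-1 * D.
  rewrite mulrA ler_wpM2r// ler_pdivrMr//; lra.
have -> : 4 * B * W = 4 * (B * W) by ring.
by move: TX DT; set y1 := B * W; set y2 := B * (_ * D); set y3 := B * X; lra.
Qed.

Lemma antipodal_free u : K u -> K (- u) -> False.
Proof.
have [_ _ _ [e' [r' r'0 h]]] := KL => /h h1 /h; rewrite dotNl; lra.
Qed.

(* Positive curvature at [u] rules out a second contact point of the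
   supporting great sphere, so contact points of nearby great spheres tend to [u]. *)
Lemma contact_near u v Q : second_form u v Q -> \det (curv_mx u v Q) != 0 ->
  forall rho, 0 < rho -> exists2 eta, 0 < eta & forall u' v', incident K L u' v' ->
    enorm (v' - v) < eta -> enorm (u' - u) < rho.
Proof.
move=> SF d0 rho rho0; have [uv sQ uQ vQ qe] := SF; have [su sv uv0] := incident_orthonormal KL uv.
have [B B0 [rho1 rho10 HB]] := curvature_coercive SF d0.
have Ku : K u by case: uv. have Lv : L v by case: uv.
(* On this compact set the pairing with [v] has a positive minimum, while a contact point [u'] of
   [v'] pairs with [v] to at most [enorm (v' - v)]. *)
pose S := K `&` [set w | rho <= enorm (w - u)].
have cS : compact S.
  apply: compact_closedI; first exact: (pair_compact KL).
  rewrite (_ : [set w | _] = (fun w => enorm (w - u)) @^-1` [set y | rho <= y])//.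
  apply: preimage_closed; first by move=> x _; exact: enorm_dist_continuous.
  exact: mathcomp.analysis.normedtype_theory.num_normedtype.closed_ge.
have Spos c : S c -> 0 < dot c v.
  move=> [Kc /= cu]; rewrite lt_neqAle (pair_ge0 KL Kc Lv) andbT eq_sym.
  apply/negP => /eqP cv.
  have cn : c != u by apply: contraTneq cu => ->; rewrite subrr enorm0 -ltNge.
  pose s := Num.min 2^-1 (rho1 / 4).
  have s0 : 0 < s by rewrite lt_min invr_gt0 ltr0n divr_gt0.
  have s2 : s <= 2^-1 by rewrite ge_min lexx.
  have s4 : s <= rho1 / 4 by rewrite ge_min lexx orbT.
  (* If [c] also touched the great sphere of [v], so would the whole arc from [u] to [c]; coercivity
     with [v' = v] allows no such point near [u] other than [u]. *)
  pose y := u + s *: c.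
  have sc := pair_sphere KL Kc.
  have yu : enorm (y - u) = s.
    by rewrite /y addrC addKr enormZ (sphere_enorm c).1// mulr1 gtr0_norm.
  have [|y0 y1 y2 y3 y4] := @unit_vec_near R m u y su; first by rewrite yu.
  have wv : incident K L (unit_vec y) v.
    split => //; last by rewrite /unit_vec dotZl /y dotDl dotZl uv0 cv mulr0 addr0 mulr0.
    apply/(pairP KL); split; first exact: unit_vec_sphere.
    move=> v1 Lv1; rewrite /unit_vec dotZl mulr_ge0 ?invr_ge0// /y dotDl dotZl addr_ge0 ?mulr_ge0 ?(ltW s0)//.
      exact: (pair_ge0 KL).
    exact: (pair_ge0 KL).
  have : enorm (unit_vec y - u) <= 0.
    have wr : enorm (unit_vec y - u) < rho1.
      by apply: le_lt_trans y4 _; rewrite yu; lra.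
    by have := HB _ wr _ wv; rewrite subrr enorm0 mulr0.
  rewrite le_eqVlt ltNge enorm_ge0 orbF enorm_eq0 subr_eq0 => /eqP wE.
  have : s *: c = (enorm y - 1) *: u.
    rewrite scalerBl scale1r -{1}wE /unit_vec scalerA divff ?enorm_eq0// scale1r.
    by rewrite /y addrC addKr.
  have sn0 := lt0r_neq0 s0.
  move=> /(congr1 (fun x => s^-1 *: x)); rewrite !scalerA mulVf// scale1r => cE.
  have : `|s^-1 * (enorm y - 1)| = 1.
    by have := (sphere_enorm c).1 sc; rewrite {1}cE enormZ (sphere_enorm u).1// mulr1.
  move=> /eqP; rewrite eqr_norml ler01 andbT => /orP[]/eqP h.
    by move: cn; rewrite cE h scale1r eqxx.
  by apply: (antipodal_free Ku); rewrite -scaleN1r -h -cE.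
have [S0|S0] := pselect (S !=set0); last first.
  exists 1 => // u' v' [Ku' _ _] _; rewrite ltNge; apply/negP => h.
  by apply: S0; exists u'.
have [|c /set_mem Sc cmin] := compact_EVT_min S0 cS (f := fun w => dot w v).
  by apply: continuous_subspaceT; exact: dot_continuous.
exists (dot c v); first exact: Spos.
move=> u' v' [Ku' Lv' uv'] h; rewrite ltNge; apply/negP => hu.
have := cmin u'; rewrite inE => /(_ (conj Ku' hu)) h1.
have : dot u' v <= enorm (v' - v).
  have -> : dot u' v = dot u' (v - v') by rewrite dotBr uv' subr0.
  apply: le_trans (dot_le _ _) _; rewrite enormB.
  by rewrite (sphere_enorm u').1 ?mul1r//; exact: (pair_sphere KL).
lra.
Qed.

(** The inverse of [curv_mx u v Q] fixes [u] and [v]; removing these two directions leaves the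
    inverse of [Q] on the tangent space. For [w] near [v], a contact point [u'] is close to [u] by
    [contact_near], with displacement comparable to [w - v] by coercivity. *)
Lemma dual_second_form u v Q : second_form u v Q -> 0 < \det (curv_mx u v Q) ->
  exists Q', dual_form v u Q' /\
    \det (curv_mx v u Q') = (\det (curv_mx u v Q))^-1.
Proof.
move=> SF dpos; have d0 := lt0r_neq0 dpos; have [uv sQ uQ vQ qe] := SF.
have on := incident_orthonormal KL uv; have [su sv uv0] := on.
have [A AE] : exists A, A = curv_mx u v Q by exists (curv_mx u v Q).
have uA : A \in unitmx by rewrite AE unitmxE unitfE.
have sA : A^T = A.
  by rewrite AE /curv_mx !linearD /= !trmx_mul !trmxK sQ.
have uAu : u *m A = u by rewrite AE mul_curv_mx uQ su uv0 scale0r addr0 scale1r add0r.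
have vAv : v *m A = v by rewrite AE mul_curv_mx vQ sv (dotC v) uv0 scale0r addr0 scale1r add0r.
have uI : u *m invmx A = u by rewrite -{1}uAu mulmxK.
have vI : v *m invmx A = v by rewrite -{1}vAv mulmxK.
have [Q' Q'E] : exists Q', Q' = invmx A - u^T *m u - v^T *m v by eexists.
have sQ' : Q'^T = Q'.
  by rewrite Q'E !linearB /= !trmx_mul !trmxK trmx_inv sA.
have mulQ' x : x *m Q' = x *m invmx A - dot x u *: u - dot x v *: v.
  by rewrite Q'E !mulmxBr !mulmx_outer.
have uQ' : u *m Q' = 0 by rewrite mulQ' uI su uv0 scale0r subr0 scale1r subrr.
have vQ' : v *m Q' = 0 by rewrite mulQ' vI sv (dotC v) uv0 scale0r subr0 scale1r subrr.
have cQ' : curv_mx v u Q' = invmx A.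
  by rewrite /curv_mx Q'E subrK subrK.
have qfQ' x : qf Q' (x *m Q) = qf Q x.
  have [tu tv] := tangent_part_dot x on.
  have tQ : tangent_part u v x *m Q = x *m Q.
    by rewrite /tangent_part !mulmxBl -!scalemxAl uQ vQ !scaler0 !subr0.
  rewrite -(qf_tangent_part x sQ uQ vQ) -tQ.
  set t := tangent_part u v x in tu tv *.
  have tA : t *m Q = t *m A by rewrite AE mul_curv_mx tu tv !scale0r !addr0.
  rewrite {1}/qf mulQ' {1}tA mulmxK//.
  have tQu : dot (t *m Q) u = 0 by rewrite dot_mulmx sQ uQ dot0r.
  have tQv : dot (t *m Q) v = 0 by rewrite dot_mulmx sQ vQ dot0r.
  by rewrite tQu tQv !scale0r !subr0 /qf dotC.
exists Q'; split; last by rewrite cQ' det_inv AE.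
split => //; first exact: incidentC.
move=> eps eps0.
have [B B0 cB] := curvature_coercive SF d0.
have [M ME] : exists M, M = mxbound Q by exists (mxbound Q).
have [M' M'E] : exists M', M' = mxbound Q' by exists (mxbound Q').
have M0 : 0 <= M by rewrite ME mxbound_ge0.
have M'0 : 0 <= M' by rewrite M'E mxbound_ge0.
have [C CE] : exists C, C = 2 * B ^+ 2 + M' * B * (1 + M * B) + 1 by eexists.
have C0 : 0 < C.
  by rewrite CE ltr_wpDl// addr_ge0 ?mulr_ge0 ?sqr_ge0 ?addr_ge0 ?mulr_ge0.
have eps1 : 0 < eps / C by rewrite divr_gt0.
have [rho rho0 H] := evtI cB (evtI (normal_expansion KL r0 eL e1 SF eps1) (qe _ eps1)).
have [eta eta0 Heta] := contact_near SF d0 rho0.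
exists eta => // w wv bw.
have [u' wu'] := (sboundaryE _ (polar_pairC KL)).1 bw.
have uw : incident K L u' w by exact: incidentC.
have [h1 [h2 h3]] := H _ (Heta _ _ uw wv).
have {}h1 := h1 _ uw; have {}h2 := h2 _ uw; have {}h3 := h3 (incident_boundary KL uw).
(* A Legendre-type identity from [dot u' w = 0] and [dot u v = 0]: it expresses the expansion at [v]
   by the one at [u], up to a product with the error of the normal. *)
have uwE : dot u w = - dot (u' - u) (w - v + (u' - u) *m Q) + qf Q (u' - u) - dot v u'.
  have [_ _ o] := uw.
  have -> : qf Q (u' - u) = dot (u' - u) ((u' - u) *m Q) by rewrite /qf dotC.
  rewrite dotDr !(dotBl _ _ (w - v)) !dotBr o uv0 (dotC v u'); ring.
have qd := qf_diff Q' (w - v) (- ((u' - u) *m Q)).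
rewrite qfN qfQ' opprK enormN -M'E in qd.
have mb := mulmx_enorm (u' - u) Q; rewrite -ME in mb.
have cs := CauchySchwarz (u' - u) (w - v + (u' - u) *m Q).
have n1 := enorm_ge0 (u' - u); have n2 := enorm_ge0 (w - v).
have n3 := enorm_ge0 (w - v + (u' - u) *m Q); have n4 := enorm_ge0 ((u' - u) *m Q).
have -> : dot u w - qf Q' (w - v) / 2 = - dot (u' - u) (w - v + (u' - u) *m Q)
    - (dot v u' - qf Q (u' - u) / 2) - (qf Q' (w - v) - qf Q (u' - u)) / 2.
  by rewrite uwE; field.
move: (dot (u' - u) _) (dot v u' - _) (qf Q' (w - v) - _) (enorm (u' - u)) (enorm (w - v))
  (enorm (w - v + _)) (enorm (_ *m Q)) n1 n2 n3 n4 qd mb cs h1 h2 h3.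
move=> a b c D W E X D0 W0 E0 X0 qd mb cs h1 h2 h3.
have a1 : `|a| <= eps / C * (B ^+ 2 * W ^+ 2).
  apply: le_trans cs _; apply: (@le_trans _ _ (D * (eps / C * D))); first by rewrite ler_wpM2l.
  rewrite mulrCA -exprMn expr2 ler_wpM2l ?(ltW eps1)//.
  by rewrite ler_pM.
have b1 : `|b| <= eps / C * (B ^+ 2 * W ^+ 2).
  apply: le_trans h3 _; rewrite ler_wpM2l ?(ltW eps1)// -exprMn ler_pXn2r// nnegrE mulr_ge0//.
have c1 : `|c / 2| <= eps / C * (M' * B * (1 + M * B) * W ^+ 2).
  rewrite normrM (ger0_norm (_ : 0 <= 2^-1)) ?invr_ge0// ler_pdivrMr//.
  apply: le_trans qd _.
  apply: (@le_trans _ _ (M' * (eps / C * (B * W)) * (W + M * (B * W)))).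
    apply: ler_pM; rewrite ?mulr_ge0 ?addr_ge0//.
      rewrite ler_wpM2l//; apply: le_trans h2 _; rewrite ler_wpM2l ?(ltW eps1)//.
    by rewrite lerD2l (le_trans mb)// ler_wpM2l.
  have -> : M' * (eps / C * (B * W)) * (W + M * (B * W)) =
    eps / C * (M' * B * (1 + M * B) * W ^+ 2) by ring.
  by rewrite ler_peMr ?ler1n// mulr_ge0 ?(ltW eps1)// !mulr_ge0 ?addr_ge0 ?mulr_ge0 ?sqr_ge0.
apply: le_trans (ler_normB _ _) _; apply: le_trans (lerD (ler_normB _ _) (lexx _)) _.
rewrite normrN; apply: le_trans (lerD (lerD a1 b1) c1) _.
have -> : eps / C * (B ^+ 2 * W ^+ 2) + eps / C * (B ^+ 2 * W ^+ 2) +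
   eps / C * (M' * B * (1 + M * B) * W ^+ 2) = eps / C * (C - 1) * W ^+ 2.
  by rewrite CE; ring.
rewrite ler_wpM2r ?sqr_ge0// mulrAC ler_pdivrMr// ler_pM2l//; lra.
Qed.

End CurvatureOfForm.

(** * Measurability of the curvature *)

Section PolynomialContinuity.
Context {R : realType} {T : topologicalType}.
Implicit Types f g : T -> R.

Lemma continuous_sum (I : finType) (f : I -> T -> R) :
  (forall i, continuous (f i)) -> continuous (fun x => \sum_i f i x).
Proof. by move=> cf; apply: continuous_big => //; exact: add_continuous. Qed.

Lemma continuous_prod (I : finType) (f : I -> T -> R) :
  (forall i, continuous (f i)) -> continuous (fun x => \prod_i f i x).
Proof. by move=> cf; apply: continuous_big => //; exact: mul_continuous. Qed.

Lemma continuousM_fun f g : continuous f -> continuous g -> continuous (fun x => f x * g x).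
Proof. by move=> cf cg x; apply: continuousM; [exact: cf|exact: cg]. Qed.

Lemma continuousD_fun f g : continuous f -> continuous g -> continuous (fun x => f x + g x).
Proof. by move=> cf cg x; apply: (@continuousD _ _ _ f g); [exact: cf|exact: cg]. Qed.

Lemma continuousB_fun f g : continuous f -> continuous g -> continuous (fun x => f x - g x).
Proof. by move=> cf cg x; apply: (@continuousB _ _ _ f g); [exact: cf|exact: cg]. Qed.

Lemma continuous_norm_fun f : continuous f -> continuous (fun x => `|f x|).
Proof. by move=> cf x; apply: continuous_comp; [exact: cf|exact: norm_continuous]. Qed.

Lemma closed_le_fun f g : continuous f -> continuous g -> closed [set x | f x <= g x].
Proof.
move=> cf cg; rewrite (_ : [set x | _] = (fun x => g x - f x) @^-1` [set y | 0 <= y]); last first.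
  by apply/seteqP; split => x /=; rewrite subr_ge0.
apply: preimage_closed; first by move=> x _; exact: continuousB_fun.
exact: mathcomp.analysis.normedtype_theory.num_normedtype.closed_ge.
Qed.

Lemma closed_eq_fun f g : continuous f -> continuous g -> closed [set x | f x = g x].
Proof.
move=> cf cg; rewrite (_ : [set x | _] = [set x | f x <= g x] `&` [set x | g x <= f x]).
  by apply: closedI; exact: closed_le_fun.
apply/seteqP; split => x /= => [->|[h1 h2]]; first by rewrite lexx.
by apply/le_anti; rewrite h1.
Qed.

Lemma continuous_dot_fun n (f g : T -> 'rV[R]_n) : (forall i, continuous (fun x => f x 0 i)) ->
  (forall i, continuous (fun x => g x 0 i)) -> continuous (fun x => dot (f x) (g x)).
Proof. by move=> cf cg; apply: continuous_sum => i; exact: continuousM_fun. Qed.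

Lemma continuous_mulmx_fun n p (f : T -> 'rV[R]_n) (A : T -> 'M[R]_(n, p)) j :
  (forall i, continuous (fun x => f x 0 i)) ->
  (forall i j, continuous (fun x => A x i j)) -> continuous (fun x => (f x *m A x) 0 j).
Proof.
move=> cf cA; rewrite (_ : (fun x => _) = fun x => \sum_i f x 0 i * A x i j).
  by apply: continuous_sum => i; exact: continuousM_fun.
by apply/funext => x; rewrite mxE.
Qed.

Lemma continuous_det_fun n (A : T -> 'M[R]_n) :
  (forall i j, continuous (fun x => A x i j)) -> continuous (fun x => \det (A x)).
Proof.
move=> cA; apply: continuous_sum => s; apply: continuousM_fun.
  by move=> x; exact: cst_continuous.
exact: continuous_prod.
Qed.

End PolynomialContinuity.

Section SecondFormMeasurable.
Context {R : realType} {m : nat}.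
Notation V := 'rV[R]_m.+2.
Notation W := 'rV[R]_(m.+2 * m.+2).
Variables (K L : set V) (e : V) (r : R).
Hypotheses (KL : polar_pair K L) (r0 : 0 < r).
Hypotheses (eL : forall v, L v -> r <= dot v e) (e1 : enorm e = 1).
Implicit Types (u v w : V) (q : W) (x : V * (V * W)).
Notation second_form := (second_form K L).

Lemma vec_mx_norm q : `|vec_mx q : 'M[R]_m.+2| <= `|q|.
Proof.
rewrite {1}/Num.norm/= mx_normrE; apply/bigmax_leP; split => [//|[i j] _ /=].
by rewrite mxE; exact: coord_norm.
Qed.

Let cU i : continuous (fun x : V * (V * W) => x.1 0 i).
Proof.
move=> x; apply: (@continuous_comp _ _ _ (fun x : V * (V * W) => x.1) (fun u : V => u 0 i)).
  exact: cvg_fst.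
exact: coord_continuous.
Qed.

Let cV i : continuous (fun x : V * (V * W) => x.2.1 0 i).
Proof.
move=> x; apply: (@continuous_comp _ _ _ (fun x : V * (V * W) => x.2.1) (fun u : V => u 0 i)).
  by apply: continuous_comp; [exact: cvg_snd|exact: cvg_fst].
exact: coord_continuous.
Qed.

Let cW i : continuous (fun x : V * (V * W) => x.2.2 0 i).
Proof.
move=> x; apply: (@continuous_comp _ _ _ (fun x : V * (V * W) => x.2.2) (fun u : W => u 0 i)).
  by apply: continuous_comp; exact: cvg_snd.
exact: coord_continuous.
Qed.

Let cQ i j : continuous (fun x : V * (V * W) => (vec_mx x.2.2 : 'M[R]_m.+2) i j).
Proof.
by rewrite (_ : (fun x => _) = fun x : V * (V * W) => x.2.2 0 (mxvec_index i j)) //;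
  apply/funext => x; rewrite mxE.
Qed.

Lemma continuous_curv_det : continuous (fun x : V * (V * W) =>
  \det (curv_mx x.1 x.2.1 (vec_mx x.2.2))).
Proof.
apply: continuous_det_fun => i j.
rewrite (_ : (fun x => _) = (fun x : V * (V * W) => (vec_mx x.2.2 : 'M[R]_m.+2) i j +
    x.1 0 i * x.1 0 j + x.2.1 0 i * x.2.1 0 j)).
  apply: continuousD_fun; last exact: continuousM_fun.
  by apply: continuousD_fun => //; exact: continuousM_fun.
by apply/funext => x; rewrite !mxE !big_ord1 !mxE.
Qed.

Variable Z : set (V * (V * W)).
Hypothesis cZ : closed Z.

(** For fixed bounds every condition is closed on a compact set, so that existence of [v] and of the
    form becomes a projection of a compact set. Matrices are flattened to row vectors to use
    compactness there. *)
Let rough (N k j : nat) : set (V * (V * W)) := [set x |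
  [/\ incident K L x.1 x.2.1, `|x.2.2| <= N%:R,
    [/\ (vec_mx x.2.2)^T = vec_mx x.2.2 :> 'M[R]_m.+2, x.1 *m vec_mx x.2.2 = 0 &
      x.2.1 *m vec_mx x.2.2 = 0], Z x &
    forall w, sboundary K w -> enorm (w - x.1) < j.+1%:R^-1 ->
      `|dot x.2.1 w - qf (vec_mx x.2.2) (w - x.1) / 2| <= k.+1%:R^-1 * enorm (w - x.1) ^+ 2]].

Let compact_rough N k j : compact (rough N k j).
Proof.
pose B := K `*` (L `*` [set q : W | `|q| <= N%:R]).
have cB : compact B.
  apply: compact_setX; first exact: (pair_compact KL).
  apply: compact_setX; first exact: (pair_compact (polar_pairC KL)).
  apply: bounded_closed_compact.
    by exists N%:R; split => // M NM q /= /le_trans; apply; exact: ltW.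
  rewrite (_ : [set q : W | _] = (fun q => `|q|) @^-1` [set y | y <= N%:R])//.
  apply: preimage_closed; first by move=> x _; exact: norm_continuous.
  exact: mathcomp.analysis.normedtype_theory.num_normedtype.closed_le.
have -> : rough N k j = B `&`
    ([set x | dot x.1 x.2.1 = 0] `&`
    ((\bigcap_(p in [set: 'I_m.+2 * 'I_m.+2])
       [set x | (vec_mx x.2.2 : 'M[R]_m.+2) p.1 p.2 = (vec_mx x.2.2 : 'M[R]_m.+2) p.2 p.1]) `&`
    ((\bigcap_(i in [set: 'I_m.+2]) [set x | (x.1 *m vec_mx x.2.2) 0 i = 0]) `&`
    ((\bigcap_(i in [set: 'I_m.+2]) [set x | (x.2.1 *m vec_mx x.2.2) 0 i = 0]) `&`
    (Z `&` \bigcap_(w in sboundary K) ([set x | j.+1%:R^-1 <= enorm (w - x.1)] `|`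
      [set x | `|dot x.2.1 w - qf (vec_mx x.2.2) (w - x.1) / 2| <=
          k.+1%:R^-1 * dot (w - x.1) (w - x.1)])))))).
  apply/seteqP; split => x.
    move=> [[Ku Lv uv] qN [sQ uQ vQ] Zx H]; split; first by split.
    split => //; split; first by move=> [i i'] _ /=; rewrite -{1}sQ mxE.
    split; first by move=> i _ /=; rewrite uQ mxE.
    split; first by move=> i _ /=; rewrite vQ mxE.
    split => // w bw /=; have [h|h] := leP j.+1%:R^-1 (enorm (w - x.1)); first by left.
    by right; rewrite -sqr_enorm; exact: H.
  move=> [[Ku [Lv qN]] [uv [sQ [uQ [vQ [Zx H]]]]]]; split => //.
    split.
    - by apply/matrixP => i i'; rewrite mxE; exact: (sQ (i', i)).
    - by apply/rowP => i; rewrite [RHS]mxE; exact: uQ.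
    - by apply/rowP => i; rewrite [RHS]mxE; exact: vQ.
  move=> w bw wx; have [/= h|/= h] := H w bw; first by rewrite ltNge h in wx.
  by rewrite sqr_enorm.
have cwx w i : continuous (fun x : V * (V * W) => (w - x.1) 0 i).
  rewrite (_ : (fun x => _) = fun x : V * (V * W) => w 0 i - x.1 0 i); last first.
    by apply/funext => x; rewrite !mxE.
  by apply: continuousB_fun => // x; exact: cst_continuous.
apply: compact_closedI => //.
apply: closedI.
  by apply: closed_eq_fun; [exact: continuous_dot_fun|move=> x; exact: cst_continuous].
apply: closedI; first by apply: closed_bigI => -[i i'] _; exact: closed_eq_fun.
apply: closedI.
  apply: closed_bigI => i _; apply: closed_eq_fun; last by move=> x; exact: cst_continuous.
  exact: continuous_mulmx_fun.
apply: closedI.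
  apply: closed_bigI => i _; apply: closed_eq_fun; last by move=> x; exact: cst_continuous.
  exact: continuous_mulmx_fun.
apply: closedI => //; apply: closed_bigI => w _; apply: closedU.
  apply: closed_le_fun; first by move=> x; exact: cst_continuous.
  move=> x; apply: (@continuous_comp _ _ _ (fun x : V * (V * W) => dot (w - x.1) (w - x.1)) (@Num.sqrt R)).
    exact: continuous_dot_fun.
  exact: sqrt_continuous.
apply: closed_le_fun; last first.
  by apply: continuousM_fun; [move=> x; exact: cst_continuous|exact: continuous_dot_fun].
apply: continuous_norm_fun; apply: continuousB_fun.
  by apply: continuous_dot_fun => // i x; exact: cst_continuous.
apply: continuousM_fun; last by move=> x; exact: cst_continuous.
by apply: continuous_dot_fun => // i; exact: continuous_mulmx_fun.
Qed.

Let ex_inv (eps : R) : 0 < eps -> exists j : nat, j.+1%:R^-1 < eps.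
Proof.
move=> eps0; have := near_infty_natSinv_lt (PosNum eps0) => -[N _ hN].
by exists N; exact: (hN N (leqnn _)).
Qed.

(** The hard inclusion has to find one witness for all precisions: the normals coincide, and the
    forms, bounded by [N], accumulate at a form that works. *)
Lemma second_form_set_eq :
  [set u | exists v q, second_form u v (vec_mx q) /\ Z (u, (v, q))] =
  \bigcup_N \bigcap_k \bigcup_j (fst @` rough N k j).
Proof.
apply/seteqP; split => u /=.
  move=> [v [q [SF Zu]]]; have [uv sQ uQ vQ qe] := SF.
  exists (Num.truncn `|q|).+1 => // k _.
  have [rho rho0 H] := qe k.+1%:R^-1 ltac:(by rewrite invr_gt0).
  have [j jr] := ex_inv rho0; exists j => //; exists (u, (v, q)) => //=; split => //=.
    by apply: ltW; exact: Num.Theory.truncnS_gt.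
  by move=> w bw wu; apply: H => //; exact: lt_trans jr.
move=> [N _ H].
have ex k : exists y : V * W, exists j, rough N k j (u, y).
  by have [j _ [[u' y] h /= uE]] := H k I; exists y, j; rewrite -uE.
have [y hy] := choice ex.
have inc k : incident K L u (y k).1 by have [j []] := hy k.
(* The bound of index 0, with error factor 1, already determines the normal. *)
have vE k : (y k).1 = (y 0%N).1.
  have [j [/= uv _ _ _ h]] := hy 0%N.
  apply: (@approx_normal_unique _ _ K L e r KL r0 eL e1 u (y 0%N).1 (y k).1 (vec_mx (y 0%N).2) 1).
  - exact: uv.
  - exact: inc.
  - exact: ler01.
  - exists j.+1%:R^-1; first by rewrite invr_gt0.
    by move=> w wu bw; have := h w bw wu; rewrite invr1.
pose v := (y 0%N).1.
pose C := [set q : W | [/\ `|q| <= N%:R, (vec_mx q)^T = vec_mx q :> 'M[R]_m.+2,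
  u *m vec_mx q = 0, v *m vec_mx q = 0 & Z (u, (v, q))]].
have Cy k : C (y k).2.
  have [j [/= _ qN [sQ uQ vQ] Zx _]] := hy k; split => //; rewrite /v -(vE k)//.
  by move: Zx; case: (y k).
have cC : compact C.
  have cq i j : continuous (fun q : W => (vec_mx q : 'M[R]_m.+2) i j).
    rewrite (_ : (fun q => _) = fun q : W => q 0 (mxvec_index i j)); first exact: coord_continuous.
    by apply/funext => q; rewrite mxE.
  have ccst (c : R) : continuous (fun _ : W => c) by move=> x; exact: cst_continuous.
  apply: bounded_closed_compact.
    by exists N%:R; split => // M NM q [/= qN _ _ _ _]; apply: le_trans qN (ltW NM).
  have -> : C = [set q : W | `|q| <= N%:R] `&`
    ((\bigcap_(p in [set: 'I_m.+2 * 'I_m.+2])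
       [set q : W | (vec_mx q : 'M[R]_m.+2) p.1 p.2 = (vec_mx q : 'M[R]_m.+2) p.2 p.1]) `&`
    ((\bigcap_(i in [set: 'I_m.+2]) [set q : W | (u *m vec_mx q) 0 i = 0]) `&`
    ((\bigcap_(i in [set: 'I_m.+2]) [set q : W | (v *m vec_mx q) 0 i = 0]) `&`
    (fun q => (u, (v, q))) @^-1` Z))).
    apply/seteqP; split => q.
      move=> [qN sQ uQ vQ Zx]; split => //.
      split; first by move=> [i i'] _ /=; rewrite -{1}sQ mxE.
      split; first by move=> i _ /=; rewrite uQ mxE.
      by split => // i _ /=; rewrite vQ mxE.
    move=> [qN [sQ [uQ [vQ Zx]]]]; split => //.
    - by apply/matrixP => i i'; rewrite mxE; exact: (sQ (i', i)).
    - by apply/rowP => i; rewrite [RHS]mxE; exact: uQ.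
    - by apply/rowP => i; rewrite [RHS]mxE; exact: vQ.
  apply: closedI; first by apply: closed_le_fun => //; move=> x; exact: norm_continuous.
  apply: closedI; first by apply: closed_bigI => -[i i'] _; exact: closed_eq_fun.
  apply: closedI.
    by apply: closed_bigI => i _; apply: closed_eq_fun => //; exact: continuous_mulmx_fun.
  apply: closedI.
    by apply: closed_bigI => i _; apply: closed_eq_fun => //; exact: continuous_mulmx_fun.
  have cp : continuous (fun q : W => (u, (v, q)) : V * (V * W)).
    move=> x; apply: (@cvg_pair _ _ _ (nbhs x) (nbhs u) (nbhs (v, x)) _ _ _ (fun _ : W => u) (fun q : W => (v, q))).
      exact: cvg_cst.
    apply: (@cvg_pair _ _ _ (nbhs x) (nbhs v) (nbhs x) _ _ _ (fun _ : W => v) (fun q : W => q)).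
      exact: cvg_cst.
    exact: cvg_id.
  by apply: preimage_closed => // x _; exact: cp.
have [q [Cq clq]] : exists q, C q /\ forall (eps : R) k0, 0 < eps -> exists2 k, (k0 <= k)%N & `|(y k).2 - q| < eps.
  have [|q [Cq clq]] := cC ((fun k => (y k).2) @ \oo) (fmap_proper_filter _ _).
    by exists 0%N => // k _; exact: Cy.
  exists q; split => // eps k0 eps0.
  have [||q' [[k kk0 <-] hq']] := clq [set q' | exists2 k, (k0 <= k)%N & (y k).2 = q'] (ball q eps).
  - by exists k0 => // k /= kk0; exists k.
  - exact: nbhsx_ballx.
  by exists k => //; rewrite distrC; move: hq'; rewrite -ball_normE.
have [qN sQ uQ vQ Zq] := Cq.
exists v, q; split => //; split => //; first exact: inc.
move=> eps eps0.
pose n2 : R := (m.+2 * m.+2)%:R.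
have n20 : 0 < n2 by rewrite ltr0n.
have e2 : 0 < eps / 2 by rewrite divr_gt0.
have [k0 k0e] := ex_inv e2.
have [k kk0 qk] := clq (eps / n2) k0 ltac:(by rewrite divr_gt0).
have [j [/= _ _ _ _ h]] := hy k.
exists j.+1%:R^-1; first by rewrite invr_gt0.
move=> w wu bw; have := h w bw wu; rewrite (vE k) -/v => hk.
have -> : dot v w - qf (vec_mx q) (w - u) / 2 =
    (dot v w - qf (vec_mx (y k).2) (w - u) / 2) + qf (vec_mx (y k).2 - vec_mx q) (w - u) / 2.
  by rewrite qf_mxB; field.
apply: le_trans (ler_normD _ _) _.
rewrite [eps]splitr mulrDl lerD//.
  apply: le_trans hk _; rewrite ler_wpM2r ?sqr_ge0//; apply: ltW; apply: le_lt_trans k0e.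
  by rewrite lef_pV2 ?posrE// ler_nat.
rewrite normrM (ger0_norm (_ : 0 <= 2^-1)) ?invr_ge0// mulrAC ler_wpM2r ?invr_ge0//.
apply: le_trans (qf_bound _ _) _; rewrite ler_wpM2r ?sqr_ge0// /mxbound -/n2.
rewrite mulrC -ler_pdivlMr//; apply: ltW; apply: le_lt_trans qk.
by rewrite -linearB; exact: vec_mx_norm.
Qed.

Lemma measurable_second_form :
  measurable ([set u | exists v q, second_form u v (vec_mx q) /\ Z (u, (v, q))] : set boxType).
Proof.
rewrite second_form_set_eq; apply: bigcupT_measurable => N; apply: bigcapT_measurable => k.
apply: bigcupT_measurable => j; apply: closed_boxType_measurable.
apply: compact_closed; first exact: norm_hausdorff.
apply: continuous_compact; last exact: compact_rough.
by apply: continuous_subspaceT => x; exact: cvg_fst.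
Qed.

End SecondFormMeasurable.

(** * The area inequality for the Gauss map *)

Section OuterContinuity.
Context {R : realType} {n : nat}.
Local Open Scope ereal_scope.
Implicit Types (A B : set 'rV[R]_n).

(** Continuity from below for arbitrary sets: each is replaced by a Borel hull, and intersecting all
    later hulls makes the sequence increasing without raising the measures. *)
Lemma hausdorff_bigcup_le k (B : (set 'rV[R]_n)^nat) (c : \bar R) :
  (forall i j, (i <= j)%N -> B i `<=` B j) -> (forall j, hausdorff k (B j) <= c) ->
  hausdorff k (\bigcup_j B j) <= c.
Proof.
move=> ndB Bc.
have ex j : exists G : set boxType, measurable G /\ B j `<=` G /\ hausdorff k G = hausdorff k (B j).
  by have [G mG [BG e]] := hausdorff_hull k (B j); exists G.
have [G hG] := choice ex.
pose G' (j : nat) : set boxType := \bigcap_(i in [set i | (j <= i)%N]) G i.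
have mG' j : measurable (G' j).
  by apply: bigcap_measurable => [|i _]; [exists j => /=|exact: (hG i).1].
have BG' j : B j `<=` G' j.
  by move=> x Bx i /= ji; apply: (hG i).2.1; exact: ndB ji _ Bx.
have G'c j : hmeasure k (G' j) <= c.
  apply: le_trans (Bc j); rewrite -(hG j).2.2; apply: le_hausdorff => x; apply => /=.
  exact: leqnn.
have ndG' : nondecreasing_seq G'.
  move=> i j ij; apply/subsetPset => x Gx l /= jl; apply: Gx => /=; exact: leq_trans jl.
apply: (@le_trans _ _ (hmeasure k (\bigcup_j G' j))).
  by apply: le_hausdorff => x [j _ Bx]; exists j => //; exact: BG'.
have /cvg_lim <- // := nondecreasing_cvg_mu (mu := hmeasure k) mG' (bigcupT_measurable G' mG') ndG'; apply: lime_le; last by near=> j; exact: G'c.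
by apply: ereal_nondecreasing_is_cvgn => i j ij; apply: le_measure; rewrite ?inE//; exact/subsetPset/ndG'.
Unshelve. all: by end_near. Qed.

Lemma hausdorff_partition k A (P : (set (@boxType R n))^nat) : (forall i, measurable (P i)) ->
  trivIset setT P -> \sum_(i <oo) hausdorff k (A `&` P i) <= hausdorff k A.
Proof.
move=> mP tP; have [G mG [AG <-]] := hausdorff_hull k A.
apply: (@le_trans _ _ (\sum_(i <oo) hmeasure k (G `&` P i))).
  apply: lee_nneseries => i _; first by move=> _; exact: hausdorff_ge0.
  by apply: le_hausdorff => x [Ax Px]; split => //; exact: AG.
have mGP i : measurable (G `&` P i) by exact: measurableI.
rewrite -(measure_semi_bigcup (hmeasure k) mGP _ (bigcupT_measurable _ mGP)); last first.
  by apply/trivIsetP => i j _ _ ij; move/trivIsetP: tP => /(_ i j I I ij) h; rewrite setIACA h setI0.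
by apply: le_hausdorff => x [i _ []].
Qed.

(** [F] stands for the image under a relation, determined by its values on points. The countable
    cover is made disjoint, and additivity over Borel pieces sums the local estimates. *)
Lemma hausdorff_pieces k p (A : set 'rV[R]_n) (F : set 'rV[R]_n -> set 'rV[R]_p)
    (C : (set (@boxType R n))^nat) (c : R) : (0 <= c)%R ->
  (forall B, F B `<=` \bigcup_(u in B) F [set u]) ->
  (forall B B', B `<=` B' -> F B `<=` F B') ->
  (forall i, measurable (C i)) -> A `<=` \bigcup_i C i ->
  (forall i S, S `<=` A -> S `<=` C i -> hausdorff k (F S) <= c%:E * hausdorff k S) ->
  hausdorff k (F A) <= c%:E * hausdorff k A.
Proof.
move=> c0 Fpt Fmono mC AC H.
have mS i : measurable (seqDU C i) by apply: measurableD => //; exact: bigsetU_measurable.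
apply: (@le_trans _ _ (\sum_(i <oo) hausdorff k (F (A `&` seqDU C i)))).
  apply: le_trans (hausdorff_sigma_subadditive k _).
  apply: le_hausdorff => v /Fpt[u Au Fu].
  have [i _ ui] : (\bigcup_i seqDU C i) u by rewrite -seqDU_bigcup_eq; exact: AC.
  by exists i => //; apply: Fmono Fu => _ ->.
apply: (@le_trans _ _ (\sum_(i <oo) c%:E * hausdorff k (A `&` seqDU C i))).
  apply: lee_nneseries => i _; first by move=> _; exact: hausdorff_ge0.
  by apply: (H i) => [x []//|x [_ []]].
rewrite nneseriesZl//; last by move=> i _; exact: hausdorff_ge0.
apply: lee_wpmul2l; first by rewrite lee_fin.
by apply: hausdorff_partition => //; exact: trivIset_seqDU.
Qed.

End OuterContinuity.

Section Grid.
Context {R : realType} {p : nat}.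

Definition grid_point (N : nat) (z : 'rV[int]_p) : 'rV[R]_p :=
  N.+1%:R^-1 *: map_mx intr z.

Lemma grid_near (N : nat) (x : 'rV[R]_p) : exists z, `|x - grid_point N z| <= N.+1%:R^-1.
Proof.
exists (\row_i Num.floor (x 0 i * N.+1%:R)).
have N0 : 0 < N.+1%:R :> R by rewrite ltr0n.
rewrite {1}/Num.norm/= mx_normrE; apply/bigmax_leP; split => [|[j i] _ /=].
  by rewrite invr_ge0 ltW.
rewrite (ord1 j) !mxE.
have /andP[f1 f2] := Num.Theory.floor_itv (x 0 i * N.+1%:R).
rewrite intrD in f2.
have -> : x 0 i - N.+1%:R^-1 * (Num.floor (x 0 i * N.+1%:R))%:~R =
    N.+1%:R^-1 * (x 0 i * N.+1%:R - (Num.floor (x 0 i * N.+1%:R))%:~R).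
  by rewrite mulrBr mulrCA mulVf ?mulr1// gt_eqF.
rewrite normrM gtr0_norm ?invr_gt0// ler_piMr ?invr_ge0 ?(ltW N0)//.
rewrite ger0_norm ?subr_ge0// lerBlDl; apply: ltW.
by apply: lt_le_trans f2 _; rewrite lerD2l.
Qed.

End Grid.

(** Eigenvalues will be raised by [s] to make a scaling invertible; the product changes by at most a
    multiple of [s], uniformly for bounded eigenvalues. *)
Lemma prod_shift_le {R : realType} (m : nat) (k : nat -> R) (M s : R) : 0 <= s -> s <= 1 ->
  (forall i, (i < m)%N -> 0 <= k i <= M) -> 0 <= M ->
  \prod_(i < m) (k i + s) <= \prod_(i < m) k i + s * (m%:R * (M + 1) ^+ m).
Proof.
move=> s0 s1 kM M0.
suff [] : \prod_(i < m) (k i + s) <= \prod_(i < m) k i + s * (m%:R * (M + 1) ^+ m) /\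
   0 <= \prod_(i < m) (k i + s) <= (M + 1) ^+ m by [].
elim: m kM => [|m IH] kM.
  by rewrite !big_ord0 mul0r mulr0 addr0 lexx ler01.
have [|h1 /andP[h2 h3]] := IH; first by move=> i im; apply: kM; rewrite ltnS ltnW.
have /andP[k0 k1] := kM m (ltnSn m).
rewrite !big_ord_recr /=; split; last first.
  rewrite mulr_ge0 ?addr_ge0//= exprSr ler_pM ?addr_ge0//.
  by rewrite lerD.
rewrite mulrDr; set P := \prod_(i < m) (k i + s) in h1 h2 h3 *; set p := \prod_(i < m) k i in h1 *.
have a1 : P * k m <= (p + s * (m%:R * (M + 1) ^+ m)) * k m by rewrite ler_wpM2r.
have a2 : P * s <= (M + 1) ^+ m * s by rewrite ler_wpM2r.
have E0 : 0 <= (M + 1) ^+ m by rewrite exprn_ge0// addr_ge0.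
apply: le_trans (lerD a1 a2) _.
rewrite mulrDl -addrA lerD2l.
have a3 : s * (m%:R * (M + 1) ^+ m) * k m <= s * (m%:R * (M + 1) ^+ m) * (M + 1).
  by rewrite ler_wpM2l ?mulr_ge0//; lra.
have a4 : (M + 1) ^+ m * s <= s * ((M + 1) ^+ m * (M + 1)).
  by rewrite mulrC ler_wpM2l// ler_peMr//; lra.
apply: le_trans (lerD a3 a4) _; rewrite -natr1 exprSr le_eqVlt; apply/orP; left; apply/eqP; ring.
Qed.

(** * Area of the set of contact normals *)

Section AreaInequality.
Context {R : realType} {m : nat}.
Notation V := 'rV[R]_m.+2.
Notation W := 'rV[R]_(m.+2 * m.+2).
Variables (K L : set V) (e : V) (r : R).
Hypotheses (KL : polar_pair K L) (r0 : 0 < r).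
Hypotheses (eL : forall v, L v -> r <= dot v e) (e1 : enorm e = 1).
Implicit Types (u v w : V) (q : W) (A B S : set V).
Notation dist u := (fun w => enorm (w - u)).
Notation second_form := (second_form K L).

Definition contact S : set V := [set v | exists2 u, S u & incident K L u v].

Let contact_pairs S : set (V * V) := [set x | S x.1 /\ incident K L x.1 x.2].

Lemma contactE S : contact S = snd @` contact_pairs S.
Proof.
apply/seteqP; split => v; first by move=> [u Su uv]; exists (u, v).
by move=> [[u v'] [/= Su uv] <-]; exists u.
Qed.

(* The map [u |-> v] is close, on small pieces, to a symmetric linear map with
   eigenvalues [k i]: rescale the coordinates along the eigenvectors. *)
Lemma contact_piece S (g : nat -> V) (k : nat -> R) (Q : 'M[R]_m.+2) (s eta : R) :
  orthonormal_upto m.+2 g -> (forall i, (i < m)%N -> g i.+2 *m Q = k i *: g i.+2 /\ 0 <= k i) ->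
  Q^T = Q -> g 0%N *m Q = 0 -> g 1%N *m Q = 0 ->
  0 < s -> 0 < eta -> eta <= 4^-1 -> eta <= s ^+ 2 / 2 ->
  (forall u v w v', S u -> S w -> incident K L u v -> incident K L w v' ->
    [/\ enorm (v' - v + (w - u) *m Q) <= eta * enorm (w - u),
        `|dot (w - u) (g 0%N)| <= eta * enorm (w - u) &
        `|dot (w - u) (g 1%N)| <= eta * enorm (w - u)]) ->
  (hausdorff m (contact S) <=
    ((1 + s) ^+ m * \prod_(i < m) (k i + s))%:E * hausdorff m S)%E.
Proof.
move=> og gk sQ g0Q g1Q s0 eta0 eta4 etas H.
pose a u : 'rV[R]_m := \row_i dot u (g i.+2).
(* The shift keeps the scaling invertible when some curvature vanishes, and lets it dominate the
   error, as [2 * eta <= s ^+ 2]. *)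
pose l : 'rV[R]_m := \row_i (k i + s).
have l0 i : 0 < l 0 i by rewrite mxE ltr_wpDl//; exact: (gk i (ltn_ord i)).2.
have decomp (x : V) : dot x x = dot x (g 0%N) ^+ 2 + (dot x (g 1%N) ^+ 2 +
    \sum_(i < m) dot x (g i.+2) ^+ 2).
  by rewrite (frame_enorm x og) big_ord_recl big_ord_recl.
have aB u w : a w - a u = a (w - u) by apply/rowP => i; rewrite !mxE dotBl.
have an x : enorm (a x) ^+ 2 = \sum_(i < m) dot x (g i.+2) ^+ 2.
  by rewrite sqr_enorm; apply: eq_bigr => i _; rewrite !mxE expr2.
have a_le x : enorm (a x) <= enorm x.
  rewrite -(@ler_pXn2r _ 2) ?nnegrE// an sqr_enorm decomp.
  by rewrite addrA ler_wpDl// addr_ge0// sqr_ge0.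
have dB u w : diag_scale l (a w) - diag_scale l (a u) = diag_scale l (a (w - u)).
  by rewrite -aB; apply/rowP => i; rewrite !mxE mulrBr.
have Qx x : enorm (x *m Q) ^+ 2 = \sum_(i < m) (k i * dot x (g i.+2)) ^+ 2.
  rewrite sqr_enorm decomp !dot_mulmx sQ g0Q g1Q !dot0r expr0n !add0r.
  by apply: eq_bigr => i _; rewrite dot_mulmx sQ (gk i (ltn_ord i)).1 dotZr.
have dn x : enorm (diag_scale l (a x)) ^+ 2 = \sum_(i < m) ((k i + s) * dot x (g i.+2)) ^+ 2.
  by rewrite sqr_enorm; apply: eq_bigr => i _; rewrite !mxE expr2.
have Qd x : enorm (x *m Q) <= enorm (diag_scale l (a x)).
  rewrite -(@ler_pXn2r _ 2) ?nnegrE// Qx dn; apply: ler_sum => i _.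
  have ki := (gk i (ltn_ord i)).2.
  by rewrite !exprMn ler_wpM2r ?sqr_ge0// ler_pXn2r ?nnegrE ?addr_ge0 ?(ltW s0)// lerDl ltW.
have sd x : s * enorm (a x) <= enorm (diag_scale l (a x)).
  rewrite -(@ler_pXn2r _ 2) ?nnegrE ?mulr_ge0 ?(ltW s0)// exprMn an dn mulr_sumr.
  apply: ler_sum => i _; have ki := (gk i (ltn_ord i)).2.
  by rewrite exprMn ler_wpM2r ?sqr_ge0// ler_pXn2r ?nnegrE ?addr_ge0 ?(ltW s0)// lerDr.
have s1 : 0 < 1 + s by rewrite addr_gt0.
rewrite contactE.
have st1 : (hausdorff m (snd @` contact_pairs S) <= ((1 + s) ^+ m)%:E *
    hausdorff m ((fun x : V * V => diag_scale l (a x.1)) @` contact_pairs S))%E.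
  apply: hausdorff_param => // -[w v'] [u v] [/= Sw wv] [/= Su uv].
  have [h1 h2 h3] := H u v w v' Su Sw uv wv.
  rewrite dB.
  (* Displacements are nearly tangential: each of the two normal components is at most a quarter of
     the length. *)
  have hn : enorm (w - u) <= 2 * enorm (a (w - u)).
    rewrite -(@ler_pXn2r _ 2) ?nnegrE ?mulr_ge0// exprMn an.
    have := decomp (w - u); rewrite -sqr_enorm.
    have hs (y : R) : `|y| <= eta * enorm (w - u) -> y ^+ 2 <= 16^-1 * enorm (w - u) ^+ 2.
      move=> hy; rewrite -real_normK ?num_real//.
      apply: (@le_trans _ _ ((4^-1 * enorm (w - u)) ^+ 2)).
        by rewrite ler_pXn2r ?nnegrE ?mulr_ge0// (le_trans hy)// ler_wpM2r.
      by rewrite exprMn ler_wpM2r ?sqr_ge0//; rewrite expr2; lra.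
    have := hs _ h2; have := hs _ h3; have -> : 2 ^+ 2 = 4 :> R by ring.
    have : 0 <= \sum_(i < m) dot (w - u) (g i.+2) ^+ 2 by apply: sumr_ge0 => i _; exact: sqr_ge0.
    move: (dot (w - u) (g 0%N) ^+ 2) (dot (w - u) (g 1%N) ^+ 2) (\sum_(i < m) _) (enorm (w - u) ^+ 2).
    by move=> y1 y2 y3 y4; lra.
  have e2 : enorm (v' - v) <= enorm ((w - u) *m Q) + eta * enorm (w - u).
    have -> : v' - v = (v' - v + (w - u) *m Q) - (w - u) *m Q by rewrite addrK.
    by apply: le_trans (enormD _ _) _; rewrite enormN addrC lerD2l.
  apply: (le_trans e2); rewrite mulrDl mul1r lerD//.
  apply: (@le_trans _ _ (eta * (2 * enorm (a (w - u))))); first by rewrite ler_pM2l.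
  apply: (@le_trans _ _ (s * (s * enorm (a (w - u))))); last by rewrite ler_pM2l.
  rewrite !mulrA ler_wpM2r// -expr2; lra.
have st2 : (hausdorff m ((fun x : V * V => diag_scale l (a x.1)) @` contact_pairs S) <=
    (\prod_i l 0 i)%:E * hausdorff m S)%E.
  rewrite (_ : (fun x : V * V => diag_scale l (a x.1)) @` contact_pairs S =
     diag_scale l @` ((fun x : V * V => a x.1) @` contact_pairs S)); last by rewrite -image_comp.
  apply: le_trans (hausdorff_diag_scale _ l0) _.
  apply: lee_wpmul2l; first by rewrite lee_fin; apply: prodr_ge0 => i _; exact: ltW.
  apply: (@le_trans _ _ ((1 ^+ m)%:E * hausdorff m (fst @` contact_pairs S))%E).
    apply: hausdorff_param => // x y _ _; rewrite mul1r aB; exact: a_le.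
  rewrite expr1n mul1e; apply: le_hausdorff => _ [x [Sx _] <-]; exact: Sx.
apply: le_trans st1 _; rewrite EFinM -muleA; apply: lee_wpmul2l.
  by rewrite lee_fin exprn_ge0// ltW.
apply: le_trans st2 _; rewrite (eq_bigr (fun i : 'I_m => k i + s))// => i _.
by rewrite mxE.
Qed.

Let close_to (rho : R) (a : V) (b : V) (c : W) : set (V * (V * W)) :=
  [set x | [/\ `|x.1 - a| <= rho, `|x.2.1 - b| <= rho & `|x.2.2 - c| <= rho]].

Let closed_close_to rho a b c : closed (close_to rho a b c).
Proof.
have -> : close_to rho a b c = [set x | `|x.1 - a| <= rho] `&`
    ([set x | `|x.2.1 - b| <= rho] `&` [set x | `|x.2.2 - c| <= rho]).
  by apply/seteqP; split => x /=; [move=> [? ? ?]|move=> [? [? ?]]].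
have cdist (n : nat) (f : V * (V * W) -> 'rV[R]_n) (y : 'rV[R]_n) : continuous f ->
    continuous (fun x => `|f x - y|).
  move=> cf x; apply: (@continuous_comp _ _ _ (fun x => f x - y) (fun z => `|z|)); last exact: norm_continuous.
  by apply: (@continuousB _ _ _ f (fun=> y)); [exact: cf|exact: cst_continuous].
have ccst : continuous (fun _ : V * (V * W) => rho) by move=> x; exact: cst_continuous.
apply: closedI; first by apply: closed_le_fun => //; apply: cdist => x; exact: cvg_fst.
apply: closedI; apply: closed_le_fun => //; apply: cdist => x; apply: continuous_comp.
- exact: cvg_snd.
- exact: cvg_fst.
- exact: cvg_snd.
- exact: cvg_snd.
Qed.

Let code := ('rV[int]_m.+2 * ('rV[int]_m.+2 * 'rV[int]_(m.+2 * m.+2)))%type.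

(** Countably many Borel sets, from a grid of width [1 / N.+1], on each of which the point, its
    normal and its form are nearly constant. *)
Let cell (N k : nat) : set V := if (unpickle k : option code) is Some z then
  [set u | exists v q, second_form u v (vec_mx q) /\
    close_to N.+1%:R^-1 (grid_point N z.1) (grid_point N z.2.1) (grid_point N z.2.2) (u, (v, q))]
  else set0.

Let measurable_cell N k : measurable (cell N k : set boxType).
Proof.
rewrite /cell; case: unpickle => [z|]; last exact: measurable0.
exact: (measurable_second_form KL r0 eL e1 (@closed_close_to _ _ _ _)).
Qed.

Let cell_cover N u v Q : second_form u v Q -> exists k, cell N k u.
Proof.
move=> SF; have [z1 h1] := grid_near N u; have [z2 h2] := grid_near N v.
have [z3 h3] := grid_near N (mxvec Q).
exists (pickle ((z1, (z2, z3)) : code)); rewrite /cell pickleK.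
by exists v, (mxvec Q); rewrite mxvecK; split.
Qed.

Let cell_close N k u v Q u' v' Q' : cell N k u -> cell N k u' ->
  second_form u v Q -> second_form u' v' Q' ->
  [/\ enorm (u - u') <= (m.+2 * m.+2)%:R * (2 / N.+1%:R),
      enorm (v - v') <= (m.+2 * m.+2)%:R * (2 / N.+1%:R) &
      mxbound (Q - Q') <= (m.+2 * m.+2)%:R * (2 / N.+1%:R)].
Proof.
rewrite /cell; case: unpickle => [z|//].
move=> [v1 [q1 [SF1 [/= a1 b1 c1]]]] [v2 [q2 [SF2 [/= a2 b2 c2]]]] SF SF'.
have [-> ->] := second_form_unique KL r0 eL e1 SF1 SF.
have [-> ->] := second_form_unique KL r0 eL e1 SF2 SF'.
have tri (n : nat) (x y c : 'rV[R]_n) : `|x - c| <= N.+1%:R^-1 -> `|y - c| <= N.+1%:R^-1 ->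
    `|x - y| <= 2 / N.+1%:R.
  move=> h1 h2; have -> : x - y = (x - c) - (y - c) by rewrite opprB addrA subrK.
  by apply: le_trans (ler_normB _ _) _; rewrite mulr_natl mulr2n lerD.
have sup2 (x : V) c : `|x| <= c -> enorm x <= (m.+2 * m.+2)%:R * c.
  move=> xc; apply: le_trans (enorm_norm _) _; apply: ler_pM => //.
  by rewrite ler_nat leq_pmulr.
split; [exact/sup2/tri/a2|exact/sup2/tri/b2|].
rewrite /mxbound ler_wpM2l// -linearB; apply: le_trans (vec_mx_norm _) _.
exact: tri c2.
Qed.

(** Points whose expansions hold to precision [eta] within the common radius [1 / j.+1]. These sets
    increase with [j] and exhaust the twice differentiable points. *)
Let tame (eta : R) (j : nat) : set V := [set u | forall v Q, second_form u v Q ->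
  forall w v', incident K L w v' -> enorm (w - u) < j.+1%:R^-1 ->
    dot v w <= eta * enorm (w - u) /\
    enorm (v' - v + (w - u) *m Q) <= eta * enorm (w - u)].

Let ex_inv (x : R) : 0 < x -> exists j : nat, j.+1%:R^-1 < x.
Proof.
move=> x0; have := near_infty_natSinv_lt (PosNum x0) => -[N _ hN].
by exists N; exact: (hN N (leqnn _)).
Qed.

Let tame_cover eta u v Q : 0 < eta -> second_form u v Q -> exists j, tame eta j u.
Proof.
move=> eta0 SF; have [uv sQ uQ vQ qe] := SF.
have S2 := approx_upper ler01 (qe _ ltr01).
have M1 : 0 < 1 + mxbound Q by rewrite ltr_wpDr// mxbound_ge0.
have [rho rho0 H] := evtI (normal_expansion KL r0 eL e1 SF eta0) (evtI S2 (evt_ltM (dist u) M1 eta0)).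
have [j jr] := ex_inv rho0; exists j => v1 Q1 SF1 w v' wv' wu.
have [-> ->] := second_form_unique KL r0 eL e1 SF SF1.
have [h1 [h2 h3]] := H w (lt_trans wu jr); split; last exact: h1.
apply: le_trans (h2 (incident_boundary KL wv')) _.
by rewrite expr2 mulrA ler_wpM2r// ltW.
Qed.

Let tame_mono eta i j : (i <= j)%N -> tame eta i `<=` tame eta j.
Proof.
move=> ij u H v Q SF w v' wv' wu; apply: (H v Q SF w v' wv').
by apply: lt_le_trans wu _; rewrite lef_pV2 ?posrE// ler_nat.
Qed.

(** A grid fine enough makes each estimate of [contact_piece] a sum of two terms of size [eta / 3]:
    the expansion at [u] itself, and the drift from the reference point of the cell. *)
Let area_tame (b M s eta : R) (j : nat) B : 0 < s -> s <= 1 -> 0 < eta ->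
  eta <= 4^-1 -> eta <= s ^+ 2 / 2 -> 0 <= M ->
  (forall u, B u -> tame (eta / 3) j u /\ exists v Q, [/\ second_form u v Q,
     \det (curv_mx u v Q) <= b & mxbound Q <= M]) ->
  (hausdorff m (contact B) <=
    ((1 + s) ^+ m * (b + s * (m%:R * (M + 1) ^+ m)))%:E * hausdorff m B)%E.
Proof.
move=> s0 s1 eta0 eta4 etas M0 HB.
have n0 : 0 < (m.+2 * m.+2)%:R * 2 :> R by rewrite mulr_gt0 ?ltr0n.
have eta3 : 0 < eta / 3 by rewrite divr_gt0.
have [N [N1 N2]] : exists N : nat, (m.+2 * m.+2)%:R * (2 / N.+1%:R) <= eta / 3 /\
    (m.+2 * m.+2)%:R * (2 / N.+1%:R) < j.+1%:R^-1 :> R.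
  have [|N hN] := @ex_inv (Num.min (eta / 3) j.+1%:R^-1 / ((m.+2 * m.+2)%:R * 2)).
    by rewrite divr_gt0// lt_min eta3 invr_gt0 ltr0n.
  move: hN; rewrite ltr_pdivlMr// lt_min => /andP[h1 h2].
  by exists N; rewrite mulrA mulrC; split => //; exact: ltW.
set tau := (m.+2 * m.+2)%:R * (2 / N.+1%:R) in N1 N2.
have b0 u : B u -> 0 <= b.
  move=> /HB[_ [v [Q [SF db _]]]]; apply: le_trans db; exact: (det_curv_ge0 KL r0 eL e1 SF).
have [/eqP B0|/set0P[ub Bub]] := boolP (B == set0).
  rewrite B0 (_ : contact set0 = set0) ?hausdorff0 ?mule0//.
  by apply/seteqP; split => v // [].
have {}b0 := b0 _ Bub.
apply: (@hausdorff_pieces _ _ m _ B contact (cell N)) => //.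
- by rewrite mulr_ge0 ?exprn_ge0 ?addr_ge0 ?(ltW s0)// mulr_ge0 ?(ltW s0)// mulr_ge0// exprn_ge0// addr_ge0.
- by move=> S v [u Su uv]; exists u => //; exists u.
- by move=> S S' SS' v [u Su uv]; exists u => //; exact: SS'.
- move=> u /HB[_ [v [Q [SF _ _]]]]; have [k hk] := cell_cover N SF; by exists k.
move=> i S SB Sc.
have [/eqP S0|/set0P[u0 Su0]] := boolP (S == set0).
  rewrite S0 (_ : contact set0 = set0) ?hausdorff0 ?mule0//.
  by apply/seteqP; split => v // [].
have [_ [v0 [Q0 [SF0 d0 M0']]]] := HB _ (SB _ Su0).
have [g [k [og g0 g1 gk dE]]] := curvature_frame KL r0 eL e1 SF0.
have [uv0 sQ0 uQ0 vQ0 _] := SF0.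
apply: (@le_trans _ _ (((1 + s) ^+ m * \prod_(i < m) (k i + s))%:E * hausdorff m S)%E).
  apply: (@contact_piece _ g k Q0 s eta) => //; rewrite ?g0 ?g1//.
  move=> u v w v' Su Sw uv wv'.
  have [tu [vu [Qu [SFu _ _]]]] := HB _ (SB _ Su).
  have [_ [vw [Qw [SFw _ _]]]] := HB _ (SB _ Sw).
  have -> := second_form_normal_unique KL r0 eL e1 SFu uv.
  have [d1 d2 d3] := cell_close (Sc _ Su0) (Sc _ Su) SF0 SFu.
  have [d4 _ _] := cell_close (Sc _ Sw) (Sc _ Su) SFw SFu.
  rewrite -/tau in d1 d2 d3 d4.
  have [t1 t2] := tu _ _ SFu _ _ wv' (le_lt_trans d4 N2).
  have [uvu _ _ _ _] := SFu; have [su svu uvu0] := incident_orthonormal KL uvu.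
  have Kw : K w by case: wv'. have Lvu : L vu by case: uvu.
  have D0 := enorm_ge0 (w - u).
  split.
  - have -> : v' - vu + (w - u) *m Q0 = (v' - vu + (w - u) *m Qu) + (w - u) *m (Q0 - Qu).
      by rewrite mulmxBr -[RHS]addrA; congr (_ + _); rewrite addrCA subrr addr0.
    apply: le_trans (enormD _ _) _.
    have h := mulmx_enorm (w - u) (Q0 - Qu).
    have h' : mxbound (Q0 - Qu) * enorm (w - u) <= eta / 3 * enorm (w - u).
      by rewrite ler_wpM2r// (le_trans d3).
    apply: le_trans (lerD t2 (le_trans h h')) _; rewrite -mulrDl ler_wpM2r//; lra.
  - have -> : dot (w - u) u0 = dot (w - u) u + dot (w - u) (u0 - u).
      by rewrite dotBr; ring.
    apply: le_trans (ler_normD _ _) _.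
    have h1 : `|dot (w - u) u| <= eta / 3 * enorm (w - u).
      rewrite dotBl su (sphere_dot su (pair_sphere KL Kw)) addrAC subrr add0r normrN.
      rewrite ger0_norm ?divr_ge0 ?sqr_ge0//.
      have -> : enorm (w - u) ^+ 2 / 2 = enorm (w - u) / 2 * enorm (w - u) by rewrite expr2 mulrAC.
      rewrite ler_wpM2r//; apply: le_trans (le_trans d4 N1); lra.
    have h2 : `|dot (w - u) (u0 - u)| <= eta / 3 * enorm (w - u).
      apply: le_trans (CauchySchwarz _ _) _; rewrite mulrC ler_wpM2r//.
      exact: le_trans d1 N1.
    apply: le_trans (lerD h1 h2) _; rewrite -mulrDl ler_wpM2r//; lra.
  - have -> : dot (w - u) v0 = dot vu w + dot (w - u) (v0 - vu).
      by rewrite dotBr [dot (w - u) vu]dotBl uvu0 subr0 (dotC w vu); ring.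
    apply: le_trans (ler_normD _ _) _.
    have h1 : `|dot vu w| <= eta / 3 * enorm (w - u).
      by rewrite ger0_norm// dotC; exact: (pair_ge0 KL).
    have h2 : `|dot (w - u) (v0 - vu)| <= eta / 3 * enorm (w - u).
      apply: le_trans (CauchySchwarz _ _) _; rewrite mulrC ler_wpM2r//.
      exact: le_trans d2 N1.
    apply: le_trans (lerD h1 h2) _; rewrite -mulrDl ler_wpM2r//; lra.
apply: lee_wpmul2r; first exact: hausdorff_ge0.
rewrite lee_fin ler_wpM2l ?exprn_ge0 ?addr_ge0 ?(ltW s0)//.
apply: (@le_trans _ _ (\prod_(i < m) k i + s * (m%:R * (M + 1) ^+ m))).
  apply: prod_shift_le => // [|i' im]; first exact: ltW.
  have [gQ k0] := gk i' im; rewrite k0 /=.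
  have gi : dot (g i'.+2) (g i'.+2) = 1 by rewrite og// eqxx.
  have := qf_bound Q0 (g i'.+2); rewrite /qf gQ dotZl gi mulr1 sqr_enorm gi mulr1 => h.
  by apply: le_trans (ler_norm _) _; exact: le_trans h M0'.
by rewrite lerD2r -dE.
Qed.

Let pow1_le (s : R) n : 0 <= s -> s <= 1 -> (1 + s) ^+ n <= 1 + s * 3 ^+ n.
Proof.
move=> s0 s1; elim: n => [|n IH]; first by rewrite !expr0 mulr1 lerDl.
rewrite !exprSr; apply: (@le_trans _ _ ((1 + s * 3 ^+ n) * (1 + s))).
  by rewrite ler_wpM2r// addr_ge0.
have T1 : 1 <= 3 ^+ n :> R by rewrite exprn_ege1// ler1n.
have : s * 1 <= s * 3 ^+ n by rewrite ler_wpM2l.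
have : s * (s * 3 ^+ n) <= s * 3 ^+ n.
  by rewrite ler_piMl// mulr_ge0// (le_trans ler01 T1).
rewrite mulrDl mul1r mulrDr !mulr1 !mulrA.
rewrite (mulrAC s (3 ^+ n) s) .
by move: (s * s * 3 ^+ n) (s * 3 ^+ n) => x y; lra.
Qed.

Let area_bounded (b M : R) B : 0 <= b -> 0 <= M -> (hausdorff m B < +oo)%E ->
  (forall u, B u -> exists v Q, [/\ second_form u v Q, \det (curv_mx u v Q) <= b & mxbound Q <= M]) ->
  (hausdorff m (contact B) <= b%:E * hausdorff m B)%E.
Proof.
move=> b0 M0 Bfin HB.
have [beta bE] : exists beta, hausdorff m B = beta%:E.
  have := hausdorff_ge0 m B; move: Bfin; case: (hausdorff m B) => [x| |]//.
  by move=> _ _; exists x.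
have beta0 : 0 <= beta by have := hausdorff_ge0 m B; rewrite bE lee_fin.
pose T := m%:R * (M + 1) ^+ m.
have T0 : 0 <= T by rewrite /T mulr_ge0// exprn_ge0// addr_ge0.
have key s : 0 < s -> s <= 1 ->
    (hausdorff m (contact B) <= ((1 + s) ^+ m * (b + s * T))%:E * hausdorff m B)%E.
  move=> s0 s1; pose eta := Num.min 4^-1 (s ^+ 2 / 2).
  have eta0 : 0 < eta by rewrite lt_min invr_gt0 ltr0n divr_gt0// exprn_gt0.
  have eta3 : 0 < eta / 3 by rewrite divr_gt0.
  have -> : contact B = \bigcup_j contact (B `&` tame (eta / 3) j).
    apply/seteqP; split => v.
      move=> [u Bu uv]; have [v1 [Q [SF _ _]]] := HB _ Bu.
      by have [j hj] := tame_cover eta3 SF; exists j => //; exists u.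
    by move=> [j _ [u [Bu _] uv]]; exists u.
  apply: hausdorff_bigcup_le.
    by move=> i j ij v [u [Bu tu] uv]; exists u => //; split => //; exact: tame_mono tu.
  move=> j; apply: (@le_trans _ _ (((1 + s) ^+ m * (b + s * T))%:E * hausdorff m (B `&` tame (eta / 3) j))%E).
    apply: (@area_tame b M s eta j) => //.
    - by rewrite ge_min lexx.
    - by rewrite ge_min lexx orbT.
    - by move=> u [Bu tu]; split => //; exact: HB.
  apply: lee_wpmul2l; last by apply: le_hausdorff => x [].
  rewrite lee_fin; apply: mulr_ge0; first by rewrite exprn_ge0// addr_ge0// ltW.
  by apply: addr_ge0 => //; apply: mulr_ge0 => //; exact: ltW.
apply/lee_addgt0Pr => eps eps0.
pose C := (3 ^+ m * (b + T) + T) * beta + 1.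
have C0 : 0 < C by rewrite ltr_wpDl// mulr_ge0// addr_ge0// mulr_ge0 ?addr_ge0// exprn_ge0.
pose s := Num.min 1 (eps / C).
have s0 : 0 < s by rewrite lt_min ltr01 divr_gt0.
have s1 : s <= 1 by rewrite ge_min lexx.
have sC : s * C <= eps by rewrite -ler_pdivlMr// ge_min lexx orbT.
apply: le_trans (key s s0 s1) _; rewrite bE -!EFinM -EFinD lee_fin.
have h1 : (1 + s) ^+ m * (b + s * T) <= (1 + s * 3 ^+ m) * (b + s * T).
  by rewrite ler_wpM2r ?pow1_le ?(ltW s0)// addr_ge0// mulr_ge0// ltW.
have h2 : (1 + s * 3 ^+ m) * (b + s * T) <= b + s * (3 ^+ m * (b + T) + T).
  have : s * 3 ^+ m * (s * T) <= s * 3 ^+ m * T.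
    rewrite ler_wpM2l// ?mulr_ge0 ?(ltW s0) ?exprn_ge0//.
    by rewrite ler_piMl.
  rewrite mulrDl mul1r !mulrDr !mulrA.
  by move: (s * 3 ^+ m * T) (s * 3 ^+ m * b) (s * T) (s * 3 ^+ m * s * T) => x1 x2 x3 x4; lra.
apply: le_trans (ler_wpM2r beta0 (le_trans h1 h2)) _.
rewrite mulrDl lerD2l -mulrA; apply: le_trans sC; by rewrite ler_pM2l// /C lerDl.
Qed.

(** The bound on the form is removed by exhausting [B]; as [B] is not assumed measurable, this uses
    continuity from below of the outer measure. *)
Lemma area_upper (b : R) B : 0 <= b -> (hausdorff m B < +oo)%E ->
  (forall u, B u -> exists v Q, second_form u v Q /\ \det (curv_mx u v Q) <= b) ->
  (hausdorff m (contact B) <= b%:E * hausdorff m B)%E.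
Proof.
move=> b0 Bfin HB.
pose BM (k : nat) := [set u | B u /\ exists v Q, [/\ second_form u v Q, \det (curv_mx u v Q) <= b & mxbound Q <= k%:R]].
have -> : contact B = \bigcup_k contact (BM k).
  apply/seteqP; split => v; last by move=> [k _ [u [Bu _] uv]]; exists u.
  move=> [u Bu uv]; have [v1 [Q [SF db]]] := HB _ Bu.
  exists (Num.truncn (mxbound Q)).+1 => //; exists u => //; split => //.
  by exists v1, Q; split => //; apply: ltW; exact: Num.Theory.truncnS_gt.
apply: hausdorff_bigcup_le.
  move=> i j ij v [u [Bu [v1 [Q [SF db Mi]]]] uv]; exists u => //; split => //.
  by exists v1, Q; split => //; rewrite (le_trans Mi)// ler_nat.
move=> k; have BB : BM k `<=` B by move=> u [].
apply: (@le_trans _ _ (b%:E * hausdorff m (BM k))%E); last first.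
  by apply: lee_wpmul2l; [rewrite lee_fin|exact: le_hausdorff].
apply: (@area_bounded b k%:R) => //; last by move=> u [].
by apply: le_lt_trans Bfin; exact: le_hausdorff.
Qed.

End AreaInequality.

(** * Integration over the dual boundary *)

Section LogCells.
Context {R : realType} {disp : measure_display} {T : measurableType disp}.
Implicit Types (a b : T -> R) (eps : R).

(** Countably many pieces of the set where both functions are positive; on each of them either
    function varies by a factor of at most [expR eps]. *)
Definition log_cell a b eps n : set T := [set x | [/\ 0 < a x, 0 < b x &
  pickle (floor (ln (a x) / eps), floor (ln (b x) / eps)) = n]].

Lemma log_cell_near a b eps n x : 0 < eps -> log_cell a b eps n x ->
  exists s t : R, [/\ 0 <= s, 0 <= t &
    forall y, log_cell a b eps n y ->
      s <= a y <= expR eps * s /\ t <= b y <= expR eps * t].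
Proof.
move=> eps0 [ax bx xn].
exists (expR (eps * (floor (ln (a x) / eps))%:~R)), (expR (eps * (floor (ln (b x) / eps))%:~R)).
have main (k : int) (c : R) : 0 < c -> floor (ln c / eps) = k ->
    expR (eps * k%:~R) <= c <= expR eps * expR (eps * k%:~R).
  move=> c0 <-; have /andP[h1 h2] := floor_itv (ln c / eps).
  rewrite -{2 3}(lnK c0) -expRD !ler_expR; apply/andP; split.
    by rewrite mulrC -ler_pdivlMr.
  by move/ltW: h2; rewrite ler_pdivrMr// intrD mulrDl mul1r mulrC addrC.
split; rewrite ?expR_ge0// => y [ay by0 yn].
have [e1 e2] : (floor (ln (a y) / eps), floor (ln (b y) / eps)) = (floor (ln (a x) / eps), floor (ln (b x) / eps)).
  by apply: (pcan_inj pickleK); rewrite xn yn.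
by split; apply: main.
Qed.

Lemma measurable_log_cell a b eps n : measurable_fun setT a -> measurable_fun setT b ->
  measurable (log_cell a b eps n).
Proof.
move=> ma mb; have [->|/set0P[x [ax bx xn]]] := eqVneq (log_cell a b eps n) set0.
  exact: measurable0.
have mp (c : T -> R) : measurable_fun setT c -> measurable [set y | 0 < c y].
  move=> mc; have := mc measurableT `]0, +oo[%classic (measurable_itv _).
  by rewrite setTI; congr measurable; apply/seteqP; split => y /=; rewrite in_itv/= andbT.
have mf (c : T -> R) k : measurable_fun setT c -> measurable [set y | floor (ln (c y) / eps) = k].
  move=> mc; have mlc : measurable_fun setT (fun y => ln (c y) / eps).
    by apply: measurable_funM => //; apply: (measurableT_comp (f := @ln R)).
  have := mlc measurableT `[k%:~R, (k + 1)%:~R[%classic (measurable_itv _).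
  rewrite setTI; congr measurable; apply/seteqP; split => y /=; rewrite in_itv/= -floor_eq.
    by move/eqP.
  by move=> ->.
rewrite (_ : log_cell _ _ _ _ = ([set y | 0 < a y] `&` [set y | 0 < b y]) `&`
  ([set y | floor (ln (a y) / eps) = floor (ln (a x) / eps)] `&`
   [set y | floor (ln (b y) / eps) = floor (ln (b x) / eps)])).
  by apply: measurableI; apply: measurableI; auto.
apply/seteqP; split => y /=.
  move=> [ay by0 yn]; split => //.
  have [e1 e2] : (floor (ln (a y) / eps), floor (ln (b y) / eps)) = (floor (ln (a x) / eps), floor (ln (b x) / eps)).
    by apply: (pcan_inj pickleK); rewrite xn yn.
  by split.
by move=> [[ay by0] [e1 e2]]; split => //; rewrite e1 e2.
Qed.

Lemma trivIset_log_cell a b eps : trivIset setT (log_cell a b eps).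
Proof. by apply/trivIsetP => i j _ _; apply: contraNeq => /set0P[x [[_ _ <-] [_ _ <-]]]. Qed.

Lemma bigcup_log_cell a b eps : \bigcup_n log_cell a b eps n = [set x | 0 < a x /\ 0 < b x].
Proof.
by apply/seteqP; split => [x [n _ [? ? _]]//|x [ax bx]]; eexists; [|split; [| |reflexivity]].
Qed.

End LogCells.

(** * Change of variables for inverse densities along a relation *)

Section InverseDensity.
Context {R : realType} {disp : measure_display} {T : measurableType disp}.
Variable mu : {measure set T -> \bar R}.

Let measurable_pos (c : T -> R) : measurable_fun setT c -> measurable [set y | 0 < c y].
Proof.
move=> mc; have := mc measurableT `]0, +oo[%classic (measurable_itv _).
by rewrite setTI; congr measurable; apply/seteqP; split => y /=; rewrite in_itv/= andbT.
Qed.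

(** On a cell both the density and the integrand are constant up to the factor [expR eps], so the
    area bound yields the inequality up to [expR eps ^+ 2], and [eps] is arbitrary. *)
Lemma inverse_density_le (H H' : T -> R) (I : T -> T -> Prop) (g : R -> R) :
  measurable_fun setT H -> measurable_fun setT H' ->
  (forall u v, 0 < H u -> I u v -> H' v = (H u)^-1) ->
  (forall v, 0 < H' v -> exists2 u, 0 < H u & I u v) ->
  (forall c B, 0 <= c -> (forall u, B u -> 0 < H u <= c) ->
    (mu [set v | exists2 u, B u & I u v] <= c%:E * mu B)%E) ->
  measurable_fun setT g -> (forall t, 0 <= g t) ->
  (\int[mu]_(v in [set v | (0 < H' v)%R]) (g (ln (H' v)))%:E <=
   \int[mu]_(u in [set u | (0 < H u)%R]) (g (- ln (H u)) * H u)%:E)%E.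
Proof.
move=> mH mH' HI dual_point area mg g0.
pose contact B := [set v | exists2 u, B u & I u v].
have mlH : measurable_fun setT (fun u => ln (H u)) by apply: (measurableT_comp (f := @ln R)).
have mlH' : measurable_fun setT (fun u => ln (H' u)) by apply: (measurableT_comp (f := @ln R)).
pose b u := g (- ln (H u)).
pose b' v := g (ln (H' v)).
have mb : measurable_fun setT b.
  by apply: (measurableT_comp mg); apply: measurableT_comp.
have mb' : measurable_fun setT b' by exact: (measurableT_comp mg).
have mbH : measurable_fun setT (fun u => (b u * H u)%:E).
  by apply/measurable_EFinP; exact: measurable_funM.
(* The density [H] read off on the dual side; the value 0 keeps points without positive dual density
   out of all cells. *)
pose Hp u := if 0 < H' u then (H' u)^-1 else 0 : R.
have HpE u : 0 < H' u -> Hp u = expR (- ln (H' u)).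
  by move=> h; rewrite /Hp h expRN lnK.
have mHp : measurable_fun setT Hp.
  rewrite (_ : Hp = (fun u => expR (- ln (H' u)) * \1_[set y | 0 < H' y] u)).
    apply: measurable_funM; last exact/measurable_indicP/measurable_pos.
    by apply: (measurableT_comp (f := @expR R)) => //; exact: measurableT_comp.
  apply/funext => u; have [h|h] := ltP 0 (H' u).
    by rewrite HpE// indicE mem_set// mulr1.
  by rewrite /Hp ltNge h indicE memNset ?mulr0//= ltNge h.
have Hp0 u : 0 < Hp u <-> 0 < H' u.
  by rewrite /Hp; case: ifPn => h; rewrite ?h ?ltxx// invr_gt0 h.
have H'K u v : 0 < H u -> I u v -> 0 < H' v /\ Hp v = H u.
  by move=> Hu uv; rewrite /Hp (HI _ _ Hu uv) invr_gt0 Hu invrK.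
have bE u v : 0 < H' v -> Hp v = H u -> b' v = b u.
  by move=> Hv E; rewrite /b /b' -E HpE// expRK opprK.
have key eps : 0 < eps -> (\int[mu]_(v in [set v | (0 < H' v)%R]) (b' v)%:E <=
   (expR eps * expR eps)%:E * \int[mu]_(u in [set u | (0 < H u)%R]) (b u * H u)%:E)%E.
  move=> eps0.
  (* This exhibits the contact image of a cell as a cell on the dual side, hence as a measurable
     set. *)
  have cellE n : log_cell Hp b' eps n = contact (log_cell H b eps n).
    apply/seteqP; split => v.
      move=> [/Hp0 Hv bv vn]; have [u Hu uv] := dual_point _ Hv.
      have [_ E] := H'K _ _ Hu uv.
      by exists u => //; split; rewrite -?(bE _ _ Hv E)// -E.
    move=> [u [Hu bu un] uv]; have [Hv E] := H'K _ _ Hu uv.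
    by split; rewrite ?(bE _ _ Hv E)// ?Hp0// E.
  rewrite (_ : (\int[_]_(v in _) _ = \int[mu]_(v in \bigcup_n log_cell Hp b' eps n) (b' v)%:E)%E); last first.
    rewrite bigcup_log_cell integral_mkcond [RHS]integral_mkcond.
    apply: eq_integral => v _; rewrite /patch.
    have [h|h] := ltP 0 (H' v); last first.
      by rewrite !memNset//= ?Hp0 ltNge h//; case.
    rewrite mem_set//; have [g1|g1] := ltP 0 (b' v).
      by rewrite mem_set//=; split => //; apply/Hp0.
    rewrite memNset; last by rewrite /= [0 < b' v]ltNge g1; case.
    by congr EFin; apply/eqP; rewrite eq_le g1 /b' g0.
  rewrite ge0_integral_bigcup//=; last first.
  - exact: trivIset_log_cell.
  - by move=> v _; rewrite lee_fin /b' g0.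
  - by apply/measurable_EFinP; apply: measurable_funTS.
  - by move=> n; exact: measurable_log_cell.
  apply: (@le_trans _ _ ((expR eps * expR eps)%:E * \int[mu]_(u in \bigcup_n log_cell H b eps n) (b u * H u)%:E)%E); last first.
    apply: lee_wpmul2l; first by rewrite lee_fin mulr_ge0// expR_ge0.
    apply: ge0_subset_integral => //.
    - by apply: bigcupT_measurable => n; exact: measurable_log_cell.
    - exact: measurable_pos.
    - exact: measurable_funTS.
    - by move=> u /= Hu; rewrite lee_fin mulr_ge0// /b ?g0// ltW.
    - by rewrite bigcup_log_cell => u [].
  rewrite ge0_integral_bigcup//=; last first.
  - exact: trivIset_log_cell.
  - by rewrite bigcup_log_cell => v [hv _]; rewrite lee_fin mulr_ge0// /b ?g0// ltW.
  - by apply: measurable_funTS.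
  - by move=> n; exact: measurable_log_cell.
  rewrite -nneseriesZl; last first.
    by move=> n _; apply: integral_ge0 => u [Hu bu _]; rewrite lee_fin mulr_ge0 ?ltW.
  apply: lee_nneseries.
    by move=> n _ _; apply: integral_ge0 => u [Hu bu _]; rewrite lee_fin ltW.
  move=> n _; rewrite cellE.
  have [->|/set0P[x0 cx0]] := eqVneq (log_cell H b eps n) set0.
    rewrite (_ : contact set0 = set0) ?integral_set0 ?mule0//.
    by apply/seteqP; split => // v [u].
  have [s [t [s0 t0 st]]] := log_cell_near eps0 cx0.
  have mC : measurable (log_cell H b eps n) by exact: measurable_log_cell.
  have mC' : measurable (contact (log_cell H b eps n)).
    by rewrite -cellE; exact: measurable_log_cell.
  apply: (@le_trans _ _ (\int[mu]_(v in contact (log_cell H b eps n)) (cst (expR eps * t)%:E v))%E).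
    apply: ge0_le_integral => //.
    - by move=> v _; rewrite lee_fin /b' g0.
    - by apply/measurable_EFinP; apply: measurable_funTS.
    - move=> v; rewrite -cellE => vc; rewrite lee_fin.
      move: (vc); rewrite cellE => -[u uc uv].
      have [Hu _ _] := uc; have [Hv E] := H'K _ _ Hu uv.
      by rewrite (bE _ _ Hv E); have [_ /andP[]] := st _ uc.
  rewrite integral_cst//.
  apply: (@le_trans _ _ ((expR eps * t)%:E * ((expR eps * s)%:E * mu (log_cell H b eps n)))%E).
    apply: lee_wpmul2l; first by rewrite lee_fin mulr_ge0// expR_ge0.
    apply: area; first by rewrite mulr_ge0// expR_ge0.
    by move=> u uc; have [Hu _ _] := uc; rewrite Hu; have [/andP[]] := st _ uc.
  rewrite muleA -EFinM (_ : expR eps * t * (expR eps * s) = expR eps * expR eps * (t * s)); last by ring.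
  rewrite EFinM -muleA; apply: lee_wpmul2l; first by rewrite lee_fin mulr_ge0// expR_ge0.
  rewrite -integral_cst//; apply: ge0_le_integral => //.
  - by move=> u _; rewrite lee_fin mulr_ge0.
  - exact: measurable_funTS.
  - move=> u uc; rewrite lee_fin; have [/andP[h1 _] /andP[h2 _]] := st _ uc.
    by rewrite ler_pM.
have I0 : (0 <= \int[mu]_(u in [set u | (0 < H u)%R]) (b u * H u)%:E)%E.
  by apply: integral_ge0 => u /= Hu; rewrite lee_fin mulr_ge0// /b ?g0// ltW.
move: I0 key; rewrite /b /b'.
case: (integral _ _ _) => [x| |]// x0 key; last by rewrite leey.
rewrite lee_fin in x0.
apply/lee_addgt0Pr => delta delta0.
(* With [eps = ln c / 2] the two factors multiply to [c], and [c * x <= x + delta]. *)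
pose c := 1 + delta / (x + 1).
have c1 : 1 < c by rewrite ltrDl divr_gt0// ltr_wpDl.
have lc : 0 < ln c / 2 by rewrite divr_gt0// ln_gt0.
apply: le_trans (key _ lc) _.
rewrite -EFinM -EFinD lee_fin -expRD -splitr lnK ?posrE ?(lt_trans _ c1)// /c mulrDl mul1r lerD2l.
by rewrite -mulrA ler_piMr ?(ltW delta0)// mulrC ler_pdivrMr ?mul1r ?lerDl ?ltr_wpDl.
Qed.

(* The upper area bound suffices: used for both sides it also bounds the areas
   from below, since the densities [H] and [H'] are inverse to each other. *)
Lemma inverse_density (H H' : T -> R) (I : T -> T -> Prop) (g : R -> R) :
  measurable_fun setT H -> measurable_fun setT H' ->
  (forall u v, 0 < H u -> I u v -> H' v = (H u)^-1) ->
  (forall u v, 0 < H' v -> I u v -> H u = (H' v)^-1) ->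
  (forall v, 0 < H' v -> exists2 u, 0 < H u & I u v) ->
  (forall u, 0 < H u -> exists2 v, 0 < H' v & I u v) ->
  (forall c B, 0 <= c -> (forall u, B u -> 0 < H u <= c) ->
    (mu [set v | exists2 u, B u & I u v] <= c%:E * mu B)%E) ->
  (forall c B, 0 <= c -> (forall v, B v -> 0 < H' v <= c) ->
    (mu [set u | exists2 v, B v & I u v] <= c%:E * mu B)%E) ->
  measurable_fun setT g -> (forall t, 0 <= g t) ->
  (\int[mu]_(v in [set v | (0 < H' v)%R]) (g (ln (H' v)))%:E =
   \int[mu]_(u in [set u | (0 < H u)%R]) (g (- ln (H u)) * H u)%:E)%E.
Proof.
move=> mH mH' HI HI' ex ex' area area' mg g0; apply/eqP; rewrite eq_le; apply/andP; split.
  exact: (inverse_density_le mH mH' HI).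
(* For this test function the exponential becomes the density [H] on one side and cancels the
   density [H'] on the other. *)
have := @inverse_density_le H' H (fun v u => I u v) (fun t => g (- t) * expR t) mH' mH (fun u v Hu uv => HI' v u Hu uv) ex' area'.
rewrite (_ : (\int[_]_(v in [set v | (0 < H v)%R]) (g (- ln (H v)) * _)%:E = \int[mu]_(u in [set u | (0 < H u)%R]) (g (- ln (H u)) * H u)%:E)%E); last first.
  by apply: eq_integral => u; rewrite inE /= => Hu; rewrite lnK.
rewrite (_ : (\int[_]_(u in [set u | (0 < H' u)%R]) (g (- - _) * _ * _)%:E = \int[mu]_(v in [set v | (0 < H' v)%R]) (g (ln (H' v)))%:E)%E); last first.
  apply: eq_integral => u; rewrite inE /= => Hu; rewrite opprK expRN lnK// mulfVK//.
  by rewrite gt_eqF.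
apply.
- apply: measurable_funM; last exact: measurable_expR.
  apply: (measurableT_comp mg); exact: oppr_measurable.
- by move=> t; rewrite mulr_ge0 ?expR_ge0.
Qed.

End InverseDensity.

Section CaratheodoryMeasure.
Context {R : realType} {n : nat}.

(* The canonical measure on [caratheodory_type] is keyed on a bundled outer
   measure, so that inference does not find it for a bare [hausdorff k]. *)
Definition hausdorff_outer k : {outer_measure set 'rV[R]_n -> \bar R} := hausdorff k.

Definition hausdorff_measure k :
    {measure set (@caratheodory_type R 'rV[R]_n (hausdorff k)) -> \bar R} :=
  (hausdorff_outer k : set (caratheodory_type (hausdorff_outer k)) -> \bar R).

End CaratheodoryMeasure.

Section DualIntegral.
Context {R : realType} {m : nat}.
Notation V := 'rV[R]_m.+2.
Notation W := 'rV[R]_(m.+2 * m.+2).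
Notation T := (@caratheodory_type R V (hausdorff m)).
Notation sigma := (@hausdorff_measure R m.+2 m).

Section Measurability.
Variables (K L : set V) (e : V) (r : R).
Hypotheses (KL : polar_pair K L) (r0 : 0 < r).
Hypotheses (eL : forall v, L v -> r <= dot v e) (e1 : enorm e = 1).

Lemma gauss_kronecker_form u : 0 < @gauss_kronecker R m.+1 K u ->
  exists v Q, second_form K L u v Q /\ gauss_kronecker K u = \det (curv_mx u v Q).
Proof.
move=> H0; have [[v [Q SF]]|/(gauss_kronecker_out KL r0 eL e1) H] := pselect (exists v Q, second_form K L u v Q).
  by exists v, Q; split => //; exact: (gauss_kroneckerE KL r0 eL e1).
by move: H0; rewrite H ltxx.
Qed.

(** For [c > 0] a superlevel set consists of points with a form whose determinant is at least [c], a
    closed condition on point, normal and form; for [c <= 0] it is everything. *)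
Lemma measurable_gauss_kronecker :
  measurable_fun [set: T] (@gauss_kronecker R m.+1 K : T -> R).
Proof.
apply: (measurability _ (RGenCInfty.measurableE R)) => //= _ [_ [c ->] <-]; rewrite setTI.
have [c0|c0] := leP c 0.
  rewrite (_ : _ @^-1` _ = setT)//; apply/seteqP; split => // u _ /=.
  by rewrite in_itv/= andbT (le_trans c0)//; exact: (gauss_kronecker_ge0 KL r0 eL e1).
have cZ : closed [set x : V * (V * W) | c <= \det (curv_mx x.1 x.2.1 (vec_mx x.2.2))].
  by apply: closed_le_fun; [exact: cst_continuous|exact: continuous_curv_det].
have := boxType_caratheodory m (measurable_second_form KL r0 eL e1 cZ).
rewrite (_ : [set u | _] = @gauss_kronecker R m.+1 K @^-1` `[c, +oo[)//.
apply/seteqP; split => u /=; rewrite in_itv/= andbT.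
  by move=> [v [q [SF h]]]; rewrite (gauss_kroneckerE KL r0 eL e1 SF).
move=> cu; have [v [Q [SF E]]] := gauss_kronecker_form (lt_le_trans c0 cu).
by exists v, (mxvec Q); rewrite mxvecK -E.
Qed.

End Measurability.

Lemma gauss_kronecker_incident (K L : set V) (e e' : V) (r r' : R) u v :
  polar_pair K L ->
  0 < r -> (forall v, L v -> r <= dot v e) -> enorm e = 1 ->
  0 < r' -> (forall u, K u -> r' <= dot u e') -> enorm e' = 1 ->
  0 < @gauss_kronecker R m.+1 K u -> incident K L u v ->
  @gauss_kronecker R m.+1 L v = (@gauss_kronecker R m.+1 K u)^-1.
Proof.
move=> KL r0 eL e1 r'0 eK e'1 Hu uv.
have [v1 [Q [SF E]]] := gauss_kronecker_form KL r0 eL e1 Hu.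
have -> : v = v1 by exact: (second_form_normal_unique KL r0 eL e1 SF uv).
have dQ : 0 < \det (curv_mx u v1 Q) by rewrite -E.
have [Q' [SF' E']] := dual_second_form KL r0 eL e1 SF dQ.
by rewrite (gauss_kroneckerE (polar_pairC KL) r'0 eK e'1 SF') E' E.
Qed.

Lemma gauss_kronecker_exists (K L : set V) (e e' : V) (r r' : R) u :
  polar_pair K L ->
  0 < r -> (forall v, L v -> r <= dot v e) -> enorm e = 1 ->
  0 < r' -> (forall u, K u -> r' <= dot u e') -> enorm e' = 1 ->
  0 < @gauss_kronecker R m.+1 K u ->
  exists2 v, 0 < @gauss_kronecker R m.+1 L v & incident K L u v.
Proof.
move=> KL r0 eL e1 r'0 eK e'1 Hu.
have [v [Q [[uv _ _ _ _] _]]] := gauss_kronecker_form KL r0 eL e1 Hu.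
exists v => //.
by rewrite (gauss_kronecker_incident KL r0 eL e1 r'0 eK e'1 Hu uv) invr_gt0.
Qed.

Lemma area_upper_pos (K L : set V) (e : V) (r : R) (c : R) (B : set V) :
  polar_pair K L ->
  0 < r -> (forall v, L v -> r <= dot v e) -> enorm e = 1 ->
  (hausdorff m (@sboundary R m.+1 K) < +oo)%E -> 0 <= c ->
  (forall u, B u -> 0 < @gauss_kronecker R m.+1 K u <= c) ->
  (hausdorff m (contact K L B) <= c%:E * hausdorff m B)%E.
Proof.
move=> KL r0 eL e1 fin c0 BH; apply: (area_upper KL r0 eL e1) => //.
  apply: le_lt_trans fin; apply: le_hausdorff => u /BH /andP[Hu _].
  have [v [Q [[uv _ _ _ _] _]]] := gauss_kronecker_form KL r0 eL e1 Hu.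
  exact: (incident_boundary KL uv).
move=> u /BH /andP[Hu Hc].
by have [v [Q [SF E]]] := gauss_kronecker_form KL r0 eL e1 Hu; exists v, Q; rewrite -E.
Qed.

Lemma dual_integral (K L : set V) (e e' : V) (r r' : R) (g : R -> R) :
  polar_pair K L ->
  0 < r -> (forall v, L v -> r <= dot v e) -> enorm e = 1 ->
  0 < r' -> (forall u, K u -> r' <= dot u e') -> enorm e' = 1 ->
  (hausdorff m (@sboundary R m.+1 K) < +oo)%E ->
  (hausdorff m (@sboundary R m.+1 L) < +oo)%E ->
  measurable_fun setT g -> (forall t, 0 <= g t) ->
  (\int[sigma]_(v in [set v | (0 < @gauss_kronecker R m.+1 L v)%R]) (g (ln (@gauss_kronecker R m.+1 L v)))%:E =
   \int[sigma]_(u in [set u | (0 < @gauss_kronecker R m.+1 K u)%R]) (g (- ln (@gauss_kronecker R m.+1 K u)) * @gauss_kronecker R m.+1 K u)%:E)%E.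
Proof.
move=> KL r0 eL e1 r'0 eK e'1 finK finL mg g0.
have LK := polar_pairC KL.
apply: (@inverse_density R _ T sigma (@gauss_kronecker R m.+1 K) (@gauss_kronecker R m.+1 L) (incident K L) g).
- exact: (measurable_gauss_kronecker KL r0 eL e1).
- exact: (measurable_gauss_kronecker LK r'0 eK e'1).
- by move=> u v Hu uv; exact: (gauss_kronecker_incident KL r0 eL e1 r'0 eK e'1).
- by move=> u v Hv uv; apply: (gauss_kronecker_incident LK r'0 eK e'1 r0 eL e1) => //; exact: incidentC.
- move=> v Hv; have [u Hu vu] := gauss_kronecker_exists LK r'0 eK e'1 r0 eL e1 Hv.
  by exists u => //; exact: incidentC.
- by move=> u Hu; exact: (gauss_kronecker_exists KL r0 eL e1 r'0 eK e'1).
- by move=> c B c0 BH; exact: (area_upper_pos KL r0 eL e1).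
- move=> c B c0 BH; have := area_upper_pos LK r'0 eK e'1 finL c0 BH.
  rewrite (_ : contact L K B = [set u | exists2 v, B v & incident K L u v])//.
  by apply/seteqP; split => u [v Bv uv]; exists v => //; exact: incidentC.
- exact: mg.
- exact: g0.
Qed.

End DualIntegral.

(** * Charts of the boundary *)

Section ChartFrames.
Context {R : realType} {m : nat}.
Notation V := 'rV[R]_m.+2.
Implicit Types (e k z w : V) (J : 'M[R]_(m, m.+2)).

(** The rows of [J] complete [e] and [k] to a frame: charts are graphs in the direction [e] over the
    affine space through [k] spanned by these rows. *)
Definition chart_frame e k J := [/\ dot k k = 1, dot e k = 0,
  J *m J^T = 1%:M, e *m J^T = 0 & k *m J^T = 0] /\
  forall z, z = dot z e *: e + dot z k *: k + z *m J^T *m J.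

Section Frame.
Variables (e k : V) (J : 'M[R]_(m, m.+2)).
Hypothesis eJ : chart_frame e k J.

Lemma frame_coord x : (k + x *m J) *m J^T = x.
Proof. by have [[_ _ JJ _ k0] _] := eJ; rewrite mulmxDl k0 add0r -mulmxA JJ mulmx1. Qed.

Lemma frame_dotk x : dot (k + x *m J) k = 1.
Proof. by have [[kk _ _ _ k0] _] := eJ; rewrite dotDl kk dot_mulmx k0 dot0r addr0. Qed.

Lemma frame_enormJ x : enorm (x *m J) = enorm x.
Proof. by have [[_ _ JJ _ _] _] := eJ; rewrite /enorm dot_mulmx -mulmxA JJ mulmx1. Qed.

Lemma frame_pythagoras w : dot w w = dot w e ^+ 2 + dot w k ^+ 2 + dot (w *m J^T) (w *m J^T).
Proof.
have [_ dec] := eJ; rewrite {2}(dec w) dotDr dotDr !dotZr !expr2 (dotC w (_ *m J)).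
by rewrite dot_mulmx.
Qed.

Lemma frame_enormJT w : enorm (w *m J^T) <= enorm w.
Proof.
by rewrite ler_sqrt ?dot_ge0// (frame_pythagoras w) lerDr addr_ge0 ?sqr_ge0.
Qed.

Lemma frame_dotk_le w : `|dot w k| <= enorm w.
Proof.
have [[kk _ _ _ _] _] := eJ; apply: le_trans (CauchySchwarz _ _) _.
by rewrite [enorm k]/enorm kk sqrtr1 mulr1.
Qed.

End Frame.

Lemma chart_frame_exists e (i : 'I_m.+1) (s : R) (g : nat -> V) : s * s = 1 ->
  orthonormal_upto m.+2 g -> g 0%N = e ->
  chart_frame e (s *: g i.+1) (\matrix_(j < m) g (lift i j).+1).
Proof.
move=> ss og g0.
have ltj j : ((lift i j).+1 < m.+2)%N by rewrite ltnS.
have lti : (i.+1 < m.+2)%N by rewrite ltnS.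
have dotJ (z : V) : z *m (\matrix_(j < m) g (lift i j).+1)^T = \row_j dot z (g (lift i j).+1).
  apply/rowP => j; rewrite !mxE; apply: eq_bigr => l _; by rewrite !mxE.
split; first split.
- by rewrite dotZl dotZr og// eqxx mulr1.
- by rewrite dotZr -g0 og// mulr0.
- apply/row_matrixP => j; rewrite row_mul rowK dotJ rowE mulmx1; apply/rowP => l.
  by rewrite !mxE og// eqSS (inj_eq val_inj) (inj_eq lift_inj) eq_sym.
- by rewrite dotJ -g0; apply/rowP => j; rewrite !mxE og.
- rewrite dotJ; apply/rowP => j; rewrite !mxE dotZl og// eqSS.
  by rewrite (inj_eq val_inj) (negbTE (neq_lift _ _)) mulr0.
move=> z; rewrite {1}(frame_decomp z og) big_ord_recl/= g0 -addrA; congr (_ + _).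
rewrite dotJ mulmx_sum_row (bigD1_ord i)//=; congr (_ + _).
  by rewrite dotZr scalerA mulrAC ss mul1r.
by apply: eq_bigr => j _; rewrite rowK mxE.
Qed.

End ChartFrames.

Lemma unit_vec_lip {R : realType} {d : nat} (y z : 'rV[R]_d.+1) :
  1 <= enorm y -> 1 <= enorm z -> enorm (unit_vec y - unit_vec z) <= 2 * enorm (y - z).
Proof.
move=> y1 z1; have y0 : 0 < enorm y by rewrite (lt_le_trans ltr01).
have z0 : 0 < enorm z by rewrite (lt_le_trans ltr01).
have -> : unit_vec y - unit_vec z =
    (enorm y)^-1 *: (y - z) + (enorm y)^-1 *: ((enorm z - enorm y) *: unit_vec z).
  rewrite /unit_vec !scalerA scalerBr -addrA; congr (_ + _).
  rewrite -scaleNr -scaleNr -scalerDl; congr (_ *: _).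
  by field; rewrite !gt_eqF.
apply: le_trans (enormD _ _) _; rewrite !enormZ ger0_norm ?invr_ge0 ?(ltW y0)// -mulrDr.
rewrite (ger0_norm (_ : 0 <= (enorm z)^-1)) ?invr_ge0// mulVf ?gt_eqF// mulr1.
have h := enorm_dist z y; rewrite enormB in h.
have y1' : (enorm y)^-1 <= 1 by rewrite invf_le1.
apply: le_trans (_ : 1 * (enorm (y - z) + enorm (y - z)) <= _); last by lra.
by apply: ler_pM => //; rewrite ?invr_ge0 ?(ltW y0) ?addr_ge0// lerD2l.
Qed.

Section Charts.
Context {R : realType} {m : nat}.
Notation V := 'rV[R]_m.+2.
Variables (K L : set V) (e : V) (r : R).
Hypotheses (KL : polar_pair K L) (r0 : 0 < r).
Hypotheses (eL : forall v, L v -> r <= dot v e) (e1 : enorm e = 1).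
Notation F := (height L e).

Section Chart.
Variables (k : V) (J : 'M[R]_(m, m.+2)).
Hypothesis eJ : chart_frame e k J.

(** The foot keeps component 1 along [k], so its length is at least 1 and the radial projection is
    Lipschitz there. *)
Definition chart (x : 'rV[R]_m) : V := unit_vec (foot L e (k + x *m J)).

Let ek : dot e k = 0. Proof. by case: eJ => -[]. Qed.

Let footk x : dot (foot L e (k + x *m J)) k = 1.
Proof. by rewrite /foot dotDl dotZl ek mulr0 addr0 (frame_dotk eJ). Qed.

Let foot_ge1 x : 1 <= enorm (foot L e (k + x *m J)).
Proof.
by apply: le_trans (frame_dotk_le eJ _); rewrite footk normr1.
Qed.

Let foot_gt0 x : 0 < enorm (foot L e (k + x *m J)).
Proof. exact: lt_le_trans ltr01 (foot_ge1 x). Qed.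

Lemma chart_boundary x : sboundary K (chart x).
Proof. by apply: (foot_boundary KL r0 eL); rewrite -enorm_eq0 gt_eqF. Qed.

Lemma chart_lip x y : enorm (chart x - chart y) <= 2 * (1 + r^-1) * enorm (x - y).
Proof.
apply: le_trans (unit_vec_lip (foot_ge1 x) (foot_ge1 y)) _.
rewrite -mulrA ler_pM2l//; apply: le_trans (foot_lip KL r0 eL e1 _ _) _.
by rewrite opprD addrACA subrr add0r -mulmxBl (frame_enormJ eJ).
Qed.

Lemma chart_dotk x : dot (chart x) k = (enorm (foot L e (k + x *m J)))^-1.
Proof. by rewrite /chart /unit_vec dotZl footk mulr1. Qed.

Lemma chart_dotk_gt0 x : 0 < dot (chart x) k.
Proof. by rewrite chart_dotk invr_gt0. Qed.

Lemma chart_coord x : chart x *m J^T = dot (chart x) k *: x.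
Proof.
rewrite chart_dotk /chart /unit_vec -scalemxAl; congr (_ *: _).
have [[_ _ _ e0 _] _] := eJ.
by rewrite /foot mulmxDl -scalemxAl e0 scaler0 addr0 (frame_coord eJ).
Qed.

Lemma boundary_foot w : sboundary K w -> 0 < dot w k ->
  foot L e (k + ((dot w k)^-1 *: (w *m J^T)) *m J) = (dot w k)^-1 *: w.
Proof.
move=> bw a0; have [_ dec] := eJ.
have w0 : F ((dot w k)^-1 *: w) = 0.
  by rewrite (heightZ KL r0 eL) ?invr_ge0 ?ltW// (boundary_height KL r0 eL bw) mulr0.
have E : k + ((dot w k)^-1 *: (w *m J^T)) *m J = (dot w k)^-1 *: w + (- ((dot w k)^-1 * dot w e)) *: e.
  have dw : dot w k *: k + w *m J^T *m J = w - dot w e *: e.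
    by rewrite [X in _ = X - _](dec w) addr3K.
  rewrite scaleNr -scalerA -scalerBr -dw scalerDr scalerA mulVf ?gt_eqF// scale1r.
  by rewrite -scalemxAl.
rewrite /foot E (heightDe KL r0 eL) w0 sub0r opprK -addrA -scalerDl.
by rewrite addNr scale0r addr0.
Qed.

Lemma chart_onto w : sboundary K w -> 0 < dot w k -> chart ((dot w k)^-1 *: (w *m J^T)) = w.
Proof.
move=> bw a0; rewrite /chart boundary_foot// /unit_vec enormZ gtr0_norm ?invr_gt0//.
have := sboundary_sphere KL bw; rewrite sphere_enorm => ->.
by rewrite mulr1 scalerA invrK mulfV ?scale1r// gt_eqF.
Qed.

End Chart.

(** [w] is orthogonal to some [v] with [dot v e >= r], so the part of [w] orthogonal to [e] must
    balance [dot v e * dot w e]; this keeps [w] away from both poles. *)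
Lemma boundary_off_pole w : sboundary K w -> (r ^+ 2 + 1) * dot w e ^+ 2 <= 1.
Proof.
move=> bw; have [v uv] := (sboundaryE w KL).1 bw.
have sw := sboundary_sphere KL bw.
have [Kw Lv wv] := uv; have sv := pair_sphere (polar_pairC KL) Lv.
have ee : dot e e = 1 by rewrite -sqr_enorm e1 expr1n.
have h : dot v e * dot w e = - dot (w - dot w e *: e) v.
  by rewrite dotBl dotZl wv (dotC e v) sub0r opprK mulrC.
have h1 : `|dot v e * dot w e| <= enorm (w - dot w e *: e).
  rewrite h normrN; apply: le_trans (CauchySchwarz _ _) _.
  by move: sv; rewrite sphere_enorm => ->; rewrite mulr1.
have h2 : enorm (w - dot w e *: e) ^+ 2 = 1 - dot w e ^+ 2.
  rewrite sqr_enorm dotBl !dotBr !dotZl !dotZr ee (dotC e w).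
  by have : dot w w = 1 by []; move=> ->; ring.
have h3 : r * `|dot w e| <= `|dot v e * dot w e|.
  by rewrite normrM ler_wpM2r//; apply: le_trans (ler_norm _); exact: eL.
have h4 : (r * `|dot w e|) ^+ 2 <= 1 - dot w e ^+ 2.
  rewrite -h2 ler_sqr ?nnegrE//; first exact: le_trans h1.
  by rewrite mulr_ge0// ltW.
by move: h4; rewrite exprMn real_normK ?num_real// => h4; lra.
Qed.

Lemma chart_cover : exists (c : R) (ks : 'I_m.+1 * bool -> V)
    (Js : 'I_m.+1 * bool -> 'M[R]_(m, m.+2)),
  [/\ 0 < c, forall i, chart_frame e (ks i) (Js i) &
    forall w, sboundary K w -> exists i, c <= dot w (ks i)].
Proof.
have [g [og g0]] := @orthonormal_frame R m.+1 1 (fun=> e) isT (fun i j =>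
  ltac:(by case: i j => [|//] [|//] _ _; rewrite -sqr_enorm e1 expr1n)).
have {}g0 := g0 0%N isT.
(* A share of at least [r ^+ 2 / (r ^+ 2 + 1)] of the square length lies on the [m.+1] axes
   orthogonal to [e], so one of them, with a suitable sign, carries a component of at least [c]. *)
pose c := Num.sqrt (r ^+ 2 / ((r ^+ 2 + 1) * m.+1%:R)).
have r2 : 0 < r ^+ 2 by rewrite exprn_gt0.
have r3 : 0 < r ^+ 2 + 1 by rewrite addr_gt0.
have q0 : 0 < r ^+ 2 / ((r ^+ 2 + 1) * m.+1%:R) by rewrite divr_gt0// mulr_gt0.
have c0 : 0 < c by rewrite sqrtr_gt0.
exists c, (fun i : 'I_m.+1 * bool => (-1) ^+ i.2 *: g i.1.+1), (fun i : 'I_m.+1 * bool => \matrix_(j < m) g (lift i.1 j).+1).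
split => // [[i s]|w bw]; first by apply: chart_frame_exists => //; rewrite -expr2 sqrr_sign.
apply: contrapT => nw.
have small (i : 'I_m.+1) : dot w (g i.+1) ^+ 2 < r ^+ 2 / ((r ^+ 2 + 1) * m.+1%:R).
  have : `|dot w (g i.+1)| < c.
    rewrite ltr_norml; apply/andP; split; rewrite ltNge; apply/negP => h; apply: nw.
      by exists (i, true); rewrite /= expr1 scaleN1r dotNr lerNr.
    by exists (i, false); rewrite /= expr0 scale1r.
  move=> h; rewrite -(sqr_sqrtr (ltW q0)) -[ltLHS]real_normK ?num_real//.
  by rewrite ltr_sqr ?nnegrE ?sqrtr_ge0.
have sw : dot w w = 1 by exact: (sboundary_sphere KL bw).
have := frame_enorm w og; rewrite sw big_ord_recl/= g0 => E.
have h : \sum_(i < m.+1) dot w (g (bump 0 i)) ^+ 2 < r ^+ 2 / (r ^+ 2 + 1).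
  apply: (@lt_le_trans _ _ (\sum_(i < m.+1) r ^+ 2 / ((r ^+ 2 + 1) * m.+1%:R))).
    apply: ltr_sum => [|i _]; last exact: small.
    by apply/hasP; exists ord0; rewrite // mem_index_enum.
  rewrite sumr_const card_ord -[X in X <= _]mulr_natr.
  by rewrite invfM mulrA mulfVK// pnatr_eq0.
have := boundary_off_pole bw; rewrite mulrC -ler_pdivlMr// => h'.
have : 1 / (r ^+ 2 + 1) + r ^+ 2 / (r ^+ 2 + 1) = 1 by field; rewrite gt_eqF.
lra.
Qed.

Lemma hausdorff_finite_cover (I : finType) n k (A : I -> set 'rV[R]_n) B :
  (forall i, hausdorff k (A i) < +oo)%E -> (forall x, B x -> exists i, A i x) ->
  (hausdorff k B < +oo)%E.
Proof.
move=> Afin BA; apply: (@le_lt_trans _ _ (hausdorff k (\big[setU/set0]_i A i))).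
  apply: le_hausdorff => x /BA [i Aix].
  by rewrite (bigD1 i)//=; left.
apply: (big_ind (fun S => hausdorff k S < +oo)%E) => //; first by rewrite hausdorff0.
move=> S S' hS hS'; apply: le_lt_trans (outer_measureU2 _ _ _) _.
exact: lte_add_pinfty.
Qed.

Lemma perimeter_finite : (hausdorff m (@sboundary R m.+1 K) < +oo)%E.
Proof.
have [c [ks [Js [c0 fr cov]]]] := chart_cover.
(* Chart coordinates are at most [c^-1] in absolute value; the added 1 is there because boxes are
   open on the right. *)
pose B : set 'rV[R]_m := box (const_mx (- c^-1)) (const_mx (c^-1 + 1)).
have Lp : 0 < 2 * (1 + r^-1) by rewrite mulr_gt0// addr_gt0// invr_gt0.
apply: (@hausdorff_finite_cover _ _ _ (fun i => chart (ks i) (Js i) @` B)) => [i|w bw].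
  apply: le_lt_trans (hausdorff_lipschitz m Lp _) _.
    by move=> x y _ _; exact: (chart_lip (fr i)).
  by apply: lte_mul_pinfty; rewrite ?lee_fin ?exprn_ge0 ?(ltW Lp)// hausdorff_box_finite.
have [i ci] := cov _ bw; exists i.
have a0 : 0 < dot w (ks i) := lt_le_trans c0 ci.
exists ((dot w (ks i))^-1 *: (w *m (Js i)^T)); last exact: (chart_onto (fr i)).
move=> j; rewrite !mxE.
have : `|((dot w (ks i))^-1 *: (w *m (Js i)^T)) 0 j| <= c^-1.
  apply: le_trans (coord_enorm _ _) _; rewrite enormZ gtr0_norm ?invr_gt0//.
  apply: (@le_trans _ _ (c^-1 * 1)); last by rewrite mulr1.
  apply: ler_pM; rewrite ?invr_ge0 ?(ltW a0)//; first by rewrite lef_pV2.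
  apply: le_trans (frame_enormJT (fr i) _) _.
  by have := sboundary_sphere KL bw; rewrite sphere_enorm => ->.
rewrite !mxE ler_norml => /andP[h1 h2]; rewrite h1/=.
by apply: le_lt_trans h2 _; rewrite ltrDl.
Qed.

(** The inverse of a chart is Lipschitz on the image of the unit cube, so a null boundary would give
    the cube measure zero. *)
Lemma perimeter_gt0 : (0 < hausdorff m (@sboundary R m.+1 K))%E.
Proof.
have [c [ks [Js [_ fr _]]]] := chart_cover.
have {c}[k [J fkJ]] : exists k J, chart_frame e k J by exists (ks (ord0, true)), (Js (ord0, true)).
have [[kk ek JJ e0 k0] _] := fkJ.
pose Q := [set x : 'rV[R]_m | forall i, 0 <= x 0 i <= 1].
(* Bounds the length of the foot over the unit cube, hence bounds the component of the chart along
   [k] below by [M^-1]. *)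
pose M := (1 + r^-1) * (1 + m%:R).
have M0 : 0 < M by rewrite mulr_gt0// ?addr_gt0 ?invr_gt0 ?ltr_wpDr.
have dk x : Q x -> M^-1 <= dot (chart k J x) k.
  move=> Qx; rewrite (chart_dotk fkJ) lef_pV2 ?posrE//; last first.
    by rewrite -invr_gt0 -(chart_dotk fkJ) chart_dotk_gt0.
  have f0 : foot L e 0 = 0.
    have := heightZ KL r0 eL 0 (lexx 0); rewrite scaler0 mul0r /foot => ->.
    by rewrite scale0r addr0.
  have := foot_lip KL r0 eL e1 (k + x *m J) 0; rewrite f0 !subr0 => /le_trans; apply.
  rewrite /M ler_pM2l ?addr_gt0 ?invr_gt0//; apply: le_trans (enormD _ _) _.
  rewrite (frame_enormJ fkJ) [enorm k]/enorm kk sqrtr1 lerD2l.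
  apply: le_trans (enorm_norm _) _; rewrite ler_piMr//.
  rewrite [`|x|]mx_normrE; apply: bigmax_le => // -[i j] _ /=.
  by rewrite ord1; have /andP[h1 h2] := Qx j; rewrite ger0_norm.
pose f (w : V) : 'rV[R]_m := (dot w k)^-1 *: (w *m J^T).
have fK x : Q x -> f (chart k J x) = x.
  move=> Qx; rewrite /f (chart_coord fkJ) scalerA mulVf ?scale1r// gt_eqF//.
  exact: (chart_dotk_gt0 fkJ).
have flip w w' : (chart k J @` Q) w -> (chart k J @` Q) w' ->
    enorm (f w - f w') <= (M + M ^+ 2) * enorm (w - w').
  move=> [x Qx <-] [y Qy <-]; have := dk x Qx; have := dk y Qy.
  have sx : enorm (chart k J x) = 1 by apply/sphere_enorm/(sboundary_sphere KL)/(chart_boundary fkJ).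
  have sy : enorm (chart k J y) = 1 by apply/sphere_enorm/(sboundary_sphere KL)/(chart_boundary fkJ).
  rewrite /f; move: (chart k J x) (chart k J y) sx sy => {x y Qx Qy} {}w {}w' sw sw' aw' aw.
  have Mi : 0 < M^-1 by rewrite invr_gt0.
  have a0 : 0 < dot w k := lt_le_trans Mi aw.
  have a0' : 0 < dot w' k := lt_le_trans Mi aw'.
  have -> : (dot w k)^-1 *: (w *m J^T) - (dot w' k)^-1 *: (w' *m J^T) =
      (dot w k)^-1 *: ((w - w') *m J^T) + ((dot w k)^-1 * (dot w' k)^-1 * dot (w' - w) k) *: (w' *m J^T).
    rewrite mulmxBl scalerBr -addrA; congr (_ + _); rewrite -!scaleNr -scalerDl; congr (_ *: _).
    by rewrite dotBl; field; rewrite !gt_eqF.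
  have iM : (dot w k)^-1 <= M by rewrite -[M]invrK lef_pV2.
  have iM' : (dot w' k)^-1 <= M by rewrite -[M]invrK lef_pV2.
  apply: le_trans (enormD _ _) _; rewrite !enormZ mulrDl; apply: lerD.
    rewrite gtr0_norm ?invr_gt0//; apply: ler_pM; rewrite ?invr_ge0 ?(ltW a0)//.
    exact: (frame_enormJT fkJ).
  rewrite 2!normrM (@gtr0_norm _ (dot w k)^-1) ?invr_gt0//.
  rewrite (@gtr0_norm _ (dot w' k)^-1) ?invr_gt0//.
  have h1 : `|dot (w' - w) k| <= enorm (w - w').
    by rewrite enormB; exact: (frame_dotk_le fkJ).
  have h2 : enorm (w' *m J^T) <= 1 by rewrite -sw'; exact: (frame_enormJT fkJ).
  rewrite -[leRHS]mulr1; apply: ler_pM => //.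
    by rewrite !mulr_ge0 ?invr_ge0 ?(ltW a0) ?(ltW a0').
  rewrite expr2; apply: ler_pM => //; first by rewrite mulr_ge0 ?invr_ge0 ?(ltW a0) ?(ltW a0').
  by apply: ler_pM; rewrite ?invr_ge0 ?(ltW a0) ?(ltW a0').
have MM : 0 < M + M ^+ 2 by rewrite addr_gt0 ?exprn_gt0.
have := hausdorff_lipschitz m MM flip.
rewrite (_ : f @` _ = Q); last first.
  apply/seteqP; split => x; first by move=> [_ [y Qy <-] <-]; rewrite fK.
  by move=> Qx; exists (chart k J x); [exists x|rewrite fK].
move=> h; rewrite lt_neqAle hausdorff_ge0 andbT; apply/negP => /eqP E.
have : (hausdorff m (chart k J @` Q) = 0)%E.
  apply/eqP; rewrite eq_le hausdorff_ge0 andbT E; apply: le_hausdorff => _ [x _ <-].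
  exact: (chart_boundary fkJ).
move=> E'; move: h; rewrite E' mule0 leNgt.
by rewrite hausdorff_closed_cube_gt0.
Qed.

End Charts.

(** * Bodies with Lipschitz Gauss map *)

(** Subgradients at both ends squeeze the increment of [h] over a short interval. Summing over
    [N.+1] equal steps leaves the extra error [|b| / 2 / N.+1], which replaces integrating the
    gradient. *)
Lemma subgradient_taylor {R : realType} (h gd : R -> R) (a b eps : R) : 0 <= eps ->
  (forall s t, h s + gd s * (t - s) <= h t) ->
  (forall t, 0 <= t <= 1 -> `|gd t - a - t * b| <= eps) ->
  `|h 1 - h 0 - a - b / 2| <= eps.
Proof.
move=> eps0 sub near; pose g t := h t - a * t - b * (t ^+ 2 / 2).
have step s t : 0 <= s -> s <= t -> t <= 1 ->
    `|g t - g s| <= (t - s) * (eps + `|b| * (t - s) / 2).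
  move=> s0 st t1; have s1 := le_trans st t1; have t0 := le_trans s0 st.
  have ns := near s; rewrite s0 s1 in ns; have {}ns := ns isT.
  have nt := near t; rewrite t0 t1 in nt; have {}nt := nt isT.
  have st0 : 0 <= t - s by rewrite subr_ge0.
  have /ler_normlP[ns1 ns2] := ns; have /ler_normlP[nt1 nt2] := nt.
  have h1 := sub s t; have h2 := sub t s.
  have p1 : (t - s) * (gd t - a - t * b) <= (t - s) * eps by rewrite ler_wpM2l.
  have p2 : (t - s) * - (gd s - a - s * b) <= (t - s) * eps by rewrite ler_wpM2l.
  have q1 : (t - s) * (b * (t - s)) <= (t - s) * (`|b| * (t - s)).
    by rewrite ler_wpM2l// ler_wpM2r// ler_norm.
  apply/ler_normlP; rewrite /g; split.
    have -> : - (h t - a * t - b * (t ^+ 2 / 2) - (h s - a * s - b * (s ^+ 2 / 2))) =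
      (h s + gd s * (t - s) - h t) + (t - s) * - (gd s - a - s * b) + (t - s) * (b * (t - s)) / 2 by field.
    have -> : (t - s) * (eps + `|b| * (t - s) / 2) = (t - s) * eps + (t - s) * (`|b| * (t - s)) / 2 by ring.
    move: h1 p2 q1; move: (h s + gd s * (t - s)) ((t - s) * _) ((t - s) * _) ((t - s) * _) ((t - s) * _) => x1 x2 x3 x4 x5; lra.
  have -> : h t - a * t - b * (t ^+ 2 / 2) - (h s - a * s - b * (s ^+ 2 / 2)) =
      (h t + gd t * (s - t) - h s) + (t - s) * (gd t - a - t * b) + (t - s) * (b * (t - s)) / 2 by field.
  have -> : (t - s) * (eps + `|b| * (t - s) / 2) = (t - s) * eps + (t - s) * (`|b| * (t - s)) / 2 by ring.
  move: h2 p1 q1; move: (h t + gd t * (s - t)) ((t - s) * _) ((t - s) * _) ((t - s) * _) ((t - s) * _) => x1 x2 x3 x4 x5; lra.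
have chain (N i : nat) : (i <= N.+1)%N ->
    `|g (i%:R / N.+1%:R) - g 0| <= i%:R / N.+1%:R * (eps + `|b| / 2 / N.+1%:R).
  elim: i => [_|i IH iN]; first by rewrite !mul0r subrr normr0.
  have := IH (ltnW iN) => {}IH.
  have d : i.+1%:R / N.+1%:R - i%:R / N.+1%:R = N.+1%:R^-1 :> R.
    by rewrite -mulrBl -natrB// subSnn mul1r.
  have := step (i%:R / N.+1%:R) (i.+1%:R / N.+1%:R).
  rewrite d divr_ge0// ler_pM2r ?invr_gt0 ?ltr0n// ler_nat leqnSn ler_pdivrMr ?ltr0n// mul1r ler_nat.
  move=> /(_ isT isT iN); rewrite (mulrAC `|b|) => hs.
  rewrite -(subrK (g (i%:R / N.+1%:R)) (g (i.+1%:R / _))) -addrA.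
  apply: le_trans (ler_normD _ _) _; apply: le_trans (lerD hs IH) _.
  by rewrite -[in leRHS]natr1 (mulrDl i%:R) mul1r [in leRHS]mulrDl addrC.
apply/ler_addgt0Pr => delta delta0.
pose N := truncn (`|b| / 2 / delta).
have hN : `|b| / 2 / N.+1%:R <= delta.
  have := Num.Theory.truncnS_gt (`|b| / 2 / delta); rewrite -/N => /ltW hh.
  by rewrite ler_pdivrMr ?ltr0n// (mulrC delta) -ler_pdivrMr.
have := chain N N.+1 (leqnn _); rewrite divff ?pnatr_eq0// mul1r.
rewrite /g expr1n expr0n/= !mul0r !mulr0 mulr1 !subr0.
have -> : h 1 - a - b * (1 / 2) - h 0 = h 1 - h 0 - a - b / 2 by field.
by move=> /le_trans; apply; rewrite lerD2l.
Qed.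

Lemma diff_at_row {R : realType} {n p : nat} (G : 'rV[R]_n -> 'rV[R]_p) (x : 'rV[R]_n) :
  (forall i, exists D, diff_at (fun y => G y 0 i) x D) ->
  exists B : 'M[R]_(n, p), forall eps, 0 < eps -> exists2 delta, 0 < delta &
    forall z, enorm z < delta -> enorm (G (x + z) - G x - z *m B) <= eps * enorm z.
Proof.
move=> /choice[D hD]; exists (\matrix_(j, i) D i 0 j) => eps eps0.
have p0 : 0 < p.+1%:R :> R by rewrite ltr0n.
have hd i : exists delta, 0 < delta /\ forall z, enorm z < delta ->
    `|G (x + z) 0 i - G x 0 i - dot (D i) z| <= eps / p.+1%:R * enorm z.
  by have [|d d0 hd] := hD i (eps / p.+1%:R); [rewrite divr_gt0|exists d].
have [d {}hd] := choice hd.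
exists (\big[Num.min/1]_i d i).
  by apply/bigmin_gtP; split => // i _; have [] := hd i.
move=> z /bigmin_gtP[_ zd].
apply: le_trans (enorm_norm _) _.
apply: (@le_trans _ _ (p%:R * (eps / p.+1%:R * enorm z))).
  rewrite ler_wpM2l// [leLHS]/Num.norm/= mx_normrE; apply: bigmax_le => [|[i j] _ /=].
    by rewrite mulr_ge0// divr_ge0// ltW.
  rewrite ord1 !mxE; have := (hd j).2 z (zd j isT).
  by congr (`|_ - _| <= _); apply: eq_bigr => l _; rewrite mxE mulrC.
rewrite mulrA ler_wpM2r// mulrCA ler_piMr ?(ltW eps0)// ler_pdivrMr// mul1r ler_nat.
exact: leqnSn.
Qed.

Lemma hausdorff_finite_cover0 {R : realType} (I : finType) n k (A : I -> set 'rV[R]_n) B :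
  (forall i, hausdorff k (A i) = 0%E) -> (forall x, B x -> exists i, A i x) ->
  hausdorff k B = 0%E.
Proof.
move=> A0 BA; apply: (@hausdorff_subset0 _ _ _ _ (\big[setU/set0]_i A i)).
  by move=> x /BA [i Aix]; rewrite (bigD1 i)//=; left.
apply: (big_ind (fun S => hausdorff k S = 0%E)) => //.
move=> S S' hS hS'; apply/eqP; rewrite eq_le hausdorff_ge0 andbT.
have h : (hausdorff k (S `|` S') <= hausdorff k S + hausdorff k S')%E by exact: outer_measureU2.
by apply: le_trans h _; rewrite hS hS' adde0.
Qed.

Section LipschitzNormal.
Context {R : realType} {m : nat}.
Notation V := 'rV[R]_m.+2.
Variables (K L : set V) (e : V) (r : R).
Hypotheses (KL : polar_pair K L) (r0 : 0 < r).
Hypotheses (eL : forall v, L v -> r <= dot v e) (e1 : enorm e = 1).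
Notation F := (height L e).
Notation p_ := (slope e).
Notation bd := (@sboundary R m.+1 K).
Variables (nu : V -> V) (C : R).
Hypotheses (C0 : 0 <= C) (nuP : forall u, bd u -> incident K L u (nu u)).
Hypothesis nu_lip : forall u w, bd u -> bd w -> enorm (nu u - nu w) <= C * enorm (u - w).

(** Since [dot u (nu w)] is nonnegative, [dot (nu u) w] is at most the pairing of the difference of
    normals with the difference of points. *)
Lemma normal_quadratic u w : bd u -> bd w -> 0 <= dot (nu u) w <= C * enorm (w - u) ^+ 2.
Proof.
move=> bu bw; have [Ku Lu uu] := nuP bu; have [Kw Lw ww] := nuP bw.
rewrite dotC (pair_ge0 KL)//=.
have -> : dot w (nu u) = dot (nu u - nu w) (w - u) - dot u (nu w).
  by rewrite dotBr !dotBl (dotC (nu w) w) ww (dotC (nu u) u) uu (dotC (nu u)) (dotC (nu w)); ring.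
have h := pair_ge0 KL Ku Lw.
apply: (@le_trans _ _ (dot (nu u - nu w) (w - u))); first by lra.
apply: le_trans (dot_le _ _) _; rewrite expr2 mulrA ler_wpM2r// (enormB w u).
exact: nu_lip.
Qed.

Lemma normal_unique u v : incident K L u v -> v = nu u.
Proof.
move=> uv; have bu := incident_boundary KL uv.
have ev : evt (fun w => enorm (w - u)) (fun w => bd w -> dot (nu u) w <= C * enorm (w - u) ^+ 2).
  by exists 1 => // w _ bw; have /andP[] := normal_quadratic bu bw.
have [c c0 h] := upper_tangent KL r0 eL e1 (nuP bu) C0 ev.
exact: (tangent_unique KL r0 eL (nuP bu) uv c0 h).
Qed.

Lemma contact_null S : hausdorff m S = 0%E -> hausdorff m (contact K L S) = 0%E.
Proof.
move=> S0; apply: (@hausdorff_subset0 _ _ _ _ (nu @` (S `&` bd))).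
  move=> v [u Su uv]; exists u; last by rewrite (normal_unique uv).
  by split => //; exact: (incident_boundary KL uv).
apply: (hausdorff_lipschitz0 C0) => [x y [_ bx] [_ by_]|]; first exact: nu_lip.
by apply: hausdorff_subset0 S0 => x [].
Qed.

Lemma slope_lip v v' : L v -> L v' ->
  enorm (p_ v - p_ v') <= (r^-1 + r^-1 * r^-1) * enorm (v - v').
Proof.
move=> Lv Lv'; have b := eL Lv; have b' := eL Lv'.
have b0 := lt_le_trans r0 b; have b0' := lt_le_trans r0 b'.
have -> : p_ v - p_ v' = - ((dot v e)^-1 *: (v - v')) +
    ((dot v e)^-1 * (dot v' e)^-1 * dot (v - v') e) *: v'.
  rewrite /slope scalerBr opprB -!scaleNr [RHS]addrAC -scalerDl opprK.
  rewrite [RHS]addrC; congr (_ + _); congr (_ *: _).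
  by rewrite dotBl; field; rewrite !gt_eqF.
have i1 : (dot v e)^-1 <= r^-1 by rewrite lef_pV2.
have i2 : (dot v' e)^-1 <= r^-1 by rewrite lef_pV2.
apply: le_trans (enormD _ _) _; rewrite enormN !enormZ mulrDl; apply: lerD.
  by rewrite gtr0_norm ?invr_gt0// ler_wpM2r.
have /sphere_enorm -> := pair_sphere (polar_pairC KL) Lv'.
rewrite mulr1 2!normrM (@gtr0_norm _ (dot v e)^-1) ?invr_gt0// (@gtr0_norm _ (dot v' e)^-1) ?invr_gt0//.
have h : `|dot (v - v') e| <= enorm (v - v').
  by apply: le_trans (CauchySchwarz _ _) _; rewrite e1 mulr1.
apply: ler_pM => //; first by rewrite mulr_ge0 ?invr_ge0 ?ltW.
by apply: ler_pM => //; rewrite invr_ge0 ltW.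
Qed.

Section Chart.
Variables (k : V) (J : 'M[R]_(m, m.+2)).
Hypothesis eJ : chart_frame e k J.
Notation phi := (chart L e k J).
Let f x := F (k + x *m J).
Let G x := p_ (nu (phi x)) *m J^T.

Let phi_bd x : bd (phi x). Proof. exact: (chart_boundary KL r0 eL eJ). Qed.
Let L_phi x : L (nu (phi x)). Proof. by have [] := nuP (phi_bd x). Qed.

Lemma chart_height x : f x = dot (p_ (nu (phi x))) (k + x *m J).
Proof.
have [_ Lv uv] := nuP (phi_bd x).
have a0 : (enorm (foot L e (k + x *m J)))^-1 != 0.
  by rewrite -(chart_dotk L eJ) gt_eqF// (chart_dotk_gt0 L eJ).
have : dot (p_ (nu (phi x))) (foot L e (k + x *m J)) = 0.
  move: uv; rewrite {1}/chart /unit_vec dotZl => /eqP; rewrite mulf_eq0 (negbTE a0)/= => /eqP h.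
  by rewrite dotZl (dotC _ (foot _ _ _)) h mulr0.
rewrite /foot dotDr dotZr (slope_e r0 eL Lv) mulrN1 => /eqP; rewrite subr_eq0 => /eqP ->.
by [].
Qed.

Lemma chart_subgradient x y : f x + dot (G x) (y - x) <= f y.
Proof.
rewrite chart_height; apply: le_trans (height_ge KL r0 eL (k + y *m J) (L_phi x)).
rewrite /G (dotC _ (y - x)) -dot_mulmx (dotC _ (p_ _)) -dotDr.
by rewrite mulmxBl -addrA (addrC (x *m J)) subrK.
Qed.

Let CG := (r^-1 + r^-1 * r^-1) * (C * (2 * (1 + r^-1))).
Lemma chart_gradient_lip x y : enorm (G x - G y) <= CG * enorm (x - y).
Proof.
rewrite /G -mulmxBl; apply: le_trans (frame_enormJT eJ _) _.
apply: le_trans (slope_lip (L_phi x) (L_phi y)) _.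
have ri : 0 <= r^-1 by rewrite invr_ge0 ltW.
rewrite /CG -!mulrA ler_wpM2l ?addr_ge0 ?mulr_ge0//.
apply: le_trans (nu_lip (phi_bd x) (phi_bd y)) _; rewrite ler_wpM2l//.
by rewrite mulrA; exact: (chart_lip KL r0 eL e1 eJ).
Qed.

(** Rademacher's theorem differentiates the gradient [G], and [subgradient_taylor] on segments
    carries this over to [f]. The derivative is symmetrised, which leaves its quadratic form
    unchanged. *)
Lemma chart_taylor : exists2 N : set 'rV[R]_m, hausdorff m N = 0%E & forall x, ~ N x ->
  exists2 S : 'M[R]_m, S^T = S & forall eps, 0 < eps -> exists2 delta, 0 < delta &
    forall z, enorm z < delta ->
    `|f (x + z) - f x - dot (G x) z - qf S z / 2| <= eps * enorm z ^+ 2.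
Proof.
have hG i x y : `|G x 0 i - G y 0 i| <= CG * enorm (x - y).
  apply: le_trans (chart_gradient_lip x y); have := coord_enorm (G x - G y) i.
  by rewrite mxE [X in _ + X]mxE.
have /choice[N hN] i : exists N : set 'rV[R]_m, hausdorff m N = 0%E /\
    forall x, ~ N x -> exists D, diff_at (fun y => G y 0 i) x D.
  by have [N N0 hN] := rademacher (hG i); exists N.
exists [set x | exists i, N i x].
  apply: (@hausdorff_finite_cover0 _ _ _ _ N) => [i|x [i Nx]]; first exact: (hN i).1.
  by exists i.
move=> x Nx; have [i|B hB] := @diff_at_row _ _ _ G x.
  by apply: (hN i).2 => Nix; apply: Nx; exists i.
exists (2^-1 *: (B + B^T)).
  by rewrite linearZ/= linearD/= trmxK addrC.
move=> eps eps0; have [d d0 hd] := hB _ eps0; exists d => // z zd.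
have -> : qf (2^-1 *: (B + B^T)) z = qf B z.
  rewrite /qf -scalemxAr dotZl mulmxDr dotDl (dot_mulmx z B^T) trmxK (dotC z).
  by field.
have E0 : enorm z ^+ 2 = enorm z * enorm z by rewrite expr2.
have := @subgradient_taylor R (fun t => f (x + t *: z)) (fun t => dot (G (x + t *: z)) z)
  (dot (G x) z) (qf B z) (eps * enorm z ^+ 2).
rewrite scale0r addr0 scale1r; apply.
- by rewrite mulr_ge0 ?exprn_ge0 ?(ltW eps0).
- move=> s t; have := chart_subgradient (x + s *: z) (x + t *: z).
  by rewrite opprD addrACA subrr add0r -scalerBl dotZr mulrC.
- move=> t /andP[t0 t1].
  have zt : enorm (t *: z) <= enorm z by rewrite enormZ ger0_norm// ler_piMl.
  have := hd _ (le_lt_trans zt zd) => h.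
  have -> : dot (G (x + t *: z)) z - dot (G x) z - t * qf B z =
      dot (G (x + t *: z) - G x - (t *: z) *m B) z.
    by rewrite !dotBl -scalemxAl dotZl.
  apply: le_trans (CauchySchwarz _ _) _; rewrite E0 mulrA ler_wpM2r//.
  by apply: le_trans h _; rewrite ler_wpM2l ?(ltW eps0).
Qed.

(** The form [S] in chart coordinates is pulled back to the ambient space by [M], rescaled by
    [be / al] to pass from heights to pairings with [v], and projected so as to annihilate both [u]
    and [v]. *)
Lemma chart_second_form x S : S^T = S ->
  (forall eps, 0 < eps -> exists2 delta, 0 < delta & forall z, enorm z < delta ->
    `|f (x + z) - f x - dot (G x) z - qf S z / 2| <= eps * enorm z ^+ 2) ->
  exists v Q, second_form K L (phi x) v Q.
Proof.
move=> SS tay.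
have bu := phi_bd x; have al0 := chart_dotk_gt0 L eJ x.
have coord := chart_coord L eJ x; have fx := chart_height x; have Gx : G x = p_ (nu (phi x)) *m J^T by [].
move: bu al0 coord fx Gx tay; move: (phi x) => u bu al0 coord fx Gx tay.
have uv := nuP bu; have nq w (bw : bd w) := normal_quadratic bu bw.
move: nq Gx fx uv; move: (nu u) => v nq Gx fx uv.
have [Ku Lv uv0] := uv; have [su sv _] := incident_orthonormal KL uv.
have [be beE] : exists be, be = dot v e by eexists.
have be0 : 0 < be by rewrite beE; exact: lt_le_trans r0 (eL Lv).
have be1 : be <= 1.
  by rewrite beE; apply: le_trans (dot_le _ _) _; rewrite e1 mulr1; move/sphere_enorm: sv => ->.
have [al alE] : exists al, al = dot u k by eexists.
rewrite -alE in al0 coord.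
(* Up to the factor [1 / dot w k], this sends the displacement [w - u] to the difference of chart
   coordinates; it annihilates [u]. *)
pose M := J^T - k^T *m x.
have yM (y : V) : y *m M = y *m J^T - dot y k *: x.
  by rewrite mulmxBr mulmxA; congr (_ - _); rewrite -mul_scalar_mx dotE; congr (_ *m _); apply/matrixP => i j; rewrite !ord1 [in RHS]mxE mulr1n.
have uM : u *m M = 0 by rewrite yM coord alE subrr.
pose Q0 := (be / al) *: (M *m S *m M^T).
have Q0S : Q0^T = Q0 by rewrite /Q0 linearZ/= !trmx_mul trmxK SS mulmxA.
have uQ0 : u *m Q0 = 0 by rewrite /Q0 -scalemxAr !mulmxA uM !mul0mx scaler0.
(* Projecting along [v] moves a boundary displacement only at second order, by [normal_quadratic],
   so it changes the form at third order. *)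
pose P := 1%:M - v^T *m v.
have yP (y : V) : y *m P = y - dot y v *: v by rewrite mulmxBr mulmx1 mulmx_outer.
have PS : P^T = P by rewrite linearB/= trmx1 trmx_mul trmxK.
have vP : v *m P = 0 by rewrite yP (sv : dot v v = 1) scale1r subrr.
have uP : u *m P = u by rewrite yP uv0 scale0r subr0.
pose Q := P *m Q0 *m P.
have qfQ y : qf Q y = qf Q0 (y *m P) by rewrite /qf /Q !mulmxA dot_mulmx PS.
have qfQ0 y : qf Q0 y = be / al * qf S (y *m M).
  by rewrite /qf /Q0 -scalemxAr dotZl !mulmxA (dot_mulmx _ M^T) trmxK.
exists v, Q; split => //.
- by rewrite /Q !trmx_mul PS Q0S mulmxA.
- by rewrite /Q !mulmxA uP uQ0 mul0mx.
- by rewrite /Q !mulmxA vP !mul0mx.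
move=> eps eps0.
have [cM cME] : exists cM, cM = 1 + enorm x by eexists.
have cM1 : 1 <= cM by rewrite cME lerDl.
have cM0 : 0 < cM := lt_le_trans ltr01 cM1.
have yMb y : enorm (y *m M) <= cM * enorm y.
  rewrite yM cME mulrDl mul1r; apply: le_trans (enormD _ _) _; rewrite enormN enormZ.
  by apply: lerD; [exact: (frame_enormJT eJ)|rewrite mulrC ler_wpM2l//; exact: (frame_dotk_le eJ)].
(* [A1], [A2] and [A3] control the Taylor remainder, the replacement of [1 / a] by [1 / al], and the
   projection [P]. *)
have [A1 A1E] : exists A1, A1 = 2 * cM ^+ 2 / al by eexists.
have [A2 A2E] : exists A2, A2 = mxbound S * cM ^+ 2 / al ^+ 2 by eexists.
have [A3 A3E] : exists A3, A3 = mxbound Q0 * C * 3 / 2 by eexists.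
have A10 : 0 < A1 by rewrite A1E divr_gt0// mulr_gt0// exprn_gt0.
have mS := mxbound_ge0 S; have mQ := mxbound_ge0 Q0.
have A20 : 0 <= A2 by rewrite A2E; apply: divr_ge0; [apply: mulr_ge0 => //|]; exact: sqr_ge0.
have A30 : 0 <= A3 by rewrite A3E divr_ge0// !mulr_ge0.
have ep1 : 0 < eps / (2 * A1) by rewrite divr_gt0// mulr_gt0.
have [d d0 hd] := tay _ ep1.
have ev1 : evt (fun w => enorm (w - u)) (fun w => 2 * enorm (w - u) < al) by exact: evt_ltM.
have ev2 : evt (fun w => enorm (w - u)) (fun w => (2 * cM / al) * enorm (w - u) < d).
  by apply: evt_ltM => //; rewrite divr_gt0// mulr_gt0.
have ev3 : evt (fun w => enorm (w - u)) (fun w => (2 * (A2 + A3 + 1)) * enorm (w - u) < eps).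
  by apply: evt_ltM => //; rewrite mulr_gt0// ltr_wpDl// addr_ge0.
apply: evtS (evtI ev1 (evtI ev2 ev3)) => w [N1 [N2 N3]] bw.
have [y yE] : exists y, y = w - u by eexists.
have [D DE] : exists D, D = enorm y by eexists.
rewrite -yE -DE in N1 N2 N3 *; have D0 : 0 <= D by rewrite DE.
have [a aE] : exists a, a = dot w k by eexists.
have aal : `|a - al| <= D by rewrite aE alE -dotBl -yE DE; exact: (frame_dotk_le eJ).
have a2 : al <= 2 * a by move/ler_normlP: aal => [h _]; lra.
have a0 : 0 < a by lra.
have ia : a^-1 <= 2 / al by rewrite ler_pdivlMr// mulrC ler_pdivrMr.
pose z := a^-1 *: (y *m M).
have xz : x + z = a^-1 *: (w *m J^T).
  rewrite /z yM yE mulmxBl coord dotBl -aE -alE scalerBl opprB.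
  rewrite addrA subrK scalerBr scalerA mulVf ?gt_eqF// scale1r.
  by rewrite addrC subrK.
have zb : enorm z <= 2 * cM / al * D.
  rewrite /z enormZ gtr0_norm ?invr_gt0//; apply: (@le_trans _ _ (2 / al * (cM * D))).
    by apply: ler_pM => //; rewrite ?invr_ge0 ?(ltW a0)// DE.
  by rewrite mulrA (mulrAC 2).
have T1 := hd z (le_lt_trans zb N2).
have wf : dot v w = a * be * (f (x + z) - f x - dot (G x) z).
  have := boundary_foot KL r0 eL eJ bw; rewrite -aE => /(_ a0).
  rewrite -xz => h.
  have dp (t : V) : dot v t = - (be * dot (p_ v) t).
    by rewrite /slope dotZl -beE mulNr mulrN opprK mulrA mulfV ?mul1r// gt_eqF.
  have h2 : a^-1 * dot v w = be * (f (x + z) - dot (p_ v) (k + (x + z) *m J)).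
    by rewrite -dotZr -h /foot dotDr dotZr -beE dp -/(f (x + z)); ring.
  have -> : f (x + z) - f x - dot (G x) z = f (x + z) - dot (p_ v) (k + (x + z) *m J).
    have -> : dot (G x) z = dot (p_ v) (z *m J) by rewrite Gx (dotC _ z) -dot_mulmx dotC.
    by rewrite -addrA -opprD fx -dotDr mulmxDl addrA.
  by rewrite -mulrA -h2 mulrA mulfV ?mul1r// gt_eqF.
have [T TE] : exists T, T = f (x + z) - f x - dot (G x) z - qf S z / 2 by eexists.
rewrite -TE in T1.
have -> : dot v w - qf Q y / 2 = a * be * T + be / 2 * ((al - a) * (a^-1 * al^-1)) * qf S (y *m M) +
    (qf Q0 y - qf Q0 (y *m P)) / 2.
  rewrite wf TE qfQ (qfQ0 y) [in qf S z]/z qfZ.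
  move: (f x) (f (x + z)) (dot (G x) z) (qf Q0 _) (qf S _) => f1 f2 f3 f4 f5.
  by field; rewrite !gt_eqF.
have B1 : `|a * be * T| <= eps / (2 * A1) * A1 * D ^+ 2.
  rewrite 2!normrM (gtr0_norm a0) (gtr0_norm be0).
  apply: (@le_trans _ _ (a * (eps / (2 * A1) * enorm z ^+ 2))).
    rewrite -mulrA ler_wpM2l ?(ltW a0)//; apply: le_trans T1.
    by rewrite ler_piMl.
  rewrite mulrCA -!mulrA ler_wpM2l ?(ltW eps0)// ler_wpM2l ?invr_ge0 ?mulr_ge0 ?(ltW A10)//.
  have -> : a * enorm z ^+ 2 = a^-1 * enorm (y *m M) ^+ 2.
    by rewrite /z enormZ gtr0_norm ?invr_gt0// exprMn; field; rewrite gt_eqF.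
  have -> : A1 * D ^+ 2 = 2 / al * (cM * D) ^+ 2 by rewrite A1E exprMn; ring.
  apply: ler_pM; rewrite ?invr_ge0 ?(ltW a0) ?exprn_ge0//.
  by rewrite ler_sqr ?nnegrE ?mulr_ge0 ?(ltW cM0)// DE.
have qS : `|qf S (y *m M)| <= mxbound S * (cM * D) ^+ 2.
  apply: le_trans (qf_bound _ _) _; rewrite ler_wpM2l// ler_sqr ?nnegrE ?mulr_ge0 ?(ltW cM0)//.
  by rewrite DE.
have B2 : `|be / 2 * ((al - a) * (a^-1 * al^-1)) * qf S (y *m M)| <= A2 * D * D ^+ 2.
  have ia0 : 0 < a^-1 by rewrite invr_gt0. have ial0 : 0 < al^-1 by rewrite invr_gt0.
  rewrite normrM [`|be / 2 * _|]normrM [`|(al - a) * _|]normrM.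
  rewrite (@gtr0_norm _ (be / 2)) ?divr_gt0// (@gtr0_norm _ (a^-1 * al^-1)) ?mulr_gt0// distrC.
  apply: (@le_trans _ _ (1 / 2 * (D * (2 / al * al^-1)) * (mxbound S * (cM * D) ^+ 2))).
    apply: ler_pM => //; first by rewrite !mulr_ge0// ltW.
    apply: ler_pM => //; [by rewrite divr_ge0// ltW|by rewrite !mulr_ge0// ltW|by rewrite ler_pM2r|].
    apply: ler_pM => //; first by rewrite mulr_ge0// ltW.
    by rewrite ler_pM2r.
  by rewrite A2E le_eqVlt; apply/orP; left; apply/eqP; field; rewrite gt_eqF.
have yv0 : 0 <= dot y v <= C * D ^+ 2.
  by rewrite yE dotBl uv0 subr0 dotC DE yE; exact: nq.
have yvD : `|dot y v| <= D.
  by rewrite DE; apply: le_trans (CauchySchwarz _ _) _; move/sphere_enorm: sv => ->; rewrite mulr1.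
have B3 : `|(qf Q0 y - qf Q0 (y *m P)) / 2| <= A3 * D * D ^+ 2.
  rewrite normrM [`|2^-1|]ger0_norm ?invr_ge0//.
  have b1 : enorm (y - y *m P) <= C * D ^+ 2.
    rewrite yP subKr enormZ; move/sphere_enorm: sv => ->; rewrite mulr1.
    by have /andP[h1 h2] := yv0; rewrite ger0_norm.
  have b2 : enorm (y *m P) <= 2 * D.
    rewrite yP; apply: le_trans (enormD _ _) _; rewrite enormN enormZ.
    by move/sphere_enorm: sv => ->; rewrite mulr1 -DE mulr_natl mulr2n lerD2l.
  have b3 := qf_diff Q0 y (y *m P).
  apply: (@le_trans _ _ (mxbound Q0 * (C * D ^+ 2) * (D + 2 * D) / 2)).
    rewrite ler_pM2r ?invr_gt0//; apply: le_trans b3 _.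
    apply: ler_pM => //; [by rewrite mulr_ge0|by rewrite addr_ge0|by rewrite ler_wpM2l|].
    by rewrite -DE lerD2l.
  by rewrite A3E le_eqVlt; apply/orP; left; apply/eqP; field.
have D2 : 0 <= D ^+ 2 by rewrite exprn_ge0.
apply: le_trans (ler_normD _ _) _; apply: le_trans (lerD (ler_normD _ _) (lexx _)) _.
apply: le_trans (lerD (lerD B1 B2) B3) _.
rewrite -!mulrDl ler_wpM2r//.
have -> : eps / (2 * A1) * A1 = eps / 2 by field; rewrite gt_eqF.
have h : (2 * (A2 + A3 + 1)) * D = 2 * ((A2 + A3) * D) + 2 * D by ring.
move: N3; rewrite h; move: ((A2 + A3) * D) (D) D0 => X Y Y0 N3.
lra.
Qed.

End Chart.

Lemma second_form_ae :
  hausdorff m (bd `\` [set u | exists v Q, second_form K L u v Q]) = 0%E.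
Proof.
have [c [ks [Js [c0 fr cov]]]] := chart_cover KL r0 eL e1.
have /choice[N hN] i : exists N : set 'rV[R]_m, hausdorff m N = 0%E /\
    forall x, ~ N x -> exists v Q, second_form K L (chart L e (ks i) (Js i) x) v Q.
  have [N N0 h] := chart_taylor (fr i); exists N; split => // x /h[S SS tay].
  exact: (chart_second_form (fr i) SS tay).
have ri : 0 <= r^-1 by rewrite invr_ge0 ltW.
apply: (@hausdorff_finite_cover0 _ _ _ _ (fun i => chart L e (ks i) (Js i) @` N i)) => [i|u [bu nu0]].
  apply: (@hausdorff_lipschitz0 _ _ _ _ _ _ (2 * (1 + r^-1))).
  - by rewrite mulr_ge0// addr_ge0.
  - by move=> x y _ _; exact: (chart_lip KL r0 eL e1 (fr i)).
  - exact: (hN i).1.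
have [i ci] := cov _ bu; exists i.
have a0 : 0 < dot u (ks i) := lt_le_trans c0 ci.
have := chart_onto KL r0 eL (fr i) bu a0.
set x := _ *: _ => E; exists x => //; apply: contrapT => /(hN i).2 h.
by apply: nu0; rewrite -E.
Qed.

End LipschitzNormal.

(** * Curvature entropy *)

Section DualBodies.
Context {R : realType} {m : nat}.
Notation V := 'rV[R]_m.+2.
Notation T := (@caratheodory_type R V (hausdorff m)).
Variables (K L : set V) (e e' : V) (r r' : R).
Hypotheses (KL : polar_pair K L).
Hypotheses (r0 : 0 < r) (eL : forall v, L v -> r <= dot v e) (e1 : enorm e = 1).
Hypotheses (r'0 : 0 < r') (eK : forall u, K u -> r' <= dot u e') (e'1 : enorm e' = 1).
Notation mu := (@hausdorff_measure R m.+2 m).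
Notation bdK := (@sboundary R m.+1 K).
Notation bdL := (@sboundary R m.+1 L).
Notation H := (@gauss_kronecker R m.+1 K).
Notation H' := (@gauss_kronecker R m.+1 L).

Let LK := polar_pairC KL.
Let finK := perimeter_finite KL r0 eL e1.
Let finL := perimeter_finite LK r'0 eK e'1.
Let mH : measurable_fun [set: T] (H : T -> R) := measurable_gauss_kronecker KL r0 eL e1.
Let mH' : measurable_fun [set: T] (H' : T -> R) := measurable_gauss_kronecker LK r'0 eK e'1.

Lemma gauss_kronecker_boundary u : 0 < H u -> bdK u.
Proof.
by move=> /(gauss_kronecker_form KL r0 eL e1)[v [Q [[uv _ _ _ _] _]]]; exact: (incident_boundary KL uv).
Qed.

Lemma measurable_sboundary (M : set V) : measurable (@sboundary R m.+1 M : set T).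
Proof. by apply: closed_caratheodory; apply: closedI; exact: closed_closure. Qed.

Lemma boundary_integral_gt0 (h : V -> \bar R) : (forall u, H u = 0 -> h u = 0%E) ->
  (\int[mu]_(u in bdK) h u = \int[mu]_(u in [set u | (0 < H u)%R]) h u)%E.
Proof.
move=> h0; rewrite integral_mkcond [RHS]integral_mkcond; apply: eq_integral => u _.
rewrite /patch; case: ifPn => [|bu]; case: ifPn => // nu.
  by move=> _; apply: h0; apply/eqP; rewrite eq_le (gauss_kronecker_ge0 KL r0 eL e1) andbT leNgt; apply: contra nu => ?; rewrite inE.
by move: bu; rewrite mem_set//; apply: gauss_kronecker_boundary; rewrite inE in nu.
Qed.

(** The change of variables with the constant function 1 turns the total curvature into the area of
    the part of the dual boundary with positive curvature. *)
Lemma total_curvature_finite : (\int[mu]_(u in bdK) (H u)%:E < +oo)%E.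
Proof.
rewrite (@boundary_integral_gt0 (fun u => (H u)%:E)); last by move=> u ->.
have := @dual_integral R m K L e e' r r' (fun=> 1) KL r0 eL e1 r'0 eK e'1 finK finL (measurable_cst _) (fun=> ler01).
rewrite (_ : (\int[_]_(u in _) (_ * _)%:E = \int[mu]_(u in [set u | (0 < H u)%R]) (H u)%:E)%E); last first.
  by apply: eq_integral => u _; rewrite mul1r.
move=> <-.
have mL : measurable ([set v | 0 < H' v] : set T).
  have := mH' measurableT (measurable_itv `]0, +oo[).
  by rewrite setTI; congr measurable; apply/seteqP; split => y /=; rewrite in_itv/= andbT.
have := @integral_cst _ T R mu _ mL 1%:E; rewrite mul1e => /= ->.
apply: le_lt_trans finL; apply: le_hausdorff => v /= Hv.
have [u [Q [[vu _ _ _ _] _]]] := gauss_kronecker_form LK r'0 eK e'1 Hv.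
exact: (incident_boundary LK vu).
Qed.

Lemma boundary_power_mean_limit (a : R) : 0 < a -> exists2 l : R, 0 <= l &
  [/\ ((\int[mu]_(x in bdK) (H x `^ (q / (a + q)))%:E / mu bdK) `^ (1 + a / q)%R)%E
        @[q --> 0^'+] --> l%:E,
      (\int[mu]_(x in bdK) (fun x => lne (H x)%:E)^\+ x < +oo)%E &
      lne l%:E = (1 / mu bdK * \int[mu]_(x in bdK) lne (H x)%:E)%E].
Proof.
move=> a0.
have [P PE] : exists P, mu bdK = P%:E.
  by move: finK (hausdorff_ge0 m bdK); rewrite -[hausdorff m bdK]/(mu bdK); case: (mu bdK) => [x| |]// _ _; exists x.
have [A AE] : exists A, (\int[mu]_(u in bdK) (H u)%:E)%E = A%:E.
  have : (0 <= \int[mu]_(u in bdK) (H u)%:E)%E.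
    by apply: integral_ge0 => u _; rewrite lee_fin (gauss_kronecker_ge0 KL r0 eL e1).
  by move: total_curvature_finite; case: integral => [x| |]// _ _; exists x.
apply: (@power_mean_limit _ T R mu bdK H P A) => //.
- exact: measurable_sboundary.
- exact: (measurable_funTS mH).
- exact: (gauss_kronecker_ge0 KL r0 eL e1).
- by rewrite -lte_fin -PE; exact: (perimeter_gt0 KL r0 eL e1).
Qed.

Section LipschitzGaussMap.
Variables (nu : V -> V) (C : R).
Hypotheses (C0 : 0 <= C) (nuP : forall u, bdK u -> incident K L u (nu u)).
Hypothesis nu_lip : forall u w, bdK u -> bdK w -> enorm (nu u - nu w) <= C * enorm (u - w).

Lemma dual_curvature_gt0_ae : hausdorff m (bdL `\` [set v | 0 < H' v]) = 0%E.
Proof.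
pose D := [set u | exists v Q, second_form K L u v Q].
have n1 : hausdorff m (contact K L (bdK `\` D)) = 0%E.
  exact: (contact_null KL r0 eL e1 C0 nuP nu_lip (second_form_ae KL r0 eL e1 C0 nuP nu_lip)).
have n2 : hausdorff m (contact K L [set u | D u /\ H u <= 0]) = 0%E.
  apply/eqP; rewrite eq_le hausdorff_ge0 andbT.
  apply: le_trans (area_upper KL r0 eL e1 (lexx 0) _ _) _; last by rewrite mul0e.
    apply: le_lt_trans finK; apply: le_hausdorff => u [[v [Q [uv _ _ _ _]]] _].
    exact: (incident_boundary KL uv).
  move=> u [[v [Q SF]] h]; exists v, Q; split => //.
  by rewrite -(gauss_kroneckerE KL r0 eL e1 SF).
apply: (@hausdorff_finite_cover0 _ bool _ _ (fun b => if b then contact K L (bdK `\` D) else contact K L [set u | D u /\ H u <= 0])).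
  by case.
move=> v [bv Hv]; have [u vu] := (sboundaryE v LK).1 bv.
have uv := incidentC vu; have bu := incident_boundary KL uv.
have [Du|nDu] := pselect (D u); last by exists true, u.
exists false, u => //; split => //; rewrite leNgt; apply/negP => Hu; apply: Hv => /=.
by rewrite (gauss_kronecker_incident KL r0 eL e1 r'0 eK e'1 Hu uv) invr_gt0.
Qed.

(** The change of variables is stated for nonnegative functions, so positive and negative parts of
    the logarithm go through it separately. *)
Let log_part (f : V -> \bar R) (g : R -> R) : measurable_fun [set: T] (f : T -> \bar R) ->
  (forall v, (0 <= f v)%E) -> measurable_fun setT g -> (forall t, 0 <= g t) ->
  (forall v, 0 < H' v -> f v = (g (ln (H' v)))%:E) ->
  (\int[mu]_(v in bdL) f v = \int[mu]_(u in [set u | (0 < H u)%R]) (g (- ln (H u)) * H u)%:E)%E.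
Proof.
move=> mf f0 mg g0 fg.
have mL : measurable ([set v | 0 < H' v] : set T).
  have := mH' measurableT (measurable_itv `]0, +oo[).
  by rewrite setTI; congr measurable; apply/seteqP; split => y /=; rewrite in_itv/= andbT.
have mb := measurable_sboundary L.
rewrite (@ge0_negligible_integral _ T R mu bdL (bdL `\` [set v | 0 < H' v]) f) //=; last first.
- exact: dual_curvature_gt0_ae.
- exact: measurable_funTS.
- exact: measurableD.
rewrite -(dual_integral KL r0 eL e1 r'0 eK e'1 finK finL mg g0).
have E : bdL `\` (bdL `\` [set v | 0 < H' v]) = [set v | 0 < H' v].
  apply/seteqP; split => v /=; first by move=> [bv h]; apply: contrapT => nh; apply: h.
  move=> Hv; split; last by case.
  have [u [Q [[vu _ _ _ _] _]]] := gauss_kronecker_form LK r'0 eK e'1 Hv.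
  exact: (incident_boundary LK vu).
apply: etrans (congr1 (fun D => integral mu D f) E) _.
by apply: eq_integral => v; rewrite inE /= => /fg.
Qed.

(** Inverting the curvature exchanges signs of the logarithm: the positive part of [log H']
    corresponds to the negative part of [H * log H]. Its finite integral is what allows the opposite
    of the difference to be rearranged. *)
Lemma dual_log_integral :
  (\int[mu]_(v in bdL) (fun v => lne (H' v)%:E)^\+ v < +oo)%E ->
  (- (\int[mu]_(v in bdL) lne (H' v)%:E) = \int[mu]_(u in bdK) ((H u)%:E * lne (H u)%:E))%E.
Proof.
pose h u := ((H u)%:E * lne (H u)%:E)%E.
have h0 u : H u = 0 -> h u = 0%E by rewrite /h => ->; rewrite mul0e.
have hE u : 0 < H u -> h u = (ln (H u) * H u)%:E.
  by move=> Hu; rewrite /h lne_EFin ?gt_eqF// -EFinM mulrC.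
have ml : measurable_fun [set: T] (fun v : T => lne (H' v)%:E).
  exact: (measurableT_comp (@measurable_lne_EFin R)).
have pos : (\int[mu]_(v in bdL) (fun v => lne (H' v)%:E)^\+ v = \int[mu]_(u in bdK) h^\- u)%E.
  rewrite (@log_part _ (fun t => Num.max t 0)).
  - rewrite (@boundary_integral_gt0 (h^\-)%E); last by move=> u /h0; rewrite funenegE => ->; rewrite oppe0 maxxx.
    apply: eq_integral => u; rewrite inE /= => Hu; rewrite funenegE hE// -EFinN -EFin_max.
    by rewrite maxr_pMl ?ltW// mul0r mulNr.
  - exact: measurable_funepos.
  - by move=> v; rewrite funepos_ge0.
  - by apply: measurable_maxr => //; exact: measurable_id.
  - by move=> t; rewrite le_max lexx orbT.
  - by move=> v Hv; rewrite funeposE lne_EFin ?gt_eqF// -EFin_max.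
have neg : (\int[mu]_(v in bdL) (fun v => lne (H' v)%:E)^\- v = \int[mu]_(u in bdK) h^\+ u)%E.
  rewrite (@log_part _ (fun t => Num.max (- t) 0)).
  - rewrite (@boundary_integral_gt0 (h^\+)%E); last by move=> u /h0; rewrite funeposE => ->; rewrite maxxx.
    apply: eq_integral => u; rewrite inE /= => Hu; rewrite funeposE hE// -EFin_max.
    by rewrite maxr_pMl ?ltW// mul0r opprK.
  - exact: measurable_funeneg.
  - by move=> v; rewrite funeneg_ge0.
  - by apply: measurable_maxr => //; exact: oppr_measurable.
  - by move=> t; rewrite le_max lexx orbT.
  - by move=> v Hv; rewrite funenegE lne_EFin ?gt_eqF// -EFinN -EFin_max.
rewrite pos => fin.
rewrite [in LHS]integralE [in RHS]integralE pos neg.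
have fn : (\int[mu]_(u in bdK) h^\- u)%E \is a fin_num.
  rewrite ge0_fin_numE//; apply: integral_ge0 => u _; exact: funeneg_ge0.
by rewrite oppeB ?fin_num_adde_defr// [LHS]addeC.
Qed.

End LipschitzGaussMap.
End DualBodies.

Lemma unit_pole {R : realType} {d : nat} (L : set 'rV[R]_d.+1) : L !=set0 ->
  (exists e, exists2 r : R, 0 < r & forall v, L v -> r <= dot v e) ->
  exists e r, [/\ 0 < r, forall v, L v -> r <= dot v e & enorm e = 1].
Proof.
move=> [v0 Lv0] [e [r r0 eL]].
have e0 : e != 0.
  by apply: contraTneq (eL _ Lv0) => ->; rewrite dot0r -ltNge.
have n0 : 0 < enorm e by rewrite enorm_gt0.
exists (unit_vec e), (r / enorm e); split; first by rewrite divr_gt0.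
  by move=> v /eL h; rewrite /unit_vec dotZr mulrC ler_pM2l ?invr_gt0.
exact/sphere_enorm/unit_vec_sphere.
Qed.

Lemma gauss_map_incident {R : realType} {d : nat} (K L : set 'rV[R]_d.+1) u :
  polar_pair K L -> sboundary K u -> incident K L u (- gauss_map K u).
Proof.
move=> KL bu; have [v uv] := (sboundaryE u KL).1 bu; have [Ku _ _] := uv.
apply/(outer_unit_normalE _ KL Ku).
have /getPex// : exists n, outer_unit_normal K u n.
by exists (- v); apply/(outer_unit_normalE _ KL Ku); rewrite opprK.
Qed.

Local Open Scope ereal_scope.

(* The first two components say that the limit defining the entropy power
   exists in [0, +oo[ and that the integral of log H in the third one is well
   defined with values in [-oo, +oo[. *)
Theorem theorem1p3 (R : realType) (d : nat) (hd : (2 <= d)%N)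
    (K : set 'rV[R]_d.+1) (hK : spherical_convex_body K)
    (hKproper : proper_body K) :
  [/\ exists2 l : R, (0 <= l)%R &
        entropy_power_fun K q @[q --> 0%R^'+] --> l%:E,
      boundary_integral (dual K) ((log_curvature (dual K)) ^\+) < +oo,
      curvature_entropy K =
        - (1 / perimeter (dual K) *
           boundary_integral (dual K) (log_curvature (dual K))) &
      C11_body K ->
      curvature_entropy K =
        1 / perimeter (dual K) *
        boundary_integral K
          (fun u => (gauss_kronecker K u)%:E * log_curvature K u)].
Proof.
have KL := body_polar_pair hK hKproper; have LK := polar_pairC KL.
have [_ _ poleL poleK] := KL.
have [e [r [r0 eL e1]]] := unit_pole (pair_nonempty KL) poleL.
have [e' [r' [r'0 eK e'1]]] := unit_pole (pair_nonempty LK) poleK.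
(* Writing [d = m.+1] puts the bodies in a space with [m.+2] coordinates and gives their boundaries
   dimension [m]. *)
case: d hd K hK hKproper KL LK poleL poleK e eL e1 e' eK e'1 => // m _ K hK hKproper KL LK _ _ e eL e1 e' eK e'1.
(* The curvature in question is that of the dual body, hence the exchanged roles and poles. *)
have [l l0 [lcvg lfin lE]] := boundary_power_mean_limit LK r'0 eK e'1 r0 eL e1 (ltr0Sn R m).
have entropyE : curvature_entropy K =
    - (1 / perimeter (dual K) * boundary_integral (dual K) (log_curvature (dual K))).
  rewrite /curvature_entropy /entropy_power (cvg_lim _ lcvg)//; congr (- _); exact: lE.
split => //; first by exists l.
move=> [_ lip]; rewrite entropyE.
have [M M0 hM] : exists2 M : R, (0 <= M)%R & forall u w, sboundary K u -> sboundary K w ->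
    (`|gauss_map K u - gauss_map K w| <= M * `|u - w|)%R.
  have [M [M0 hM]] := pinfty_ex_gt0 lip; exists M; first exact: ltW.
  by move=> u w bu bw; have := hM (u, w) (conj bu bw).
(* The Gauss map is Lipschitz for the sup norm; the factor [m.+2] converts the bound to Euclidean
   lengths. *)
have C0 : (0 <= m.+2%:R * M)%R by rewrite mulr_ge0.
have nuL u w : sboundary K u -> sboundary K w ->
    (enorm (- gauss_map K u - - gauss_map K w) <= m.+2%:R * M * enorm (u - w))%R.
  move=> bu bw; rewrite -opprD enormN.
  apply: le_trans (enorm_norm _) _; rewrite -mulrA ler_wpM2l//.
  by apply: le_trans (hM _ _ bu bw) _; rewrite ler_wpM2l// norm_enorm.
rewrite -muleN; congr (_ * _).
exact: (dual_log_integral KL r0 eL e1 r'0 eK e'1 C0 (fun u bu => gauss_map_incident KL bu) nuL lfin).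
Qed.
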